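(* Let $F$ be a driver satisfying assumptions (i) and (ii) of the context and let $Q\in L^2(\mathbb{R};\mathcal{G}_T)$. Then there exists a unique triple of $\mathbb{G}$-adapted processes $(Y,Z_1,Z_2)$ which solves $$Y_t-\int_t^T F(u,Y_u,Z_1(u),Z_2(u),X_u)\,du+\int_t^T Z_1(u)\,dW_u+\int_t^T Z_2^{\top}(u)\,dM_u=Q,\qquad t\in[0,T].$$
   Context: Let $(\Omega,\mathcal{F},P)$ be a complete probability space and $T>0$. $W=\{W_t\}_{t\in[0,T]}$ is a standard Brownian motion. $X=\{X_t\}_{t\in[0,T]}$ is a continuous-time Markov chain, independent of $W$, with state space $\mathcal{S}=\{e_1,\dots,e_N\}$, the standard basis of $\mathbb{R}^N$, and time-independent rate matrix $A=[a_{ij}]_{N\times N}$, where for $i\ne j$, $a_{ji}$ is the transition rate from $e_i$ to $e_j$ (so columns of $A$ sum to $0$). There is $c\in(0,1)$ with $a_{ij}\in[c,c^{-1}]$ for all $i\neq j$. The chain has the semimartingale dynamics $X_t=X_0+\int_0^t AX_s\,ds+M_t$, with $M$ an $\mathbb{R}^N$-valued square-integrable martingale with respect to the augmented natural filtration of $X$. $\mathcal{G}_t=\mathcal{F}^X_t\vee\mathcal{F}^W_t$, where $\mathcal{F}^X,\mathcal{F}^W$ are the $P$-augmented natural filtrations of $X$ and $W$, and $\mathbb{G}=\{\mathcal{G}_t\}_{t\in[0,T]}$. Define the nonnegative definite matrix $\psi_t:=\mathrm{diag}(AX_{t-})-A\,\mathrm{diag}(X_{t-})-\mathrm{diag}(X_{t-})A^{\top}$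 and the seminorm $\lVert C\rVert^2_{X_{t-}}:=C^{\top}\psi_tC$ for $C\in\mathbb{R}^N$. $M^2(0,T;\mathbb{R},\mathcal{G}_t)$ is the set of real-valued $\mathbb{G}$-adapted processes that are square-integrable over $\Omega\times[0,T]$. $P^2(0,T;\mathbb{R}^N,\mathcal{G}_t)$ is the set of $\mathbb{R}^N$-valued $\mathbb{G}$-predictable processes $\varphi$ with $E\int_0^T\lVert\varphi_s\rVert^2_{X_{s-}}ds<\infty$. $L^2(\mathbb{R};\mathcal{G}_T)$ is the set of real square-integrable $\mathcal{G}_T$-measurable random variables. The driver is $F:\Omega\times[0,T]\times\mathbb{R}\times\mathbb{R}\times\mathbb{R}^N\times\mathcal{S}\to\mathbb{R}$ ($\omega$ suppressed). Assumptions: (i) for all $(y,z_1,z_2,x)$, $F(\cdot,y,z_1,z_2,x)\in M^2(0,T;\mathbb{R},\mathcal{G}_t)$; (ii) there is a constant $\mu>0$ such that for all $(\omega,t,x)$ and all $(y,z_1,z_2),(y',z_1',z_2')\in\mathbb{R}\times\mathbb{R}\times\mathbb{R}^N$, $$|F(t,y,z_1,z_2,x)-F(t,y',z_1',z_2',x)|^2\le\mu\left(|y-y'|^2+|z_1-z_1'|^2+\lVert z_2-z_2'\rVert^2_{X_{t-}}\right).$$ A solution is a triple $(Y,Z_1,Z_2)\in M^2(0,T;\mathbb{R},\mathcal{G}_t)\times M^2(0,T;\mathbb{R},\mathcal{G}_t)\times P^2(0,T;\mathbb{R}^N,\mathcal{G}_t)$ for which the equation holds $P$-a.s. for all $t\in[0,T]$.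 Uniqueness means: for two solutions, $Y^1_t=Y^2_t$ $P$-a.s. for all $t$, $Z_1^1=Z_1^2$ $dt\times P$-a.e., and $Z_2^1=Z_2^2$ $d\langle M,M\rangle_t\times dP$-a.e., i.e. $\lVert Z^1_2(t)-Z_2^2(t)\rVert_{X_{t-}}=0$ $dt\times P$-a.e. *)

(* Defs.v *)
From HB Require Import structures.
From mathcomp Require Export all_boot all_order all_algebra.
From mathcomp Require Export all_classical all_reals all_analysis.
Export Order.TTheory GRing.Theory Num.Theory.
Export numFieldNormedType.Exports.

Set Implicit Arguments.
Unset Strict Implicit.
Unset Printing Implicit Defensive.

Local Open Scope classical_set_scope.
Local Open Scope ring_scope.

(* Processes are functions of a real time and of the outcome; only times in
   [0, T] are ever used.  Vectors are columns, measurable entry by entry. *)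

Section paths.
Context {R : realType}.
Implicit Types (T : R) (f : R -> R).

Definition cadlag T f :=
  (forall t, 0 <= t < T -> f s @[s --> t^'+] --> f t) /\
  (forall t, 0 < t <= T -> cvg (f s @[s --> t^'-])).

(* The left limit x_{t-}, with the convention x_{0-} = x_0. *)
Definition left_lim N (x : R -> 'cV[R]_N) (t : R) : 'cV[R]_N :=
  if t == 0 then x 0 else \col_i lim (x s i 0 @[s --> t^'-]).

End paths.

Section processes.
Context {R : realType} {d : measure_display} {Omega : measurableType d}.
Variables (P : probability Omega R) (T : R).
Implicit Types (G : R -> set (set Omega)) (H : set (set Omega)).

Local Notation leb := (@lebesgue_measure R).

Definition measurable_wrt H (f : Omega -> R) :=
  preimage_set_system setT f measurable `<=` H.

Definition adapted G (Z : R -> Omega -> R) :=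
  forall t, 0 <= t <= T -> measurable_wrt (G t) (Z t).

(* The P-augmented natural filtration of a family of real processes. *)
Definition aug_filtration (I : Type) (Z : I -> R -> Omega -> R) (t : R)
    : set (set Omega) :=
  <<s P.-negligible `|` \bigcup_(s in `[0, t]%classic)
        \bigcup_(i in [set: I]) preimage_set_system setT (Z i s) measurable >>.

Definition filtrationW (W : R -> Omega -> R) :=
  aug_filtration (fun _ : unit => W).

Definition filtrationX N (X : R -> Omega -> 'cV[R]_N) :=
  aug_filtration (fun (i : 'I_N) s w => X s w i 0).

Definition filtration_join G1 G2 (t : R) : set (set Omega) :=
  <<s G1 t `|` G2 t >>.

Definition independent H1 H2 :=
  forall A B, H1 A -> H2 B -> P (A `&` B) = (P A * P B)%E.

Definition brownian_motion (W : R -> Omega -> R) :=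
  [/\ forall t, 0 <= t <= T -> measurable_fun setT (W t),
      {ae P, forall w, W 0 w = 0},
      {ae P, forall w, {within `[0, T]%classic, continuous (W ^~ w)}} &
      forall s t, 0 <= s -> s < t -> t <= T ->
        (forall B, measurable B ->
           P ((W t \- W s) @^-1` B) = normal_prob 0 (Num.sqrt (t - s)) B) /\
        independent (filtrationW W s)
          (preimage_set_system setT (W t \- W s) measurable)].

Definition domain : set (Omega * R) := setT `*` `[0, T]%classic.

(* M^2(0, T; R, G_t). *)
Definition M2 G (Z : R -> Omega -> R) :=
  [/\ adapted G Z,
      measurable_fun domain (fun p : Omega * R => Z p.2 p.1) &
      (\int[P \x leb]_(p in domain) ((Z p.2 p.1 ^+ 2)%:E) < +oo)%E].

(* L^2(R; H). *)
Definition L2 H (Q : Omega -> R) :=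
  measurable_wrt H Q /\ (\int[P]_w ((Q w ^+ 2)%:E) < +oo)%E.

Definition predictable_sets G : set (set (Omega * R)) :=
  <<s domain, [set E | exists2 B, G 0 B & E = B `*` [set 0]] `|`
     [set E | exists s t B, [/\ 0 <= s, s < t, t <= T, G s B &
                                E = B `*` `]s, t]%classic]] >>.

Definition predictable G m (Z : R -> Omega -> 'cV[R]_m) :=
  forall i, preimage_set_system domain
    (fun p : Omega * R => Z p.2 p.1 i 0) measurable `<=` predictable_sets G.

Definition square_integrable_martingale G m (M : R -> Omega -> 'cV[R]_m) :=
  forall i,
  [/\ adapted G (fun t w => M t w i 0),
      forall t, 0 <= t <= T -> (\int[P]_w ((M t w i 0 ^+ 2)%:E) < +oo)%E &
      forall s t B, 0 <= s -> s <= t -> t <= T -> G s B ->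
        \int[P]_(w in B) (M t w i 0) = \int[P]_(w in B) (M s w i 0)].

(* A simple integrand takes the value [si_val k] on ]t_k, t_{k+1}], where
   t_k is [si_time k] and k < [si_size]. *)
Record simple_integrand (m : nat) := SimpleIntegrand {
  si_size : nat;
  si_time : nat -> R;
  si_val : nat -> Omega -> 'cV[R]_m }.

Definition simple_adapted G m (h : simple_integrand m) :=
  [/\ forall k, (k <= si_size h)%N -> 0 <= si_time h k <= T,
      forall k, (k < si_size h)%N -> si_time h k <= si_time h k.+1,
      forall k i, (k < si_size h)%N ->
        measurable_wrt (G (si_time h k)) (fun w => si_val h k w i 0) &
      exists C, forall k w i, (k < si_size h)%N -> `|si_val h k w i 0| <= C].

Definition simple_fun m (h : simple_integrand m) (t : R) (w : Omega)
    : 'cV[R]_m :=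
  \sum_(k < si_size h)
    (if si_time h k < t <= si_time h k.+1 then si_val h k w else 0).

Definition simple_int m (L : R -> Omega -> 'cV[R]_m) (h : simple_integrand m)
    (t : R) (w : Omega) : R :=
  \sum_(k < si_size h) ((si_val h k w)^T *m
     (L (Num.min (si_time h k.+1) t) w - L (Num.min (si_time h k) t) w)) 0 0.

Definition qform m (C : 'cV[R]_m) (psi : 'M[R]_m) : R :=
  (C^T *m psi *m C) 0 0.

(* J is the stochastic integral of Z against the square-integrable
   G-martingale L with d<L, L>_t = psi_t dt: an adapted process with cadlag
   paths which is the L^2 limit of the integrals of simple integrands
   converging to Z in L^2(d<L, L> dP).  Such a J is unique up to
   indistinguishability. *)
Definition is_stochastic_integral G m (L : R -> Omega -> 'cV[R]_m)
    (psi : R -> Omega -> 'M[R]_m) (Z : R -> Omega -> 'cV[R]_m)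
    (J : R -> Omega -> R) :=
  [/\ adapted G J,
      {ae P, forall w, cadlag T (J ^~ w)} &
      exists h : nat -> simple_integrand m,
      [/\ forall n, simple_adapted G (h n),
          (\int[P \x leb]_(p in domain)
             (qform (Z p.2 p.1 - simple_fun (h n) p.2 p.1)
                    (psi p.2 p.1))%:E)%E @[n --> \oo] --> 0%E &
          forall t, 0 <= t <= T ->
            (\int[P]_w ((J t w - simple_int L (h n) t w) ^+ 2)%:E)%E
              @[n --> \oo] --> 0%E]].

(* Real integrand and integrator, with d<W, W>_t = dt. *)
Definition is_ito_integral G (W Z J : R -> Omega -> R) :=
  is_stochastic_integral G (fun t w => const_mx (W t w) : 'cV[R]_1)
    (fun _ _ => 1%:M) (fun t w => const_mx (Z t w)) J.

End processes.

Section markov_chains.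
Context {R : realType} {d : measure_display} {Omega : measurableType d}.
Variables (P : probability Omega R) (T : R) (N : nat) (A : 'M[R]_N).
Implicit Types X : R -> Omega -> 'cV[R]_N.

Definition basis_vec (i : 'I_N) : 'cV[R]_N := delta_mx i 0.

Definition states : set 'cV[R]_N := range basis_vec.

(* A j i is the rate from e_i to e_j. *)
Definition rate_matrix (c : R) :=
  (forall i, \sum_j A j i = 0) /\
  (forall i j, i != j -> c <= A i j <= c^-1).

(* p h j i is the probability to go from e_i to e_j in time h. *)
Definition transition_function (p : R -> 'M[R]_N) :=
  [/\ forall h i j, 0 <= h -> 0 <= p h j i,
      forall h i, 0 <= h -> \sum_j p h j i = 1,
      p 0 = 1%:M,
      forall s t, 0 <= s -> 0 <= t -> p (s + t) = p s *m p t &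
      forall i j, (p h j i - (j == i)%:R) / h @[h --> 0^'+] --> A j i].

Definition markov_chain X :=
  [/\ forall t w, 0 <= t <= T -> states (X t w),
      forall t i, 0 <= t <= T -> measurable_fun setT (fun w => X t w i 0),
      forall w i, cadlag T (fun t => X t w i 0) &
      exists2 p, transition_function p &
        forall s t B i j, 0 <= s -> s <= t -> t <= T -> filtrationX P X s B ->
          (P (B `&` [set w | X s w = basis_vec i]
                `&` [set w | X t w = basis_vec j]) =
           (p (t - s) j i)%:E * P (B `&` [set w | X s w = basis_vec i]))%E].

(* M_t = X_t - X_0 - \int_0^t A X_s ds. *)
Definition chain_martingale X (t : R) (w : Omega) : 'cV[R]_N :=
  X t w - X 0 w -
  \col_i \int[lebesgue_measure]_(s in `[0, t]%classic) ((A *m X s w) i 0).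

Definition psi_mx (x : 'cV[R]_N) : 'M[R]_N :=
  diag_mx (A *m x)^T - A *m diag_mx x^T - diag_mx x^T *m A^T.

Definition psi X (t : R) (w : Omega) : 'M[R]_N :=
  psi_mx (left_lim (X ^~ w) t).

(* The squared seminorm of C at X_{t-}. *)
Definition seminorm2 X (t : R) (w : Omega) (C : 'cV[R]_N) : R :=
  qform C (psi X t w).

(* P^2(0, T; R^N, G_t). *)
Definition P2 (G : R -> set (set Omega)) X (Z : R -> Omega -> 'cV[R]_N) :=
  predictable T G Z /\
  (\int[P \x (@lebesgue_measure R)]_(q in domain T)
     ((seminorm2 X q.2 q.1 (Z q.2 q.1))%:E) < +oo)%E.

End markov_chains.

Section bsde.
Context {R : realType} {d : measure_display} {Omega : measurableType d}.
Variables (P : probability Omega R) (T : R) (N : nat) (A : 'M[R]_N).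
Variables (W : R -> Omega -> R) (X : R -> Omega -> 'cV[R]_N).

Definition filtrationG : R -> set (set Omega) :=
  filtration_join (filtrationX P X) (filtrationW P W).

(* F w t y z1 z2 x; only the values at states x matter. *)
Definition driver := Omega -> R -> R -> R -> 'cV[R]_N -> 'cV[R]_N -> R.

Definition driver_M2 (F : driver) :=
  forall y z1 z2 x, states x ->
    M2 P T filtrationG (fun t w => F w t y z1 z2 x).

Definition driver_lipschitz (F : driver) :=
  exists2 mu, 0 < mu &
    forall w t x y y' z1 z1' z2 z2', 0 <= t <= T -> states x ->
      `|F w t y z1 z2 x - F w t y' z1' z2' x| ^+ 2 <=
        mu * (`|y - y'| ^+ 2 + `|z1 - z1'| ^+ 2
              + seminorm2 A X t w (z2 - z2')).

(* J1 and J2 are the processes \int_0^. Z1 dW and \int_0^. Z2^T dM. *)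
Definition bsde_solution (F : driver) (Q : Omega -> R)
    (Y Z1 : R -> Omega -> R) (Z2 : R -> Omega -> 'cV[R]_N) :=
  [/\ M2 P T filtrationG Y, M2 P T filtrationG Z1, P2 P T A filtrationG X Z2 &
      exists J1 J2,
      [/\ is_ito_integral P T filtrationG W Z1 J1,
          is_stochastic_integral P T filtrationG (chain_martingale A X)
            (psi A X) Z2 J2 &
          {ae P, forall w, forall t, 0 <= t <= T ->
            Y t w
            - \int[lebesgue_measure]_(u in `[t, T]%classic)
                F w u (Y u w) (Z1 u w) (Z2 u w) (X u w)
            + (J1 T w - J1 t w) + (J2 T w - J2 t w) = Q w}]].

Definition same_solution (Y Z1 : R -> Omega -> R)
    (Z2 : R -> Omega -> 'cV[R]_N) (Y' Z1' : R -> Omega -> R)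
    (Z2' : R -> Omega -> 'cV[R]_N) :=
  [/\ {ae P, forall w, forall t, 0 <= t <= T -> Y t w = Y' t w},
      {ae (P \x (@lebesgue_measure R))%E, forall q, domain T q ->
         Z1 q.2 q.1 = Z1' q.2 q.1} &
      {ae (P \x (@lebesgue_measure R))%E, forall q, domain T q ->
         seminorm2 A X q.2 q.1 (Z2 q.2 q.1 - Z2' q.2 q.1) = 0}].

End bsde.

Arguments driver R {d} Omega N.

(* Main.v *)
(** Every square-integrable [G_T]-measurable variable is a [G_0]-measurable one
    plus stochastic integrals against [W] and [M]. Indeed, products of functions
    of [(X_t, W_t)] at finitely many times are total in L^2; such a function is
    expanded backwards over a fine partition into first-order terms, which are
    elementary integrals against [W] and [M], and into step errors whose sum is
    small because they are orthogonal with squared norm O(h^2). The isometry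
    identifies the integrands of the limit.

    If the driver is a given process [f], the equation is solved by representing
    [Q + \int_0^T f]. The energy identity for the difference of two solutions,
    integrated against [exp (2 g t)], bounds the weighted norm of
    [(Y - Y', Z - Z')] by [3 / g] times that of [f - f']. By the Lipschitz
    hypothesis the map sending [f] to the process [F(t, Y_t, Z1_t, Z2_t, X_t)] of
    the solution for [f] is a contraction when [g] is large: its fixed point gives
    existence, and the contraction estimate gives uniqueness. *)

Require Import Defs.
From mathcomp Require Import measurable_realfun ring lra.

Set Implicit Arguments.
Unset Strict Implicit.
Unset Printing Implicit Defensive.

Local Open Scope classical_set_scope.
Local Open Scope ring_scope.

(** Conditioning never appears as an operator: each martingale or Markov property is an
    orthogonality [ip P setT xi U = 0] against the variables [xi] of the past, proved on the
    indicators of a generating pi-system. The two noises are separated by two enlarged filtrations,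
    each joining the past of one noise with the whole of the other.

    The seminorm given by [psi] is degenerate, so limits of integrands cannot be taken in it
    directly. A square root [rho] of the bracket turns an integrand into components in the ordinary
    L^2 of [domain T], where limits exist; the lower bound [c] on the rates permits the division
    that recovers an integrand from its components.

    Cadlag integrals are built path by path from a maximal inequality, off a null set contained in
    every [G t]. Drivers are only adapted and jointly measurable, whence a separate argument for the
    adaptedness of time integrals. The fixed point is sought among the processes [f] and not among
    the solutions, so that each iteration solves an explicit equation whose [Y] is adapted by
    construction. *)

Local Notation Rm := measurableTypeR.
Local Notation OxR Omega R := (Omega * Rm R)%type.

(** * Square-integrable functions *)

Section square_integrable.
Context d (T : measurableType d) (R : realType).
Variables (mu : {measure set T -> \bar R}) (D : set T).
Hypothesis mD : measurable D.
Implicit Types f g h : T -> R.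

Definition sqi f := measurable_fun D f /\
  (\int[mu]_(x in D) ((f x ^+ 2)%:E) < +oo)%E.

(** A real number even when the integral is infinite, in which case it takes the default value 0;
    the linearity laws below therefore carry [sqi] hypotheses. *)
Definition ip f g : R := \int[mu]_(x in D) (f x * g x).

Lemma sqi_integrable_sqr f : sqi f ->
  mu.-integrable D (EFin \o (fun x => f x ^+ 2)).
Proof.
move=> [mf foo]; apply/integrableP; split.
  by apply/measurable_EFinP; apply: measurable_funX.
under eq_integral => x _ do rewrite /= ger0_norm ?sqr_ge0//.
exact: foo.
Qed.

Lemma sqi_integrable f g : sqi f -> sqi g ->
  mu.-integrable D (EFin \o (fun x => f x * g x)).
Proof.
move=> sf sg.
apply: (@le_integrable _ _ _ mu D mD _
   ((EFin \o (fun x => f x ^+ 2)%R) \+ (EFin \o (fun x => g x ^+ 2)%R))%E).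
- by apply/measurable_EFinP; apply: measurable_funM; [case: sf|case: sg].
- move=> x Dx /=; rewrite lee_fin [leRHS]ger0_norm ?addr_ge0 ?sqr_ge0// ler_norml.
  by apply/andP; split; nra.
- by apply: integrableD => //; apply: sqi_integrable_sqr.
Qed.

Lemma ipC f g : ip f g = ip g f.
Proof. by apply: eq_Rintegral => x _; rewrite mulrC. Qed.

Lemma ipBC f g : ip (f \- g) (f \- g) = ip (g \- f) (g \- f).
Proof. by apply: eq_Rintegral => x _ /=; ring. Qed.

Lemma ip_ge0 f : 0 <= ip f f.
Proof. by apply: Rintegral_ge0 => x _; rewrite -expr2 sqr_ge0. Qed.

Lemma integral_sqrE f : sqi f ->
  (\int[mu]_(x in D) ((f x ^+ 2)%:E) = (ip f f)%:E)%E.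
Proof.
move=> sf; rewrite /ip /Rintegral fineK; last first.
  by apply: integrable_fin_num => //; apply: sqi_integrable.
by apply: eq_integral => x _; rewrite expr2.
Qed.

Lemma eq_ip f g f' g' : {in D, f =1 f'} -> {in D, g =1 g'} ->
  ip f g = ip f' g'.
Proof. by move=> ff gg; apply: eq_Rintegral => x xD; rewrite ff// gg. Qed.

Lemma ip_eq0 f g : {in D, forall x, f x * g x = 0} -> ip f g = 0.
Proof. by move=> fg0; rewrite /ip (@eq_Rintegral _ _ _ _ _ (fun=> 0))// /Rintegral integral0. Qed.

Lemma ip_zerol f : ip (fun=> 0) f = 0.
Proof. by apply: ip_eq0 => x _; rewrite mul0r. Qed.

Lemma sqiD f g : sqi f -> sqi g -> sqi (f \+ g).
Proof.
move=> sf sg; split; first by apply: measurable_funD; [case: sf|case: sg].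
pose h x := f x ^+ 2 + g x ^+ 2 + (f x * g x + f x * g x).
have mh : measurable_fun D (EFin \o h).
  apply/measurable_EFinP; case: sf => mf _; case: sg => mg _.
  by repeat (apply: measurable_funD || apply: measurable_funM
             || apply: measurable_funX || assumption).
apply: (@le_lt_trans _ _ (\int[mu]_(x in D) (h x)%:E)%E).
  apply: ge0_le_integral => //.
  - by move=> x _; rewrite lee_fin sqr_ge0.
  - apply/measurable_EFinP; apply: measurable_funX.
    by apply: measurable_funD; [case: sf|case: sg].
  - by move=> x _; rewrite lee_fin /h /=; nra.
have /integrableP[_] : mu.-integrable D (EFin \o h).
  have -> : EFin \o h = (((EFin \o (fun x => f x ^+ 2)%R) \+ (EFin \o (fun x => g x ^+ 2)%R)) \+
      ((EFin \o (fun x => f x * g x)%R) \+ (EFin \o (fun x => f x * g x)%R)))%E by [].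
  by repeat apply: integrableD => //; (apply: sqi_integrable_sqr || apply: sqi_integrable).
apply: le_lt_trans; apply: ge0_le_integral => //.
- move=> x _; rewrite lee_fin /h (_ : _ + _ = (f x + g x) ^+ 2) ?sqr_ge0//; ring.
- exact: measurableT_comp.
- by move=> x _; rewrite lee_fin /= ler_norm.
Qed.

Lemma sqiZ c f : sqi f -> sqi (fun x => c * f x).
Proof.
move=> sf; split.
  by apply: measurable_funM => //; case: sf.
under eq_integral => x _ do rewrite exprMn EFinM.
rewrite ge0_integralZl_EFin ?sqr_ge0//.
- by rewrite integral_sqrE// -EFinM ltry.
- by move=> x _; rewrite lee_fin sqr_ge0.
- by apply/measurable_EFinP; apply: measurable_funX; case: sf.
Qed.

Lemma sqiN f : sqi f -> sqi (fun x => - f x).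
Proof.
move=> /(sqiZ (-1)) sf; rewrite (_ : (fun x => - f x) = (fun x => -1 * f x))//.
by apply/funext => x; rewrite mulN1r.
Qed.

Lemma sqiB f g : sqi f -> sqi g -> sqi (f \- g).
Proof. by move=> sf /sqiN sg; apply: sqiD. Qed.

Lemma sqi0 : sqi (fun=> 0).
Proof.
split; first exact: measurable_cst.
by under eq_integral => x _ do rewrite expr0n/=; rewrite integral0.
Qed.

Lemma sqi_sum (I : Type) (r : seq I) (Q : pred I) (F : I -> T -> R) :
  (forall i, Q i -> sqi (F i)) -> sqi (fun x => \sum_(i <- r | Q i) F i x).
Proof.
move=> sF; elim: r => [|i r IH].
  by rewrite (_ : (fun x => _) = fun=> 0); [exact: sqi0|apply/funext => x; rewrite big_nil].
have [Qi|nQi] := boolP (Q i).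
  rewrite (_ : (fun x => _) = F i \+ (fun x => \sum_(i <- r | Q i) F i x)).
    by apply: sqiD => //; apply: sF.
  by apply/funext => x; rewrite big_cons Qi.
by rewrite (_ : (fun x => _) = (fun x => \sum_(i <- r | Q i) F i x)) //;
   apply/funext => x; rewrite big_cons (negbTE nQi).
Qed.

Lemma ipDl f g h : sqi f -> sqi g -> sqi h -> ip (f \+ g) h = ip f h + ip g h.
Proof.
move=> sf sg sh; rewrite /ip -RintegralD//; try exact: sqi_integrable.
by apply: eq_Rintegral => x _; rewrite mulrDl.
Qed.

Lemma ipDr f g h : sqi f -> sqi g -> sqi h -> ip h (f \+ g) = ip h f + ip h g.
Proof. by move=> sf sg sh; rewrite ipC ipDl// ![ip _ h]ipC. Qed.

Lemma ipZl c f g : sqi f -> sqi g -> ip (fun x => c * f x) g = c * ip f g.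
Proof.
move=> sf sg; rewrite /ip -RintegralZl//; last exact: sqi_integrable.
by apply: eq_Rintegral => x _; rewrite mulrA.
Qed.

Lemma ipZr c f g : sqi f -> sqi g -> ip f (fun x => c * g x) = c * ip f g.
Proof. by move=> sf sg; rewrite ipC ipZl// ipC. Qed.

Lemma ipNl f g : sqi f -> sqi g -> ip (fun x => - f x) g = - ip f g.
Proof.
move=> sf sg; rewrite -mulN1r -ipZl//; apply: eq_ip => // x _.
by rewrite mulN1r.
Qed.

Lemma ipBl f g h : sqi f -> sqi g -> sqi h -> ip (f \- g) h = ip f h - ip g h.
Proof. by move=> sf sg sh; rewrite -ipNl// -ipDl//; exact: sqiN. Qed.

Lemma ipBr f g h : sqi f -> sqi g -> sqi h -> ip h (f \- g) = ip h f - ip h g.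
Proof. by move=> sf sg sh; rewrite ipC ipBl// ![ip _ h]ipC. Qed.

Lemma ip_suml (I : Type) (r : seq I) (Q : pred I) (F : I -> T -> R) g :
  (forall i, Q i -> sqi (F i)) -> sqi g ->
  ip (fun x => \sum_(i <- r | Q i) F i x) g = \sum_(i <- r | Q i) ip (F i) g.
Proof.
move=> sF sg; elim: r => [|i r IH].
  by rewrite big_nil; apply: ip_eq0 => x _; rewrite big_nil mul0r.
rewrite big_cons; have [Qi|nQi] := boolP (Q i).
  rewrite -IH -ipDl//; [|exact: sF|exact: sqi_sum].
  by apply: eq_ip => // x _; rewrite big_cons Qi.
by rewrite -IH; apply: eq_ip => // x _; rewrite big_cons (negbTE nQi).
Qed.

Lemma ip_sumr (I : Type) (r : seq I) (Q : pred I) (F : I -> T -> R) g :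
  (forall i, Q i -> sqi (F i)) -> sqi g ->
  ip g (fun x => \sum_(i <- r | Q i) F i x) = \sum_(i <- r | Q i) ip g (F i).
Proof.
move=> sF sg; rewrite ipC ip_suml//.
by apply: eq_bigr => i _; rewrite ipC.
Qed.

Lemma ipDD f g : sqi f -> sqi g ->
  ip (f \+ g) (f \+ g) = ip f f + 2 * ip f g + ip g g.
Proof.
move=> sf sg; rewrite ipDl ?ipDr//; last exact: sqiD.
by rewrite (ipC g f); lra.
Qed.

Lemma ipBB f g : sqi f -> sqi g ->
  ip (f \- g) (f \- g) = ip f f - 2 * ip f g + ip g g.
Proof.
move=> sf sg; rewrite ipBl ?ipBr//; last exact: sqiB.
by rewrite (ipC g f); lra.
Qed.

Lemma ip_le2 f g : sqi f -> sqi g ->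
  ip (f \+ g) (f \+ g) <= 2 * ip f f + 2 * ip g g.
Proof.
move=> sf sg; rewrite ipDD//.
by have := ip_ge0 (f \- g); rewrite ipBB//; lra.
Qed.

Lemma ipB_le2 f g : sqi f -> sqi g ->
  ip (f \- g) (f \- g) <= 2 * ip f f + 2 * ip g g.
Proof.
move=> sf sg; rewrite ipBB//.
by have := ip_ge0 (f \+ g); rewrite ipDD//; lra.
Qed.

Lemma ip_dist_le2 f g h : sqi f -> sqi g -> sqi h ->
  ip (f \- h) (f \- h) <= 2 * ip (f \- g) (f \- g) + 2 * ip (g \- h) (g \- h).
Proof.
move=> sf sg sh; rewrite -(_ : ip ((f \- g) \+ (g \- h)) ((f \- g) \+ (g \- h)) = ip (f \- h) (f \- h)).
  by apply: ip_le2; exact: sqiB.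
by apply: eq_ip => x _ /=; lra.
Qed.

Lemma cauchy_schwarz f g : sqi f -> sqi g -> ip f g ^+ 2 <= ip f f * ip g g.
Proof.
move=> sf sg.
have H (c : R) : 0 <= ip f f - 2 * (c * ip f g) + c ^+ 2 * ip g g.
  have sc : sqi (fun x => c * g x) by exact: sqiZ.
  have := ip_ge0 (f \- (fun x => c * g x)).
  rewrite ipBB// ipZr// ipZl// ipZr//; lra.
have [g0|gn0] := eqVneq (ip g g) 0.
  rewrite g0 mulr0.
  have [->|fg0] := eqVneq (ip f g) 0; first by rewrite expr0n.
  (* With [ip g g = 0] the quadratic [H] is affine in [c]; this [c] gives it the value
     [- ip f f - 2]. *)
  have := H ((ip f f + 1) / ip f g); rewrite g0 mulfVK//.
  have := ip_ge0 f; lra.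
have gp : 0 < ip g g by rewrite lt_neqAle eq_sym gn0 ip_ge0.
have := H (ip f g / ip g g).
have -> : ip f f - 2 * (ip f g / ip g g * ip f g) + (ip f g / ip g g) ^+ 2 * ip g g
   = (ip f f * ip g g - ip f g ^+ 2) / ip g g by field.
by rewrite pmulr_lge0 ?invr_gt0// subr_ge0.
Qed.

Lemma sqi_le f g : measurable_fun D f -> sqi g ->
  (forall x, D x -> `|f x| <= `|g x|) -> sqi f.
Proof.
move=> mf sg fg; split => //.
case: sg => mg; apply: le_lt_trans; apply: ge0_le_integral => //.
- by move=> x _; rewrite lee_fin sqr_ge0.
- by apply/measurable_EFinP; exact: measurable_funX.
- by apply/measurable_EFinP; exact: measurable_funX.
- move=> x Dx; rewrite lee_fin -[leLHS]real_normK ?num_real//.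
  by rewrite -[leRHS]real_normK ?num_real// lerXn2r ?nnegrE//; exact: fg.
Qed.

Lemma ip_le f g : measurable_fun D f -> sqi g ->
  (forall x, D x -> `|f x| <= `|g x|) -> ip f f <= ip g g.
Proof.
move=> mf sg fg; have sf := sqi_le mf sg fg.
apply: le_Rintegral => //; try exact: sqi_integrable.
move=> x Dx; rewrite -!expr2 -[leLHS]real_normK ?num_real//.
by rewrite -[leRHS]real_normK ?num_real// lerXn2r ?nnegrE//; exact: fg.
Qed.

Lemma sqi_mulb f g C : measurable_fun D f -> sqi g ->
  (forall x, D x -> `|f x| <= C) -> sqi (fun x => f x * g x).
Proof.
move=> mf sg fC; apply: (@sqi_le _ (fun x => C * g x)).
- by apply: measurable_funM => //; case: sg.
- exact: sqiZ.
- move=> x Dx; rewrite !normrM ler_wpM2r//.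
  by apply: (le_trans (fC _ Dx)); exact: ler_norm.
Qed.

Lemma ip_mulb f g C : measurable_fun D f -> sqi g ->
  (forall x, D x -> `|f x| <= C) ->
  ip (fun x => f x * g x) (fun x => f x * g x) <= C ^+ 2 * ip g g.
Proof.
move=> mf sg fC; have -> : C ^+ 2 * ip g g = ip (fun x => C * g x) (fun x => C * g x).
  by rewrite ipZl ?ipZr//; [rewrite mulrA|exact: sqiZ].
apply: ip_le.
- by apply: measurable_funM => //; case: sg.
- exact: sqiZ.
- move=> x Dx; rewrite !normrM ler_wpM2r//.
  by apply: (le_trans (fC _ Dx)); exact: ler_norm.
Qed.

Lemma sqi_bounded f C : (mu D < +oo)%E -> measurable_fun D f ->
  (forall x, D x -> `|f x| <= C) -> sqi f.
Proof.
move=> Doo mf fC; apply: (@sqi_le _ (fun=> C)) => //.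
  split; first exact: measurable_cst.
  by rewrite integral_cst// lte_mul_pinfty// lee_fin sqr_ge0.
by move=> x Dx; apply: (le_trans (fC _ Dx)); exact: ler_norm.
Qed.

Lemma sqi_integrable1 f : (mu D < +oo)%E -> sqi f -> mu.-integrable D (EFin \o f).
Proof.
move=> Doo sf.
have s1 : sqi (fun=> 1) by apply: (@sqi_bounded _ 1) => // x _; rewrite normr1.
have := sqi_integrable s1 sf.
by rewrite (_ : EFin \o _ = EFin \o f)//; apply/funext => x /=; rewrite mul1r.
Qed.

End square_integrable.

(** * Geometric convergence of sequences and limits in L^2 *)

Section fast_sequences.
Context {R : realType}.

Lemma cvg_sqr (I : Type) (F : set_system I) {FF : Filter F} (u : I -> R) (l : R) :
  u @ F --> l -> u x ^+ 2 @[x --> F] --> l ^+ 2.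
Proof. by move=> ul; rewrite expr2; under eq_fun do rewrite expr2; exact: cvgM. Qed.

Lemma cvg_sqrt (I : Type) (F : set_system I) {FF : Filter F} (u : I -> R) (l : R) :
  u @ F --> l -> Num.sqrt (u x) @[x --> F] --> Num.sqrt l.
Proof. by move=> ul; apply: continuous_cvg => //; exact: sqrt_continuous. Qed.

Lemma le_cvg0 (a : R) (u : R^nat) : (forall n, a <= u n) ->
  u @ \oo --> 0 -> a <= 0.
Proof.
move=> au u0; rewrite -(cvg_lim _ u0)//; apply: limr_ge.
  by apply/cvg_ex; exists 0.
exact: nearW.
Qed.

Lemma cvg0_le (u v : R^nat) : (forall n, 0 <= u n <= v n) ->
  v @ \oo --> 0 -> u @ \oo --> 0.
Proof.
move=> uv; apply: (@squeeze_cvgr _ _ _ _ (fun=> 0)); first exact: nearW.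
exact: cvg_cst.
Qed.

Lemma cvgZ0 (c : R) (u : R^nat) : u @ \oo --> 0 -> (fun n => c * u n) @ \oo --> 0.
Proof. by move=> u0; rewrite -[X in _ --> X](mulr0 c); exact: cvgMr. Qed.

Lemma cvg0D (u v : R^nat) : u @ \oo --> 0 -> v @ \oo --> 0 ->
  (fun n => u n + v n) @ \oo --> 0.
Proof. by move=> u0 v0; rewrite -[X in _ --> X]addr0; exact: cvgD. Qed.

(** The hypothesis bounds the steps by [sqrt S * 2^-k], whose tails are geometric: adding
    [2 sqrt S * 2^-n] to [u n] gives a nonincreasing sequence, subtracting it a nondecreasing one,
    and the limit lies between the two. The same sandwich yields the rate. *)
Lemma fast_cvg (u : R^nat) (S : R) :
  (forall k, 4 ^+ k * (u k.+1 - u k) ^+ 2 <= S) ->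
  cvgn u /\ forall n, (limn u - u n) ^+ 2 <= 4 * S * (4^-1) ^+ n.
Proof.
move=> H.
have S0 : 0 <= S by apply: le_trans (H 0%N); rewrite expr0 mul1r sqr_ge0.
pose s := Num.sqrt S.
have s0 : 0 <= s by exact: sqrtr_ge0.
have sS : s ^+ 2 = S by rewrite sqr_sqrtr.
have d k : `|u k.+1 - u k| <= s * (2^-1) ^+ k.
  rewrite -(@ler_pXn2r _ 2)// ?nnegrE ?mulr_ge0 ?exprn_ge0//.
  rewrite real_normK ?num_real// exprMn sS -exprM mulnC exprM.
  rewrite [X in X ^+ k](_ : _ = (4)^-1); last by field.
  by rewrite exprVn ler_pdivlMr ?exprn_gt0// mulrC.
pose v n := u n + 2 * s * (2^-1) ^+ n.
pose w n := u n - 2 * s * (2^-1) ^+ n.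
have vn : nonincreasing_seq v.
  apply/nonincreasing_seqP => n; rewrite /v exprSr.
  by have := d n; rewrite ler_norml => /andP[_]; lra.
have wn : nondecreasing_seq w.
  apply/nondecreasing_seqP => n; rewrite /w exprSr.
  by have := d n; rewrite ler_norml => /andP[]; lra.
have wv n : w n <= v n.
  have h0 : 0 <= s * 2^-1 ^+ n by rewrite mulr_ge0// exprn_ge0.
  by rewrite /w /v; lra.
have half0 : (fun n => 2 * s * 2^-1 ^+ n) @ \oo --> (0 : R).
  by apply: (@cvg_geometric R (2 * s) 2^-1); rewrite gtr0_norm//; lra.
have cv : cvgn v.
  apply: nonincreasing_is_cvgn => //; exists (w 0%N) => _ [n _ <-].
  by apply: le_trans (wv n); apply: wn.
have uv : u @ \oo --> limn v.
  rewrite (_ : u = v \- (fun n => 2 * s * 2^-1 ^+ n)); last first.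
    by apply/funext => n; rewrite /v /=; lra.
  by rewrite -[X in _ --> X]subr0; apply: cvgB.
have wl : w @ \oo --> limn v.
  by rewrite -[X in _ --> X]subr0; apply: cvgB.
split; first by apply/cvg_ex; exists (limn v).
move=> n; rewrite (cvg_lim _ uv)//.
have h1 := nonincreasing_cvgn_ge vn cv n.
have h2 : w n <= limn v.
  by rewrite -(cvg_lim _ wl)//; apply: nondecreasing_cvgn_le => //; apply/cvg_ex; exists (limn v).
have : `|limn v - u n| <= 2 * s * 2^-1 ^+ n.
  by rewrite ler_norml; move: h1 h2; rewrite /v /w; lra.
rewrite -(@ler_pXn2r _ 2)// ?nnegrE ?mulr_ge0 ?exprn_ge0//.
rewrite real_normK ?num_real// !exprMn sS -exprM mulnC exprM.
by rewrite [X in X ^+ n](_ : _ = (4)^-1); [lra|field].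
Qed.

(* The limit of [fs _ x] where it exists; elsewhere a junk value, which keeps
   it measurable for any sigma-algebra making the [fs n] measurable. *)
Definition flim (T : Type) (fs : nat -> T -> R) (x : T) : R :=
  fine (limn_esup (fun n => (fs n x)%:E)).

Lemma flimE (T : Type) (fs : nat -> T -> R) x l :
  fs ^~ x @ \oo --> l -> flim fs x = l.
Proof.
move=> fl; rewrite /flim is_cvg_limn_esupE.
  by rewrite (@cvg_lim _ _ _ _ _ _ l%:E)//; apply/cvg_EFin => //; exact: nearW.
by apply/cvg_ex; exists l%:E; apply/cvg_EFin => //; exact: nearW.
Qed.

Lemma measurable_flim d (T : measurableType d) (D : set T)
  (fs : nat -> T -> R) : (forall n, measurable_fun D (fs n)) ->
  measurable_fun D (flim fs).
Proof.
move=> mf; rewrite /flim.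
apply: (measurableT_comp (f := fine)) => //.
by apply: measurable_fun_limn_esup => n; apply/measurable_EFinP.
Qed.

End fast_sequences.

Lemma cvg_finite_sum (R : realType) (S : Type) (F : set_system S) {FF : Filter F} (I : Type)
  (r : seq I) (u : I -> S -> R) (l : I -> R) : (forall i, u i x @[x --> F] --> l i) ->
  \sum_(i <- r) u i x @[x --> F] --> \sum_(i <- r) l i.
Proof.
move=> ul; elim: r => [|i r IH].
  by rewrite big_nil; under eq_fun do rewrite big_nil; exact: cvg_cst.
by rewrite big_cons; under eq_fun do rewrite big_cons; exact: cvgD.
Qed.

Section L2_limits.
Context d (T : measurableType d) (R : realType).
Variables (mu : {measure set T -> \bar R}) (D : set T).
Hypothesis mD : measurable D.
Implicit Types f g h : T -> R.
Local Notation sqi := (sqi mu D).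
Local Notation ip := (ip mu D).

Definition l2cvg (fs : nat -> T -> R) f :=
  ip (fs n \- f) (fs n \- f) @[n --> \oo] --> (0 : R).

Lemma l2cvg_cst f : l2cvg (fun=> f) f.
Proof.
rewrite /l2cvg (_ : (fun n => _) = fun=> 0); first exact: cvg_cst.
by apply/funext => n; apply: ip_eq0 => x _ /=; rewrite subrr mul0r.
Qed.

(** The rate [8^-1] leaves room for the weight [4 ^+ k]: the series of weighted squared increments
    has integral at most 2, the sum of the [2^-k], so it is finite almost everywhere and serves
    pointwise as the constant [S] of [fast_cvg]. Integrating the pointwise rate gives the rate in
    L^2, with 8 = 4 * 2. *)
Lemma flim_fast (fs : nat -> T -> R) : (forall n, sqi (fs n)) ->
  (forall n, ip (fs n.+1 \- fs n) (fs n.+1 \- fs n) <= (8^-1) ^+ n) ->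
  [/\ {ae mu, forall x, D x -> fs ^~ x @ \oo --> flim fs x},
      sqi (flim fs) & forall n, ip (flim fs \- fs n) (flim fs \- fs n) <= 8 * (4^-1) ^+ n].
Proof.
move=> sf fast.
have mf n : measurable_fun D (fs n) by case: (sf n).
pose q k x : \bar R := (4 ^+ k * (fs k.+1 x - fs k x) ^+ 2)%:E.
have mq k : measurable_fun D (q k).
  apply/measurable_EFinP; apply: measurable_funM => //.
  by apply: measurable_funX; apply: measurable_funB.
have q0 k x : D x -> (0 <= q k x)%E.
  by move=> _; rewrite lee_fin mulr_ge0 ?sqr_ge0 ?exprn_ge0//.
pose S x := (\sum_(k <oo) q k x)%E.
have mS : measurable_fun D S by apply: ge0_emeasurable_sum => // k x Dx _; exact: q0.
have S0 x : D x -> (0 <= S x)%E by move=> Dx; apply: nneseries_ge0 => k _ _; exact: q0.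
have iq k : (\int[mu]_(x in D) q k x <= ((2^-1) ^+ k)%:E)%E.
  rewrite /q; under eq_integral => x _ do rewrite EFinM.
  rewrite ge0_integralZl_EFin ?exprn_ge0//.
  - rewrite (_ : (fun x => _) = (fun x => (((fs k.+1 \- fs k) x) ^+ 2)%:E))//.
    rewrite integral_sqrE//; last exact: sqiB.
    rewrite -EFinM lee_fin (_ : 2^-1 = 4 * 8^-1 :> R); last by field.
    by rewrite exprMn ler_wpM2l ?exprn_ge0.
  - by move=> x _; rewrite lee_fin sqr_ge0.
  - by apply/measurable_EFinP; apply: measurable_funX; apply: measurable_funB.
have iS : (\int[mu]_(x in D) S x <= 2%:E)%E.
  rewrite integral_nneseries//.
  apply: (@le_trans _ _ (\sum_(k <oo) ((2^-1) ^+ k)%:E)%E).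
    by apply: lee_nneseries => // k _ _; apply: integral_ge0 => x Dx; exact: q0.
  rewrite (@cvg_lim _ _ _ _ _ _ 2%:E)//.
  rewrite (_ : (fun n => _) = EFin \o series (geometric 1 (2^-1 : R))).
    apply/cvg_EFin; first exact: nearW.
    rewrite [X in _ --> X](_ : _ = 1 * (1 - 2^-1)^-1 :> R); last by field.
    by apply: cvg_geometric_series; rewrite gtr0_norm//; lra.
  apply/funext => n /=; rewrite sumEFin; congr EFin.
  by apply: eq_bigr => k _; rewrite /geometric /= mul1r.
have Sfin : {ae mu, forall x, D x -> S x \is a fin_num}.
  apply: integrable_ae => //; apply/integrableP; split => //.
  rewrite (@eq_integral _ _ _ mu D S).
    by apply: (le_lt_trans iS); rewrite ltry.
  by move=> x; rewrite inE => Dx; rewrite gee0_abs// S0.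
have pt x : D x -> S x \is a fin_num -> cvgn (fs ^~ x) /\
   forall n, (limn (fs ^~ x) - fs n x) ^+ 2 <= 4 * fine (S x) * (4^-1) ^+ n.
  move=> Dx Sx; apply: fast_cvg => k.
  rewrite -lee_fin fineK//; rewrite /S (@nneseriesD1 _ _ k)//; last by move=> ? _; exact: q0.
  by rewrite leeDl//; apply: nneseries_ge0 => ? _ _; exact: q0.
have cv : {ae mu, forall x, D x -> fs ^~ x @ \oo --> flim fs x}.
  apply: filterS Sfin => x Sx Dx; have [c _] := pt _ Dx (Sx Dx).
  by rewrite (flimE c).
have mfl : measurable_fun D (flim fs) by exact: measurable_flim.
have bd n : (\int[mu]_(x in D) (((flim fs \- fs n) x) ^+ 2)%:E <= (8 * (4^-1) ^+ n)%:E)%E.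
  apply: (@le_trans _ _ (\int[mu]_(x in D) ((4 * (4^-1) ^+ n)%:E * S x))%E).
    apply: ae_ge0_le_integral => //.
    - by move=> x _; rewrite lee_fin sqr_ge0.
    - by apply/measurable_EFinP; apply: measurable_funX; apply: measurable_funB.
    - by move=> x Dx; rewrite mule_ge0 ?S0// lee_fin mulr_ge0 ?exprn_ge0.
    - exact: measurable_funeM.
    apply: filterS2 Sfin cv => x Sx cx Dx.
    have [c h] := pt _ Dx (Sx Dx).
    rewrite -[S x]fineK ?Sx// -EFinM lee_fin /= -(cvg_lim _ (cx Dx))//.
    by have := h n; lra.
  rewrite ge0_integralZl_EFin ?mulr_ge0 ?exprn_ge0//.
  rewrite (_ : 8 * 4^-1 ^+ n = 4 * 4^-1 ^+ n * 2); last by lra.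
  by rewrite [leRHS]EFinM; apply: lee_wpmul2l => //; rewrite lee_fin mulr_ge0 ?exprn_ge0.
have sd n : sqi (flim fs \- fs n).
  by split; [exact: measurable_funB|apply: (le_lt_trans (bd n)); rewrite ltry].
split => //.
  rewrite (_ : flim fs = (flim fs \- fs 0%N) \+ fs 0%N); last first.
    by apply/funext => x /=; lra.
  exact: sqiD.
by move=> n; rewrite -lee_fin -integral_sqrE.
Qed.

Lemma l2cvg_dominated (fs : nat -> T -> R) f g : (forall n, measurable_fun D (fs n)) ->
  measurable_fun D f -> sqi g ->
  {ae mu, forall x, D x -> fs ^~ x @ \oo --> f x} ->
  (forall n x, D x -> `|fs n x| <= g x) -> l2cvg fs f.
Proof.
move=> mfs mf sg cv bd.
have fg : {ae mu, forall x, D x -> `|f x| <= g x}.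
  apply: filterS cv => x cx Dx.
  have /cvg_lim <- // : `|fs n x| @[n --> \oo] --> `|f x| by apply: cvg_norm; exact: cx.
  apply: limr_le; first by apply/cvg_ex; exists `|f x|; apply: cvg_norm; exact: cx.
  by apply: nearW => n; exact: bd.
have := @dominated_convergence _ T R mu D mD (fun n x => ((fs n x - f x) ^+ 2)%:E)
  (fun=> 0%:E) (fun x => ((2 * g x) ^+ 2)%:E).
case.
- by move=> n; apply/measurable_EFinP; apply: measurable_funX; apply: measurable_funB.
- exact: measurable_cst.
- apply: filterS cv => x cx Dx; apply/cvg_EFin; first exact: nearW.
  rewrite [X in _ --> X](_ : _ = (f x - f x) ^+ 2); last by rewrite subrr expr0n.
  by apply: cvg_sqr; apply: cvgB; [exact: cx|exact: cvg_cst].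
- by apply: sqi_integrable_sqr => //; exact: sqiZ.
- apply: filterS fg => x fx n Dx; rewrite /= lee_fin ger0_norm ?sqr_ge0//.
  rewrite -[leLHS]real_normK ?num_real// lerXn2r ?nnegrE//.
    by rewrite mulr_ge0//; apply: le_trans (fx Dx).
  by apply: (le_trans (ler_normB _ _)); rewrite mulr2n mulrDl mul1r lerD ?bd ?fx.
move=> _ _; rewrite integral0 => h.
by rewrite /l2cvg; apply/fine_cvg.
Qed.

Lemma ip_eq0_ae f : sqi f -> ip f f = 0 -> {ae mu, forall x, D x -> f x = 0}.
Proof.
move=> sf f0.
have /ae_eq_integral_abs : measurable_fun D (fun x => ((f x) ^+ 2)%:E).
  by apply/measurable_EFinP; apply: measurable_funX; case: sf.
move=> /(_ mu mD)[+ _].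
have -> : (\int[mu]_(x in D) `|((f x) ^+ 2)%:E|)%E = 0%E.
  transitivity (ip f f)%:E; last by rewrite f0.
  rewrite -integral_sqrE//.
  by apply: eq_integral => x _; rewrite gee0_abs// lee_fin sqr_ge0.
move=> /(_ erefl); apply: filterS => x /= h Dx; have := h Dx.
by move=> [] /eqP; rewrite sqrf_eq0 => /eqP.
Qed.

Lemma ae_sqi f g : measurable_fun D f -> sqi g ->
  {ae mu, forall x, D x -> f x = g x} -> sqi f.
Proof.
move=> mf sg fg; split=> //.
rewrite (@ge0_ae_eq_integral _ _ _ mu D _ (fun x => ((g x) ^+ 2)%:E))//.
- by case: sg.
- by apply/measurable_EFinP; apply: measurable_funX.
- by apply/measurable_EFinP; apply: measurable_funX; case: sg.
- by move=> x _; rewrite lee_fin sqr_ge0.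
- by move=> x _; rewrite lee_fin sqr_ge0.
- by apply: filterS fg => x fx Dx; rewrite fx.
Qed.

Lemma ae_ip f g f' g' : measurable_fun D f -> measurable_fun D g ->
  measurable_fun D f' -> measurable_fun D g' ->
  {ae mu, forall x, D x -> f x = f' x} ->
  {ae mu, forall x, D x -> g x = g' x} -> ip f g = ip f' g'.
Proof.
move=> mf mg mf' mg' ff gg; rewrite /ip /Rintegral; congr fine.
apply: ae_eq_integral => //; try by apply/measurable_EFinP; exact: measurable_funM.
by apply: filterS2 ff gg => x fx gx Dx; rewrite fx// gx.
Qed.

(** Expanding around the limits, every term other than [ip f g] has a factor that tends to 0 in L^2
    and is controlled by Cauchy-Schwarz. *)
Lemma l2cvg_ip fs f gs g : (forall n, sqi (fs n)) -> sqi f ->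
  (forall n, sqi (gs n)) -> sqi g -> l2cvg fs f -> l2cvg gs g ->
  ip (fs n) (gs n) @[n --> \oo] --> ip f g.
Proof.
move=> sfs sf sgs sg cf cg.
have sm (us : nat -> T -> R) u (vs : nat -> T -> R) (l : R) : (forall n, sqi (us n)) ->
    sqi u -> (forall n, sqi (vs n)) -> l2cvg us u ->
    ip (vs n) (vs n) @[n --> \oo] --> l -> ip (us n \- u) (vs n) @[n --> \oo] --> (0 : R).
  move=> sus su sv cu vl; apply/norm_cvg0P.
  apply: (@cvg0_le R _ (fun n => Num.sqrt (ip (us n \- u) (us n \- u) * ip (vs n) (vs n)))).
    move=> n; rewrite normr_ge0 /= -sqrtr_sqr ler_wsqrtr//.
    by apply: cauchy_schwarz => //; exact: sqiB.
  rewrite -[X in _ --> X]sqrtr0; apply: cvg_sqrt.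
  by rewrite -[X in _ --> X](mul0r l); apply: cvgM.
have small (us : nat -> T -> R) u v : (forall n, sqi (us n)) -> sqi u -> sqi v ->
    l2cvg us u -> ip (us n \- u) v @[n --> \oo] --> (0 : R).
  move=> sus su sv cu; apply: (@sm us u (fun=> v) (ip v v)) => //; exact: cvg_cst.
have small2 : ip (fs n \- f) (gs n \- g) @[n --> \oo] --> (0 : R).
  by apply: (@sm fs f (fun n => gs n \- g) 0) => // n; exact: sqiB.
rewrite (_ : (fun n => ip (fs n) (gs n)) = (fun n =>
   ip (fs n \- f) (gs n \- g) + ip (fs n \- f) g + ip (gs n \- g) f + ip f g)).
  rewrite -[X in _ --> X]add0r; apply: cvgD; last exact: cvg_cst.
  by apply: cvg0D; [apply: cvg0D; last exact: small|exact: small].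
apply/funext => n; rewrite !ipBl ?ipBr//; try exact: sqiB.
by rewrite (ipC _ _ (gs n) f) (ipC _ _ g f); lra.
Qed.

Lemma l2cvg_unique fs f g : (forall n, sqi (fs n)) -> sqi f -> sqi g ->
  l2cvg fs f -> l2cvg fs g -> ip (f \- g) (f \- g) = 0.
Proof.
move=> sfs sf sg cf cg; apply/eqP; rewrite eq_le ip_ge0 andbT.
apply: (@le_cvg0 R _ (fun n => 2 * ip (fs n \- f) (fs n \- f) + 2 * ip (fs n \- g) (fs n \- g))).
  move=> n; rewrite (@eq_ip _ _ _ _ _ _ _ ((fs n \- g) \- (fs n \- f)) ((fs n \- g) \- (fs n \- f))).
  - by rewrite addrC; apply: ipB_le2 => //; exact: sqiB.
  - by move=> x _ /=; lra.
  - by move=> x _ /=; lra.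
by apply: cvg0D; exact: cvgZ0.
Qed.

Lemma l2cvg_le fs f gs g hs h : (forall n, ip (hs n \- h) (hs n \- h) <=
    2 * ip (fs n \- f) (fs n \- f) + 2 * ip (gs n \- g) (gs n \- g)) ->
  l2cvg fs f -> l2cvg gs g -> l2cvg hs h.
Proof.
move=> le cf cg; apply: cvg0_le (cvg0D (@cvgZ0 R 2 _ cf) (@cvgZ0 R 2 _ cg)).
by move=> n; rewrite ip_ge0 le.
Qed.

Lemma l2cvgD fs f gs g : (forall n, sqi (fs n)) -> sqi f ->
  (forall n, sqi (gs n)) -> sqi g -> l2cvg fs f -> l2cvg gs g ->
  l2cvg (fun n => fs n \+ gs n) (f \+ g).
Proof.
move=> sfs sf sgs sg; apply: l2cvg_le => n.
rewrite (@eq_ip _ _ _ _ _ _ _ ((fs n \- f) \+ (gs n \- g)) ((fs n \- f) \+ (gs n \- g))).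
- by apply: ip_le2 => //; exact: sqiB.
- by move=> x _ /=; lra.
- by move=> x _ /=; lra.
Qed.

Lemma l2cvgB fs f gs g : (forall n, sqi (fs n)) -> sqi f ->
  (forall n, sqi (gs n)) -> sqi g -> l2cvg fs f -> l2cvg gs g ->
  l2cvg (fun n => fs n \- gs n) (f \- g).
Proof.
move=> sfs sf sgs sg; apply: l2cvg_le => n.
rewrite (@eq_ip _ _ _ _ _ _ _ ((fs n \- f) \- (gs n \- g)) ((fs n \- f) \- (gs n \- g))).
- by apply: ipB_le2 => //; exact: sqiB.
- by move=> x _ /=; lra.
- by move=> x _ /=; lra.
Qed.

Lemma l2cvg_ae fs f g : measurable_fun D f -> measurable_fun D g ->
  (forall n, measurable_fun D (fs n)) -> {ae mu, forall x, D x -> f x = g x} ->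
  l2cvg fs f -> l2cvg fs g.
Proof.
move=> mf mg mfs fg; rewrite /l2cvg (_ : (fun n => _) = fun n => ip (fs n \- g) (fs n \- g))//.
apply/funext => n; have e : {ae mu, forall x, D x -> (fs n \- f) x = (fs n \- g) x}.
  by apply: filterS fg => x /= h Dx; rewrite h.
by apply: (ae_ip _ _ _ _ e e); exact: measurable_funB.
Qed.

Lemma l2cvg_mulb (u : T -> R) C fs f : measurable_fun D u ->
  (forall x, D x -> `|u x| <= C) -> (forall n, sqi (fs n)) -> sqi f ->
  l2cvg fs f -> l2cvg (fun n x => u x * fs n x) (fun x => u x * f x).
Proof.
move=> mu' uC sfs sf cf.
apply: cvg0_le (@cvgZ0 R (C ^+ 2) _ cf) => n; rewrite ip_ge0 /=.
rewrite (@eq_ip _ _ _ _ _ _ _ (fun x => u x * (fs n \- f) x) (fun x => u x * (fs n \- f) x)).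
- by apply: ip_mulb => //; exact: sqiB.
- by move=> x _ /=; lra.
- by move=> x _ /=; lra.
Qed.

Lemma l2cvg_geometric fs f (c q : R) : 0 <= q < 1 ->
  (forall n, ip (fs n \- f) (fs n \- f) <= c * q ^+ n) -> l2cvg fs f.
Proof.
move=> /andP[q0 q1] h; apply: (@cvg0_le R _ (fun n => c * q ^+ n)).
  by move=> n; rewrite ip_ge0 h.
by apply: (@cvg_geometric R c q); rewrite ger0_norm.
Qed.

Lemma l2cvg_flim fs : (forall n, sqi (fs n)) ->
  (forall n, ip (fs n.+1 \- fs n) (fs n.+1 \- fs n) <= (8^-1) ^+ n) ->
  sqi (flim fs) /\ l2cvg fs (flim fs).
Proof.
move=> sfs fast; have [_ sl bd] := flim_fast sfs fast; split => //.
apply: (@l2cvg_geometric _ _ 8 (4^-1)); first by lra.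
by move=> n; rewrite ipBC.
Qed.

End L2_limits.

(** * Measurability with respect to a sub-sigma-algebra *)

Section integrable_real.
Context d (T : measurableType d) (R : realType).
Variables (mu : {measure set T -> \bar R}) (D : set T).
Hypothesis mD : measurable D.
Implicit Types f g : T -> R.

Lemma rintegrableD f g : mu.-integrable D (EFin \o f) -> mu.-integrable D (EFin \o g) ->
  mu.-integrable D (EFin \o (fun x => f x + g x)).
Proof. exact: (@integrableD _ _ _ mu D mD (EFin \o f) (EFin \o g)). Qed.

Lemma rintegrableB f g : mu.-integrable D (EFin \o f) -> mu.-integrable D (EFin \o g) ->
  mu.-integrable D (EFin \o (fun x => f x - g x)).
Proof. exact: (@integrableB _ _ _ mu D mD (EFin \o f) (EFin \o g)). Qed.

Lemma rintegrableZ c f : mu.-integrable D (EFin \o f) ->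
  mu.-integrable D (EFin \o (fun x => c * f x)).
Proof. exact: (@integrableZl _ _ _ mu D mD c (EFin \o f)). Qed.

Lemma rintegrable_measurable f : mu.-integrable D (EFin \o f) -> measurable_fun D f.
Proof. by move=> /measurable_int /measurable_EFinP. Qed.

Lemma bounded_integrable f C : (mu D < +oo)%E -> measurable_fun D f ->
  (forall x, D x -> `|f x| <= C) -> mu.-integrable D (EFin \o f).
Proof.
move=> Doo mf fC; apply: measurable_bounded_integrable => //.
exists C; split; first exact: num_real.
by move=> y Cy x Dx /=; apply: le_trans (ltW Cy); exact: fC.
Qed.

End integrable_real.

Lemma cvg_indic_bigcup (T : Type) (R : realType) (F : (set T)^nat) x :
  nondecreasing_seq F ->
  (\1_(F n) x : R) @[n --> \oo] --> (\1_(\bigcup_i F i) x : R).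
Proof.
move=> ndF; have [[n _ Fn]|nF] := pselect ((\bigcup_i F i) x); last first.
  rewrite indicE memNset//.
  rewrite (_ : (fun n => _) = fun=> 0); first exact: cvg_cst.
  by apply/funext => n; rewrite indicE memNset// => Fn; apply: nF; exists n.
apply: cvg_near_cst; exists n => // m /= nm; rewrite !indicE !mem_set//.
- by exists n.
- by move: Fn; apply/subsetPset; exact: ndF.
Qed.

Section sub_sigma_algebra.
Context d (T : measurableType d) (R : realType).
Implicit Types (H : set (set T)) (f g : T -> R).

(** Generating from [H] adds no set, so the usual lemmas on measurable functions apply on the type
    that carries [H]. *)
Lemma mwP H f : sigma_algebra setT H ->
  measurable_wrt H f <-> measurable_fun [set: g_sigma_algebraType H] f.
Proof.
move=> sH; split=> [mf _ B mB|mf _ [B mB <-]].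
  by rewrite /measurable /= sigma_algebra_id//; apply: mf; exists B.
by have := mf measurableT B mB; rewrite /measurable /= sigma_algebra_id.
Qed.

Lemma mw_measurable H f : H `<=` measurable -> measurable_wrt H f ->
  measurable_fun setT f.
Proof. by move=> Hm mf _ B mB; apply: Hm; apply: mf; exists B. Qed.

Lemma mwS H1 H2 f : H1 `<=` H2 -> measurable_wrt H1 f -> measurable_wrt H2 f.
Proof. by move=> H12 mf; apply: subset_trans H12. Qed.

Lemma mw_preimage H f (B : set R) : measurable_wrt H f -> measurable B ->
  H (f @^-1` B).
Proof. by move=> mf mB; rewrite -[X in H X]setTI; apply: mf; exists B. Qed.

Variables (H : set (set T)) (sH : sigma_algebra setT H).

Lemma sigma_algebra_setI (A B : set T) : H A -> H B -> H (A `&` B).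
Proof.
move=> HA HB; have := @measurableI _ (g_sigma_algebraType H) A B.
by rewrite /measurable /= sigma_algebra_id//; exact.
Qed.

Lemma sigma_algebra_setT : H setT.
Proof. by have [h1 h2 _] := sH; rewrite -(setD0 setT); exact: h2. Qed.

Lemma mw_cst (c : R) : measurable_wrt H (fun=> c).
Proof. by apply/mwP => //; exact: measurable_cst. Qed.

Lemma mwD f g : measurable_wrt H f -> measurable_wrt H g ->
  measurable_wrt H (f \+ g).
Proof. by move=> /mwP-/(_ sH) mf /mwP-/(_ sH) mg; apply/mwP => //; exact: measurable_funD. Qed.

Lemma mwB f g : measurable_wrt H f -> measurable_wrt H g ->
  measurable_wrt H (f \- g).
Proof. by move=> /mwP-/(_ sH) mf /mwP-/(_ sH) mg; apply/mwP => //; exact: measurable_funB. Qed.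

Lemma mwM f g : measurable_wrt H f -> measurable_wrt H g ->
  measurable_wrt H (fun x => f x * g x).
Proof. by move=> /mwP-/(_ sH) mf /mwP-/(_ sH) mg; apply/mwP => //; exact: measurable_funM. Qed.

Lemma mw_sum (I : Type) (r : seq I) (F : I -> T -> R) :
  (forall i, measurable_wrt H (F i)) ->
  measurable_wrt H (fun x => \sum_(i <- r) F i x).
Proof.
move=> mF; apply/mwP => //; apply: measurable_sum => i.
by apply/mwP.
Qed.

Lemma mw_prod (I : eqType) (r : seq I) (F : I -> T -> R) :
  (forall i, i \in r -> measurable_wrt H (F i)) ->
  measurable_wrt H (fun x => \prod_(i <- r) F i x).
Proof.
move=> mF; apply/mwP => //; apply: measurable_prod => i ir.
by apply/mwP => //; exact: mF.
Qed.

Lemma mw_comp (g : R -> R) f : measurable_fun setT g -> measurable_wrt H f ->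
  measurable_wrt H (g \o f).
Proof. by move=> mg /mwP-/(_ sH) mf; apply/mwP => //; exact: measurableT_comp. Qed.

Lemma mw_flim (fs : nat -> T -> R) : (forall n, measurable_wrt H (fs n)) ->
  measurable_wrt H (flim fs).
Proof.
by move=> mf; apply/mwP => //; apply: (@measurable_flim _ _ (g_sigma_algebraType H)) => n; apply/mwP.
Qed.

Lemma mw_indic (B : set T) : H B -> measurable_wrt H (\1_B : T -> R).
Proof.
move=> HB; apply/mwP => //; apply: measurable_indic.
by rewrite /measurable /= sigma_algebra_id.
Qed.

(** Terms are added one by one and the sets may overlap, so that a property stable under linear
    combinations passes from indicators to simple functions by induction. *)
Inductive simple_wrt : (T -> R) -> Prop :=
| simple_wrt0 : simple_wrt (fun=> 0)
| simple_wrt_add c B f : H B -> simple_wrt f ->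
    simple_wrt (fun x => c * \1_B x + f x).

Lemma simple_wrt_sum (I : Type) (r : seq I) (c : I -> R) (B : I -> set T) f :
  (forall i, H (B i)) -> simple_wrt f ->
  simple_wrt (fun x => \sum_(i <- r) c i * \1_(B i) x + f x).
Proof.
move=> HB sf; elim: r => [|i r IH].
  rewrite (_ : (fun x => _) = f)//.
  by apply/funext => x; rewrite big_nil add0r.
rewrite (_ : (fun x => _) = (fun x => c i * \1_(B i) x +
  (\sum_(i <- r) c i * \1_(B i) x + f x))); first exact: simple_wrt_add.
by apply/funext => x; rewrite big_cons addrA.
Qed.

Lemma simple_wrtB f g : simple_wrt f -> simple_wrt g -> simple_wrt (f \- g).
Proof.
move=> sf sg; elim: sf => [|c B f' HB _ IH].
  elim: sg => [|c B g' HB _ IH].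
    rewrite (_ : _ \- _ = fun=> 0); first exact: simple_wrt0.
    by apply/funext => x /=; rewrite subrr.
  rewrite (_ : _ \- _ = fun x => - c * \1_B x + (0 - g' x)); first exact: simple_wrt_add.
  by apply/funext => x /=; lra.
rewrite (_ : _ \- _ = fun x => c * \1_B x + (f' \- g) x); first exact: simple_wrt_add.
by apply/funext => x /=; lra.
Qed.

Lemma simple_wrt_measurable f : H `<=` measurable -> simple_wrt f ->
  measurable_fun setT f.
Proof.
move=> Hm; elim=> [|c B g HB _ IH]; first exact: measurable_cst.
apply: measurable_funD => //; apply: measurable_funM => //.
by apply: measurable_indic; exact: Hm.
Qed.

Import HBNNSimple.

(** Positive and negative parts are approximated from below separately; at each point one of them is
    0, so the difference stays below [|f|], which is the bound used later for dominated
    convergence. *)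
Lemma mw_approx f : measurable_wrt H f ->
  exists fs : nat -> T -> R, [/\ forall n, simple_wrt (fs n),
    forall n x, `|fs n x| <= `|f x| & forall x, fs ^~ x @ \oo --> f x].
Proof.
move=> /mwP-/(_ sH) mf.
have pos (g : g_sigma_algebraType H -> R) : measurable_fun setT g -> (forall x, 0 <= g x) ->
    exists fs : nat -> T -> R, [/\ forall n, simple_wrt (fs n),
    forall n x, 0 <= fs n x <= g x & forall x, fs ^~ x @ \oo --> g x].
  move=> mg g0.
  have mgE : measurable_fun setT (EFin \o g) by exact/measurable_EFinP.
  pose F n := nnsfun_approx measurableT mgE n.
  exists (fun n => F n); split=> [n|n x|x].
  - rewrite (_ : (F n : T -> R) = (fun x => \sum_(y <- finmap.enum_fset (fset_set (range (F n)))) y * \1_(F n @^-1` [set y]) x + 0)).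
      apply: simple_wrt_sum => [y|]; last exact: simple_wrt0.
      have := @measurable_funPT _ _ _ _ (F n) measurableT [set y] (measurable_set1 _).
      by rewrite setTI /measurable /= sigma_algebra_id.
    apply/funext => x; rewrite addr0 [LHS](fimfunE (F n)) fsbig_finite//.
  - apply/andP; split; first exact: fun_ge0.
    rewrite -lee_fin /F nnsfun_approxE.
    by apply: (@le_approx _ _ _ setT) => // y _; rewrite lee_fin.
  - have := cvg_nnsfun_approx measurableT mgE (fun y _ => g0 y) (I : setT x).
    move=> /fine_cvgP[_].
    by apply: cvg_trans; apply: near_eq_cvg; exact: nearW.
have [fp [sp bp cp]] := pos _ (measurable_funrpos mf) (funrpos_ge0 f).
have [fn [sn bn cn]] := pos _ (measurable_funrneg mf) (funrneg_ge0 f).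
exists (fun n => fp n \- fn n); split=> [n|n x|x].
- exact: simple_wrtB.
- have := bp n x; have := bn n x; rewrite /funrpos /funrneg ler_norml /Num.max.
  move=> /andP[a b] /andP[c e]; move: a b c e.
  have [f0|f0] := leP 0 (f x).
    rewrite ger0_norm//=.
    by case: ifP => h ? ? ? ?; apply/andP; split; lra.
  rewrite ltr0_norm//=.
  by case: ifP => h ? ? ? ?; apply/andP; split; lra.
- by rewrite -[X in _ --> X x]funrposBneg; apply: cvgB.
Qed.

End sub_sigma_algebra.

Section sub_sigma_integrals.
Context d (T : measurableType d) (R : realType) (P : probability T R).
Implicit Types (H : set (set T)) (f g U W : T -> R).
Local Notation E f := (\int[P]_x f x).

Lemma integrable_indicM (B : set T) U : measurable B ->
  P.-integrable setT (EFin \o U) ->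
  P.-integrable setT (EFin \o (fun x => \1_B x * U x)).
Proof.
move=> mB iU; apply: (@le_integrable _ _ _ P setT measurableT _ (EFin \o U)) => //.
  apply/measurable_EFinP; apply: measurable_funM; first exact: measurable_indic.
  by apply/measurable_EFinP; exact: measurable_int iU.
move=> x _ /=; rewrite lee_fin normrM ler_piMl// indicE.
by case: (_ \in _); rewrite ?normr1 ?normr0.
Qed.

Lemma Rintegral_lim_eq0 (fs : nat -> T -> R) f g : (forall n, measurable_fun setT (fs n)) ->
  measurable_fun setT f -> P.-integrable setT (EFin \o g) ->
  (forall x, fs ^~ x @ \oo --> f x) -> (forall n x, `|fs n x| <= `|g x|) ->
  (forall n, E (fs n) = 0) -> E f = 0.
Proof.
move=> mfs mf ig cv bd z.
have ifs n : P.-integrable setT (EFin \o fs n).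
  apply: (@le_integrable _ _ _ P setT measurableT _ (EFin \o g)) => //; first exact/measurable_EFinP.
  by move=> x _; rewrite /= lee_fin.
have [_ _] := @dominated_convergence _ T R P setT measurableT (fun n => EFin \o fs n)
  (EFin \o f) (abse \o (EFin \o g))
  (fun n => ltac:(exact/measurable_EFinP)) (ltac:(exact/measurable_EFinP))
  (ltac:(by apply: aeW => x _; apply/cvg_EFin; [exact: nearW|exact: cv]))
  (integrable_abse ig) (ltac:(by apply: aeW => x n _; rewrite /= lee_fin)).
rewrite (_ : [sequence _]_n = fun=> 0%E).
  by move=> /cvg_lim; rewrite lim_cst// /Rintegral => <-.
by apply/funext => n /=; rewrite -[RHS]/(0%:E) -(z n) /Rintegral fineK//; exact: integrable_fin_num (ifs n).
Qed.

(** Plays the role of E(f W) = E(f E(W | H)) when E(W | H) = 0: the integral vanishes for simple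
    [f], and the approximations of [mw_approx] are dominated by [|f W|]. *)
Lemma integral_mul_eq0 H W f : sigma_algebra setT H -> H `<=` measurable ->
  P.-integrable setT (EFin \o W) ->
  (forall B, H B -> E (fun x => \1_B x * W x) = 0) ->
  measurable_wrt H f ->
  P.-integrable setT (EFin \o (fun x => f x * W x)) ->
  E (fun x => f x * W x) = 0.
Proof.
move=> sH Hm iW HW mf ifW.
have [fs [ss bs cs]] := mw_approx sH mf.
have mW : measurable_fun setT W by apply/measurable_EFinP; exact: measurable_int iW.
have mfs n : measurable_fun setT (fs n) by apply: simple_wrt_measurable (ss n).
have simple g : simple_wrt H g -> P.-integrable setT (EFin \o (fun x => g x * W x)) /\
    E (fun x => g x * W x) = 0.
  elim=> [|c B h HB sh [ih h0]].
    rewrite (_ : (fun x => 0 * W x) = fun=> 0); last by apply/funext => x; rewrite mul0r.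
    by split; [exact: integrable0|rewrite /Rintegral integral0].
  have iB : P.-integrable setT (EFin \o (fun x => c * (\1_B x * W x))).
    by apply: rintegrableZ => //; apply: integrable_indicM => //; exact: Hm.
  rewrite (_ : (fun x => (c * \1_B x + h x) * W x) =
     (fun x => c * (\1_B x * W x) + h x * W x)); last by apply/funext => x; lra.
  split; first by apply: (@integrableD _ _ _ P setT measurableT _ _ iB ih).
  rewrite RintegralD// h0 addr0 RintegralZl// ?HW ?mulr0//.
  by apply: integrable_indicM => //; exact: Hm.
have mf' := mw_measurable Hm mf.
apply: (@Rintegral_lim_eq0 (fun n x => fs n x * W x) _ (fun x => f x * W x)) => //.
- by move=> n; apply: measurable_funM.
- exact: measurable_funM.
- by move=> x; apply: cvgM; [exact: cs|exact: cvg_cst].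
- by move=> n x; rewrite !normrM ler_wpM2r.
- by move=> n; have [_ ->] := simple _ (ss n).
Qed.

(** Intersections of a set of [H1] with a set of [H2] form a pi-system generating the join, and the
    sets over which [W] integrates to 0 form a lambda-system. *)
Lemma integral_indic_eq0 H1 H2 W : sigma_algebra setT H1 -> sigma_algebra setT H2 ->
  H1 `<=` measurable -> H2 `<=` measurable ->
  P.-integrable setT (EFin \o W) ->
  (forall A B, H1 A -> H2 B -> E (fun x => \1_(A `&` B) x * W x) = 0) ->
  forall D, <<s H1 `|` H2 >> D -> E (fun x => \1_D x * W x) = 0.
Proof.
move=> sH1 sH2 Hm1 Hm2 iW HW D sD.
pose G : set (set T) := [set C | exists A B, [/\ H1 A, H2 B & C = A `&` B]].
pose L : set (set T) := [set C | measurable C /\ E (fun x => \1_C x * W x) = 0].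
have H1T := sigma_algebra_setT sH1.
have H2T := sigma_algebra_setT sH2.
have GI : setI_closed G.
  move=> _ _ [A [B [HA HB ->]]] [A' [B' [HA' HB' ->]]].
  exists (A `&` A'), (B `&` B'); split; last by rewrite setIACA.
  - exact: (sigma_algebra_setI sH1).
  - exact: (sigma_algebra_setI sH2).
have LL : lambda_system setT L.
  split => //.
  - split=> //; have := HW _ _ H1T H2T; by rewrite setTI.
  - move=> A B BA [mA A0] [mB B0]; split; first exact: measurableD.
    rewrite (_ : (fun x => _) = (fun x => \1_A x * W x - \1_B x * W x)).
      by rewrite RintegralB ?A0 ?B0 ?subrr//; exact: integrable_indicM.
    apply/funext => x; rewrite !indicE in_setD.
    have [xB|xB] := boolP (x \in B); last by rewrite andbT mul0r subr0.
    by rewrite (mem_set (BA _ (set_mem xB))) /= subrr mul0r.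
  - move=> F ndF HF; have mF n : measurable (F n) by case: (HF n).
    split; first exact: bigcupT_measurable.
    have mW : measurable_fun setT W by apply/measurable_EFinP; exact: measurable_int iW.
    apply: (@Rintegral_lim_eq0 (fun n x => \1_(F n) x * W x) _ W) => //.
    + by move=> n; apply: measurable_funM => //; exact: measurable_indic.
    + by apply: measurable_funM => //; apply: measurable_indic; exact: bigcupT_measurable.
    + by move=> x; apply: cvgM; [exact: (cvg_indic_bigcup ndF)|exact: cvg_cst].
    + by move=> n x; rewrite normrM ler_piMl// indicE; case: (_ \in _); rewrite ?normr1 ?normr0.
    + by move=> n; have [] := HF n.
have GL : G `<=` L.
  move=> _ [A [B [HA HB ->]]]; split; last exact: HW.
  by apply: measurableI; [exact: Hm1|exact: Hm2].
suff : L D by case.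
apply: (lambda_system_subset GI LL GL) => //.
apply: (smallest_sub (smallest_sigma_algebra _ _) _ sD) => C [HC|HC] /=;
  apply: sub_sigma_algebra.
- by exists C, setT; split => //; rewrite setIT.
- by exists setT, C; split => //; rewrite setTI.
Qed.

(** Independence of events says that the centred indicator of [B] integrates to 0 over each set of
    [H1]; [integral_mul_eq0] replaces that set by [U]. *)
Lemma independent_integral H1 H2 U B : sigma_algebra setT H1 -> sigma_algebra setT H2 ->
  H1 `<=` measurable -> H2 `<=` measurable -> independent P H1 H2 ->
  measurable_wrt H1 U -> P.-integrable setT (EFin \o U) -> H2 B ->
  E (fun x => \1_B x * U x) = fine (P B) * E U.
Proof.
move=> sH1 sH2 Hm1 Hm2 ind mU iU HB.
have mB : measurable B by exact: Hm2.
have iB C : measurable C -> P.-integrable setT (EFin \o (\1_C : T -> R)).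
  by move=> mC; exact: integrable_indic.
have EB C : measurable C -> E (\1_C) = fine (P C).
  by move=> mC; rewrite /Rintegral integral_indic// setIT.
have : E (fun x => U x * (\1_B x - fine (P B))) = 0.
  apply: (@integral_mul_eq0 H1) => //.
  - apply: rintegrableB => //; first exact: iB.
    exact: finite_measure_integrable_cst.
  - move=> A HA; have mA := Hm1 _ HA.
    rewrite (_ : (fun x => _) = (fun x => \1_(A `&` B) x - fine (P B) * \1_A x)).
      rewrite RintegralB//; [|by apply: iB; exact: measurableI|].
        rewrite RintegralZl//; last exact: iB.
        rewrite !EB//; last exact: measurableI.
        by rewrite ind// fineM ?fin_num_measure// mulrC subrr.
      by apply: rintegrableZ => //; exact: iB.
    by apply/funext => x; rewrite indicI /=; lra.
  - rewrite (_ : (fun x => U x * _) = (fun x => \1_B x * U x - fine (P B) * U x)).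
      by apply: rintegrableB => //; [exact: integrable_indicM|exact: rintegrableZ].
    by apply/funext => x; lra.
rewrite (_ : (fun x => U x * _) = (fun x => \1_B x * U x - fine (P B) * U x)).
  rewrite RintegralB//; [|exact: integrable_indicM|]; last first.
    exact: rintegrableZ.
  by rewrite RintegralZl// => /eqP; rewrite subr_eq0 => /eqP.
by apply/funext => x; lra.
Qed.

End sub_sigma_integrals.

Section complete_sub_sigma.
Context d (T : measurableType d) (R : realType) (P : probability T R).
Variable H : set (set T).
Hypotheses (sH : sigma_algebra setT H) (Hm : H `<=` measurable)
  (HN : P.-negligible `<=` H).
Implicit Types f g : T -> R.

Lemma mw_ae f g : measurable_wrt H f -> {ae P, forall x, f x = g x} ->
  measurable_wrt H g.
Proof.
move=> mf fg _ [B mB <-]; rewrite setTI.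
have nN : P.-negligible [set x | f x <> g x] by exact: fg.
rewrite (_ : g @^-1` B = ((f @^-1` B) `&` ~` [set x | f x <> g x]) `|`
   ((g @^-1` B) `&` [set x | f x <> g x])); last first.
  apply/seteqP; split=> x /=.
    move=> gB; have [fgx|] := pselect (f x = g x); last by right.
    by left; split => //; rewrite fgx.
  by case=> -[] // fB /contrapT <-.
have HU A B' : H A -> H B' -> H (A `|` B').
  move=> HA HB'; rewrite -[A `|` B']setCK setCU -setTD.
  have hC C : H C -> H (setT `\` C) by case: (sH) => _ hC _; exact: hC.
  by apply: (hC); apply: (sigma_algebra_setI sH); rewrite -setTD; exact: (hC).
apply: HU.
  apply: (sigma_algebra_setI sH); first exact: mw_preimage.
  by rewrite -setTD; case: (sH) => _ hC _; apply: hC; exact: HN.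
by apply: HN; apply: negligibleS nN => x [].
Qed.

(** The factor 1/4 absorbs the constant 2 of [ipB_le2]: consecutive terms of the subsequence are
    then within [8^-1 ^+ k] of each other, the speed required by [flim_fast]. *)
Lemma l2cvg_subseq (fs : nat -> T -> R) f : l2cvg P setT fs f ->
  exists phi : nat -> nat, forall k,
   ip P setT (fs (phi k) \- f) (fs (phi k) \- f) <= (8^-1) ^+ k / 4.
Proof.
move=> cf; have ex k : exists n, ip P setT (fs n \- f) (fs n \- f) <= (8^-1) ^+ k / 4.
  have e0 : 0 < (8^-1) ^+ k / 4 :> R by rewrite divr_gt0// exprn_gt0.
  have /cvgrPdist_le/(_ _ e0)[N _ hN] := cf.
  exists N; have := hN N (leqnn N); rewrite /= sub0r normrN.
  by rewrite ger0_norm// ip_ge0.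
by have [phi hphi] := choice ex; exists phi.
Qed.

(** A fast subsequence converges almost everywhere to the limit, its pointwise limit [flim] is
    measurable for [H], and [H] contains the null set on which the two differ. *)
Lemma mw_l2cvg (fs : nat -> T -> R) f : (forall n, sqi P setT (fs n)) ->
  (forall n, measurable_wrt H (fs n)) -> sqi P setT f ->
  l2cvg P setT fs f -> measurable_wrt H f.
Proof.
move=> sfs mfs sf /l2cvg_subseq[phi hphi].
have [|sl lf] := @l2cvg_flim _ _ _ P setT measurableT (fun k => fs (phi k)) (fun k => sfs _).
  move=> k; rewrite (@eq_ip _ _ _ _ _ _ _ ((fs (phi k.+1) \- f) \- (fs (phi k) \- f))
    ((fs (phi k.+1) \- f) \- (fs (phi k) \- f))); try by move=> x _ /=; lra.
  apply: (le_trans (ipB_le2 measurableT _ _)); try exact: sqiB.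
  have h1 := hphi k; have := hphi k.+1; rewrite exprS.
  have : 0 <= (8^-1) ^+ k :> R by rewrite exprn_ge0.
  lra.
apply: (@mw_ae (flim (fun k => fs (phi k)))); first by apply: mw_flim => // n; exact: mfs.
have : ip P setT (flim (fun k => fs (phi k)) \- f) (flim (fun k => fs (phi k)) \- f) = 0.
  have sphi n : sqi P setT ((fun k => fs (phi k)) n) by exact: sfs.
  apply: (l2cvg_unique measurableT sphi) => //.
  apply: (@l2cvg_geometric _ _ _ P setT _ _ 4^-1 8^-1); first by lra.
  by move=> n; have := hphi n; lra.
move/(ip_eq0_ae measurableT); move=> /(_ (sqiB measurableT sl sf)).
by apply: filterS => x /(_ I) /= /eqP; rewrite subr_eq0 => /eqP.
Qed.

End complete_sub_sigma.

Lemma prob_setT_lty d (T : measurableType d) (R : realType) (P : probability T R) :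
  (P setT < +oo)%E.
Proof. by rewrite probability_setT ltry. Qed.

Section bounded_variables.
Context {R : realType} {d} {Omega : measurableType d}.
Variables (P : probability Omega R).

Lemma bounded_sqi (f : Omega -> R) C : measurable_fun setT f ->
  (forall w, `|f w| <= C) -> sqi P setT f.
Proof. by move=> mf fC; apply: (sqi_bounded measurableT (prob_setT_lty P) mf) => w _; exact: fC. Qed.

Lemma bounded_int (f : Omega -> R) C : measurable_fun setT f ->
  (forall w, `|f w| <= C) -> P.-integrable setT (EFin \o f).
Proof. by move=> mf fC; apply: (bounded_integrable measurableT (prob_setT_lty P) mf) => w _; exact: fC. Qed.

Lemma indic_norm1 (B : set Omega) w : `|\1_B w : R| <= 1.
Proof. by rewrite indicE; case: (_ \in _); rewrite ?normr1 ?normr0. Qed.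

Lemma indic_sqi (B : set Omega) : measurable B -> sqi P setT (\1_B : Omega -> R).
Proof. by move=> mB; apply: (@bounded_sqi _ 1); [exact: measurable_indic|exact: indic_norm1]. Qed.

Lemma cst_sqi (a : R) : sqi P setT (fun=> a).
Proof. by apply: (bounded_sqi (C := `|a|)). Qed.

Lemma sqi_int (f : Omega -> R) : sqi P setT f -> P.-integrable setT (EFin \o f).
Proof. exact: (sqi_integrable1 measurableT (prob_setT_lty P)). Qed.

Lemma ip1E (f : Omega -> R) : ip P setT (fun=> 1) f = \int[P]_w f w.
Proof. by apply: eq_Rintegral => w _; rewrite mul1r. Qed.

Lemma ip_bounded_le (f g h : Omega -> R) C : sqi P setT f -> sqi P setT g -> sqi P setT h ->
  (forall w, `|f w| <= C) -> (forall w, `|g w| <= h w) ->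
  `|ip P setT f g| <= C * ip P setT (fun=> 1) h.
Proof.
move=> sf sg sh fC gh; have ifg := sqi_integrable measurableT sf sg.
apply: (le_trans (le_normr_Rintegral _ ifg)) => //.
rewrite ip1E -RintegralZl//; last exact: sqi_int.
apply: le_Rintegral => //.
- exact: integrable_norm.
- by apply: rintegrableZ => //; exact: sqi_int.
- move=> w _; rewrite normrM ler_pM//.
Qed.

Lemma ip11 : ip P setT (fun=> 1 : R) (fun=> 1) = 1.
Proof. by rewrite ip1E Rintegral_cst// mul1r; exact: (congr1 fine (probability_setT P)). Qed.

End bounded_variables.

Section freezing.
Context d d1 d2 (T : measurableType d) (T1 : measurableType d1)
  (T2 : measurableType d2) (R : realType) (P : probability T R).
Variables (U : T -> T1) (V : T -> T2).
Hypotheses (mU : measurable_fun setT U) (mV : measurable_fun setT V).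
Hypothesis indUV : forall A B, measurable A -> measurable B ->
  P (U @^-1` A `&` V @^-1` B) = (P (U @^-1` A) * P (V @^-1` B))%E.

(** Independence identifies the law of the pair [U], [V] with the product of the two laws, and
    Fubini integrates [V] out first. The target of [U] is an abstract measurable space, so that [U]
    can be the identity of [Omega] with values in a coarser sigma-algebra. *)
Lemma integral_freeze (f : T1 * T2 -> R) (C : R) :
  measurable_fun setT f -> (forall z, `|f z| <= C) ->
  \int[P]_w f (U w, V w) = \int[P]_w \int[P]_w' f (U w, V w').
Proof.
move=> mf fC.
pose mfpack d' (T' : measurableType d') (g : T -> T') (mg : measurable_fun setT g) :=
  MeasurableFun.Pack (MeasurableFun.Class (isMeasurableFun.Build _ _ _ _ g mg)).
pose m1 := distribution P (mfpack _ _ U mU).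
pose m2 := distribution P (mfpack _ _ V mV).
pose UV w := (U w, V w).
have mUV : measurable_fun setT UV by apply: measurable_fun_pair.
pose m' := distribution P (mfpack _ _ UV mUV).
have m'E X : measurable X -> (m1 \x m2)%E X = m' X.
  apply: product_measure_unique => A B mA mB.
  by rewrite /m' /m1 /m2 /distribution /pushforward /= -indUV.
have mfE : measurable_fun setT (EFin \o f) by apply/measurable_EFinP.
have step1 : (\int[P]_w (f (UV w))%:E = \int[m']_z (f z)%:E)%E.
  rewrite /m' integral_distribution//.
  by apply: (bounded_int P (C := C)) => //; exact: measurableT_comp.
have step2 : (\int[m']_z (f z)%:E = \int[m1 \x m2]_z (f z)%:E)%E.
  by apply: eq_measure_integral => X mX _; exact/esym/m'E.
have p1 : ((m1 \x m2)%E setT < +oo)%E.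
  rewrite (_ : (m1 \x m2)%E setT = 1%E) ?ltry//.
  by rewrite (m'E setT) /m' /distribution /pushforward ?preimage_setT ?probability_setT.
rewrite /Rintegral; congr fine; rewrite step1 step2.
rewrite -integral12_prod_meas1; last first.
  by apply: (@bounded_integrable _ _ _ _ _ _ _ C) => //; exact: p1.
have mfV x : measurable_fun setT (fun w => f (x, V w)).
  by apply: measurableT_comp => //; apply: measurable_fun_pair.
have ifV x := bounded_int P (mfV x) (fun w => fC _).
have inner x : fubini_F m2 (EFin \o f) x = (\int[P]_w' f (x, V w'))%:E.
  have mx : measurable_fun setT (fun y => f (x, y)).
    by apply: measurableT_comp => //; apply: measurable_fun_pair.
  rewrite /fubini_F /m2 integral_distribution//; [|exact/measurable_EFinP|exact: ifV].
  by rewrite /Rintegral fineK//; apply: integrable_fin_num => //; exact: ifV.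
have mF : measurable_fun setT (fun x => (\int[P]_w' f (x, V w'))%:E).
  rewrite (_ : (fun x => _) = fubini_F m2 (EFin \o f)); last exact/esym/funext.
  apply: (measurable_fubini_F (m1 := m1)).
  by apply: (@bounded_integrable _ _ _ _ _ _ _ C) => //; exact: p1.
transitivity (\int[m1]_x (\int[P]_w' f (x, V w'))%:E)%E.
  by apply: eq_integral => x _; exact: inner.
rewrite /m1 integral_distribution//.
apply: (bounded_int P (C := C)) => [|w].
  by apply/measurable_EFinP; apply: (measurableT_comp mF mU).
apply: (le_trans (le_normr_Rintegral _ (ifV _))) => //.
apply: (@le_trans _ _ (\int[P]_w' C)); last first.
  by rewrite Rintegral_cst// [X in fine X]probability_setT mulr1.
apply: le_Rintegral => //.
- exact: integrable_norm (ifV _).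
- exact: sqi_int (cst_sqi _ _).
Qed.

End freezing.

(** * Gaussian moments *)

Section gaussian_moments.
Context {R : realType}.
Implicit Types (s x a : R).
Local Notation leb := (@lebesgue_measure R).

Lemma integral_normal_prob_integrable s (f : R -> \bar R) :
  (normal_prob 0 s).-integrable setT f ->
  (\int[normal_prob 0 s]_x f x = \int[leb]_x (f x * (normal_pdf 0 s x)%:E))%E.
Proof.
move=> intf; have mf := measurable_int _ intf.
rewrite -(Radon_Nikodym_change_of_variables (@normal_prob_dominates R 0 s))//=.
apply: ae_eq_integral => //.
- apply: emeasurable_funM => //; apply: (measurable_int leb).
  by apply: Radon_Nikodym_integrable; exact: normal_prob_dominates.
- by apply: emeasurable_funM => //=; apply/measurable_EFinP; exact: measurable_normal_pdf.
- apply: ae_eqe_mul2l => /=.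
  rewrite Radon_NikodymE//=; first exact: normal_prob_dominates.
  move=> abmu.
  case: cid => /= h [h1 h2 h3].
  apply: integral_ae_eq => //=.
  + by apply/measurable_EFinP; exact: measurable_normal_pdf.
  + by move=> E E01 mE; rewrite -h3.
Qed.

(** Truncation at [n] gives bounded, hence integrable functions; monotone convergence then covers
    functions of possibly infinite integral, since finiteness of the moments is still to be
    proved. *)
Lemma integral_normal_prob s (f : R -> R) : measurable_fun setT f ->
  (forall x, 0 <= f x) ->
  (\int[normal_prob 0 s]_x (f x)%:E = \int[leb]_x ((f x * normal_pdf 0 s x)%:E))%E.
Proof.
move=> mf f0.
pose fn (n : nat) x := Num.min (f x) n%:R.
have mfn n : measurable_fun setT (fn n) by apply: measurable_minr.
have fn0 n x : 0 <= fn n x by rewrite /fn le_min f0 ler0n.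
have ndfn x : {homo fn ^~ x : n m / (n <= m)%N >-> n <= m}.
  move=> n m nm; rewrite /fn le_min ge_min lexx /=.
  by rewrite ge_min ler_nat nm orbT.
have cfn x : fn ^~ x @ \oo --> f x.
  apply: cvg_near_cst; exists (Num.truncn (f x)).+1 => // n /= hn.
  rewrite /fn; apply/min_idPl; apply: ltW.
  by apply: (lt_le_trans (truncnS_gt (f x))); rewrite ler_nat.
have in_ n : (normal_prob 0 s).-integrable setT (EFin \o fn n).
  apply: measurable_bounded_integrable => //.
  - by rewrite -ge0_fin_numE//; exact: fin_num_measure.
  - exact: mfn.
  exists n%:R; split; first exact: num_real.
  move=> y ny x _ /=; rewrite ger0_norm//; apply: le_trans (ltW ny).
  by rewrite /fn ge_min lexx orbT.
transitivity (limn (fun n => \int[normal_prob 0 s]_x (fn n x)%:E))%E.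
  rewrite -monotone_convergence//.
  - apply: eq_integral => x _; apply/esym/cvg_lim => //.
    by apply/cvg_EFin; [exact: nearW|exact: cfn].
  - by move=> n; apply/measurable_EFinP; exact: mfn.
  - by move=> n x _; rewrite lee_fin.
  - by move=> x _ n m nm; rewrite lee_fin; exact: ndfn.
transitivity (limn (fun n => \int[leb]_x (fn n x * normal_pdf 0 s x)%:E))%E.
  by congr (limn _); apply/funext => n; exact: (integral_normal_prob_integrable (in_ n)).
rewrite -monotone_convergence//.
- apply: eq_integral => x _; apply/cvg_lim => //.
  apply/cvg_EFin; first exact: nearW.
  by apply: cvgM; [exact: cfn|exact: cvg_cst].
- move=> n; apply/measurable_EFinP.
  by apply: measurable_funM; [exact: mfn|exact: measurable_normal_pdf].
- by move=> n x _; rewrite lee_fin mulr_ge0// normal_pdf_ge0.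
- by move=> x _ n m nm; rewrite lee_fin ler_wpM2r ?normal_pdf_ge0//; exact: ndfn.
Qed.

Definition gauss a x := expR (- (a * x ^+ 2)).

Lemma is_derive_gauss a x : is_derive x 1 (gauss a) (- (2 * a * x) * gauss a x).
Proof.
have h : is_derive x 1 (fun y : R => - (a * y ^+ 2)) (- (2 * a * x)).
  rewrite (_ : (fun y => _) = - (a \*: (@id R ^+ 2))); last first.
    by apply/funext => y; rewrite /= !fctE /GRing.scale/=.
  by apply: is_derive_eq; rewrite /GRing.scale/= expr1 mulr1; lra.
rewrite /gauss mulrC; exact: (is_derive1_comp (f := expR) (g := fun y => - (a * y ^+ 2))).
Qed.

Lemma normal_pdf_gauss s x : s != 0 ->
  normal_pdf 0 s x = normal_peak s * gauss ((2 * s ^+ 2)^-1) x.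
Proof.
move=> s0; rewrite normal_pdfE// /normal_fun /gauss subr0.
by congr (_ * expR _); rewrite mulNr mulrC -mulr_natl.
Qed.

(** The fundamental theorem of calculus on growing symmetric intervals, with dominated convergence.
    Mean and variance of the normal law follow by applying it to multiples of the density and of [x]
    times the density. *)
Lemma integral_derivative_eq0 (F f : R -> R) : continuous f ->
  (forall x, is_derive x 1 F (f x)) ->
  leb.-integrable setT (EFin \o f) ->
  (fun n : nat => F n%:R) @ \oo --> (0 : R) ->
  (fun n : nat => F (- n%:R)) @ \oo --> (0 : R) ->
  (\int[leb]_x (f x)%:E = 0)%E.
Proof.
move=> cf dF intf F0 FN0.
have cF : continuous F by move=> x; apply: differentiable_continuous; apply/derivable1_diffP; exact: ex_derive.
have ftc n : (\int[leb]_(x in `[(- n.+1%:R)%R, (n.+1%:R)%R]) (f x)%:E = (F n.+1%:R - F (- n.+1%:R))%:E)%E.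
  rewrite (@continuous_FTC2 _ f F)//.
  - by apply: (@lt_trans _ _ 0); rewrite ?oppr_lt0 ltr0Sn.
  - exact: continuous_subspaceT.
  - split.
    + by move=> x _; exact: ex_derive.
    + by apply: cvg_at_right_filter; exact: cF.
    + by apply: cvg_at_left_filter; exact: cF.
  - by move=> x _; rewrite derive1E; exact: derive_val.
have mf : measurable_fun setT f by apply: rintegrable_measurable intf.
have [_ _] := @dominated_convergence _ _ R leb setT measurableT
  (fun n x => (f x * \1_(`[- n.+1%:R, n.+1%:R]%classic) x)%:E) (EFin \o f) (abse \o (EFin \o f))
  (fun n => ltac:(by apply/measurable_EFinP; apply: measurable_funM => //; exact: measurable_indic))
  (ltac:(by apply/measurable_EFinP))
  (ltac:(by apply: aeW => x _; apply: cvg_near_cst;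
     exists (Num.truncn `|x|).+1 => // n /= hn; rewrite indicE mem_set ?mulr1//=;
     rewrite in_itv /= -ler_norml; apply: ltW; apply: (lt_trans (truncnS_gt _)); rewrite ltr_nat ltnS))
  (integrable_abse intf)
  (ltac:(by apply: aeW => x n _; rewrite /= lee_fin normrM ler_piMr// indicE;
     case: (_ \in _); rewrite ?normr1 ?normr0)).
rewrite (_ : [sequence _]_n = fun n => (F n.+1%:R - F (- n.+1%:R))%:E); last first.
  apply/funext => n /=; rewrite -ftc [RHS]integral_mkcond.
  by apply: eq_integral => x _; rewrite restrict_EFin /= /patch indicE; case: ifP => _ /=; rewrite ?mulr1 ?mulr0.
move=> /(@cvg_unique _ _); apply => //.
apply/cvg_EFin; first exact: nearW.
rewrite -[X in _ --> X](subrr (0 : R)).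
apply: cvgB.
  by move: F0; rewrite -(@cvg_shiftS _ (fun n : nat => F n%:R) (nbhs (0 : R))).
by move: FN0; rewrite -(@cvg_shiftS _ (fun n : nat => F (- n%:R)) (nbhs (0 : R))).
Qed.

(** Half of the exponent absorbs the power: with [y = x^2 / (4 s^2)] one has [x^4 = 16 s^4 y^2] and
    [y^2 expR (- y) <= 2]. The other half is the exponent of a Gaussian of standard deviation
    [sqrt 2 s], whose peak is at least half the original one. Hence 64 = 16 * 2 * 2. *)
Lemma normal_pdf_x4 s x : 0 < s ->
  x ^+ 4 * normal_pdf 0 s x <= 64 * s ^+ 4 * normal_pdf 0 (Num.sqrt 2 * s) x.
Proof.
move=> s0; have r0 : 0 < Num.sqrt 2 * s by rewrite mulr_gt0// sqrtr_gt0.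
have r2 : (Num.sqrt 2 * s) ^+ 2 = 2 * s ^+ 2 by rewrite exprMn sqr_sqrtr.
rewrite !normal_pdf_gauss ?gt_eqF// r2.
have pk : normal_peak s <= 2 * normal_peak (Num.sqrt 2 * s).
  rewrite /normal_peak r2 (_ : 2 * s ^+ 2 * pi *+ 2 = 2 * (s ^+ 2 * pi *+ 2)); last first.
    by rewrite mulrnAr mulrA.
  rewrite sqrtrM// invfM mulrA ler_peMl ?invr_ge0//.
  rewrite ler_pdivlMr ?sqrtr_gt0// mul1r.
  by rewrite -(@ler_pXn2r _ 2) ?nnegrE// sqr_sqrtr//; lra.
set y := (2 * (2 * s ^+ 2))^-1 * x ^+ 2.
have y0 : 0 <= y by rewrite /y; apply: mulr_ge0; rewrite ?invr_ge0 ?sqr_ge0//; apply: mulr_ge0 => //; apply: mulr_ge0 => //; exact: sqr_ge0.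
have s20 : s ^+ 2 != 0 by rewrite expf_neq0// gt_eqF.
have xy : x ^+ 4 = 16 * s ^+ 4 * y ^+ 2.
  by rewrite /y; field; rewrite gt_eqF.
have -> : gauss (2 * s ^+ 2)^-1 x = expR (- y) * expR (- y).
  by rewrite -expRD /gauss /y; congr expR; field; rewrite gt_eqF.
rewrite -[gauss _ x]/(expR (- y)).
have ye : y ^+ 2 * expR (- y) <= 2.
  rewrite expRN ler_pdivrMr ?expR_gt0//.
  have := @expR_ge1Dxn R y 1 y0; rewrite -[_`!%:R]/(2 : R).
  by have := expR_gt0 y; lra.
have e0 := expR_ge0 (- y).
rewrite xy.
have -> : 16 * s ^+ 4 * y ^+ 2 * (normal_peak s * (expR (- y) * expR (- y))) =
  (16 * s ^+ 4 * (y ^+ 2 * expR (- y))) * (normal_peak s * expR (- y)) by ring.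
have -> : 64 * s ^+ 4 * (normal_peak (Num.sqrt 2 * s) * expR (- y)) =
  (16 * s ^+ 4 * 2) * (2 * normal_peak (Num.sqrt 2 * s) * expR (- y)) by ring.
have s4 : 0 <= s ^+ 4 by rewrite exprn_ge0// ltW.
apply: ler_pM.
- by rewrite mulr_ge0// mulr_ge0// sqr_ge0.
- by rewrite mulr_ge0// normal_peak_ge0.
- by rewrite ler_wpM2l// mulr_ge0.
- by rewrite ler_wpM2r.
Qed.

Lemma normal_moment4 s : 0 < s ->
  (\int[normal_prob 0 s]_x (x ^+ 4)%:E <= (64 * s ^+ 4)%:E)%E.
Proof.
move=> s0; rewrite integral_normal_prob//; last first.
  by move=> x; rewrite exprn_even_ge0.
apply: (@le_trans _ _ (\int[leb]_x (64 * s ^+ 4 * normal_pdf 0 (Num.sqrt 2 * s) x)%:E)%E).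
  apply: ge0_le_integral => //.
  - by move=> x _; rewrite lee_fin mulr_ge0 ?normal_pdf_ge0// exprn_even_ge0.
  - apply/measurable_EFinP; apply: measurable_funM; last exact: measurable_normal_pdf.
    exact: measurable_funX.
  - apply/measurable_EFinP; apply: measurable_funM => //; exact: measurable_normal_pdf.
  - by move=> x _; rewrite lee_fin; exact: normal_pdf_x4.
have s4 : 0 <= 64 * s ^+ 4 by rewrite mulr_ge0// exprn_ge0// ltW.
under eq_integral => x _ do rewrite EFinM.
rewrite ge0_integralZl_EFin//.
- by rewrite integral_normal_pdf mule1.
- by move=> x _; rewrite lee_fin normal_pdf_ge0.
- by apply/measurable_EFinP; exact: measurable_normal_pdf.
Qed.

Lemma normal_prob_le4_integrable s (f : R -> R) : 0 < s -> measurable_fun setT f ->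
  (forall x, `|f x| <= 1 + x ^+ 4) ->
  (normal_prob 0 s).-integrable setT (EFin \o f).
Proof.
move=> s0 mf fx.
apply: (@le_integrable _ _ R (normal_prob 0 s) setT measurableT (EFin \o f) (EFin \o (fun x => 1 + x ^+ 4))) => //.
- exact/measurable_EFinP.
- by move=> x _; rewrite lee_fin (le_trans (fx x))// ler_norm.
apply: rintegrableD => //.
  by apply: finite_measure_integrable_cst.
apply/integrableP; split.
  by apply/measurable_EFinP; exact: measurable_funX.
under eq_integral => x _ do rewrite gee0_abs ?lee_fin ?exprn_even_ge0//.
by apply: (le_lt_trans (normal_moment4 s0)); rewrite ltry.
Qed.

Lemma normal_pdf_decay s : 0 < s ->
  exists K, forall x, (1 + `|x|) ^+ 2 * normal_pdf 0 s x <= K.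
Proof.
move=> s0; exists (8 * (64 * s ^+ 4 * normal_peak (Num.sqrt 2 * s) + normal_peak s)) => x.
have r0 : 0 < Num.sqrt 2 * s by rewrite mulr_gt0// sqrtr_gt0.
have h1 := normal_pdf_x4 x s0.
have h2 : 64 * s ^+ 4 * normal_pdf 0 (Num.sqrt 2 * s) x <= 64 * s ^+ 4 * normal_peak (Num.sqrt 2 * s).
  by rewrite ler_wpM2l ?normal_pdf_ub ?gt_eqF// mulr_ge0// exprn_ge0// ltW.
have h3 : normal_pdf 0 s x <= normal_peak s by rewrite normal_pdf_ub// gt_eqF.
have h4 : (1 + `|x|) ^+ 2 <= 8 * (x ^+ 4 + 1).
  have -> : x ^+ 4 = (`|x| ^+ 2) ^+ 2 by rewrite real_normK ?num_real// -exprM.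
  have := normr_ge0 x; set z := `|x| => z0.
  have := sqr_ge0 (z ^+ 2 - 1); have := sqr_ge0 (z - 1); nra.
have h5 := normal_pdf_ge0 0 s x.
have := ler_wpM2r h5 h4; lra.
Qed.

(** These are the boundary terms of the first two moments: [k] is the power of the variable and [e]
    selects the end of the line. *)
Lemma normal_pdf_tail s (k : nat) (e : bool) : 0 < s -> (k <= 1)%N ->
  (fun n : nat => n%:R ^+ k * normal_pdf 0 s ((-1) ^+ e * n%:R)) @ \oo --> (0 : R).
Proof.
move=> s0 k1; have [K HK] := normal_pdf_decay s0.
apply: cvg0_le (@cvgZ0 R K _ (@cvg_harmonic R)) => n; apply/andP; split.
  by rewrite mulr_ge0 ?normal_pdf_ge0// exprn_ge0.
rewrite /harmonic /= ler_pdivlMr ?ltr0Sn//; apply: le_trans (HK ((-1) ^+ e * n%:R)).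
rewrite normrM normrX normrN1 expr1n mul1r normr_nat mulrAC ler_wpM2r ?normal_pdf_ge0//.
rewrite -[n.+1]addn1 natrD [n%:R + _]addrC expr2 ler_wpM2r ?addr_ge0//.
case: k k1 => [|[|//]] _; rewrite ?expr0 ?expr1; last by lra.
by rewrite lerDl.
Qed.

Lemma is_derive_normal_pdf s x : 0 < s ->
  is_derive x 1 (normal_pdf 0 s) (- (s ^+ 2)^-1 * (x * normal_pdf 0 s x)).
Proof.
move=> s0; have sn : s != 0 by rewrite gt_eqF.
rewrite (_ : normal_pdf 0 s = normal_peak s \*: gauss (2 * s ^+ 2)^-1); last first.
  by apply/funext => y; rewrite normal_pdf_gauss.
have d := is_derive_gauss (2 * s ^+ 2)^-1 x.
apply: (is_derive_eq (@is_deriveZ _ _ _ _ (normal_peak s) x 1 _ d)).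
by rewrite /= /GRing.scale /=; field.
Qed.

Lemma le_1Dexp4 (x : R) : `|x| <= 1 + x ^+ 4.
Proof.
have -> : x ^+ 4 = (`|x| ^+ 2) ^+ 2 by rewrite real_normK ?num_real// -exprM.
have := sqr_ge0 (`|x| ^+ 2 - 1); have := sqr_ge0 (`|x| - 1); nra.
Qed.

Lemma le_1Dexp4_sqr (x : R) : `|x ^+ 2| <= 1 + x ^+ 4.
Proof.
rewrite ger0_norm ?sqr_ge0// (_ : x ^+ 4 = (x ^+ 2) ^+ 2); last by rewrite -exprM.
by have := sqr_ge0 (x ^+ 2 - 1); nra.
Qed.

Lemma normal_integrable1 s : 0 < s -> (normal_prob 0 s).-integrable setT (EFin \o (@id R)).
Proof. by move=> s0; apply: normal_prob_le4_integrable => //; exact: le_1Dexp4. Qed.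

Lemma normal_integrable2 s : 0 < s ->
  (normal_prob 0 s).-integrable setT (EFin \o (fun x : R => x ^+ 2)).
Proof.
move=> s0; apply: normal_prob_le4_integrable => //; exact: le_1Dexp4_sqr.
Qed.

Lemma normal_integrable_pdf s (f : R -> R) : 0 < s -> measurable_fun setT f ->
  (normal_prob 0 s).-integrable setT (EFin \o f) ->
  leb.-integrable setT (EFin \o (fun x => f x * normal_pdf 0 s x)).
Proof.
move=> s0 mf /integrableP[_ foo]; apply/integrableP; split.
  apply/measurable_EFinP; apply: measurable_funM => //.
  exact: measurable_normal_pdf.
move: foo; rewrite -[X in (X < _)%E]/(\int[normal_prob 0 s]_x (`|f x|)%:E)%E.
rewrite integral_normal_prob//; last exact: measurableT_comp.
apply: le_lt_trans; rewrite le_eqVlt; apply/orP; left; apply/eqP.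
apply: eq_integral => x _ /=; rewrite normrM.
by rewrite (@ger0_norm _ (normal_pdf 0 s x)) ?normal_pdf_ge0.
Qed.

Lemma continuous_normal_pdf0 s : 0 < s -> continuous (normal_pdf 0 s).
Proof. by move=> s0; apply: continuous_normal_pdf; rewrite gt_eqF. Qed.

Lemma normal_moment1 s : 0 < s -> \int[normal_prob 0 s]_x x = 0.
Proof.
move=> s0; have sn : s != 0 by rewrite gt_eqF.
have i1 := normal_integrable1 s0.
rewrite /Rintegral integral_normal_prob_integrable//.
rewrite -[RHS]/(fine 0%:E); congr fine.
apply: (@integral_derivative_eq0 (fun x => - s ^+ 2 * normal_pdf 0 s x)
  (fun x => x * normal_pdf 0 s x)).
- by move=> x; apply: cvgM; [exact: cvg_id|exact: continuous_normal_pdf0].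
- move=> x; have d := is_derive_normal_pdf x s0.
  apply: (is_derive_eq (@is_deriveZ _ _ _ _ (- s ^+ 2) x 1 _ d)).
  by rewrite /GRing.scale /=; field.
- exact: normal_integrable_pdf.
- have := @normal_pdf_tail s 0 false s0 isT; under eq_fun do rewrite !expr0 !mul1r.
  exact: cvgZ0.
- have := @normal_pdf_tail s 0 true s0 isT; under eq_fun do rewrite !expr0 expr1 mul1r mulN1r.
  exact: cvgZ0.
Qed.

Lemma normal_moment2 s : 0 < s -> \int[normal_prob 0 s]_x (x ^+ 2) = s ^+ 2.
Proof.
move=> s0; have sn : s != 0 by rewrite gt_eqF.
have i2 := normal_integrable2 s0.
have ic : (normal_prob 0 s).-integrable setT (EFin \o (fun=> s ^+ 2 : R)).
  exact: finite_measure_integrable_cst.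
have : \int[normal_prob 0 s]_x (x ^+ 2 - s ^+ 2) = 0.
  rewrite /Rintegral integral_normal_prob_integrable//; last exact: rintegrableB.
  rewrite -[RHS]/(fine 0%:E); congr fine.
  apply: (@integral_derivative_eq0 (fun x => - s ^+ 2 * (x * normal_pdf 0 s x))
    (fun x => (x ^+ 2 - s ^+ 2) * normal_pdf 0 s x)).
  - move=> x; apply: cvgM; last exact: continuous_normal_pdf0.
    by apply: cvgB; [exact: exprn_continuous|exact: cvg_cst].
  - move=> x; have d := is_derive_normal_pdf x s0.
    have d2 := @is_deriveM _ _ (@id R) (normal_pdf 0 s) x 1 _ _ (is_derive_id _ _) d.
    apply: (is_derive_eq (@is_deriveZ _ _ _ _ (- s ^+ 2) x 1 _ d2)).
    by rewrite /GRing.scale /=; field.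
  - apply: normal_integrable_pdf => //; last exact: rintegrableB.
    by apply: measurable_funB => //; exact: (@measurable_funX _ _ R setT (@id R) 2).
  - have := @normal_pdf_tail s 1 false s0 isT; under eq_fun do rewrite !expr1 !expr0 mul1r.
    exact: cvgZ0.
  - have := @normal_pdf_tail s 1 true s0 isT; under eq_fun do rewrite !expr1 mulN1r.
    move=> /(@cvgZ0 _ (s ^+ 2)); apply: cvg_trans; apply: near_eq_cvg; apply: nearW => n /=.
    by lra.
rewrite RintegralB//.
have -> : \int[normal_prob 0 s]_x (s ^+ 2) = s ^+ 2.
  rewrite /Rintegral integral_cst//.
  have E := @probability_setT _ _ _ (normal_prob (0 : R) s).
  transitivity (fine ((s ^+ 2)%:E * 1)%E); last by rewrite mule1.
  by congr (fine (_ * _)%E); exact: E.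
move=> /eqP.
by rewrite subr_eq0 => /eqP.
Qed.

End gaussian_moments.

Section gaussian_variable.
Context d (Omega : measurableType d) (R : realType) (P : probability Omega R).
Variables (D : Omega -> R) (s : R).
Hypotheses (s0 : 0 < s) (mD : measurable_fun setT D).
Hypothesis lawD : forall B, measurable B -> P (D @^-1` B) = normal_prob 0 s B.

Lemma normal_integral_ge0 (f : R -> R) : measurable_fun setT f ->
  (forall x, 0 <= f x) ->
  (\int[P]_w (f (D w))%:E = \int[normal_prob 0 s]_x (f x)%:E)%E.
Proof.
move=> mf f0.
rewrite -[LHS](@ge0_integral_pushforward _ _ Omega (Rm R) R D mD P setT (EFin \o f))//.
- apply: eq_measure_integral => B mB _; rewrite /pushforward; exact: lawD.
- exact/measurable_EFinP.
- by move=> x _; rewrite lee_fin.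
Qed.

Lemma normal_integrable (f : R -> R) : measurable_fun setT f ->
  (normal_prob 0 s).-integrable setT (EFin \o f) ->
  P.-integrable setT (EFin \o (f \o D)).
Proof.
move=> mf /integrableP[_ foo]; apply/integrableP; split.
  by apply/measurable_EFinP; exact: measurableT_comp.
by rewrite /= (@normal_integral_ge0 (fun x => `|f x|))//; exact: measurableT_comp.
Qed.

Lemma normal_integral (f : R -> R) : measurable_fun setT f ->
  (normal_prob 0 s).-integrable setT (EFin \o f) ->
  \int[P]_w (f (D w)) = \int[normal_prob 0 s]_x (f x).
Proof.
move=> mf iF; rewrite /Rintegral; congr fine.
rewrite -[LHS](@integral_pushforward _ _ Omega (Rm R) R D mD P setT (EFin \o f))//.
- apply: eq_measure_integral => B mB _; rewrite /pushforward; exact: lawD.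
- exact/measurable_EFinP.
- exact: normal_integrable.
Qed.

Lemma normal_sqi : sqi P setT D.
Proof.
split=> //; have /integrableP[_] := normal_integrable2 s0.
rewrite -(@normal_integral_ge0 (fun x => `|x ^+ 2|))//; last first.
  by apply: measurableT_comp => //; exact: (@measurable_funX _ _ R setT (@id R) 2).
apply: le_lt_trans; rewrite le_eqVlt; apply/orP; left; apply/eqP.
by apply: eq_integral => w _; rewrite ger0_norm ?sqr_ge0.
Qed.

Lemma normal_mean : \int[P]_w D w = 0.
Proof. by rewrite (@normal_integral (@id R))// ?normal_moment1//; exact: normal_integrable1. Qed.

Lemma normal_variance : \int[P]_w (D w ^+ 2) = s ^+ 2.
Proof.
rewrite (@normal_integral (fun x => x ^+ 2)) ?normal_moment2//; exact: normal_integrable2.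
Qed.

Lemma normal_sqi2 : sqi P setT (fun w => D w ^+ 2).
Proof.
split; first exact: measurable_funX.
under eq_integral do rewrite -exprM.
rewrite (@normal_integral_ge0 (fun x => x ^+ 4)).
- by apply: (le_lt_trans (normal_moment4 s0)); rewrite ltry.
- exact: (@measurable_funX _ _ R setT (@id R) 4).
- by move=> x; rewrite exprn_even_ge0.
Qed.

Lemma normal_fourth : ip P setT (fun w => D w ^+ 2) (fun w => D w ^+ 2) <= 64 * s ^+ 4.
Proof.
rewrite -lee_fin -integral_sqrE//; last exact: normal_sqi2.
under eq_integral do rewrite -exprM.
rewrite (@normal_integral_ge0 (fun x => x ^+ 4)).
- exact: (normal_moment4 s0).
- exact: (@measurable_funX _ _ R setT (@id R) 4).
- by move=> x; rewrite exprn_even_ge0.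
Qed.

End gaussian_variable.

(** * Partitions and cadlag processes *)

Section uniform_partition.
Context {R : realType}.
Implicit Types (s t r : R) (V : R -> R) (n k : nat).

(** There are [n.+1] steps, which keeps the mesh meaningful for every [n]. *)
Definition part s t n k : R := s + (t - s) * (k%:R / n.+1%:R).

Lemma part0 s t n : part s t n 0 = s.
Proof. by rewrite /part mul0r mulr0 addr0. Qed.

Lemma partn s t n : part s t n n.+1 = t.
Proof. by rewrite /part divff ?mulr1 ?pnatr_eq0//; lra. Qed.

Lemma partS s t n k : part s t n k.+1 - part s t n k = (t - s) / n.+1%:R.
Proof. by rewrite /part -(addn1 k) natrD; field; rewrite (_ : 1 + n%:R = n.+1%:R) ?pnatr_eq0// -natr1 addrC. Qed.

Lemma part_mono s t n k l : s <= t -> (k <= l)%N -> part s t n k <= part s t n l.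
Proof.
move=> st kl; rewrite /part lerD2l ler_wpM2l ?subr_ge0//.
by rewrite ler_wpM2r ?invr_ge0// ler_nat.
Qed.

Lemma part_ge s t n k : s <= t -> s <= part s t n k.
Proof. by move=> st; rewrite -{1}(part0 s t n); exact: part_mono. Qed.

Lemma part_le s t n k : s <= t -> (k <= n.+1)%N -> part s t n k <= t.
Proof. by move=> st kn; rewrite -[leRHS](partn s t n); exact: part_mono. Qed.

Lemma part_itv t n k : 0 <= t -> (k <= n.+1)%N -> 0 <= part 0 t n k <= t.
Proof. by move=> t0 kn; rewrite part_ge// part_le. Qed.

(** Values at left end points on left-open intervals converge to left limits and remain predictable.
    [right_step] takes values at right end points on right-open intervals and converges along
    right-continuous paths. *)
Definition left_step V s t n r : R :=
  \sum_(k < n.+1) V (part s t n k) * (part s t n k < r <= part s t n k.+1)%R%:R.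

Definition right_step V s t n r : R :=
  \sum_(k < n.+1) V (part s t n k.+1) * (part s t n k <= r < part s t n k.+1)%R%:R.

Lemma left_stepE s t n r : s < r <= t -> exists2 k, (k < n.+1)%N &
  part s t n k < r <= part s t n k.+1 /\ forall V, left_step V s t n r = V (part s t n k).
Proof.
move=> /andP[sr rt]; have st : s <= t by exact: ltW (lt_le_trans sr rt).
have ex : exists k, r <= part s t n k.+1 by exists n; rewrite partn.
pose k := ex_minn ex; have [rk kmin] : r <= part s t n k.+1 /\ forall m, r <= part s t n m.+1 -> (k <= m)%N.
  by rewrite /k; case: ex_minnP.
have kn : (k < n.+1)%N by rewrite ltnS; apply: kmin; rewrite partn.
have kr : part s t n k < r.
  case: k rk kmin kn => [|k] rk kmin kn; first by rewrite part0.
  by rewrite ltNge; apply/negP => /kmin; rewrite ltnn.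
exists k => //; split=> [|V]; first by rewrite kr.
rewrite /left_step (bigD1 (Ordinal kn))//= kr rk mulr1 big1 ?addr0// => -[l ln] /= lk.
rewrite (_ : (_ < _ <= _) = false) ?mulr0//; apply/negbTE/negP => /andP[lr rl].
have kl := kmin _ rl.
have : (k < l)%N by rewrite ltn_neqAle kl andbT; apply: contra lk => /eqP kl'; apply/eqP/val_inj.
by move=> /(part_mono n st) h; have := le_lt_trans (le_trans rk h) lr; rewrite ltxx.
Qed.

Lemma right_stepE s t n r : s <= r < t -> exists2 k, (k < n.+1)%N &
  part s t n k <= r < part s t n k.+1 /\ forall V, right_step V s t n r = V (part s t n k.+1).
Proof.
move=> /andP[sr rt]; have st : s <= t by exact: ltW (le_lt_trans sr rt).
have ex : exists k, r < part s t n k.+1 by exists n; rewrite partn.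
pose k := ex_minn ex; have [rk kmin] : r < part s t n k.+1 /\ forall m, r < part s t n m.+1 -> (k <= m)%N.
  by rewrite /k; case: ex_minnP.
have kn : (k < n.+1)%N by rewrite ltnS; apply: kmin; rewrite partn.
have kr : part s t n k <= r.
  case: k rk kmin kn => [|k] rk kmin kn; first by rewrite part0.
  by rewrite leNgt; apply/negP => /kmin; rewrite ltnn.
exists k => //; split=> [|V]; first by rewrite kr.
rewrite /right_step (bigD1 (Ordinal kn))//= kr rk mulr1 big1 ?addr0// => -[l ln] /= lk.
rewrite (_ : (_ <= _ < _) = false) ?mulr0//; apply/negbTE/negP => /andP[lr rl].
have kl := kmin _ rl.
have : (k < l)%N by rewrite ltn_neqAle kl andbT; apply: contra lk => /eqP kl'; apply/eqP/val_inj.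
by move=> /(part_mono n st) h; have := lt_le_trans rk (le_trans h lr); rewrite ltxx.
Qed.

Lemma mesh_small s t e : 0 < e -> \forall n \near \oo, (t - s) / n.+1%:R < e.
Proof.
move=> e0; exists (Num.truncn (`|t - s| / e)).+1 => // n /= hn.
rewrite ltr_pdivrMr ?ltr0Sn// -ltr_pdivrMl// mulrC.
apply: (@le_lt_trans _ _ (`|t - s| / e)); first by apply: ler_wpM2r; [rewrite invr_ge0 ltW|exact: ler_norm].
by apply: (lt_trans (truncnS_gt _)); rewrite ltr_nat ltnS; exact: hn.
Qed.

Lemma cvg_left_step V s t r l : s < r <= t -> V x @[x --> r^'-] --> l ->
  left_step V s t n r @[n --> \oo] --> (l : R).
Proof.
move=> srt Vl; apply/cvgrPdist_le => e e0.
move/cvgrPdist_le : Vl => /(_ e e0) [dl /= dl0 Hd].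
have [n0 _ Hn] := mesh_small s t dl0.
exists n0 => // n /= /Hn hn; have [k kn [/andP[kr rk] ->]] := left_stepE n srt.
apply: Hd => //=; rewrite ger0_norm ?subr_ge0 ?ltW//.
by move: hn; rewrite -(partS s t n k); lra.
Qed.

Lemma cvg_right_step V s t r l : s <= r < t -> V x @[x --> r^'+] --> l ->
  right_step V s t n r @[n --> \oo] --> (l : R).
Proof.
move=> srt Vl; apply/cvgrPdist_le => e e0.
move/cvgrPdist_le : Vl => /(_ e e0) [dl /= dl0 Hd].
have [n0 _ Hn] := mesh_small s t dl0.
exists n0 => // n /= /Hn hn; have [k kn [/andP[kr rk] ->]] := right_stepE n srt.
apply: Hd => //=; rewrite ler0_norm ?subr_le0 ?ltW//.
by move: hn; rewrite -(partS s t n k); lra.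
Qed.

End uniform_partition.

Section cadlag_measurable.
Context {R : realType} {d} {Omega : measurableType d}.
Variables (T : R) (V : R -> Omega -> R).
Hypothesis T0 : 0 < T.
Hypothesis mV : forall t, 0 <= t <= T -> measurable_fun setT (V t).
Hypothesis rV : forall w t, 0 <= t < T -> V s w @[s --> t^'+] --> V t w.

Lemma measurable_itvl_indic (s t : R) :
  measurable_fun [set: OxR Omega R] (fun p : OxR Omega R => (s <= p.2 < t)%R%:R : R).
Proof.
rewrite (_ : (fun p => _) = (\1_(`[s, t[%classic) : R -> R) \o snd).
  by apply: measurableT_comp => //; exact: measurable_indic.
apply/funext => p /=; rewrite indicE.
by congr (nat_of_bool _)%:R; apply/idP/idP; rewrite inE /= in_itv.
Qed.

Lemma measurable_eq_indic (t : R) :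
  measurable_fun [set: OxR Omega R] (fun p : OxR Omega R => (p.2 == t)%R%:R : R).
Proof.
rewrite (_ : (fun p => _) = (\1_([set t]) : R -> R) \o snd).
  by apply: measurableT_comp => //; apply: measurable_indic; exact: measurable_set1.
apply/funext => p /=; rewrite indicE.
by congr (nat_of_bool _)%:R; apply/idP/idP; rewrite inE /= => /eqP.
Qed.

Lemma cadlag_measurable2 :
  measurable_fun (domain T : set (OxR Omega R)) (fun p : OxR Omega R => V p.2 p.1).
Proof.
(* The half-open steps leave out the time [T], whose value is added by hand. *)
pose f n (p : OxR Omega R) := right_step (V ^~ p.1) 0 T n p.2 + V T p.1 * (p.2 == T)%:R.
apply: (@measurable_fun_cvg _ _ _ _ f).
- move=> n; apply: measurable_funTS; apply: measurable_funD.
    apply: measurable_sum => k; apply: measurable_funM; last exact: measurable_itvl_indic.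
    apply: (measurableT_comp (f := V (part 0 T n k.+1)) (g := fst)) => //.
    by apply: mV; rewrite part_ge ?part_le// ltW.
  apply: measurable_funM; last exact: measurable_eq_indic.
  apply: (measurableT_comp (f := V T) (g := fst)) => //.
  by apply: mV; rewrite lexx ltW.
- move=> [w t] [_ /=]; rewrite in_itv /= => /andP[t0 tT].
  have [->|tn] := eqVneq t T.
    rewrite (_ : f ^~ (w, T) = fun=> V T w); first exact: cvg_cst.
    apply/funext => n; rewrite /f /= eqxx mulr1 /right_step big1 ?add0r// => k _.
    rewrite (_ : (_ <= _ < _) = false) ?mulr0//; apply/negbTE; rewrite negb_and -!leNgt; apply/orP; right.
    by apply: part_le => //; exact: ltW.
  have tlt : 0 <= t < T by rewrite t0 lt_neqAle tn.
  rewrite (_ : f ^~ (w, t) = fun n => right_step (V ^~ w) 0 T n t).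
    by apply: cvg_right_step => //; exact: rV.
  by apply/funext => n; rewrite /f /= (negbTE tn) mulr0 addr0.
Qed.

Lemma cadlag_path_measurable w : measurable_fun (`[0, T]%classic : set (Rm R)) (V ^~ w : Rm R -> R).
Proof.
apply: (@measurable_comp _ _ _ _ _ _ (domain T : set (OxR Omega R)) (fun p : OxR Omega R => V p.2 p.1) _ (fun t => (w, t))).
- by apply: measurableX.
- by move=> _ [t tT <-].
- exact: cadlag_measurable2.
- by apply: measurable_funTS; apply: measurable_fun_pair.
Qed.

End cadlag_measurable.

Lemma measurable_domain {R : realType} {d} {Omega : measurableType d} (T : R) :
  @measurable _ (OxR Omega R) (domain T).
Proof. by apply: measurableX. Qed.

(** * Integration over Omega x [0, T] *)

Section product_domain.
Context {R : realType} {d} {Omega : measurableType d}.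
Variables (P : probability Omega R) (T : R).

Local Notation leb := (@lebesgue_measure R).
Local Notation PL := (P \x leb)%E.
Local Notation dom := (@domain R d Omega T).
Local Notation ip2 := (ip PL dom).
Local Notation sqi2 := (sqi PL dom).
Local Notation I := (`[0, T]%classic : set R).

Let mdom := @measurable_domain R d Omega T.

Lemma PL_fin : (PL dom < +oo)%E.
Proof.
rewrite /domain product_measure1E//= probability_setT mul1e.
by rewrite lebesgue_measure_itv /=; case: ifP => _; rewrite ?ltry// -EFinD ltry.
Qed.

Lemma itv_indicE (s t r : R) : (s < r <= t)%R%:R = \1_(`]s, t]%classic) r :> R.
Proof. by rewrite indicE; congr (nat_of_bool _)%:R; apply/idP/idP; rewrite inE /= in_itv. Qed.

Lemma itv_indic_measurable (s t : R) : measurable_fun [set: OxR Omega R]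
  (fun q : OxR Omega R => (s < q.2 <= t)%R%:R : R).
Proof.
rewrite (_ : (fun q => _) = (\1_(`]s, t]%classic) : R -> R) \o snd).
  by apply: measurableT_comp => //; exact: measurable_indic.
by apply/funext => q /=; exact: itv_indicE.
Qed.

Lemma itv_indic_sqi s t : sqi2 (fun q => (s < q.2 <= t)%R%:R).
Proof.
apply: (sqi_bounded mdom (C := 1) PL_fin).
  by apply: measurable_funTS; exact: itv_indic_measurable.
by move=> q _; case: (_ < _ <= _); rewrite ?normr1 ?normr0.
Qed.

Lemma dom_bounded_sqi (f : OxR Omega R -> R) C : measurable_fun dom f ->
  (forall q, dom q -> `|f q| <= C) -> sqi2 f.
Proof. by move=> mf fC; exact: (sqi_bounded mdom PL_fin mf fC). Qed.

Lemma patch_dom (f : Omega * R -> \bar R) w t :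
  (f \_ dom) (w, t) = ((fun t => f (w, t)) \_ I) t.
Proof.
rewrite !patchE; congr (if _ then _ else _).
by apply/idP/idP; rewrite !inE /domain /= => -[].
Qed.

Lemma patch_dom_w (f : Omega * R -> \bar R) t :
  (\int[P]_w (f \_ dom) (w, t) = ((fun t => \int[P]_w f (w, t)) \_ I) t)%E.
Proof.
under eq_integral => w _ do rewrite patch_dom.
rewrite !patchE; case: ifP => It.
  by apply: eq_integral => w _; rewrite patchE It.
rewrite (@eq_integral _ _ _ P setT (fun=> 0%E)) ?integral0// => w _.
by rewrite patchE It.
Qed.

Section tonelli.
Variable f : OxR Omega R -> \bar R.
Hypotheses (mf : measurable_fun dom f) (f0 : forall q, dom q -> (0 <= f q)%E).

Let mg : measurable_fun [set: OxR Omega R] (f \_ dom).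
Proof. by apply/(measurable_restrictT _ mdom). Qed.

Let g0 q : (0 <= (f \_ dom) q)%E.
Proof. by rewrite patchE; case: ifPn => //; rewrite inE => /f0. Qed.

Lemma dom_tonelli_t :
  (\int[PL]_(q in dom) f q = \int[leb]_(t in I) \int[P]_w f (w, t))%E.
Proof.
transitivity (\int[leb]_t fubini_G P (f \_ dom) t)%E.
  by rewrite integral_mkcond; rewrite fubini_tonelli2.
by rewrite [RHS]integral_mkcond; apply: eq_integral => t _; exact: patch_dom_w.
Qed.

Lemma dom_tonelli_w :
  (\int[PL]_(q in dom) f q = \int[P]_w \int[leb]_(t in I) f (w, t))%E.
Proof.
transitivity (\int[P]_w fubini_F leb (f \_ dom) w)%E.
  by rewrite integral_mkcond; rewrite fubini_tonelli1.
by apply: eq_integral => w _; rewrite [RHS]integral_mkcond; apply: eq_integral => t _; exact: patch_dom.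
Qed.

Lemma dom_tonelli_measurable_t : measurable_fun (I : set (Rm R)) (fun t => \int[P]_w f (w, t))%E.
Proof.
have := @measurable_fun_fubini_tonelli_G _ _ _ _ _ P _ mg g0.
move=> h; apply/(measurable_restrictT _ (measurable_itv _)).
by apply: eq_measurable_fun h => t _; exact: patch_dom_w.
Qed.

Lemma dom_tonelli_measurable_w : measurable_fun setT (fun w => \int[leb]_(t in I) f (w, t))%E.
Proof.
have := @measurable_fun_fubini_tonelli_F _ _ _ _ _ leb _ mg g0.
rewrite (_ : fubini_F _ _ = (fun w => \int[leb]_(t in I) f (w, t))%E)//.
apply/funext => w; rewrite [RHS]integral_mkcond.
by apply: eq_integral => t _; exact: patch_dom.
Qed.

End tonelli.

Section fubini.
Variable f : OxR Omega R -> R.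
Hypothesis intf : PL.-integrable dom (EFin \o f).

Let ig : PL.-integrable setT ((EFin \o f) \_ dom).
Proof. exact: (integrable_mkcond _ mdom).1 intf. Qed.

Lemma dom_fubini_t : (\int[PL]_(q in dom) (f q)%:E = \int[leb]_(t in I) \int[P]_w (f (w, t))%:E)%E.
Proof.
transitivity (\int[leb]_t fubini_G P ((EFin \o f) \_ dom) t)%E.
  by rewrite integral_mkcond; exact/esym/(fubini2 ig).
rewrite [RHS]integral_mkcond.
by apply: eq_integral => t _; exact: (patch_dom_w (EFin \o f)).
Qed.

Lemma dom_fubini_w : (\int[PL]_(q in dom) (f q)%:E = \int[P]_w \int[leb]_(t in I) (f (w, t))%:E)%E.
Proof.
transitivity (\int[P]_w fubini_F leb ((EFin \o f) \_ dom) w)%E.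
  by rewrite integral_mkcond; exact/esym/(fubini1 ig).
apply: eq_integral => w _; rewrite [RHS]integral_mkcond; apply: eq_integral => t _; exact: (patch_dom (EFin \o f)).
Qed.

Lemma dom_fubini_measurable_w : measurable_fun setT (fun w => \int[leb]_(t in I) (f (w, t))%:E)%E.
Proof.
have := measurable_fubini_F ig.
rewrite (_ : fubini_F _ _ = (fun w => \int[leb]_(t in I) (f (w, t))%:E)%E)//.
apply/funext => w; rewrite [RHS]integral_mkcond.
by apply: eq_integral => t _; exact: (patch_dom (EFin \o f)).
Qed.

End fubini.

Lemma integral_rect (f : Omega -> R) C s t : 0 <= s -> s <= t -> t <= T ->
  measurable_fun setT f -> (forall w, `|f w| <= C) ->
  ip2 (fun q => f q.1) (fun q => (s < q.2 <= t)%R%:R) = (t - s) * \int[P]_w f w.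
Proof.
move=> s0 st tT mf fC.
have s1 : sqi2 (fun q => f q.1).
  by apply: (dom_bounded_sqi (C := C)) => //; apply: measurable_funTS; exact: measurableT_comp.
rewrite /ip /Rintegral dom_fubini_w; last by apply: sqi_integrable => //; exact: itv_indic_sqi.
rewrite [X in fine X = _](@eq_integral _ _ _ P setT (EFin \o (fun w => (t - s) * f w))); last first.
  move=> w _ /=; under eq_integral => r _ do rewrite itv_indicE EFinM.
  rewrite integralZl//; last first.
    by apply: (integrableS measurableT) => //; exact: integrable_indic_itv.
  rewrite integral_indic// (_ : _ `&` _ = `]s, t]%classic); last first.
    apply/setIidPl => r /=; rewrite !in_itv /= => /andP[sr rt].
    by rewrite (le_trans s0 (ltW sr)) (le_trans rt tT).
  rewrite /= lebesgue_measure_itv /= lte_fin.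
  case: ltP => [_|ts]; first by rewrite EFinN -EFinB -EFinM mulrC.
  by rewrite (_ : t - s = 0) ?mul0r ?mule0//; lra.
rewrite -[LHS]/(Rintegral P setT (fun w => (t - s) * f w)) RintegralZl//.
exact: bounded_int fC.
Qed.

End product_domain.

(** * The Markov chain and its martingale *)

Section augmented_filtration.
Context {R : realType} {d} {Omega : measurableType d}.
Variables (P : probability Omega R) (I : Type) (Z : I -> R -> Omega -> R).

Lemma aug_sigma t : sigma_algebra setT (aug_filtration P Z t).
Proof. exact: smallest_sigma_algebra. Qed.

Lemma aug_mono s t : s <= t -> aug_filtration P Z s `<=` aug_filtration P Z t.
Proof.
move=> st; apply: sub_sigma_algebra2; apply: setUS => B [r /= + ZB].
by rewrite !in_itv /= => /andP[r0 rs]; exists r => //=; rewrite in_itv /= r0 (le_trans rs).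
Qed.

Lemma aug_negligible t : P.-negligible `<=` aug_filtration P Z t.
Proof. by move=> B nB; apply: sub_sigma_algebra; left. Qed.

Lemma aug_mw i s t : 0 <= s <= t -> measurable_wrt (aug_filtration P Z t) (Z i s).
Proof.
move=> st B ZB; apply: sub_sigma_algebra; right.
by exists s => //=; exists i.
Qed.

Lemma aug_sub t : measure_is_complete P ->
  (forall i s, 0 <= s <= t -> measurable_fun setT (Z i s)) ->
  aug_filtration P Z t `<=` measurable.
Proof.
move=> hP mZ; apply: smallest_sub; first exact: sigma_algebra_measurable.
move=> B [nB|[s /= st [i _ [C mC <-]]]]; first exact: hP.
by apply: mZ => //; move: st; rewrite in_itv.
Qed.

End augmented_filtration.

Section chain.
Context {R : realType} {d} {Omega : measurableType d}.
Variables (P : probability Omega R) (T : R) (N : nat) (A : 'M[R]_N) (c : R).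
Variable X : R -> Omega -> 'cV[R]_N.
Hypotheses (hP : measure_is_complete P) (T0 : 0 < T) (hc : 0 < c < 1)
  (hA : rate_matrix A c) (hX : markov_chain P T A X)
  (hM : square_integrable_martingale P T (filtrationX P X) (chain_martingale A X)).

Local Notation leb := (@lebesgue_measure R).
Local Notation FX := (filtrationX P X).
Local Notation x i := (fun t w => X t w i 0).
Local Notation E f := (\int[P]_w f w).
Local Notation integrable f := (P.-integrable setT (EFin \o f)).

Lemma states_index (v : 'cV[R]_N) : states v -> exists a, forall j, v j 0 = (j == a)%:R.
Proof. by move=> [a _ <-]; exists a => j; rewrite mxE eqxx andbT. Qed.

Lemma index_states (v : 'cV[R]_N) a : (forall j, v j 0 = (j == a)%:R) -> v = basis_vec a.
Proof. by move=> va; apply/matrixP => j k; rewrite ord1 va mxE eqxx andbT. Qed.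

Lemma chain_index t w : 0 <= t <= T -> exists a, forall j, X t w j 0 = (j == a)%:R.
Proof. by move=> tT; apply: states_index; case: hX => + _ _ _; exact. Qed.

Lemma chain_norm1 i t w : 0 <= t <= T -> `|X t w i 0| <= 1.
Proof. by move=> /(chain_index w)[a ->]; case: (_ == _); rewrite ?normr1 ?normr0. Qed.

Lemma chain_sum1 t w : 0 <= t <= T -> \sum_i X t w i 0 = 1.
Proof.
move=> /(chain_index w)[a Xa]; rewrite (bigD1 a)//= Xa eqxx big1 ?addr0// => j ja.
by rewrite Xa (negbTE ja).
Qed.

Lemma chain_measurable i t : 0 <= t <= T -> measurable_fun setT (x i t).
Proof. by case: hX => _ + _ _; exact. Qed.

Lemma chain_sqi i t : 0 <= t <= T -> sqi P setT (x i t).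
Proof. by move=> tT; apply: (@bounded_sqi _ _ _ _ _ 1) => [|w]; [exact: chain_measurable|exact: chain_norm1]. Qed.

Lemma FX_sub t : t <= T -> FX t `<=` measurable.
Proof.
move=> tT; apply: aug_sub => // i s /andP[s0 st]; apply: chain_measurable.
by rewrite s0 (le_trans st tT).
Qed.

Lemma chain_indic i s w : 0 <= s <= T ->
  X s w i 0 = \1_([set w | X s w = basis_vec i]) w.
Proof.
move=> /(chain_index w)[a Xa]; rewrite Xa indicE.
congr (nat_of_bool _)%:R; apply/eqP/idP => [ia|].
  by rewrite inE /=; apply: index_states => j; rewrite Xa ia.
rewrite inE /= => Xi; have := Xa i; rewrite Xi mxE eqxx eqxx /=.
by case: eqP => // _ /eqP; rewrite oner_eq0.
Qed.

Lemma chain_right i w t : 0 <= t < T -> X s w i 0 @[s --> t^'+] --> X t w i 0.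
Proof. by move=> tT; case: hX => _ _ /(_ w i)[+ _] _; exact. Qed.

Lemma chain_left i w t : 0 < t <= T -> cvg (X s w i 0 @[s --> t^'-]).
Proof. by move=> tT; case: hX => _ _ /(_ w i)[_ +] _; exact. Qed.

Definition KA : R := \sum_i \sum_j `|A i j|.

Lemma KA_ge i j : `|A i j| <= KA.
Proof.
rewrite /KA (bigD1 i)//= (bigD1 j)//= -addrA lerDl addr_ge0// sumr_ge0// => k _.
by rewrite sumr_ge0.
Qed.

Lemma KA_ge0 : 0 <= KA.
Proof. by apply: sumr_ge0 => i _; apply: sumr_ge0. Qed.

Lemma AX_index (v : 'cV[R]_N) a i : (forall j, v j 0 = (j == a)%:R) -> (A *m v) i 0 = A i a.
Proof.
move=> va; rewrite mxE (bigD1 a)//= va eqxx mulr1 big1 ?addr0// => j ja.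
by rewrite va (negbTE ja) mulr0.
Qed.

Lemma AX_bounded i t w : 0 <= t <= T -> `|(A *m X t w) i 0| <= KA.
Proof. by move=> /(chain_index w)[a Xa]; rewrite (AX_index _ Xa) KA_ge. Qed.

Lemma AX_path_measurable i w (B : set R) : B `<=` `[0, T]%classic ->
  measurable (B : set (Rm R)) ->
  measurable_fun (B : set (Rm R)) (fun s : Rm R => (A *m X s w) i 0).
Proof.
move=> BT mB; apply: (measurable_funS _ BT) => //.
rewrite (_ : (fun s => _) = fun s => \sum_j A i j * X s w j 0); last first.
  by apply/funext => s; rewrite mxE.
apply: measurable_sum => j; apply: measurable_funM => //.
apply: (@cadlag_path_measurable _ _ _ T (x j)) => //.
- by move=> t; exact: chain_measurable.
- by move=> w' t; exact: chain_right.
Qed.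

Lemma itv_lty (a b : itv_bound R) (s t : R) : [set` Interval a b] `<=` `[s, t]%classic ->
  (leb [set` Interval a b] < +oo)%E.
Proof.
move=> sub; apply: (@le_lt_trans _ _ (leb `[s, t]%classic)).
  by apply: le_measure => //; rewrite inE.
by rewrite /= lebesgue_measure_itv /=; case: ifP => _; rewrite ?ltry// -EFinD ltry.
Qed.

Lemma AX_integrable i w (a b : itv_bound R) : [set` Interval a b] `<=` `[0, T]%classic ->
  leb.-integrable [set` Interval a b] (EFin \o (fun s => (A *m X s w) i 0)).
Proof.
move=> sub; apply: (@bounded_integrable _ _ _ _ _ _ _ KA) => //.
- exact: itv_lty sub.
- exact: AX_path_measurable.
- by move=> t /sub /=; rewrite in_itv; exact: AX_bounded.
Qed.

Definition drift i s t w : R := \int[leb]_(r in `]s, t]%classic) (A *m X r w) i 0.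

Local Notation Mi i := (fun t w => chain_martingale A X t w i 0).

Lemma martingale_increment i s t w : 0 <= s -> s <= t -> t <= T ->
  Mi i t w - Mi i s w = (X t w i 0 - X s w i 0) - drift i s t w.
Proof.
move=> s0 st tT; rewrite /chain_martingale !mxE.
have := @Rintegral_itvB _ (fun r => (A *m X r w) i 0) (BLeft 0) (BRight t) s.
move=> /(_ _ _ _)/wrap[].
- apply: AX_integrable => r /=; rewrite !in_itv /= => /andP[-> rt]; exact: le_trans tT.
- by rewrite bnd_simp.
- by rewrite bnd_simp.
by move=> h; rewrite /drift -h; lra.
Qed.

Lemma drift_bound i s t w : 0 <= s -> s <= t -> t <= T -> `|drift i s t w| <= KA * (t - s).
Proof.
move=> s0 st tT.
have sub : `]s, t]%classic `<=` `[0, T]%classic.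
  by move=> r /=; rewrite !in_itv /= => /andP[sr rt]; rewrite (le_trans s0 (ltW sr)) (le_trans rt tT).
have iA := @AX_integrable i w _ _ sub.
apply: (le_trans (le_normr_Rintegral _ _)) => //.
apply: (@le_trans _ _ (\int[leb]_(r in `]s, t]%classic) KA)).
  apply: le_Rintegral => //.
  - exact: integrable_norm.
  - by apply: (@bounded_integrable _ _ _ _ _ _ _ `|KA|) => //; exact: itv_lty sub.
  - by move=> r /sub /=; rewrite in_itv; exact: AX_bounded.
rewrite Rintegral_cst//= lebesgue_measure_itv /= lte_fin.
by case: ltP => [_|ts]; rewrite ?EFinN -?EFinB//= ?mulr0 mulr_ge0 ?KA_ge0// subr_ge0.
Qed.

(** The entry [i], [j] of [psi_mx] in the state [a], as a mean of products of jumps: a jump from [a]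
    to [b], of rate [A b a], moves component [i] by the first difference and component [j] by the
    second. The term [b = a] is 0. *)
Definition psi0 i j a : R :=
  \sum_b A b a * ((b == i)%:R - (a == i)%:R) * ((b == j)%:R - (a == j)%:R).

Lemma col_sum0 a : \sum_b A b a = 0.
Proof. by case: hA => + _; exact. Qed.

Lemma sum_delta (f : 'I_N -> R) i : \sum_b f b * (b == i)%:R = f i.
Proof.
rewrite (bigD1 i)//= eqxx mulr1 big1 ?addr0// => b bi.
by rewrite (negbTE bi) mulr0.
Qed.

Lemma psi0E i j a : psi0 i j a =
  A i a * (i == j)%:R - A i a * (a == j)%:R - A j a * (a == i)%:R.
Proof.
rewrite /psi0 (eq_bigr (fun b => (A b a * (i == j)%:R - A b a * (a == j)%:R) * (b == i)%:R
  - A b a * (a == i)%:R * (b == j)%:R + A b a * ((a == i)%:R * (a == j)%:R))).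
  by rewrite big_split /= sumrB /= !sum_delta -mulr_suml col_sum0 mul0r addr0.
by move=> b _; have [->|bi] := eqVneq b i; rewrite ?eqxx /=; ring.
Qed.

Lemma psi_mx_index (v : 'cV[R]_N) a i j : (forall k, v k 0 = (k == a)%:R) ->
  psi_mx A v i j = psi0 i j a.
Proof.
move=> va; rewrite psi0E /psi_mx !mxE.
have -> : (\sum_j0 A i j0 * v j0 0) = A i a.
  by under eq_bigr => b _ do rewrite va; exact: sum_delta.
have -> : \sum_j0 A i j0 * diag_mx v^T j0 j = A i j * v j 0.
  rewrite (bigD1 j)//= !mxE eqxx mulr1n big1 ?addr0// => b bj.
  by rewrite !mxE (negbTE bj) mulr0n mulr0.
have -> : \sum_j0 diag_mx v^T i j0 * A^T j0 j = v i 0 * A j i.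
  rewrite (bigD1 i)//= !mxE eqxx mulr1n big1 ?addr0// => b bj.
  by rewrite !mxE eq_sym (negbTE bj) mulr0n mul0r.
rewrite !va -[_ *+ (i == j)]mulr_natr.
have [->|ja] := eqVneq j a; have [->|ia] := eqVneq i a; rewrite ?eqxx.
all: by rewrite ?(eq_sym a) ?(negbTE ia) ?(negbTE ja) /=; ring.
Qed.

(** Left steps are basis vectors, and being one is a closed condition: the entries are idempotent,
    distinct entries have product 0, and the sum is 1. All three pass to the limit. *)
Lemma left_lim_index w t : 0 <= t <= T ->
  exists a, forall j, left_lim (X ^~ w) t j 0 = (j == a)%:R.
Proof.
move=> tT; rewrite /left_lim; have [t0|t0] := eqVneq t 0.
  by apply: chain_index; rewrite lexx ltW.
have t0T : 0 < t <= T by case/andP: tT => h ->; rewrite lt_neqAle eq_sym t0 h.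
pose l j := lim (X s w j 0 @[s --> t^'-]).
have cl j : left_step (x j ^~ w) 0 T n t @[n --> \oo] --> l j.
  by apply: cvg_left_step => //; exact: chain_left.
have st n : exists a, forall j, left_step (x j ^~ w) 0 T n t = (j == a)%:R.
  have [k kn [/andP[kt tk] Vk]] := left_stepE n t0T.
  have [a Xa] : exists a, forall j, X (part 0 T n k) w j 0 = (j == a)%:R.
    by apply: chain_index; rewrite part_ge ?part_le ?ltW// ltnW.
  by exists a => j; rewrite Vk Xa.
have limE (f : R^nat) (u v : R) : f @ \oo --> u -> (forall n, f n = v) -> u = v.
  move=> fu fv; apply/esym/(cvg_unique _ _ fu) => //.
  by rewrite (_ : f = fun=> v); [exact: cvg_cst|exact/funext].
have sq j : l j * l j = l j.
  have cq : (fun n => left_step (x j ^~ w) 0 T n t * left_step (x j ^~ w) 0 T n t - left_step (x j ^~ w) 0 T n t)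
    @ \oo --> l j * l j - l j by apply: cvgB => //; exact: cvgM.
  apply/eqP; rewrite -subr_eq0; apply/eqP; apply: (limE _ _ 0 cq) => n.
  by have [a Ha] := st n; rewrite Ha; case: (_ == _); rewrite ?mulr1 ?mulr0 subrr.
have dis j k : j != k -> l j * l k = 0.
  move=> jk.
  have cq : (fun n => left_step (x j ^~ w) 0 T n t * left_step (x k ^~ w) 0 T n t)
    @ \oo --> l j * l k by exact: cvgM.
  apply: (limE _ _ 0 cq) => n.
  have [a Ha] := st n; rewrite !Ha; case: eqP => [ja|]; last by rewrite mul0r.
  by case: eqP => [ka|]; [move: jk; rewrite ja ka eqxx|rewrite mulr0].
have s1 : \sum_j l j = 1.
  apply: (limE _ _ 1 (@cvg_finite_sum R _ \oo _ _ (index_enum _) (fun j n => left_step (x j ^~ w) 0 T n t) l cl)).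
  move=> n; have [a Ha] := st n.
  rewrite (bigD1 a)//= Ha eqxx big1 ?addr0// => j ja.
  by rewrite Ha (negbTE ja).
have [a la] : exists a, l a != 0.
  apply/not_existsP => h; move: s1; rewrite big1.
    by move/eqP; rewrite eq_sym oner_eq0.
  by move=> j _; apply/eqP/negPn/negP; exact: h.
have la1 : l a = 1 by apply: (mulfI la); rewrite sq mulr1.
exists a => j; rewrite mxE -/(l j); have [->|ja] := eqVneq j a; first by [].
by have := dis _ _ ja; rewrite la1 mulr1.
Qed.

Definition transition_law (p : R -> 'M[R]_N) :=
  forall s t B i j, 0 <= s -> s <= t -> t <= T -> FX s B ->
    (P (B `&` [set w | X s w = basis_vec i] `&` [set w | X t w = basis_vec j]) =
     (p (t - s) j i)%:E * P (B `&` [set w | X s w = basis_vec i]))%E.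

Lemma chain_markov s t p : transition_function A p -> transition_law p ->
  forall B i j, 0 <= s -> s <= t -> t <= T -> FX s B ->
  E (fun w => \1_B w * (X s w i 0 * X t w j 0)) =
  p (t - s) j i * E (fun w => \1_B w * X s w i 0).
Proof.
move=> tp mk B i j s0 st tT FB.
have sT : 0 <= s <= T by rewrite s0 (le_trans st).
have tT' : 0 <= t <= T by rewrite tT (le_trans s0).
have mB : measurable B by apply: FX_sub FB; exact: le_trans tT.
have mset k r : 0 <= r <= T -> measurable [set w | X r w = basis_vec k].
  move=> rT; rewrite (_ : [set w | _] = x k r @^-1` [set 1]); last first.
    apply/seteqP; split=> w /=; have := chain_indic k w rT; rewrite indicE.
      by move=> e h; rewrite e mem_set.
    case: (boolP (w \in _)); first by rewrite inE.
    by move=> _ -> /eqP; rewrite eq_sym oner_eq0.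
  have := @chain_measurable k r rT measurableT [set 1] (measurable_set1 _).
  by rewrite setTI.
have -> : E (fun w => \1_B w * (X s w i 0 * X t w j 0)) =
   fine (P (B `&` [set w | X s w = basis_vec i] `&` [set w | X t w = basis_vec j])).
  have mB3 : measurable (B `&` [set w | X s w = basis_vec i] `&` [set w | X t w = basis_vec j]).
    by apply: measurableI; [apply: measurableI => //|]; exact: mset.
  rewrite -[X in P X]setIT -(integral_indic P measurableT)//.
  by congr fine; apply: eq_integral => w _; rewrite !indicI /= -!chain_indic// mulrA.
have -> : E (fun w => \1_B w * X s w i 0) = fine (P (B `&` [set w | X s w = basis_vec i])).
  have mB2 : measurable (B `&` [set w | X s w = basis_vec i]).
    by apply: measurableI => //; exact: mset.
  rewrite -[X in P X]setIT -(integral_indic P measurableT)//.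
  by congr fine; apply: eq_integral => w _; rewrite !indicI /= -!chain_indic.
rewrite mk// fineM//; apply: fin_num_measure; apply: measurableI => //; exact: mset.
Qed.

Section transition.
Variable p : R -> 'M[R]_N.
Hypothesis tp : transition_function A p.

(** Sums over all entries so that a single step size serves every pair of states. *)
Definition ratio_error h := \sum_i \sum_j `|(p h j i - (j == i)%:R) / h - A j i|.

Lemma ratio_error_cvg : ratio_error h @[h --> 0^'+] --> 0.
Proof.
rewrite [X in _ --> X](_ : 0 = \sum_(i < N) \sum_(j < N) 0); last first.
  by rewrite big1// => i _; rewrite big1.
apply: cvg_finite_sum => i; apply: cvg_finite_sum => j.
have [_ _ _ _ lA] := tp.
rewrite -[X in _ --> X](normr0 R); apply: cvg_norm.
rewrite -[X in _ --> X](subrr (A j i)); have := lA i j => lAij.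
exact: (cvgB lAij (cvg_cst (A j i))).
Qed.

Lemma transition_near e : 0 < e -> exists2 h0, 0 < h0 & forall h, 0 < h -> h < h0 ->
  forall i j, `|p h j i - (j == i)%:R - A j i * h| <= e * h.
Proof.
move=> e0; have /cvgrPdist_lt/(_ e e0) := ratio_error_cvg.
move=> [h0 /= h00 H]; exists h0 => // h hp hh0 i j.
have := H h; rewrite /= distrC subr0 gtr0_norm// => /(_ hh0 hp).
rewrite distrC subr0 ger0_norm; last by apply: sumr_ge0 => k _; apply: sumr_ge0.
move=> Hh; have -> : p h j i - (j == i)%:R - A j i * h = ((p h j i - (j == i)%:R) / h - A j i) * h.
  by field; rewrite gt_eqF.
rewrite normrM (gtr0_norm hp) ler_pM2r//; apply: le_trans (ltW Hh).
rewrite /ratio_error (bigD1 i)//= (bigD1 j)//= -addrA lerDl addr_ge0// sumr_ge0// => k _.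
by rewrite sumr_ge0.
Qed.

Lemma transition_jump : exists C, 0 <= C /\ exists2 h0, 0 < h0 & forall h, 0 < h -> h < h0 ->
  forall i, 1 - p h i i <= C * h.
Proof.
have [h0 h00 H] := transition_near ltr01.
exists (KA + 1); split; first by rewrite addr_ge0// KA_ge0.
exists h0 => // h hp hh i; have := H h hp hh i i; rewrite eqxx /=.
rewrite ler_norml => /andP[h1 _]; have := KA_ge i i; rewrite ler_norml => /andP[h2 _].
by have := ler_wpM2r (ltW hp) h2; lra.
Qed.

End transition.

(** * Enlargement by a sigma-algebra independent of the chain *)

Variable HW : set (set Omega).
Hypotheses (sHW : sigma_algebra setT HW) (mHW : HW `<=` measurable)
  (indW : independent P (FX T) HW).

(** The past of the chain with all of [HW], later the whole Brownian filtration at [T]. It contains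
    the joint filtration, and independence lets the Markov and martingale properties of the chain
    survive the enlargement. *)
Definition FXW s := <<s FX s `|` HW >>.

Lemma FXW_sigma s : sigma_algebra setT (FXW s).
Proof. exact: smallest_sigma_algebra. Qed.

Lemma FXW_sub s : s <= T -> FXW s `<=` measurable.
Proof.
move=> sT; apply: smallest_sub; first exact: sigma_algebra_measurable.
by move=> B [/(FX_sub sT)|/mHW].
Qed.

Lemma FXW_mono s t : s <= t -> FXW s `<=` FXW t.
Proof. by move=> st; apply: sub_sigma_algebra2; apply: setSU; exact: aug_mono. Qed.

Lemma FX_FXW s : FX s `<=` FXW s.
Proof. by move=> B FB; apply: sub_sigma_algebra; left. Qed.

Local Notation ip1 := (ip P setT).
Local Notation sqi1 := (sqi P setT).

(** On a set [B] of [FX s] intersected with a set [D] of [HW], independence of [D] from the chain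
    factors out the probability of [D] and leaves the hypothesis on [B]. Such intersections generate
    [FXW s]. *)
Lemma FXW_orth s U eta : s <= T -> measurable_wrt (FX T) U -> integrable U ->
  (forall B, FX s B -> E (fun w => \1_B w * U w) = 0) ->
  measurable_wrt (FXW s) eta -> integrable (fun w => eta w * U w) ->
  ip1 eta U = 0.
Proof.
move=> sT mU iU H meta ieta.
apply: (@integral_mul_eq0 _ _ _ P (FXW s) U eta) => //; [exact: FXW_sigma|exact: FXW_sub|].
apply: integral_indic_eq0 => //; [exact: aug_sigma|exact: FX_sub|].
move=> B D FB HD.
have mB : measurable B by exact: FX_sub FB.
have FTB : FX T B by apply: aug_mono FB.
have -> : E (fun w => \1_(B `&` D) w * U w) = E (fun w => \1_D w * (\1_B w * U w)).
  by apply: eq_Rintegral => w _; rewrite indicI /=; ring.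
rewrite (@independent_integral _ _ _ P (FX T) HW) ?H ?mulr0//.
- exact: aug_sigma.
- exact: FX_sub.
- by apply: mwM => //; [exact: aug_sigma|apply: mw_indic => //; exact: aug_sigma].
- exact: integrable_indicM.
Qed.

Lemma chain_adapted i t : 0 <= t <= T -> measurable_wrt (FX t) (x i t).
Proof. by move=> /andP[t0 _]; apply: (aug_mw (Z := fun i t w => X t w i 0)); rewrite t0 lexx. Qed.

Lemma markov_FXW p : transition_function A p -> transition_law p ->
  forall s t eta C i j, 0 <= s -> s <= t -> t <= T ->
  measurable_wrt (FXW s) eta -> (forall w, `|eta w| <= C) ->
  ip1 eta (fun w => x i s w * x j t w) = p (t - s) j i * ip1 eta (x i s).
Proof.
move=> tp mk s t eta C i j s0 st tT meta etaC.
have s0T : 0 <= s <= T by rewrite s0 (le_trans st).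
have t0T : 0 <= t <= T by rewrite tT (le_trans s0).
have meta' : measurable_fun setT eta by apply: mw_measurable meta; apply: FXW_sub; case/andP: s0T.
have seta : sqi1 eta by exact: bounded_sqi etaC.
have mx k r : 0 <= r <= T -> measurable_wrt (FX T) (x k r).
  by move=> rT; apply: mwS (@chain_adapted k r rT); apply: aug_mono; case/andP: rT.
have sT := @aug_sigma _ _ _ P _ (fun (i : 'I_N) s w => X s w i 0) T.
have sx := chain_sqi.
have sxx : sqi1 (fun w => x i s w * x j t w).
  apply: (sqi_mulb measurableT (C := 1)); [exact: chain_measurable|exact: sx|move=> w _; exact: chain_norm1].
rewrite -ipZr//; last exact: sx.
apply/eqP; rewrite -subr_eq0 -ipBr//; [|exact: sqiZ (sx _ _ _)].
have sU : sqi1 ((fun w => x i s w * x j t w) \- (fun w => p (t - s) j i * x i s w)).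
  by apply: sqiB => //; exact: sqiZ (sx _ _ _).
apply/eqP; apply: (@FXW_orth s) => //.
- by case/andP: s0T.
- apply: mwB => //; apply: mwM => //; try exact: mx.
  exact: mw_cst.
- exact: sqi_int.
- move=> B FB; have mB : measurable B by apply: FX_sub FB; case/andP: s0T.
  have sB := @indic_sqi _ _ _ P _ mB.
  rewrite -/(ip1 _ _) ipBr//; [|exact: sqiZ (sx _ _ _)].
  rewrite ipZr//; last exact: sx.
  by rewrite /ip (chain_markov tp mk)// subrr.
- exact: sqi_integrable.
Qed.

Lemma chain_martingale_measurable i t : 0 <= t <= T -> measurable_wrt (FX t) (Mi i t).
Proof. by move=> tT; have [aM _ _] := hM i; exact: aM. Qed.

(** The right-hand side is the indicator of the event that the states at [s] and [t] differ. *)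
Lemma norm_increment i s t w : 0 <= s -> s <= t -> t <= T ->
  `|X t w i 0 - X s w i 0| <= 1 - \sum_a X s w a 0 * X t w a 0.
Proof.
move=> s0 st tT.
have [a Xa] := chain_index w (introT andP (conj s0 (le_trans st tT))).
have [b Xb] := chain_index w (introT andP (conj (le_trans s0 st) tT)).
have -> : \sum_k X s w k 0 * X t w k 0 = (a == b)%:R.
  rewrite (bigD1 a)//= Xa eqxx mul1r Xb big1 ?addr0// => k ka.
  by rewrite Xa (negbTE ka) mul0r.
rewrite Xa Xb; have [->|ab] := eqVneq a b; first by rewrite subrr normr0 subrr.
rewrite subr0; case: (i == a); case: (i == b); rewrite ?subrr ?subr0 ?sub0r ?normrN ?normr0 ?normr1//.
Qed.

(** Bounded increments keep products of several increments of [M] square-integrable, as the bracket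
    computations require. *)
Lemma martingale_bounded i s t w : 0 <= s -> s <= t -> t <= T ->
  `|Mi i t w - Mi i s w| <= 2 + KA * T.
Proof.
move=> s0 st tT; rewrite martingale_increment//.
have h1 := chain_norm1 i w (introT andP (conj s0 (le_trans st tT))).
have h2 := chain_norm1 i w (introT andP (conj (le_trans s0 st) tT)).
have h3 := drift_bound i w s0 st tT.
have h4 : KA * (t - s) <= KA * T by rewrite ler_wpM2l ?KA_ge0//; lra.
move: h1 h2 h3; rewrite !ler_norml => /andP[? ?] /andP[? ?] /andP[? ?].
by apply/andP; split; lra.
Qed.

Lemma martingale_sqi i t : 0 <= t <= T -> sqi1 (Mi i t).
Proof.
move=> tT; split; last by have [_ + _] := hM i; exact.
by apply: mw_measurable (@chain_martingale_measurable i t tT); apply: FX_sub; case/andP: tT.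
Qed.

Lemma martingale_FXW i s t eta : 0 <= s -> s <= t -> t <= T ->
  measurable_wrt (FXW s) eta -> sqi1 eta -> ip1 eta (Mi i t \- Mi i s) = 0.
Proof.
move=> s0 st tT meta seta.
have s0T : 0 <= s <= T by rewrite s0 (le_trans st).
have t0T : 0 <= t <= T by rewrite tT (le_trans s0).
have sT := @aug_sigma _ _ _ P _ (fun (i : 'I_N) s w => X s w i 0) T.
have sU : sqi1 (Mi i t \- Mi i s) by apply: sqiB => //; exact: martingale_sqi.
have mFT r : 0 <= r <= T -> measurable_wrt (FX T) (Mi i r).
  by move=> rT; apply: mwS (@chain_martingale_measurable i r rT); apply: aug_mono; case/andP: rT.
apply: (@FXW_orth s) => //.
- by case/andP: s0T.
- by apply: mwB => //; exact: mFT.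
- exact: sqi_int.
- move=> B FB; have mB : measurable B by apply: FX_sub FB; case/andP: s0T.
  have sB := @indic_sqi _ _ _ P _ mB.
  rewrite -/(ip1 _ _) ipBr//; try exact: martingale_sqi.
  have eqB r : ip1 (\1_B) (Mi i r) = \int[P]_(w in B) Mi i r w.
    rewrite Rintegral_mkcond /ip; apply: eq_Rintegral => w _.
    by rewrite patchE indicE; case: (w \in B); rewrite ?mul1r ?mul0r.
  by apply/eqP; rewrite subr_eq0 !eqB; apply/eqP; have [_ _ mM] := hM i; exact: mM.
- exact: sqi_integrable.
Qed.

(** The integrand indicates a change of state. Starting from [a] this has probability [1 - p h a a],
    of order [h]; summing over the [N] states gives the constant. *)
Lemma jump_mean p : transition_function A p -> transition_law p ->
  exists C, 0 <= C /\ exists2 h0, 0 < h0 & forall u h, 0 <= u -> 0 < h -> h < h0 ->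
  u + h <= T -> E (fun w => 1 - \sum_a X u w a 0 * X (u + h) w a 0) <= C * h.
Proof.
move=> tp mk; have [C [C0 [h0 h00 jump]]] := transition_jump tp.
exists (C * N%:R); split; first by rewrite mulr_ge0.
exists h0 => // u h u0 hp hh uhT.
have uuh : u <= u + h by rewrite lerDl ltW.
have uT : 0 <= u <= T by rewrite u0 (le_trans uuh).
have uhT' : 0 <= u + h <= T by rewrite uhT (le_trans u0).
have sX := chain_sqi.
have sXX a : sqi1 (fun w => x a u w * x a (u + h) w).
  apply: (sqi_mulb measurableT (C := 1)); [exact: chain_measurable|exact: sX|].
  by move=> w _; exact: chain_norm1.
have s1 : sqi1 (fun=> 1) by exact: cst_sqi.
rewrite -ip1E -[X in ip1 _ X]/((fun=> 1) \- (fun w => \sum_a x a u w * x a (u + h) w)).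
rewrite ipBr//; last exact: sqi_sum.
rewrite ip11 ip_sumr//.
rewrite [X in X - _](_ : 1 = \sum_a ip1 (fun=> 1) (x a u)); last first.
  rewrite -ip_sumr//; last by move=> a _; exact: sX.
  by rewrite -[LHS](ip11 P); apply: eq_ip => w _ //=; rewrite chain_sum1.
rewrite -sumrB; apply: (@le_trans _ _ (\sum_(a < N) C * h)); last first.
  by rewrite sumr_const card_ord -mulr_natr; lra.
apply: ler_sum => a _.
rewrite (markov_FXW (C := 1) tp mk)//; last first.
- by move=> w; rewrite normr1.
- by apply: mw_cst; exact: FXW_sigma.
rewrite (_ : u + h - u = h); last by lra.
have E0 : 0 <= ip1 (fun=> 1) (x a u).
  rewrite ip1E; apply: Rintegral_ge0 => // w _; have [b ->] := chain_index w uT.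
  by case: (_ == _).
have E1 : ip1 (fun=> 1) (x a u) <= 1.
  rewrite -[leRHS](mulr1 1) -[X in _ <= _ * X](ip11 P); apply: le_trans (ler_norm _) _.
  apply: ip_bounded_le => //; [exact: sX|by move=> w; rewrite normr1|by move=> w; exact: chain_norm1].
have pj := jump h hp hh a.
have Ch : 0 <= C * h by rewrite mulr_ge0// ltW.
rewrite -[X in X - _]mul1r -mulrBl; apply: (@le_trans _ _ (C * h * ip1 (fun=> 1) (x a u))).
  by rewrite ler_wpM2r.
by rewrite ler_piMr.
Qed.

(** Products of chain increments are computed exactly from the transition probabilities, which
    differ from the identity plus [h] times the rates by at most [e * h]. Replacing [M] by [X] costs
    O(h^2): drift increments are O(h), and a chain increment is nonzero with probability O(h). The
    error is small compared with [h], so it disappears when summed over a fine partition. *)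
Lemma local_bracket i j : exists K, 0 <= K /\ forall e, 0 < e -> exists2 h0, 0 < h0 &
  forall u h eta C, 0 <= u -> 0 < h -> h < h0 -> u + h <= T ->
  measurable_wrt (FXW u) eta -> 0 <= C -> (forall w, `|eta w| <= C) ->
  `|ip1 eta (fun w => (Mi i (u + h) w - Mi i u w) * (Mi j (u + h) w - Mi j u w)) -
    h * ip1 eta (fun w => \sum_a psi0 i j a * X u w a 0)| <= C * h * (K * e).
Proof.
case: hX => _ _ _ [p tp mk].
have [C1 [C10 [h1 h10 jump]]] := jump_mean tp mk.
pose K := N%:R * N%:R + (2 * KA * C1 + KA ^+ 2).
have K0 : 0 <= K by rewrite !addr_ge0 ?mulr_ge0 ?KA_ge0 ?sqr_ge0.
exists K; split => // e e0; have [h2 h20 near] := transition_near tp e0.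
(* Taking [h < e] turns the terms of order [h^2] into [h * e]. *)
exists (Num.min e (Num.min h1 h2)); first by rewrite !lt_min e0 h10.
move=> u h eta C u0 hp + uhT meta C0 etaC; rewrite !lt_min => /and3P[he hh1 hh2].
have uuh : u <= u + h by rewrite lerDl ltW.
have uT : 0 <= u <= T by rewrite u0 (le_trans uuh).
have uhT' : 0 <= u + h <= T by rewrite uhT (le_trans u0).
have mX a r : 0 <= r <= T -> measurable_fun setT (x a r) by exact: chain_measurable.
have sX := chain_sqi.
have sXX a b : sqi1 (fun w => x a u w * x b (u + h) w).
  by apply: (sqi_mulb measurableT (C := 1)); [exact: chain_measurable|exact: sX|move=> w _; exact: chain_norm1].
have meta' : measurable_fun setT eta by apply: mw_measurable meta; apply: FXW_sub; case/andP: uT.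
have seta : sqi1 eta by exact: bounded_sqi etaC.
have mkv a b : ip1 eta (fun w => x a u w * x b (u + h) w) = p h b a * ip1 eta (x a u).
  by rewrite (markov_FXW (C := C) tp mk)//; rewrite (_ : u + h - u = h)//; lra.
pose ka a b : R := ((b == i)%:R - (a == i)%:R) * ((b == j)%:R - (a == j)%:R).
pose dX k w := x k (u + h) w - x k u w.
pose dM k w := Mi k (u + h) w - Mi k u w.
have dXX w : dX i w * dX j w = \sum_a \sum_b ka a b * (x a u w * x b (u + h) w).
  have [a0 Xa] := chain_index w uT; have [b0 Xb] := chain_index w uhT'.
  rewrite (bigD1 a0)//= [X in _ + X]big1 ?addr0; last first.
    by move=> a /negbTE na; rewrite big1// => b _; rewrite Xa na mul0r mulr0.
  rewrite (bigD1 b0)//= [X in _ + X]big1 ?addr0; last first.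
    by move=> b /negbTE nb; rewrite Xb nb !mulr0.
  by rewrite /dX !Xa !Xb !eqxx mulr1 mulr1 /ka !(eq_sym i) !(eq_sym j).
have sdX k : sqi1 (dX k) by apply: sqiB => //; exact: sX.
have sdM k : sqi1 (dM k) by apply: sqiB => //; exact: martingale_sqi.
have x01 a r w : 0 <= r <= T -> 0 <= x a r w <= 1.
  by move=> rT; have [b ->] := chain_index w rT; case: (_ == _) => /=; rewrite ?lexx ?ler01.
have s1 : sqi1 (fun=> 1) by exact: cst_sqi.
have xle a : `|ip1 eta (x a u)| <= C.
  rewrite -[leRHS]mulr1 -(ip11 P); apply: ip_bounded_le => //; first exact: sX.
  by move=> w; exact: chain_norm1.
have main : `|ip1 eta (fun w => dX i w * dX j w) - h * ip1 eta (fun w => \sum_a psi0 i j a * X u w a 0)| <=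
   C * h * (N%:R * N%:R * e).
  have -> : ip1 eta (fun w => dX i w * dX j w) = \sum_a \sum_b ka a b * p h b a * ip1 eta (x a u).
    rewrite (_ : (fun w => dX i w * dX j w) =
       fun w => \sum_a \sum_b ka a b * (x a u w * x b (u + h) w)); last by apply/funext.
    rewrite ip_sumr//; last by move=> a _; apply: sqi_sum => // b _; exact: sqiZ.
    apply: eq_bigr => a _; rewrite ip_sumr//; last by move=> b _; exact: sqiZ.
    by apply: eq_bigr => b _; rewrite ipZr// mkv mulrA.
  have -> : ip1 eta (fun w => \sum_a psi0 i j a * X u w a 0) = \sum_a \sum_b ka a b * A b a * ip1 eta (x a u).
    rewrite ip_sumr//; last by move=> a _; apply: sqiZ => //; exact: sX.
    apply: eq_bigr => a _; rewrite ipZr//; last exact: sX.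
    by rewrite /psi0 mulr_suml; apply: eq_bigr => b _; rewrite /ka; ring.
  rewrite mulr_sumr -sumrB; apply: (le_trans (ler_norm_sum _ _ _)).
  apply: (@le_trans _ _ (\sum_(a < N) \sum_(b < N) (C * h * e))); last first.
    rewrite !(sumr_const, card_ord) -[_ *+ N *+ N]mulr_natr -[_ *+ N]mulr_natr; lra.
  apply: ler_sum => a _; rewrite mulr_sumr -sumrB; apply: (le_trans (ler_norm_sum _ _ _)).
  apply: ler_sum => b _.
  (* [ka] vanishes for [b = a], so the Kronecker delta may be subtracted from [p h b a] for free. *)
  have -> : ka a b * p h b a * ip1 eta (x a u) - h * (ka a b * A b a * ip1 eta (x a u)) =
     (ka a b * (p h b a - (b == a)%:R - A b a * h)) * ip1 eta (x a u).
    have : ka a b * (b == a)%:R = 0 by rewrite /ka; have [->|] := eqVneq b a; rewrite ?subrr ?mul0r ?mulr0.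
    by move=> k0; rewrite !mulrBr k0; ring.
  rewrite normrM (_ : C * h * e = e * h * C); last by ring.
  apply: ler_pM => //.
  rewrite normrM -[leRHS]mul1r ler_pM//; last exact: near.
  rewrite /ka normrM -[leRHS]mulr1 ler_pM//.
    by case: (b == i); case: (a == i); rewrite ?subrr ?subr0 ?sub0r ?normrN ?normr0 ?normr1.
  by case: (b == j); case: (a == j); rewrite ?subrr ?subr0 ?sub0r ?normrN ?normr0 ?normr1.
have rest : `|ip1 eta (fun w => dM i w * dM j w) - ip1 eta (fun w => dX i w * dX j w)| <=
   C * h * ((2 * KA * C1 + KA ^+ 2) * e).
  have sdd (f g : Omega -> R) c' : sqi1 f -> sqi1 g -> (forall w, `|f w| <= c') -> sqi1 (fun w => f w * g w).
    by move=> [mf _] sg fc'; apply: (sqi_mulb measurableT (C := c')).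
  have sMM : sqi1 (fun w => dM i w * dM j w).
    by apply: (sdd (dM i) (dM j) (2 + KA * T)) => // w; exact: (@martingale_bounded i u (u + h) w u0 uuh uhT).
  have dX1 k w : `|dX k w| <= 1.
    apply: (le_trans (norm_increment k w u0 uuh uhT)).
    rewrite gerBl; apply: sumr_ge0 => a _.
    by apply: mulr_ge0; [have /andP[] := x01 a u w uT|have /andP[] := x01 a (u + h) w uhT'].
  have sXX' : sqi1 (fun w => dX i w * dX j w) by apply: (sdd _ _ 1) => // w; exact: dX1.
  rewrite -ipBr//.
  pose J w := 1 - \sum_a x a u w * x a (u + h) w.
  have sJ : sqi1 J by apply: sqiB => //; apply: sqi_sum => // a _; exact: sXX.
  have EJ : ip1 (fun=> 1) J <= C1 * h by rewrite ip1E; exact: jump.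
  have bnd w : `|dM i w * dM j w - dX i w * dX j w| <= 2 * KA * h * J w + (KA * h) ^+ 2.
    have hi := drift_bound i w u0 uuh uhT; have hj := drift_bound j w u0 uuh uhT.
    have xi := norm_increment i w u0 uuh uhT; have xj := norm_increment j w u0 uuh uhT.
    rewrite -/(dX _ _) -/(J w) in xi xj; rewrite (_ : u + h - u = h) in hi hj; last by lra.
    rewrite /dM !martingale_increment// -!/(dX _ _).
    have -> : (dX i w - drift i u (u + h) w) * (dX j w - drift j u (u + h) w) - dX i w * dX j w =
       - (drift i u (u + h) w * dX j w) - drift j u (u + h) w * dX i w + drift i u (u + h) w * drift j u (u + h) w by ring.
    apply: (le_trans (ler_normD _ _)); apply: lerD; last first.
      by rewrite normrM expr2 ler_pM.
    apply: (le_trans (ler_normB _ _)); rewrite normrN !normrM.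
    have := ler_pM (normr_ge0 _) (normr_ge0 _) hi xj.
    have := ler_pM (normr_ge0 _) (normr_ge0 _) hj xi.
    lra.
  apply: (le_trans (ip_bounded_le (C := C) (h := fun w => 2 * KA * h * J w + (KA * h) ^+ 2) _ _ _ _ _)) => //.
  - by apply: sqiB.
  - by apply: sqiD => //; [exact: sqiZ|exact: cst_sqi].
  rewrite -[leRHS]mulrA ler_wpM2l//.
  rewrite (_ : ip1 _ _ = 2 * KA * h * ip1 (fun=> 1) J + (KA * h) ^+ 2); last first.
    rewrite -[in RHS](mulr1 ((KA * h) ^+ 2)) -[X in _ + _ * X](ip11 P) -!ipZr//.
    rewrite -ipDr//; [|exact: sqiZ|exact: sqiZ].
    by apply: eq_ip => // w _ /=; rewrite mulr1.
  have k1 : 2 * KA * h * ip1 (fun=> 1) J <= 2 * KA * h * (C1 * h).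
    by rewrite ler_wpM2l// !mulr_ge0 ?KA_ge0// ltW.
  apply: (le_trans (lerD k1 (lexx _))).
  have -> : 2 * KA * h * (C1 * h) + (KA * h) ^+ 2 = (2 * KA * C1 + KA ^+ 2) * h * h by ring.
  have k2 : 0 <= 2 * KA * C1 + KA ^+ 2 by rewrite !addr_ge0 ?mulr_ge0 ?KA_ge0 ?sqr_ge0.
  rewrite [leRHS]mulrC; apply: ler_pM => //; rewrite ?mulr_ge0 ?(ltW hp)//.
  by apply: ler_wpM2l => //; exact: ltW.
rewrite /K mulrDl mulrDr; apply: le_trans (lerD main rest).
have tri (a b b' : R) : `|a - b'| <= `|b - b'| + `|a - b|.
  by have := ler_normD (b - b') (a - b); rewrite (_ : b - b' + (a - b) = a - b'); last by ring.
exact: tri.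
Qed.

(** * The bracket of the chain martingale over a time interval *)

Local Notation PL := (P \x leb)%E.
Local Notation dom := (@domain R d Omega T).
Local Notation ip2 := (ip PL dom).
Local Notation sqi2 := (sqi PL dom).

Definition XL (a : 'I_N) (q : OxR Omega R) : R := left_lim (X ^~ q.1) q.2 a 0.

(** Predictable approximations of [XL]. The first term realises the convention X_{0-} = X_0, since
    the left steps vanish at time 0. *)
Definition XLn n (a : 'I_N) (q : OxR Omega R) : R :=
  (q.2 == 0)%:R * X 0 q.1 a 0 + left_step (fun s => X s q.1 a 0) 0 T n q.2.

Let mdom := @measurable_domain R d Omega T.

Lemma XL_cvg a q : dom q -> XLn n a q @[n --> \oo] --> XL a q.
Proof.
move=> [_ /=]; rewrite in_itv /= /XL /XLn /left_lim => /andP[q0 qT].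
have [->|n0] := eqVneq q.2 0.
  rewrite (_ : (fun n => _) = fun=> X 0 q.1 a 0); first exact: cvg_cst.
  apply/funext => n; rewrite mul1r /left_step big1 ?addr0// => k _.
  have -> : (part 0 T n k < 0) = false by apply/negbTE; rewrite -leNgt part_ge// ltW.
  by rewrite mulr0.
have qq : 0 < q.2 <= T by rewrite lt_neqAle eq_sym n0 q0.
rewrite mxE (_ : (fun n => _) = (fun n => left_step (fun s => X s q.1 a 0) 0 T n q.2)).
  by apply: cvg_left_step => //; exact: chain_left.
by apply/funext => n; rewrite mul0r add0r.
Qed.

Lemma XLn_measurable n a : measurable_fun [set: OxR Omega R] (XLn n a).
Proof.
apply: measurable_funD.
  apply: measurable_funM; first exact: measurable_eq_indic.
  apply: (measurableT_comp (f := fun w => X 0 w a 0)) => //.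
  by apply: chain_measurable; rewrite lexx ltW.
apply: measurable_sum => k; apply: measurable_funM.
  apply: (measurableT_comp (f := fun w => X (part 0 T n k) w a 0)) => //; apply: chain_measurable.
  by rewrite part_ge ?part_le ?ltW// ltnW.
rewrite (_ : (fun q => _) = (\1_(`]part 0 T n k, part 0 T n k.+1]%classic) : R -> R) \o snd).
  by apply: measurableT_comp => //; exact: measurable_indic.
apply/funext => q /=; rewrite indicE.
by congr (nat_of_bool _)%:R; apply/idP/idP; rewrite inE /= in_itv.
Qed.

Lemma XL_measurable a : measurable_fun dom (XL a).
Proof.
apply: (@measurable_fun_cvg _ _ _ _ (XLn ^~ a)).
  by move=> n; apply: measurable_funTS; exact: XLn_measurable.
by move=> q dq; exact: XL_cvg.
Qed.

Lemma XL_index q : dom q -> exists a, forall j, XL j q = (j == a)%:R.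
Proof. by move=> [_ /=]; rewrite in_itv /=; exact: left_lim_index. Qed.

Lemma XL_norm1 a q : dom q -> `|XL a q| <= 1.
Proof. by move=> /XL_index[b ->]; case: (_ == _); rewrite ?normr1 ?normr0. Qed.

Definition psiL i j q := \sum_a psi0 i j a * XL a q.

Lemma psiLE i j q : dom q -> psiL i j q = psi A X q.2 q.1 i j.
Proof.
move=> dq; have [a Xa] := XL_index dq; rewrite /psiL /psi (psi_mx_index _ _ Xa).
rewrite (bigD1 a)//= Xa eqxx mulr1 big1 ?addr0// => b ba.
by rewrite Xa (negbTE ba) mulr0.
Qed.

Lemma left_step_out (V : R -> R) (s t : R) n (r : R) : s <= t -> ~~ (s < r <= t) -> left_step V s t n r = 0.
Proof.
move=> st out; rewrite /left_step big1// => k _.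
have -> : (part s t n k < r <= part s t n k.+1) = false; last by rewrite mulr0.
apply: contraNF out => /andP[kr rk].
by rewrite (le_lt_trans (part_ge _ _ st) kr) (le_trans rk)// part_le.
Qed.

Lemma XL_left_step a s t q : 0 <= s -> s < q.2 <= t -> t <= T ->
  left_step (fun r => X r q.1 a 0) s t n q.2 @[n --> \oo] --> XL a q.
Proof.
move=> s0 /andP[sq qt] tT; have q0 : 0 < q.2 by exact: le_lt_trans sq.
rewrite /XL /left_lim gt_eqF// mxE.
by apply: cvg_left_step; rewrite ?sq//; apply: chain_left; rewrite q0 (le_trans qt).
Qed.

Local Notation dM i s t := (fun w => Mi i t w - Mi i s w).

Lemma increment_sqi i s t : 0 <= s -> s <= t -> t <= T -> sqi1 (dM i s t).
Proof.
move=> s0 st tT; apply: sqiB => //; apply: martingale_sqi.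
  by rewrite tT (le_trans s0).
by rewrite s0 (le_trans st).
Qed.

Lemma increment_mw i r s t : 0 <= r -> r <= s -> s <= t -> t <= T -> measurable_wrt (FXW t) (dM i r s).
Proof.
move=> r0 rs st tT; apply: mwB; first exact: FXW_sigma.
  apply: mwS (@chain_martingale_measurable i s _).
    by apply: subset_trans (@FX_FXW s) _; exact: FXW_mono.
  by rewrite (le_trans r0 rs) (le_trans st).
apply: mwS (@chain_martingale_measurable i r _).
  by apply: subset_trans (@FX_FXW r) _; apply: FXW_mono; exact: le_trans st.
by rewrite r0 (le_trans rs)// (le_trans st).
Qed.

Lemma ip_mul_split (eta U U' V V' : Omega -> R) : sqi1 eta ->
  sqi1 (fun w => U w * V w) -> sqi1 (fun w => U' w * V' w) ->
  sqi1 (fun w => U w * V' w) -> sqi1 (fun w => V w * U' w) ->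
  ip1 eta (fun w => U w * V' w) = 0 -> ip1 eta (fun w => V w * U' w) = 0 ->
  ip1 eta (fun w => (U w + U' w) * (V w + V' w)) =
  ip1 eta (fun w => U w * V w) + ip1 eta (fun w => U' w * V' w).
Proof.
move=> se s1 s2 s3 s4 e3 e4.
rewrite (_ : (fun w => _) = ((fun w => U w * V w) \+ (fun w => U' w * V' w)) \+
  ((fun w => U w * V' w) \+ (fun w => V w * U' w))); last first.
  by apply/funext => w /=; ring.
by rewrite ipDr ?ipDr ?e3 ?e4 ?addr0//; exact: sqiD.
Qed.

(** The two cross terms vanish: the increment over []u, t]] is orthogonal to [eta] times the
    increment over []s, u]]. *)
Lemma bracket_split i j s u t eta C : 0 <= s -> s <= u -> u <= t -> t <= T ->
  measurable_wrt (FXW s) eta -> (forall w, `|eta w| <= C) ->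
  ip1 eta (fun w => dM i s t w * dM j s t w) =
  ip1 eta (fun w => dM i s u w * dM j s u w) + ip1 eta (fun w => dM i u t w * dM j u t w).
Proof.
move=> s0 su ut tT meta etaC.
have u0 := le_trans s0 su; have uT := le_trans ut tT; have st := le_trans su ut.
have meta' : measurable_fun setT eta.
  by apply: mw_measurable meta; apply: FXW_sub; exact: le_trans tT.
have seta : sqi1 eta by exact: bounded_sqi etaC.
have sm k r v : 0 <= r -> r <= v -> v <= T -> measurable_fun setT (dM k r v).
  by move=> *; have [] := increment_sqi k (s := r) (t := v).
have sMM k l r v r' v' : 0 <= r -> r <= v -> v <= T -> 0 <= r' -> r' <= v' -> v' <= T ->
    sqi1 (fun w => dM k r v w * dM l r' v' w).
  move=> *; apply: (sqi_mulb measurableT (C := 2 + KA * T)); [exact: sm|exact: increment_sqi|].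
  by move=> w _; exact: martingale_bounded.
have cross k l : ip1 eta (fun w => dM k s u w * dM l u t w) = 0.
  rewrite -[RHS](@martingale_FXW l u t (fun w => eta w * dM k s u w))//.
  - by apply: eq_Rintegral => w _ /=; rewrite mulrA.
  - apply: mwM; [exact: FXW_sigma|by apply: mwS meta; exact: FXW_mono|exact: increment_mw].
  - apply: (sqi_mulb measurableT (C := C)) => //; exact: increment_sqi.
transitivity (ip1 eta (fun w => (dM i s u w + dM i u t w) * (dM j s u w + dM j u t w))).
  have E (a b e a' b' e' : R) : (a - e) * (a' - e') = ((b - e) + (a - b)) * ((b' - e') + (a' - b')) by ring.
  by apply: eq_Rintegral => w _; congr (_ * _); exact: E.
apply: ip_mul_split => //; apply: sMM => //.
Qed.

Lemma bracket_partition i j s t n m eta C : 0 <= s -> s <= t -> t <= T -> (m <= n.+1)%N ->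
  measurable_wrt (FXW s) eta -> (forall w, `|eta w| <= C) ->
  ip1 eta (fun w => dM i s (part s t n m) w * dM j s (part s t n m) w) =
  \sum_(k < m) ip1 eta (fun w => dM i (part s t n k) (part s t n k.+1) w *
                               dM j (part s t n k) (part s t n k.+1) w).
Proof.
move=> s0 st tT mn meta etaC; elim: m mn => [|m IH] mn.
  by rewrite big_ord0 part0; apply: ip_eq0 => w _; rewrite !subrr !mulr0.
rewrite big_ord_recr /= -IH; last exact: ltnW.
apply: (@bracket_split i j s _ _ eta C) => //.
- exact: part_ge.
- exact: part_mono.
- by apply: le_trans tT; exact: part_le.
Qed.

(** Both sides are limits of the same Riemann sums, the products of [eta] with [S n]. Dominated
    convergence of the left steps leads to the right-hand side; additivity over the partition, with
    [local_bracket] on each of its intervals, leads to the left-hand side. *)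
Lemma chain_bracket i j s t eta C : 0 <= s -> s <= t -> t <= T ->
  measurable_wrt (FXW s) eta -> (forall w, `|eta w| <= C) ->
  ip1 eta (fun w => dM i s t w * dM j s t w) =
  ip2 (fun q => eta q.1) (fun q => (s < q.2 <= t)%R%:R * psiL i j q).
Proof.
move=> s0; rewrite le_eqVlt => /predU1P[<- _ _ _|st tT meta etaC].
  rewrite !ip_eq0// => q _; last by rewrite !subrr !mulr0.
  by case: (boolP (s < q.2 <= s)) => [/andP[a b]|_]; [have := lt_le_trans a b; rewrite ltxx|rewrite mul0r mulr0].
have st' := ltW st.
have C0 : 0 <= C by apply: le_trans (etaC point); exact: normr_ge0.
have meta' : measurable_fun setT eta.
  by apply: mw_measurable meta; apply: FXW_sub; exact: le_trans tT.
pose V (q : OxR Omega R) (r : R) : R := \sum_a psi0 i j a * X r q.1 a 0.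
pose S n (q : OxR Omega R) := left_step (V q) s t n q.2.
pose h n : R := (t - s) / n.+1%:R.
have h0 n : 0 < h n by rewrite divr_gt0// subr_gt0.
have uT n k : (k <= n.+1)%N -> 0 <= part s t n k <= T.
  by move=> kn; rewrite (le_trans s0 (part_ge _ _ st'))// (le_trans _ tT)// part_le.
have seta : sqi1 eta by exact: bounded_sqi etaC.
have sX := chain_sqi.
have SE n : S n = fun q => \sum_(k < n.+1) \sum_a psi0 i j a *
    (X (part s t n k) q.1 a 0 * (part s t n k < q.2 <= part s t n k.+1)%R%:R).
  apply/funext => q; rewrite /S /left_step; apply: eq_bigr => k _.
  by rewrite /V mulr_suml; apply: eq_bigr => a _; rewrite mulrA.
have mXq n a (k : 'I_n.+1) : measurable_fun dom (fun q : OxR Omega R => X (part s t n k) q.1 a 0).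
  apply: measurable_funTS; apply: (measurableT_comp (f := fun w => X (part s t n k) w a 0)) => //.
  by apply: chain_measurable; apply: uT; rewrite ltnW.
have sXq n a (k : 'I_n.+1) : sqi2 (fun q => X (part s t n k) q.1 a 0 * (part s t n k < q.2 <= part s t n k.+1)%R%:R).
  apply: (sqi_mulb mdom (C := 1)); [exact: mXq|exact: (@itv_indic_sqi _ _ _ P T (part s t n k) (part s t n k.+1))|].
  by move=> q _; apply: chain_norm1; apply: uT; rewrite ltnW.
have sS n : sqi2 (S n).
  rewrite SE; apply: (sqi_sum mdom) => k _; apply: (sqi_sum mdom) => a _; exact: (sqiZ mdom).
have sE : sqi2 (fun q : OxR Omega R => eta q.1).
  by apply: (@dom_bounded_sqi _ _ _ P T _ C) => //; apply: measurable_funTS; exact: measurableT_comp.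
have ipS n : ip2 (fun q => eta q.1) (S n) =
    \sum_(k < n.+1) h n * ip1 eta (fun w => \sum_a psi0 i j a * X (part s t n k) w a 0).
  rewrite SE (ip_sumr mdom)//; last first.
    by move=> k _; apply: (sqi_sum mdom) => a _; exact: (sqiZ mdom).
  apply: eq_bigr => k _; rewrite (ip_sumr mdom)//; last by move=> a _; exact: (sqiZ mdom).
  rewrite ip_sumr//; last first.
    by move=> a _; apply: sqiZ => //; apply: sX; apply: uT; rewrite ltnW.
  rewrite mulr_sumr; apply: eq_bigr => a _; rewrite (ipZr mdom)//.
  rewrite ipZr//; last by apply: sX; apply: uT; rewrite ltnW.
  rewrite mulrCA; congr (_ * _).
  rewrite /h -(partS s t n k).
  have /andP[ua _] := uT n k (ltnW (ltn_ord k)); have /andP[_ ub] := uT n k.+1 (ltn_ord k).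
  rewrite -(@integral_rect _ _ _ P T (fun w => eta w * X (part s t n k) w a 0) C)//.
  - by apply: eq_Rintegral => q _; rewrite mulrA.
  - by apply: part_mono.
  - by apply: measurable_funM => //; apply: chain_measurable; apply: uT; rewrite ltnW.
  - move=> w; rewrite normrM -[leRHS]mulr1 ler_pM// chain_norm1//; apply: uT; rewrite ltnW//.
have bV q r : 0 <= r <= T -> `|V q r| <= \sum_a `|psi0 i j a|.
  move=> rT; apply: (le_trans (ler_norm_sum _ _ _)); apply: ler_sum => a _.
  by rewrite normrM -[leRHS]mulr1 ler_pM// chain_norm1.
have bS n q : dom q -> `|S n q| <= \sum_a `|psi0 i j a|.
  move=> dq; rewrite /S; case: (boolP (s < q.2 <= t)) => [sq|nsq].
    have [k kn [_ ->]] := left_stepE n sq; apply: bV; apply: uT; exact: ltnW.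
  by rewrite left_step_out// normr0 sumr_ge0.
have mP : measurable_fun dom (fun q : OxR Omega R => (s < q.2 <= t)%R%:R * psiL i j q).
  apply: measurable_funM; first by apply: measurable_funTS; exact: itv_indic_measurable.
  by apply: measurable_sum => a; apply: measurable_funM => //; exact: XL_measurable.
have cS : l2cvg PL dom S (fun q => (s < q.2 <= t)%R%:R * psiL i j q).
  apply: (l2cvg_dominated mdom (g := fun=> \sum_a `|psi0 i j a|)) => //.
  - by move=> n; have [] := sS n.
  - by apply: (@dom_bounded_sqi _ _ _ P T _ (`|\sum_a `|psi0 i j a| |)).
  - apply: aeW => q dq; case: (boolP (s < q.2 <= t)) => [sq|nsq]; last first.
      rewrite mul0r (_ : S ^~ q = fun=> 0); first exact: cvg_cst.
      by apply/funext => n; rewrite /S left_step_out.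
    rewrite mul1r (_ : S ^~ q = fun n => \sum_a psi0 i j a * left_step (fun r => X r q.1 a 0) s t n q.2).
      apply: cvg_finite_sum => a; apply: cvgM; first exact: cvg_cst.
      exact: XL_left_step.
    apply/funext => n; rewrite SE exchange_big /=; apply: eq_bigr => a _.
    by rewrite /left_step mulr_sumr; apply: eq_bigr.
have sPsi : sqi2 (fun q => (s < q.2 <= t)%R%:R * psiL i j q).
  apply: (@dom_bounded_sqi _ _ _ P T _ (\sum_a `|psi0 i j a|)) => // q dq.
  rewrite normrM -[leRHS]mul1r ler_pM//; first by case: (_ < _ <= _); rewrite ?normr1 ?normr0.
  apply: (le_trans (ler_norm_sum _ _ _)); apply: ler_sum => a _.
  by rewrite normrM -[leRHS]mulr1 ler_pM// XL_norm1.
have lim1 := l2cvg_ip mdom (fun=> sE) sE sS sPsi (l2cvg_cst _ _ _) cS.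
have [K [K0 loc]] := local_bracket i j.
have lim2 : ip2 (fun q => eta q.1) (S n) @[n --> \oo] --> ip1 eta (fun w => dM i s t w * dM j s t w).
  apply/cvgrPdist_le => e e0.
  (* The local errors [C * h * (K * e')] add up to [C * (t - s) * K * e'] over the partition; the
     summand 1 keeps the denominator positive. *)
  pose e' := e / (C * (t - s) * K + 1).
  have den : 0 < C * (t - s) * K + 1 by rewrite ltr_wpDl// !mulr_ge0// subr_ge0.
  have e'0 : 0 < e' by rewrite divr_gt0.
  have [d0 d00 locd] := loc e' e'0.
  near=> n.
  have hd : h n < d0 by near: n; exact: mesh_small.
  have := @bracket_partition i j s t n n.+1 eta C s0 st' tT (leqnn _) meta etaC.
  rewrite partn => ->; rewrite ipS -sumrB; apply: (le_trans (ler_norm_sum _ _ _)).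
  apply: (@le_trans _ _ (\sum_(k < n.+1) C * h n * (K * e'))).
    apply: ler_sum => k _.
    have /andP[ua _] := uT n k (ltnW (ltn_ord k)); have /andP[_ ub] := uT n k.+1 (ltn_ord k).
    have eu : part s t n k.+1 = part s t n k + h n by rewrite /h -(partS s t n k) addrC subrK.
    rewrite eu in ub *; apply: locd => //.
    by apply: mwS meta; apply: FXW_mono; exact: part_ge.
  rewrite sumr_const card_ord -mulr_natr.
  have hn : h n * n.+1%:R = t - s by rewrite /h divfK// pnatr_eq0.
  have -> : C * h n * (K * e') * n.+1%:R = C * (h n * n.+1%:R) * K * e' by ring.
  rewrite hn.
  rewrite /e' mulrA ler_pdivrMr// mulrC ler_pM2l//; lra.
exact: (cvg_unique _ lim2 lim1).
Unshelve. all: by end_near.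
Qed.

End chain.

(** * Block integrals *)

Section blocks.
Context {R : realType} {d} {Omega : measurableType d}.
Variables (P : probability Omega R) (T : R) (K M : finType).

Local Notation leb := (@lebesgue_measure R).
Local Notation PL := (P \x leb)%E.
Local Notation dom := (@domain R d Omega T).
Local Notation ip1 := (ip P setT).
Local Notation ip2 := (ip PL dom).
Local Notation sqi1 := (sqi P setT).
Local Notation sqi2 := (sqi PL dom).

Variables (L : K -> R -> Omega -> R) (G : R -> set (set Omega)).
Variable rho : M -> K -> Omega * R -> R.

(** The elementary integrand with value [b_val] on []b_lo, b_hi]] against the single martingale
    [b_idx]. Blocks in a list may overlap, so that integrands are added by concatenation, without a
    common refinement. *)
Record block := Block {
  b_lo : R; b_hi : R; b_idx : K; b_val : Omega -> R }.

Definition block_ok b := [/\ 0 <= b_lo b, b_lo b <= b_hi b, b_hi b <= T,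
  measurable_wrt (G (b_lo b)) (b_val b) & exists C, forall w, `|b_val b w| <= C].

Definition block_int b w := b_val b w * (L (b_idx b) (b_hi b) w - L (b_idx b) (b_lo b) w).

(** Component [m] of the integrand after multiplication by the square root [rho] of the bracket,
    which replaces the degenerate seminorm by ordinary L^2 norms. *)
Definition block_proc b m (p : Omega * R) : R :=
  b_val b p.1 * (b_lo b < p.2 <= b_hi b)%R%:R * rho m (b_idx b) p.

(* A square-integrable martingale family L with bracket
   d<L k, L l> = \sum_m rho m k * rho m l dt. *)
Record integrator : Prop := Integrator {
  itg_sigma : forall t, sigma_algebra setT (G t);
  itg_sub : forall t, t <= T -> G t `<=` measurable;
  itg_mono : forall s t, 0 <= s -> s <= t -> t <= T -> G s `<=` G t;
  itg_adapted : forall k t, 0 <= t <= T -> measurable_wrt (G t) (L k t);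
  itg_sqi : forall k t, 0 <= t <= T -> sqi1 (L k t);
  itg_mart : forall k s t xi, 0 <= s -> s <= t -> t <= T ->
    measurable_wrt (G s) xi -> sqi1 xi -> ip1 xi (L k t \- L k s) = 0;
  itg_rho : forall m k, measurable_fun dom (rho m k);
  itg_rho_bounded : exists C, forall m k p, dom p -> `|rho m k p| <= C;
  itg_bracket : forall k l s t eta C, 0 <= s -> s <= t -> t <= T ->
    measurable_wrt (G s) eta -> (forall w, `|eta w| <= C) ->
    ip1 (fun w => eta w * (L k t w - L k s w)) (L l t \- L l s) =
    \sum_m ip2 (fun p => eta p.1 * (s < p.2 <= t)%R%:R * rho m k p)
              (fun p => (s < p.2 <= t)%R%:R * rho m l p) }.

Hypothesis itg : integrator.
Hypothesis T0 : 0 < T.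

Let mdom := @measurable_domain R d Omega T.

Lemma block_ok_measurable b : block_ok b -> measurable_fun setT (b_val b).
Proof.
case=> _ lohi hiT mb _; apply: mw_measurable mb; apply: itg_sub itg _ _.
exact: le_trans hiT.
Qed.

Lemma block_int_sqi b : block_ok b -> sqi1 (block_int b).
Proof.
move=> okb; have mb := block_ok_measurable okb.
case: okb => lo lohi hi _ [C bC].
apply: (@sqi_mulb _ _ _ _ _ measurableT _ _ C) => //.
apply: sqiB => //; apply: itg_sqi itg _ _ _; apply/andP; split => //.
- exact: le_trans lohi.
- exact: le_trans hi.
Qed.

Lemma block_proc_sqi b m : block_ok b -> sqi2 (block_proc b m).
Proof.
move=> okb; have mb := block_ok_measurable okb.
have [Cr rC] := itg_rho_bounded itg.
case: okb => lo lohi hi _ [C bC].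
apply: (@sqi_bounded _ _ _ _ _ mdom _ (C * Cr)).
- exact: PL_fin.
- apply: measurable_funM; last exact: itg_rho itg _ _.
  apply: measurable_funTS; apply: measurable_funM; last exact: itv_indic_measurable.
  exact: measurableT_comp.
- move=> p dp; rewrite !normrM ler_pM// ?rC//.
  rewrite -[leRHS]mulr1 ler_pM//.
  by case: (_ < _ <= _); rewrite ?normr1 ?normr0.
Qed.

Lemma block_int_split b c : b_lo b <= c -> c <= b_hi b -> block_int b =
  block_int (Block (b_lo b) c (b_idx b) (b_val b)) \+
  block_int (Block c (b_hi b) (b_idx b) (b_val b)).
Proof. by move=> _ _; apply/funext => w; rewrite /block_int /=; lra. Qed.

Lemma block_proc_split b c m : b_lo b <= c -> c <= b_hi b -> block_proc b m =
  block_proc (Block (b_lo b) c (b_idx b) (b_val b)) m \+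
  block_proc (Block c (b_hi b) (b_idx b) (b_val b)) m.
Proof.
move=> lc ch; apply/funext => p; rewrite /block_proc /= -!mulrA -mulrDr; congr (_ * _).
rewrite -mulrDl; congr (_ * _).
have [/= lp|] := ltP (b_lo b) p.2; have [/=pc|] := leP p.2 c.
- by rewrite (le_trans pc ch) add0r || rewrite (le_trans pc ch) addr0.
- by rewrite /= add0r.
- by move=> pl; rewrite (le_lt_trans pl) // addr0 || by rewrite addr0.
- by move=> cp pl; have := lt_le_trans cp (le_trans pl lc); rewrite ltxx.
Qed.

Lemma block_ok_split1 b c : b_lo b <= c -> c <= b_hi b -> block_ok b ->
  block_ok (Block (b_lo b) c (b_idx b) (b_val b)).
Proof.
move=> lc ch [lo _ hi mb bb]; split => //=; exact: le_trans hi.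
Qed.

Lemma block_ok_split2 b c : b_lo b <= c -> c <= b_hi b -> block_ok b ->
  block_ok (Block c (b_hi b) (b_idx b) (b_val b)).
Proof.
move=> lc ch [lo _ hi mb bb]; split => //=; first exact: le_trans lc.
by apply: mwS mb; apply: itg_mono itg _ _ _ _ _ => //; exact: le_trans hi.
Qed.

Lemma block_isom_disjoint b c : block_ok b -> block_ok c -> b_hi b <= b_lo c ->
  ip1 (block_int b) (block_int c) = \sum_m ip2 (block_proc b m) (block_proc c m).
Proof.
move=> okb okc bc; rewrite big1 => [|m _]; last first.
  apply: ip_eq0 => p _; rewrite /block_proc.
  have [/= bp|] := boolP (b_lo b < p.2 <= b_hi b); last by rewrite !(mulr0, mul0r).
  have [/= /andP[cp _]|] := boolP (b_lo c < p.2 <= b_hi c); last by rewrite !(mulr0, mul0r).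
  by move: bp => /andP[_ ph]; have := le_lt_trans (le_trans ph bc) cp; rewrite ltxx.
have sb := block_int_sqi okb; have mc := block_ok_measurable okc.
case: (okc) => c0 clh chT mcv [C cC].
rewrite -[RHS](@itg_mart itg (b_idx c) (b_lo c) (b_hi c) (fun w => b_val c w * block_int b w))//.
- by rewrite /ip; apply: eq_Rintegral => w _; rewrite /block_int /=; lra.
- apply: mwM => //; first exact: itg_sigma itg _.
  case: (okb) => b0 blh bhT mbv _.
  have sub s : 0 <= s -> s <= b_lo c -> G s `<=` G (b_lo c).
    by move=> s0 sc; apply: itg_mono itg _ _ _ _ _ => //; exact: le_trans chT.
  have sG := itg_sigma itg (b_lo c).
  apply: mwM => //; first by apply: mwS mbv; apply: sub => //; exact: le_trans bc.
  apply: mwB => //.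
    apply: (@mwS _ _ _ (G (b_hi b))); first by apply: sub => //; exact: le_trans blh.
    by apply: itg_adapted itg _ _ _; rewrite bhT (le_trans b0 blh).
  apply: (@mwS _ _ _ (G (b_lo b))); first by apply: sub => //; exact: le_trans bc.
  by apply: itg_adapted itg _ _ _; rewrite b0 (le_trans blh bhT).
- by apply: (@sqi_mulb _ _ _ _ _ measurableT _ _ C).
Qed.

Lemma block_isom_same (u v : Omega -> R) (k l : K) s t :
  block_ok (Block s t k u) -> block_ok (Block s t l v) ->
  ip1 (block_int (Block s t k u)) (block_int (Block s t l v)) =
  \sum_m ip2 (block_proc (Block s t k u) m) (block_proc (Block s t l v) m).
Proof.
move=> [s0 st tT mu [C uC]] [_ _ _ mv [C' vC]]; rewrite /= in s0 st tT mu uC mv vC.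
have := @itg_bracket itg k l s t (fun w => u w * v w) (C * C') s0 st tT.
move=> /(_ _ _)/wrap[].
  by apply: mwM => //; exact: itg_sigma itg _.
  by move=> w; rewrite normrM ler_pM.
move=> h; transitivity (ip1 (fun w => u w * v w * (L k t w - L k s w)) (L l t \- L l s)).
  by rewrite /ip; apply: eq_Rintegral => w _; rewrite /block_int /=; lra.
rewrite h; apply: eq_bigr => m _; rewrite /ip; apply: eq_Rintegral => p _.
by rewrite /block_proc /=; ring.
Qed.

Lemma block_isom_lo b c : block_ok b -> block_ok c -> b_lo b = b_lo c ->
  ip1 (block_int b) (block_int c) = \sum_m ip2 (block_proc b m) (block_proc c m).
Proof.
wlog hh : b c / b_hi b <= b_hi c.
  move=> H okb okc bc; have [|/ltW] := leP (b_hi b) (b_hi c); first by move=> /H; exact.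
  move=> /H/(_ okc okb (esym bc)); rewrite ipC => ->.
  by apply: eq_bigr => m _; rewrite ipC.
move=> okb okc bc; have lb : b_lo c <= b_hi b by rewrite -bc; case: okb.
have ok1 := block_ok_split1 lb hh okc; have ok2 := block_ok_split2 lb hh okc.
rewrite (block_int_split lb hh) ipDr//; try exact: block_int_sqi.
under eq_bigr => m _.
  rewrite (block_proc_split m lb hh) ipDr; [|exact: mdom|exact: block_proc_sqi|exact: block_proc_sqi|exact: block_proc_sqi].
  over.
rewrite big_split /=; congr (_ + _); last exact: block_isom_disjoint.
move: okb ok1 bc; case: b {hh lb ok2} => lo hi k u /= okb ok1 bc.
by rewrite -bc in ok1 *; exact: block_isom_same.
Qed.

(** Cutting a block at an end point of the other leaves two cases: intervals that follow one
    another, where both sides are 0, and equal intervals, where the bracket of the integrator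
    applies. *)
Lemma block_isom b c : block_ok b -> block_ok c ->
  ip1 (block_int b) (block_int c) = \sum_m ip2 (block_proc b m) (block_proc c m).
Proof.
wlog bc : b c / b_lo b <= b_lo c.
  move=> H okb okc; have [|] := leP (b_lo b) (b_lo c); first by move=> /H; exact.
  move=> /ltW /H/(_ okc okb); rewrite ipC => ->.
  by apply: eq_bigr => m _; rewrite ipC.
move=> okb okc.
have [|/ltW hc] := leP (b_hi b) (b_lo c); first exact: block_isom_disjoint.
have ok1 := block_ok_split1 bc hc okb; have ok2 := block_ok_split2 bc hc okb.
rewrite (block_int_split bc hc) ipDl//; try exact: block_int_sqi.
under eq_bigr => m _.
  rewrite (block_proc_split m bc hc) ipDl; [|exact: mdom|exact: block_proc_sqi|exact: block_proc_sqi|exact: block_proc_sqi].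
  over.
rewrite big_split /=; congr (_ + _); first exact: block_isom_disjoint.
exact: block_isom_lo.
Qed.

Fixpoint blocks_ok bs := if bs is b :: bs' then block_ok b /\ blocks_ok bs' else True.

Definition blocks_int bs w := \sum_(b <- bs) block_int b w.

Definition blocks_proc bs m p := \sum_(b <- bs) block_proc b m p.

Definition block_tail t b := Block (Num.max (b_lo b) t) (Num.max (b_hi b) t) (b_idx b) (b_val b).

(** The integral up to [t] is the total minus the part after [t]. The latter is again given by a
    list of blocks and is orthogonal to the past of [t], so the martingale property is immediate. *)
Definition blocks_int_at t bs w := blocks_int bs w - blocks_int (map (block_tail t) bs) w.

Definition block_scale (u : Omega -> R) b := Block (b_lo b) (b_hi b) (b_idx b) (fun w => u w * b_val b w).

Lemma blocks_ok_cat bs bs' : blocks_ok bs -> blocks_ok bs' -> blocks_ok (bs ++ bs').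
Proof. by elim: bs => //= b bs IH [okb okbs] ok'; split => //; exact: IH. Qed.

Lemma blocks_int_cons b bs : blocks_int (b :: bs) = block_int b \+ blocks_int bs.
Proof. by apply/funext => w; rewrite /blocks_int big_cons. Qed.

Lemma blocks_int_cat bs bs' : blocks_int (bs ++ bs') = blocks_int bs \+ blocks_int bs'.
Proof. by apply/funext => w; rewrite /blocks_int big_cat. Qed.

Lemma blocks_proc_cons b bs m : blocks_proc (b :: bs) m = block_proc b m \+ blocks_proc bs m.
Proof. by apply/funext => w; rewrite /blocks_proc big_cons. Qed.

Lemma blocks_proc_cat bs bs' m : blocks_proc (bs ++ bs') m = blocks_proc bs m \+ blocks_proc bs' m.
Proof. by apply/funext => w; rewrite /blocks_proc big_cat. Qed.

Lemma blocks_int_sqi bs : blocks_ok bs -> sqi1 (blocks_int bs).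
Proof.
elim: bs => [_|b bs IH [okb okbs]].
  by rewrite (_ : blocks_int [::] = fun=> 0); [exact: sqi0|apply/funext => w; rewrite /blocks_int big_nil].
by rewrite blocks_int_cons; apply: sqiD => //; [exact: block_int_sqi|exact: IH].
Qed.

Lemma blocks_proc_sqi bs m : blocks_ok bs -> sqi2 (blocks_proc bs m).
Proof.
elim: bs => [_|b bs IH [okb okbs]].
  by rewrite (_ : blocks_proc [::] m = fun=> 0); [exact: sqi0|apply/funext => w; rewrite /blocks_proc big_nil].
by rewrite blocks_proc_cons; apply: sqiD; [exact: mdom|exact: block_proc_sqi|exact: IH].
Qed.

Lemma blocks_isom bs bs' : blocks_ok bs -> blocks_ok bs' ->
  ip1 (blocks_int bs) (blocks_int bs') = \sum_m ip2 (blocks_proc bs m) (blocks_proc bs' m).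
Proof.
move=> okbs okbs'.
have one b : block_ok b -> ip1 (block_int b) (blocks_int bs') = \sum_m ip2 (block_proc b m) (blocks_proc bs' m).
  move=> okb; elim: bs' okbs' => [_|c cs IH [okc okcs]].
    rewrite (_ : blocks_int [::] = fun=> 0); last by apply/funext => w; rewrite /blocks_int big_nil.
    rewrite ipC ip_zerol big1// => m _.
    by rewrite (_ : blocks_proc [::] m = fun=> 0) 1?ipC ?ip_zerol//; apply/funext => w; rewrite /blocks_proc big_nil.
  rewrite blocks_int_cons ipDr//; [|exact: block_int_sqi|exact: blocks_int_sqi|exact: block_int_sqi].
  under eq_bigr => m _.
    rewrite blocks_proc_cons ipDr; [|exact: mdom|exact: block_proc_sqi|exact: blocks_proc_sqi|exact: block_proc_sqi].
    over.
  by rewrite big_split /= IH// block_isom.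
elim: bs okbs => [_|b bs IH [okb okbs]].
  rewrite (_ : blocks_int [::] = fun=> 0); last by apply/funext => w; rewrite /blocks_int big_nil.
  rewrite ip_zerol big1// => m _.
  by rewrite (_ : blocks_proc [::] m = fun=> 0) ?ip_zerol//; apply/funext => w; rewrite /blocks_proc big_nil.
rewrite blocks_int_cons ipDl//; [|exact: block_int_sqi|exact: blocks_int_sqi|exact: blocks_int_sqi].
under eq_bigr => m _.
  rewrite blocks_proc_cons ipDl; [|exact: mdom|exact: block_proc_sqi|exact: blocks_proc_sqi|exact: blocks_proc_sqi].
  over.
by rewrite big_split /= IH// one.
Qed.

Lemma block_tail_ok t b : 0 <= t <= T -> block_ok b -> block_ok (block_tail t b).
Proof.
move=> /andP[t0 tT] [lo lohi hi mb bb]; split => //=.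
- by rewrite le_max lo.
- by rewrite ge_max !le_max lohi lexx orbT.
- by rewrite ge_max hi tT.
- apply: mwS mb; apply: itg_mono itg _ _ _ _ _ => //.
    by rewrite le_max lexx.
  by rewrite ge_max tT (le_trans lohi hi).
Qed.

Lemma blocks_tail_ok t bs : 0 <= t <= T -> blocks_ok bs -> blocks_ok (map (block_tail t) bs).
Proof.
move=> tT; elim: bs => //= b bs IH [okb okbs]; split; first exact: block_tail_ok.
exact: IH.
Qed.

Lemma block_proc_tail t b m p : block_proc (block_tail t b) m p = (t < p.2)%R%:R * block_proc b m p.
Proof.
rewrite /block_proc /= gt_max le_max; have [tp|pt] := ltP t p.2.
  by rewrite andbT orbF mul1r.
by rewrite andbF /= mulr0 !mul0r.
Qed.

Lemma blocks_proc_tail t bs m p :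
  blocks_proc (map (block_tail t) bs) m p = (t < p.2)%R%:R * blocks_proc bs m p.
Proof.
rewrite /blocks_proc big_map mulr_sumr; apply: eq_bigr => b _.
exact: block_proc_tail.
Qed.

Lemma block_int_atE t b w : block_int b w - block_int (block_tail t b) w =
  b_val b w * (L (b_idx b) (Num.min (b_hi b) t) w - L (b_idx b) (Num.min (b_lo b) t) w).
Proof.
rewrite /block_int /= -mulrBr; congr (_ * _).
have mm s : L (b_idx b) s w + L (b_idx b) t w = L (b_idx b) (Num.min s t) w + L (b_idx b) (Num.max s t) w.
  by have [st|ts] := leP s t; lra.
by have := mm (b_lo b); have := mm (b_hi b); lra.
Qed.

Lemma blocks_int_atE t bs w : blocks_int_at t bs w = \sum_(b <- bs)
  b_val b w * (L (b_idx b) (Num.min (b_hi b) t) w - L (b_idx b) (Num.min (b_lo b) t) w).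
Proof.
rewrite /blocks_int_at /blocks_int big_map -sumrB.
by apply: eq_bigr => b _; exact: block_int_atE.
Qed.

Lemma blocks_int_at_adapted t bs : 0 <= t <= T -> blocks_ok bs ->
  measurable_wrt (G t) (blocks_int_at t bs).
Proof.
move=> tT; have sG := itg_sigma itg t.
elim: bs => [_|b bs IH [okb okbs]].
  rewrite (_ : blocks_int_at t [::] = fun=> 0); first exact: mw_cst.
  by apply/funext => w; rewrite blocks_int_atE big_nil.
rewrite (_ : blocks_int_at t (b :: bs) = (fun w => b_val b w *
  (L (b_idx b) (Num.min (b_hi b) t) w - L (b_idx b) (Num.min (b_lo b) t) w)) \+ blocks_int_at t bs).
  apply: mwD => //; last exact: IH.
  case: okb => lo lohi hi mb _; move: tT => /andP[t0 tT].
  have [lt|tl] := leP (b_lo b) t; last first.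
    rewrite (min_idPr _) ?(le_trans (ltW tl))// (_ : (fun w => _) = fun=> 0); first exact: mw_cst.
    by apply/funext => w; rewrite subrr mulr0.
  have sub s : 0 <= s -> s <= t -> measurable_wrt (G t) (L (b_idx b) s).
    move=> s0 st; apply: (@mwS _ _ _ (G s)); first by apply: itg_mono itg _ _ _ _ _.
    by apply: itg_adapted itg _ _ _; rewrite s0 (le_trans st tT).
  apply: mwM => //; first by apply: mwS mb; apply: itg_mono itg _ _ _ _ _.
  apply: mwB => //; apply: sub => //.
  by rewrite le_min t0 (le_trans lo lohi).
  by rewrite ge_min lexx orbT.
by apply/funext => w; rewrite /= !blocks_int_atE big_cons.
Qed.

Lemma blocks_int_at_sqi t bs : 0 <= t <= T -> blocks_ok bs -> sqi1 (blocks_int_at t bs).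
Proof.
move=> tT okbs; apply: sqiB => //; first exact: blocks_int_sqi.
by apply: blocks_int_sqi; exact: blocks_tail_ok.
Qed.

Lemma blocks_int_atT bs : blocks_ok bs -> blocks_int_at T bs = blocks_int bs.
Proof.
elim: bs => [_|b bs IH [okb okbs]]; apply/funext => w.
  by rewrite blocks_int_atE /blocks_int !big_nil.
rewrite blocks_int_atE big_cons -blocks_int_atE IH// /blocks_int big_cons; congr (_ + _).
by case: okb => lo lohi hi _ _; rewrite !(min_idPl _)// (le_trans lohi).
Qed.

Lemma block_int_orth xi b : block_ok b -> measurable_wrt (G (b_lo b)) xi -> sqi1 xi ->
  ip1 xi (block_int b) = 0.
Proof.
move=> okb mxi sxi; have mb := block_ok_measurable okb.
case: (okb) => lo lohi hi mbG [C bC].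
rewrite -[RHS](@itg_mart itg (b_idx b) (b_lo b) (b_hi b) (fun w => b_val b w * xi w))//.
- by rewrite /ip; apply: eq_Rintegral => w _; rewrite /block_int /=; ring.
- by apply: mwM => //; exact: itg_sigma itg _.
- by apply: (@sqi_mulb _ _ _ _ _ measurableT _ _ C).
Qed.

Lemma blocks_tail_orth t xi bs : 0 <= t <= T -> blocks_ok bs ->
  measurable_wrt (G t) xi -> sqi1 xi ->
  ip1 xi (blocks_int (map (block_tail t) bs)) = 0.
Proof.
move=> tT + mxi sxi; elim: bs => [_|b bs IH [okb okbs]].
  rewrite (_ : blocks_int _ = fun=> 0); last by apply/funext => w; rewrite /blocks_int big_nil.
  by rewrite ipC ip_zerol.
rewrite map_cons blocks_int_cons ipDr//; last 2 first.
- by apply: block_int_sqi; exact: block_tail_ok.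
- by apply: blocks_int_sqi; exact: blocks_tail_ok.
rewrite IH// addr0; have okt := block_tail_ok tT okb.
apply: block_int_orth => //; apply: mwS mxi; apply: itg_mono itg _ _ _ _ _ => /=.
- by case/andP: tT.
- by rewrite le_max lexx orbT.
- by case: okt => /= _ h1 h2 _ _; exact: le_trans h2.
Qed.

(* J is the integral process of the integrand whose rho-components are Z. *)
Definition is_integral (Z : M -> Omega * R -> R) (J : R -> Omega -> R) :=
  exists bs : nat -> seq block,
  [/\ forall n, blocks_ok (bs n),
      forall m, sqi2 (Z m) /\ l2cvg PL dom (fun n => blocks_proc (bs n) m) (Z m) &
      forall t, 0 <= t <= T -> sqi1 (J t) /\ l2cvg P setT (fun n => blocks_int_at t (bs n)) (J t)].

Let t0T : 0 <= T <= T. Proof. by rewrite lexx ltW. Qed.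

Lemma is_integral_tail Z J t : is_integral Z J -> 0 <= t <= T -> exists bs : nat -> seq block,
  [/\ forall n, blocks_ok (bs n),
      forall m, sqi2 (Z m) /\ l2cvg PL dom (fun n => blocks_proc (bs n) m) (Z m) &
      l2cvg P setT (fun n => blocks_int (map (block_tail t) (bs n))) (J T \- J t)].
Proof.
move=> [bs [okbs cZ cJ]] tT; exists bs; split => //.
have [sT cT] := cJ T t0T; have [st ct] := cJ t tT.
rewrite (_ : (fun n => _) = (fun n => blocks_int_at T (bs n) \- blocks_int_at t (bs n))).
  by apply: l2cvgB => // n; exact: blocks_int_at_sqi.
by apply/funext => n; apply/funext => w; rewrite /= blocks_int_atT// /blocks_int_at; lra.
Qed.

Lemma is_integral_isom Z J t : is_integral Z J -> 0 <= t <= T ->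
  ip1 (J T \- J t) (J T \- J t) =
  \sum_m ip2 (fun p => (t < p.2)%R%:R * Z m p) (fun p => (t < p.2)%R%:R * Z m p).
Proof.
move=> iZJ tT; have [bs [okbs cZ cJ]] := is_integral_tail iZJ tT.
have [bs0 [_ _ sJ]] := iZJ.
have sJt : sqi1 (J T \- J t) by apply: sqiB => //; [exact: (sJ _ t0T).1|exact: (sJ _ tT).1].
have okt n : blocks_ok (map (block_tail t) (bs n)) by exact: blocks_tail_ok.
have c1 := l2cvg_ip measurableT (fun n => blocks_int_sqi (okt n)) sJt
  (fun n => blocks_int_sqi (okt n)) sJt cJ cJ.
have mt : measurable_fun dom (fun p : OxR Omega R => (t < p.2)%R%:R : R).
  apply: measurable_funTS; rewrite (_ : (fun p => _) = (\1_(`]t, +oo[%classic) : R -> R) \o snd).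
    by apply: measurableT_comp => //; exact: measurable_indic.
  apply/funext => p /=; rewrite indicE.
  by congr (nat_of_bool _)%:R; apply/idP/idP; rewrite inE /= in_itv /= andbT.
have bt (p : OxR Omega R) : dom p -> `|(t < p.2)%R%:R : R| <= 1.
  by move=> _; case: (_ < _); rewrite ?normr1 ?normr0.
have sZ m : sqi2 (fun p => (t < p.2)%R%:R * Z m p).
  by apply: (sqi_mulb mdom mt (cZ m).1 bt).
have c2 : (fun n => \sum_m ip2 (blocks_proc (map (block_tail t) (bs n)) m)
   (blocks_proc (map (block_tail t) (bs n)) m)) @ \oo -->
   \sum_m ip2 (fun p => (t < p.2)%R%:R * Z m p) (fun p => (t < p.2)%R%:R * Z m p).
  apply: cvg_finite_sum => m.
  have cm : l2cvg PL dom (fun n => blocks_proc (map (block_tail t) (bs n)) m)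
    (fun p => (t < p.2)%R%:R * Z m p).
    have := l2cvg_mulb mdom mt bt (fun n => blocks_proc_sqi m (okbs n)) (cZ m).1 (cZ m).2.
    rewrite (_ : (fun n => _) = (fun n => blocks_proc [seq block_tail t i | i <- bs n] m))//.
    by apply/funext => n; apply/funext => p; rewrite blocks_proc_tail.
  by apply: (l2cvg_ip mdom) => // n; exact: blocks_proc_sqi.
have E : (fun n => ip1 (blocks_int (map (block_tail t) (bs n))) (blocks_int (map (block_tail t) (bs n)))) =
  (fun n => \sum_m ip2 (blocks_proc (map (block_tail t) (bs n)) m)
   (blocks_proc (map (block_tail t) (bs n)) m)).
  by apply/funext => n; exact: blocks_isom.
by rewrite E in c1; exact: (cvg_unique _ c1 c2).
Qed.

Lemma is_integral_orth Z J t xi : is_integral Z J -> 0 <= t <= T ->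
  measurable_wrt (G t) xi -> sqi1 xi -> ip1 xi (J T \- J t) = 0.
Proof.
move=> iZJ tT mxi sxi; have [bs [okbs cZ cJ]] := is_integral_tail iZJ tT.
have [bs0 [_ _ sJ]] := iZJ.
have sJt : sqi1 (J T \- J t) by apply: sqiB => //; [exact: (sJ _ t0T).1|exact: (sJ _ tT).1].
have okt n : blocks_ok (map (block_tail t) (bs n)) by exact: blocks_tail_ok.
have c1 := l2cvg_ip measurableT (fun=> sxi) sxi
  (fun n => blocks_int_sqi (okt n)) sJt (l2cvg_cst _ _ _) cJ.
have c0 : ip1 xi (blocks_int (map (block_tail t) (bs n))) @[n --> \oo] --> (0 : R).
  rewrite (_ : (fun n => _) = fun=> 0); first exact: cvg_cst.
  by apply/funext => n; exact: blocks_tail_orth.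
exact: (cvg_unique _ c1 c0).
Qed.

Lemma blocks_ok_map (I : eqType) (s : seq I) (f : I -> block) :
  (forall i, i \in s -> block_ok (f i)) -> blocks_ok (map f s).
Proof.
elim: s => //= i s IH H; split; first by apply: H; rewrite inE eqxx.
by apply: IH => j js; apply: H; rewrite inE js orbT.
Qed.

Definition block_opp b := Block (b_lo b) (b_hi b) (b_idx b) (fun w => - b_val b w).

Lemma blocks_opp_ok bs : blocks_ok bs -> blocks_ok (map block_opp bs).
Proof.
elim: bs => //= b bs IH [[lo lohi hi mb [C bC]] okbs]; split; last exact: IH.
split => //=.
  rewrite (_ : (fun w => _) = (fun w => (-1) * b_val b w)).
    by apply: mwM => //; [exact: itg_sigma itg _|apply: mw_cst; exact: itg_sigma itg _].
  by apply/funext => w; rewrite mulN1r.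
by exists C => w; rewrite normrN.
Qed.

Definition blocks_sub bs bs' := bs ++ map block_opp bs'.

Lemma blocks_sub_ok bs bs' : blocks_ok bs -> blocks_ok bs' -> blocks_ok (blocks_sub bs bs').
Proof. by move=> okbs okbs'; apply: blocks_ok_cat => //; exact: blocks_opp_ok. Qed.

Lemma blocks_sub_proc bs bs' m :
  blocks_proc (blocks_sub bs bs') m = blocks_proc bs m \- blocks_proc bs' m.
Proof.
apply/funext => p; rewrite blocks_proc_cat /=; congr (_ + _).
by rewrite /blocks_proc big_map -sumrN; apply: eq_bigr => b _; rewrite /block_proc /= !mulNr.
Qed.

Lemma blocks_sub_int bs bs' : blocks_int (blocks_sub bs bs') = blocks_int bs \- blocks_int bs'.
Proof.
apply/funext => w; rewrite /blocks_int big_cat big_map /= -sumrN; congr (_ + _).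
by apply: eq_bigr => b _; rewrite /block_int mulNr.
Qed.

Lemma blocks_sub_int_at bs bs' t :
  blocks_int_at t (blocks_sub bs bs') = blocks_int_at t bs \- blocks_int_at t bs'.
Proof.
apply/funext => w; rewrite /= !blocks_int_atE big_cat big_map /= -sumrN; congr (_ + _).
by apply: eq_bigr => b _; rewrite mulNr.
Qed.

Lemma is_integralB Z J Z' J' : is_integral Z J -> is_integral Z' J' ->
  is_integral (fun m => Z m \- Z' m) (fun t => J t \- J' t).
Proof.
move=> [bs [okbs cZ cJ]] [bs' [okbs' cZ' cJ']].
exists (fun n => blocks_sub (bs n) (bs' n)); split.
- by move=> n; exact: blocks_sub_ok.
- move=> m; have [sZ lZ] := cZ m; have [sZ' lZ'] := cZ' m.
  split; first exact: (sqiB mdom).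
  rewrite (_ : (fun n => _) = (fun n => blocks_proc (bs n) m \- blocks_proc (bs' n) m)).
    by apply: (l2cvgB mdom) => // n; exact: blocks_proc_sqi.
  by apply/funext => n; rewrite blocks_sub_proc.
- move=> t tT; have [sJ lJ] := cJ t tT; have [sJ' lJ'] := cJ' t tT.
  split; first exact: sqiB.
  rewrite (_ : (fun n => _) = (fun n => blocks_int_at t (bs n) \- blocks_int_at t (bs' n))).
    by apply: l2cvgB => // n; exact: blocks_int_at_sqi.
  by apply/funext => n; rewrite blocks_sub_int_at.
Qed.

End blocks.

(** * The Brownian motion and the joint noise *)

Lemma big_option (R : realType) (I : finType) (F : option I -> R) :
  \sum_m F m = F None + \sum_i F (Some i).
Proof.
rewrite (bigD1 None)//=; congr (_ + _).
rewrite (reindex_omap Some id)//=; last by case.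
by apply: eq_bigl => i; rewrite eqxx.
Qed.

Lemma E_cst d (Omega : measurableType d) (R : realType) (P : probability Omega R) (a : R) :
  \int[P]_w a = a.
Proof. by rewrite Rintegral_cst// (congr1 fine (probability_setT P)) mulr1. Qed.

Section joint.
Context {R : realType} {d} {Omega : measurableType d}.
Variables (P : probability Omega R) (T : R) (N : nat) (A : 'M[R]_N) (c : R).
Variables (W : R -> Omega -> R) (X : R -> Omega -> 'cV[R]_N).
Hypotheses (hP : measure_is_complete P) (T0 : 0 < T) (hc : 0 < c < 1)
  (hA : rate_matrix A c) (hW : brownian_motion P T W) (hX : markov_chain P T A X)
  (hWX : independent P (filtrationX P X T) (filtrationW P W T))
  (hM : square_integrable_martingale P T (filtrationX P X) (chain_martingale A X)).

Local Notation leb := (@lebesgue_measure R).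
Local Notation FX := (filtrationX P X).
Local Notation FW := (filtrationW P W).
Local Notation G := (filtrationG P W X).
Local Notation Mi i := (fun t w => chain_martingale A X t w i 0).
Local Notation ip1 := (ip P setT).
Local Notation sqi1 := (sqi P setT).
Local Notation PL := (P \x leb)%E.
Local Notation dom := (@domain R d Omega T).
Local Notation ip2 := (ip PL dom).
Local Notation sqi2 := (sqi PL dom).
Local Notation E f := (\int[P]_w f w).

Lemma W_measurable t : 0 <= t <= T -> measurable_fun setT (W t).
Proof. by case: hW => + _ _ _; exact. Qed.

Lemma FW_sub t : t <= T -> FW t `<=` measurable.
Proof.
move=> tT; apply: aug_sub => // i s /andP[s0 st]; apply: W_measurable.
by rewrite s0 (le_trans st tT).
Qed.

Lemma FX_sigma t : sigma_algebra setT (FX t). Proof. exact: aug_sigma. Qed.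
Lemma FW_sigma t : sigma_algebra setT (FW t). Proof. exact: aug_sigma. Qed.
Lemma G_sigma t : sigma_algebra setT (G t). Proof. exact: smallest_sigma_algebra. Qed.

Lemma G_sub t : t <= T -> G t `<=` measurable.
Proof.
move=> tT; apply: smallest_sub; first exact: sigma_algebra_measurable.
by move=> B [/(FX_sub hP hX tT)|/(FW_sub tT)].
Qed.

Lemma G_mono s t : s <= t -> G s `<=` G t.
Proof.
move=> st; apply: sub_sigma_algebra2 => B [FB|FB]; [left|right]; exact: aug_mono FB.
Qed.

Lemma FX_G t : FX t `<=` G t.
Proof. by move=> B FB; apply: sub_sigma_algebra; left. Qed.

Lemma FW_G t : FW t `<=` G t.
Proof. by move=> B FB; apply: sub_sigma_algebra; right. Qed.

Lemma G_negligible t : P.-negligible `<=` G t.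
Proof. by move=> B nB; apply: FX_G; exact: aug_negligible. Qed.

Lemma W_adapted t : 0 <= t <= T -> measurable_wrt (FW t) (W t).
Proof. by move=> /andP[t0 _]; apply: (@aug_mw _ _ _ P unit (fun=> W) tt); rewrite t0 lexx. Qed.

Lemma W_adaptedG t : 0 <= t <= T -> measurable_wrt (G t) (W t).
Proof. by move=> tT; apply: mwS (W_adapted tT); exact: FW_G. Qed.

Lemma X_adaptedG i t : 0 <= t <= T -> measurable_wrt (G t) (fun w => X t w i 0).
Proof. by move=> tT; apply: mwS (@chain_adapted _ _ _ P T _ X i t tT); exact: FX_G. Qed.

(** The past of [W] with the whole chain, the mirror image of [FXW]. All increments of [M] up to [T]
    belong to it, which makes them orthogonal to those of [W]. *)
Definition FWX s := <<s FX T `|` FW s >>.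

Lemma FWX_sigma s : sigma_algebra setT (FWX s). Proof. exact: smallest_sigma_algebra. Qed.

Lemma FWX_sub s : s <= T -> FWX s `<=` measurable.
Proof.
move=> sT; apply: smallest_sub; first exact: sigma_algebra_measurable.
by move=> B [/(FX_sub hP hX (lexx T))|/(FW_sub sT)].
Qed.

Lemma G_FWX s : s <= T -> G s `<=` FWX s.
Proof. by move=> sT; apply: sub_sigma_algebra2; apply: setSU; exact: aug_mono. Qed.

Lemma G_FXW s : s <= T -> G s `<=` FXW P X (FW T) s.
Proof. by move=> sT; apply: sub_sigma_algebra2; apply: setUS; exact: aug_mono. Qed.

Lemma FX_FWX s : FX T `<=` FWX s.
Proof. by move=> B FB; apply: sub_sigma_algebra; left. Qed.

Lemma W_law s t : 0 <= s -> s < t -> t <= T -> forall B, measurable B ->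
  P ((W t \- W s) @^-1` B) = normal_prob 0 (Num.sqrt (t - s)) B.
Proof. by move=> s0 st tT; case: hW => _ _ _ /(_ s t s0 st tT)[]. Qed.

Lemma dW_measurable s t : 0 <= s -> s <= t -> t <= T -> measurable_fun setT (W t \- W s).
Proof.
move=> s0 st tT; apply: measurable_funB; apply: W_measurable.
  by rewrite (le_trans s0).
by rewrite s0 (le_trans st).
Qed.

Lemma sqrt_gt0 (s t : R) : s < t -> 0 < Num.sqrt (t - s).
Proof. by move=> st; rewrite sqrtr_gt0 subr_gt0. Qed.

(** For [A'] in [FX T] and [B'] in [FW s], the intersection of [B'] with the increment event lies in
    [FW T]: the chain splits off by its independence from [W], then the increment by its
    independence from [FW s]. The sets [A'] intersected with [B'] generate [FWX s]. *)
Lemma increment_indep s t : 0 <= s -> s < t -> t <= T ->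
  independent P (preimage_set_system setT (W t \- W s) measurable) (FWX s).
Proof.
move=> s0 st tT _ D [B mB <-] FD; rewrite setTI.
have sT : s <= T by rewrite (le_trans (ltW st)).
have mD : measurable D by exact: (FWX_sub sT FD).
have md := dW_measurable s0 (ltW st) tT.
set dB := (W t \- W s) @^-1` B.
have mdB : measurable dB by rewrite -[dB]setTI; exact: md.
have FWdB : FW T dB.
  apply: (@mw_preimage _ _ _ (FW T) (W t \- W s)) => //.
  apply: mwB; first exact: FW_sigma.
    by apply: mwS (@W_adapted t _); [exact: aug_mono|rewrite (le_trans s0 (ltW st))].
  by apply: mwS (@W_adapted s _); [exact: aug_mono|rewrite s0].
have ind A' B' : FX T A' -> FW T B' -> P (A' `&` B') = (P A' * P B')%E by exact: hWX.
have indW' A' : FW s A' -> P (A' `&` dB) = (P A' * P dB)%E.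
  move=> FA; case: hW => _ _ _ /(_ s t s0 st tT)[_]; apply => //.
  by exists B => //; rewrite setTI.
pose U w : R := \1_dB w - fine (P dB).
have mU : measurable_fun setT U by apply: measurable_funB => //; exact: measurable_indic.
have iU : P.-integrable setT (EFin \o U).
  apply: (@bounded_int _ _ _ P _ (1 + `|fine (P dB)|)) => // w.
  by apply: (le_trans (ler_normB _ _)); rewrite lerD// indic_norm1.
have EU B' : measurable B' -> E (fun w => \1_B' w * U w) =
    fine (P (B' `&` dB)) - fine (P B') * fine (P dB).
  move=> mB'.
  have s1 := @indic_sqi _ _ _ P _ mB'; have s2 := @indic_sqi _ _ _ P _ mdB.
  have s3 := @cst_sqi _ _ _ P (fine (P dB)).
  rewrite -[LHS]/(ip1 (\1_B') ((\1_dB) \- (fun=> fine (P dB)))) ipBr//; congr (_ - _).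
    rewrite /ip /Rintegral; congr fine.
    transitivity (\int[P]_w (\1_(B' `&` dB) w)%:E)%E.
      by apply: eq_integral => w _; rewrite indicI.
    by rewrite integral_indic ?setIT//; exact: measurableI.
  rewrite ipC -[LHS]/(E (fun w => fine (P dB) * \1_B' w)) RintegralZl//; last exact: sqi_int.
  rewrite mulrC; congr (_ * _); rewrite /Rintegral; congr fine.
  by rewrite integral_indic ?setIT.
have fin B' : measurable B' -> P B' = (fine (P B'))%:E.
  by move=> mB'; rewrite fineK// fin_num_measure.
have H A' B' : FX T A' -> FW s B' -> E (fun w => \1_(A' `&` B') w * U w) = 0.
  move=> FA FB; have mA := FX_sub hP hX (lexx T) FA; have mB' := FW_sub sT FB.
  have FTB : FW T B' by apply: aug_mono FB.
  rewrite EU; last exact: measurableI.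
  have FBd : FW T (B' `&` dB).
    by apply: sigma_algebra_setI FTB FWdB; exact: FW_sigma.
  rewrite -setIA (ind _ _ FA FBd) indW'// (ind _ _ FA FTB) (fin _ mA) (fin _ mB') (fin _ mdB) -!EFinM /=; ring.
have := integral_indic_eq0 (FX_sigma T) (FW_sigma s) (FX_sub hP hX (lexx T)) (FW_sub sT) iU H FD.
rewrite EU// => /eqP; rewrite subr_eq0 => /eqP e.
rewrite setIC (fin (D `&` dB)) ?e; last exact: measurableI.
by rewrite EFinM -!fin// muleC.
Qed.

Lemma dW_sqi s t : 0 <= s -> s <= t -> t <= T -> sqi1 (W t \- W s).
Proof.
move=> s0; rewrite le_eqVlt => /predU1P[<- sT|st tT].
  rewrite (_ : _ \- _ = fun=> 0); first exact: sqi0.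
  by apply/funext => w /=; rewrite subrr.
apply: (normal_sqi (sqrt_gt0 st)); [exact: dW_measurable (ltW st) _|exact: W_law].
Qed.

Lemma W_sqi t : 0 <= t <= T -> sqi1 (W t).
Proof.
move=> /andP[t0 tT].
have s0 : sqi1 (W 0).
  apply: (@ae_sqi _ _ _ P setT measurableT (W 0) (fun=> 0)).
  - by apply: W_measurable; rewrite lexx ltW.
  - exact: sqi0.
  - by case: hW => _ + _ _; apply: filterS => w W0 _.
rewrite (_ : W t = (W t \- W 0) \+ W 0); last by apply/funext => w /=; rewrite subrK.
by apply: sqiD => //; exact: dW_sqi.
Qed.

(** Used with the identity for the martingale property, and with [x ^+ 2 - (t - s)] for the bracket
    of [W]. *)
Lemma increment_orth s t (f : R -> R) xi : 0 <= s -> s < t -> t <= T ->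
  measurable_fun setT f -> sqi1 (fun w => f ((W t \- W s) w)) ->
  E (fun w => f ((W t \- W s) w)) = 0 ->
  measurable_wrt (FWX s) xi -> sqi1 xi -> ip1 xi (fun w => f ((W t \- W s) w)) = 0.
Proof.
move=> s0 st tT mf sf Ef mxi sxi; have sT : s <= T by rewrite (le_trans (ltW st)).
apply: (@integral_mul_eq0 _ _ _ P (FWX s)) => //; [exact: FWX_sigma|exact: FWX_sub|exact: sqi_int| |exact: sqi_integrable].
have md := dW_measurable s0 (ltW st) tT.
move=> D FD; rewrite (@independent_integral _ _ _ P (preimage_set_system setT (W t \- W s) measurable) (FWX s)) ?Ef ?mulr0//.
- by apply: sigma_algebra_preimage; exact: sigma_algebra_measurable.
- exact: FWX_sigma.
- by move=> _ [B mB <-]; exact: md.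
- exact: FWX_sub.
- exact: increment_indep.
- move=> _ [B mB <-]; exists (f @^-1` B) => //.
  by rewrite -[X in measurable X]setTI; exact: mf.
- exact: sqi_int.
Qed.

Lemma W_martingale s t xi : 0 <= s -> s <= t -> t <= T ->
  measurable_wrt (FWX s) xi -> sqi1 xi -> ip1 xi (W t \- W s) = 0.
Proof.
move=> s0; rewrite le_eqVlt => /predU1P[<- sT _ _|st tT mxi sxi].
  by apply: ip_eq0 => w _ /=; rewrite subrr mulr0.
apply: (@increment_orth s t id) => //; first exact: dW_sqi (ltW st) _.
exact: (normal_mean (sqrt_gt0 st) (dW_measurable s0 (ltW st) tT) (W_law s0 st tT)).
Qed.

Lemma W_bracket s t eta C : 0 <= s -> s <= t -> t <= T ->
  measurable_wrt (FWX s) eta -> (forall w, `|eta w| <= C) ->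
  ip1 eta (fun w => (W t w - W s w) * (W t w - W s w)) = (t - s) * E eta.
Proof.
move=> s0; rewrite le_eqVlt => /predU1P[<- sT _ _|st tT meta etaC].
  by rewrite subrr mul0r; apply: ip_eq0 => w _ /=; rewrite subrr !mulr0.
have sT : s <= T by rewrite (le_trans (ltW st)).
have md := dW_measurable s0 (ltW st) tT; have law := W_law s0 st tT; have sg := sqrt_gt0 st.
have meta' : measurable_fun setT eta by apply: mw_measurable meta; exact: FWX_sub.
have seta : sqi1 eta by exact: bounded_sqi etaC.
have s2 : sqi1 (fun w => (W t \- W s) w ^+ 2) by exact: normal_sqi2 md law.
have sc : sqi1 (fun=> t - s) by exact: cst_sqi.
have sqrt2 : Num.sqrt (t - s) ^+ 2 = t - s by rewrite sqr_sqrtr// subr_ge0 ltW.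
have : ip1 eta ((fun w => (W t \- W s) w ^+ 2) \- (fun=> t - s)) = 0.
  apply: (@increment_orth s t (fun x => x ^+ 2 - (t - s)) eta) => //.
  - by apply: measurable_funB => //; exact: measurable_funX.
  - exact: sqiB.
  - rewrite -ip1E -[LHS]/(ip1 _ ((fun w => (W t \- W s) w ^+ 2) \- (fun=> t - s))) ipBr//; last exact: cst_sqi.
    by rewrite !ip1E (normal_variance sg md law) E_cst sqrt2 subrr.
rewrite ipBr// => /eqP; rewrite subr_eq0 => /eqP e.
transitivity (ip1 eta (fun w => (W t \- W s) w ^+ 2)).
  by apply: eq_Rintegral => w _; rewrite /= expr2.
rewrite e ipC -[LHS]/(E (fun w => (t - s) * eta w)) RintegralZl//; exact: sqi_int.
Qed.

Let hIW : independent P (FX T) (FW T). Proof. exact: hWX. Qed.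
Let sFW := FW_sigma T.
Let mFW := @FW_sub T (lexx T).

(* The index [None] stands for [W] and [Some i] for the i-th component of the
   chain martingale. The matrix [noise_rho] is a square root of the bracket: a
   jump from the current state [a] to [b] contributes
   [A b a (e_b - e_a) (e_b - e_a)^T] to [psi]. *)
Definition noise (k : option 'I_N) (t : R) (w : Omega) : R :=
  if k is Some i then chain_martingale A X t w i 0 else W t w.

Definition noise_rho (m k : option 'I_N) (q : Omega * R) : R :=
  match m, k with
  | None, None => 1
  | Some b, Some i => \sum_a XL X a q * (Num.sqrt (A b a) * ((b == i)%:R - (a == i)%:R))
  | _, _ => 0
  end.

Lemma noise_rho_index b i q a : (forall j, XL X j q = (j == a)%:R) ->
  noise_rho (Some b) (Some i) q = Num.sqrt (A b a) * ((b == i)%:R - (a == i)%:R).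
Proof.
move=> Xa; rewrite /= (bigD1 a)//= Xa eqxx mul1r big1 ?addr0// => e ea.
by rewrite Xa (negbTE ea) mul0r.
Qed.

Lemma rate_ge0 b a : b != a -> 0 <= A b a.
Proof. by move=> ba; case: hA => _ /(_ b a ba)/andP[cA _]; case/andP: hc => /ltW c0 _; exact: le_trans cA. Qed.

(** Squaring [Num.sqrt] recovers nonnegative rates, and the off-diagonal ones are; the diagonal term
    vanishes on both sides because its jump is 0. *)
Lemma sum_rho i j q : dom q ->
  \sum_b noise_rho (Some b) (Some i) q * noise_rho (Some b) (Some j) q = psiL A X i j q.
Proof.
move=> dq; have [a Xa] := XL_index T0 hX dq.
have -> : psiL A X i j q = psi0 A i j a.
  rewrite /psiL (bigD1 a)//= Xa eqxx mulr1 big1 ?addr0// => e ea.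
  by rewrite Xa (negbTE ea) mulr0.
rewrite /psi0; apply: eq_bigr => b _; rewrite !(noise_rho_index _ _ Xa).
have [->|ba] := eqVneq b a; first by rewrite !subrr !mulr0.
by rewrite mulrACA -expr2 sqr_sqrtr ?rate_ge0// mulrA.
Qed.

Lemma noise_rho_measurable m k : measurable_fun dom (noise_rho m k).
Proof.
case: m => [b|]; case: k => [i|]; try exact: measurable_cst.
apply: measurable_sum => a; apply: measurable_funM => //.
exact: (XL_measurable T0 hX a).
Qed.

Lemma noise_rho_bounded : exists C, forall m k q, dom q -> `|noise_rho m k q| <= C.
Proof.
exists (1 + \sum_b \sum_a (Num.sqrt (A b a))) => m k q dq.
have S0 : 0 <= \sum_b \sum_a (Num.sqrt (A b a)).
  by apply: sumr_ge0 => b _; apply: sumr_ge0 => a _; exact: sqrtr_ge0.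
case: m => [b|]; case: k => [i|] /=; rewrite ?normr1 ?normr0 ?lerDl ?addr_ge0//.
have [a Xa] := XL_index T0 hX dq; rewrite -/(noise_rho (Some b) (Some i) q) (noise_rho_index _ _ Xa).
rewrite -[leLHS]add0r lerD// normrM ger0_norm ?sqrtr_ge0//.
apply: (@le_trans _ _ (Num.sqrt (A b a))).
  rewrite -[leRHS]mulr1 ler_pM// ?sqrtr_ge0//.
  by case: (b == i); case: (a == i); rewrite ?subrr ?subr0 ?sub0r ?normrN ?normr0 ?normr1.
rewrite (bigD1 b)//= (bigD1 a)//= -addrA lerDl addr_ge0// sumr_ge0// => e _; rewrite ?sqrtr_ge0//.
by apply: sumr_ge0 => f _; exact: sqrtr_ge0.
Qed.

Lemma noise_integrator : integrator P T noise G noise_rho.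
Proof.
have [Cr rC] := noise_rho_bounded.
have mdom := @measurable_domain R d Omega T.
split.
- exact: G_sigma.
- exact: G_sub.
- by move=> s t _ st _; exact: G_mono.
- move=> [i|] t tT; last exact: W_adaptedG.
  by apply: mwS (@chain_martingale_measurable _ _ _ P T _ A X hM i t tT); exact: FX_G.
- move=> [i|] t tT; last exact: W_sqi.
  exact: (martingale_sqi hP hX hM i tT).
- move=> [i|] s t xi s0 st tT mxi sxi.
    apply: (martingale_FXW hP hX hM sFW mFW hIW i s0 st tT) => //.
    by apply: mwS mxi; apply: G_FXW; exact: le_trans tT.
  apply: W_martingale => //.
  by apply: mwS mxi; apply: G_FWX; exact: le_trans tT.
- exact: noise_rho_measurable.
- exact: noise_rho_bounded.
- move=> k l s t eta C s0 st tT meta etaC.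
  have sT := le_trans st tT.
  have metaX : measurable_wrt (FXW P X (FW T) s) eta by apply: mwS meta; exact: G_FXW.
  have metaW : measurable_wrt (FWX s) eta by apply: mwS meta; exact: G_FWX.
  have meta' : measurable_fun setT eta by apply: mw_measurable meta; exact: G_sub.
  have se : sqi2 (fun q => eta q.1).
    by apply: (@dom_bounded_sqi _ _ _ P T _ C) => //; apply: measurable_funTS; exact: measurableT_comp.
  have ipz (f g : Omega * R -> R) : (forall q, f q * g q = 0) -> ip2 f g = 0.
    move=> fg; transitivity (ip2 (fun=> 0) (fun=> 0)); last exact: ip_zerol.
    by apply: eq_Rintegral => q _; rewrite fg mul0r.
  rewrite big_option.
  (* The increment of [M] is measurable for [FX T], hence belongs to the past [FWX s], to which the
     increment of [W] is orthogonal. *)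
  have cross i : ip1 (fun w => eta w * (Mi i t w - Mi i s w)) (W t \- W s) = 0.
    apply: W_martingale => //.
      apply: mwM => //; first exact: FWX_sigma.
      apply: mwB; first exact: FWX_sigma.
        apply: mwS (@chain_martingale_measurable _ _ _ P T _ A X hM i t _).
          by apply: subset_trans (@FX_FWX s); exact: aug_mono.
        by rewrite (le_trans s0 st).
      apply: mwS (@chain_martingale_measurable _ _ _ P T _ A X hM i s _).
        by apply: subset_trans (@FX_FWX s); exact: aug_mono.
      by rewrite s0.
    apply: (sqi_mulb measurableT (C := C)) => //.
    exact: (increment_sqi hP hX hM i s0 st tT).
  case: k => [i|]; case: l => [j|] /=.
  + rewrite ipz ?add0r; last by move=> q; rewrite mulr0 mul0r.
    transitivity (ip1 eta (fun w => (Mi i t w - Mi i s w) * (Mi j t w - Mi j s w))).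
      by apply: eq_Rintegral => w _ /=; rewrite mulrA.
    rewrite (chain_bracket hP T0 hX hM sFW mFW hIW i j s0 st tT metaX etaC).
    pose g b (q : Omega * R) := (s < q.2 <= t)%R%:R * (noise_rho (Some b) (Some i) q * noise_rho (Some b) (Some j) q).
    have sg b : sqi2 (g b).
      apply: (@dom_bounded_sqi _ _ _ P T _ (Cr * Cr)).
        apply: measurable_funM; first by apply: measurable_funTS; exact: itv_indic_measurable.
        by apply: measurable_funM; exact: noise_rho_measurable.
      move=> q dq; rewrite normrM -[leRHS]mul1r ler_pM//.
        by case: (_ < _ <= _); rewrite ?normr1 ?normr0.
      by rewrite normrM ler_pM// rC.
    transitivity (ip2 (fun q => eta q.1) (fun q => \sum_b g b q)).
      apply: eq_ip => // q; rewrite inE => dq.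
      by rewrite -(sum_rho i j dq) mulr_sumr.
    rewrite (ip_sumr mdom)//; apply: eq_bigr => b _.
    apply: eq_Rintegral => q _; rewrite /g.
    by case: (s < q.2 <= t); rewrite ?mul1r ?mulr1 ?mul0r ?mulr0 ?mul0r ?mulrA.
  + rewrite cross ipz ?add0r; last by move=> q; rewrite mulr0 mul0r.
    by rewrite big1// => b _; rewrite ipz// => q; rewrite !mulr0.
  + rewrite ipz ?add0r; last by move=> q; rewrite !mulr0.
    rewrite big1; last by move=> b _; rewrite ipz// => q; rewrite mulr0 mul0r.
    by rewrite -(cross j) /ip; apply: eq_Rintegral => w _ /=; rewrite -!mulrA [X in _ * X]mulrC.
  + rewrite [X in _ + X]big1 ?addr0; last by move=> b _; rewrite ipz// => q; rewrite mulr0 mul0r.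
    transitivity (ip1 eta (fun w => (W t w - W s w) * (W t w - W s w))).
      by apply: eq_Rintegral => w _ /=; rewrite mulrA.
    rewrite (W_bracket s0 st tT metaW etaC) -(@integral_rect _ _ _ P T eta C s t)//.
    apply: eq_Rintegral => q _ /=; rewrite !mulr1 -mulrA.
    by case: (_ < _ <= _); rewrite ?mulr1 ?mulr0.
Qed.

End joint.

(** * One-step expansions *)

Lemma lipschitz_sqr_continuous (R : realType) (f : R -> R) (K : R) :
  (forall x y, `|f x - f y| ^+ 2 <= K * (x - y) ^+ 2) -> continuous f.
Proof.
move=> lf x; apply/cvgrPdist_le => e e0.
have K1 : 0 < `|K| + 1 by rewrite ltr_wpDl.
have s0 : 0 < Num.sqrt ((`|K| + 1)^-1 * e ^+ 2) by rewrite sqrtr_gt0 mulr_gt0 ?invr_gt0 ?exprn_gt0.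
exists (Num.sqrt ((`|K| + 1)^-1 * e ^+ 2)) => //= y; rewrite /ball_ /= => xy.
rewrite -(ler_sqr (normr_ge0 _) (ltW e0)); apply: (le_trans (lf x y)).
apply: (@le_trans _ _ ((`|K| + 1) * (x - y) ^+ 2)).
  by rewrite ler_wpM2r ?sqr_ge0// (le_trans (ler_norm K))// lerDl.
rewrite -ler_pdivlMl// -[leLHS]real_normK ?num_real//.
have <- : Num.sqrt ((`|K| + 1)^-1 * e ^+ 2) ^+ 2 = (`|K| + 1)^-1 * e ^+ 2.
  by rewrite sqr_sqrtr// mulr_ge0 ?invr_ge0 ?ltW ?exprn_gt0.
by rewrite ler_sqr ?nnegrE ?normr_ge0// ltW.
Qed.

Section smooth_functions.
Context {R : realType} {I : finType}.
Implicit Types (g h : I -> R -> R) (K : R).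

(** A uniform first-order expansion takes the place of differentiability. The three bounds are
    inherited, with the same [K], by averages of translates, without differentiating under an
    integral. *)
Record smooth K g (g' : I -> R -> R) : Prop := Smooth {
  smooth_bound : forall i x, `|g i x| <= K;
  smooth_bound' : forall i x, `|g' i x| <= K;
  smooth_taylor : forall i x y, `|g i (x + y) - g i x - g' i x * y| <= K * y ^+ 2 }.

Section one.
Variables (K : R) (g g' : I -> R -> R).
Hypothesis sg : smooth K g g'.

Lemma smooth_ge0 (i : I) : 0 <= K.
Proof. exact: le_trans (smooth_bound sg i 0). Qed.

Lemma smooth_lip (i : I) (x y : R) : `|g i (x + y) - g i x| <= 2 * K * `|y|.
Proof.
have K0 := smooth_ge0 i.
have [y1|y1] := leP `|y| 1.
  have -> : g i (x + y) - g i x = (g i (x + y) - g i x - g' i x * y) + g' i x * y by ring.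
  apply: (le_trans (ler_normD _ _)).
  have h1 := smooth_taylor sg i x y.
  have h2 : `|g' i x * y| <= K * `|y| by rewrite normrM ler_wpM2r// (smooth_bound' sg).
  have h3 : K * y ^+ 2 <= K * `|y| by rewrite ler_wpM2l// -(real_normK (num_real y)) expr2 ler_piMr.
  lra.
have h1 : `|g i (x + y) - g i x| <= 2 * K.
  apply: (le_trans (ler_normB _ _)); have := smooth_bound sg i (x + y); have := smooth_bound sg i x; lra.
apply: (le_trans h1); rewrite ler_peMr ?mulr_ge0//; exact: ltW.
Qed.

(** The remainders of the expansions from [x] to [x + y] and back add up to exactly
    [(g' i (x + y) - g' i x) * y]. *)
Lemma smooth_lip' (i : I) (x y : R) : `|g' i (x + y) - g' i x| <= 2 * K * `|y|.
Proof.
have K0 := smooth_ge0 i.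
have [->|y0] := eqVneq y 0; first by rewrite addr0 subrr normr0 mulr0.
rewrite -(@ler_pM2r _ `|y|) ?normr_gt0// -normrM -(mulrA (2 * K)).
rewrite (_ : `|y| * `|y| = y ^+ 2); last by rewrite -expr2 real_normK ?num_real.
have h1 := smooth_taylor sg i x y; have h2 := smooth_taylor sg i (x + y) (- y).
rewrite addrK sqrrN in h2.
have -> : (g' i (x + y) - g' i x) * y =
  (g i (x + y) - g i x - g' i x * y) + (g i x - g i (x + y) - g' i (x + y) * - y) by ring.
by apply: (le_trans (ler_normD _ _)); lra.
Qed.

Lemma lip_continuous (f : R -> R) L : 0 <= L -> (forall x y, `|f (x + y) - f x| <= L * `|y|) -> continuous f.
Proof.
move=> L0 H; apply: (@lipschitz_sqr_continuous _ _ (L ^+ 2)) => x y.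
rewrite -[(x - y) ^+ 2]real_normK ?num_real// -exprMn lerXn2r ?nnegrE ?mulr_ge0//.
by have := H y (x - y); rewrite [y + _]addrC subrK.
Qed.

Lemma smooth_measurable i : measurable_fun setT (g i).
Proof.
apply: continuous_measurable_fun; apply: (@lip_continuous _ (2 * K)); last exact: smooth_lip.
by rewrite mulr_ge0// (smooth_ge0 i).
Qed.

Lemma smooth_measurable' i : measurable_fun setT (g' i).
Proof.
apply: continuous_measurable_fun; apply: (@lip_continuous _ (2 * K)); last exact: smooth_lip'.
by rewrite mulr_ge0// (smooth_ge0 i).
Qed.

End one.

(** The remainder of the product splits into three: the two Taylor remainders contribute [K1 * K2]
    each, and the product of two first-order increments contributes twice that, which makes 4. *)
Lemma smoothM K1 K2 g (g' : I -> R -> R) h (h' : I -> R -> R) : smooth K1 g g' -> smooth K2 h h' ->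
  smooth (4 * (K1 * K2)) (fun i x => g i x * h i x) (fun i x => g' i x * h i x + g i x * h' i x).
Proof.
move=> sg sh; split=> i x.
- have k1 := smooth_ge0 sg i; have k2 := smooth_ge0 sh i; have k12 := mulr_ge0 k1 k2.
  have := ler_pM (normr_ge0 _) (normr_ge0 _) (smooth_bound sg i x) (smooth_bound sh i x).
  by rewrite normrM; lra.
- have k1 := smooth_ge0 sg i; have k2 := smooth_ge0 sh i; have k12 := mulr_ge0 k1 k2.
  have h1 := ler_pM (normr_ge0 _) (normr_ge0 _) (smooth_bound' sg i x) (smooth_bound sh i x).
  have h2 := ler_pM (normr_ge0 _) (normr_ge0 _) (smooth_bound sg i x) (smooth_bound' sh i x).
  by apply: (le_trans (ler_normD _ _)); rewrite !normrM; lra.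
- move=> y; have -> : g i (x + y) * h i (x + y) - g i x * h i x - (g' i x * h i x + g i x * h' i x) * y =
     (g i (x + y) - g i x - g' i x * y) * h i (x + y) + g' i x * y * (h i (x + y) - h i x) +
     g i x * (h i (x + y) - h i x - h' i x * y) by ring.
  have h1 := ler_pM (normr_ge0 _) (normr_ge0 _) (smooth_taylor sg i x y) (smooth_bound sh i (x + y)).
  have h2 := ler_pM (normr_ge0 _) (normr_ge0 _) (smooth_bound sg i x) (smooth_taylor sh i x y).
  have h3 : `|g' i x * y| <= K1 * `|y| by rewrite normrM ler_wpM2r// (smooth_bound' sg).
  have h4 := ler_pM (normr_ge0 _) (normr_ge0 _) h3 (smooth_lip sh i x y).
  have y2 : `|y| * `|y| = y ^+ 2 by rewrite -expr2 real_normK// num_real.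
  have e4 : K1 * `|y| * (2 * K2 * `|y|) = 2 * K1 * K2 * (`|y| * `|y|) by ring.
  rewrite e4 y2 in h4.
  apply: (le_trans (ler_normD _ _)); rewrite [X in _ + X]normrM.
  apply: (le_trans (lerD (ler_normD _ _) (lexx _))); rewrite ![`|_ * _|]normrM in h4 *.
  lra.
Qed.

End smooth_functions.

(** * Smooth approximations of half-line indicators *)

Section cutoff.
Context {R : realType}.
Implicit Types x y : R.

(** Continuously differentiable across 0, with a quadratic Taylor remainder. Rescaled around [a] it
    tends to the indicator of the ray above [a], and rays generate the Borel sets. *)
Definition cutoff x : R := if 0 < x then x ^+ 2 / (1 + x ^+ 2) else 0.
Definition cutoff' x : R := if 0 < x then 2 * x / (1 + x ^+ 2) ^+ 2 else 0.

Let D0 x : 0 < 1 + x ^+ 2. Proof. by rewrite ltr_pwDl// sqr_ge0. Qed.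
Let D1 x : 1 <= 1 + x ^+ 2. Proof. by rewrite lerDl sqr_ge0. Qed.

Let D2 x : 1 + x ^+ 2 <= (1 + x ^+ 2) ^+ 2.
Proof. by rewrite [leRHS]expr2 ler_peMl ?D1// ltW. Qed.

Lemma cutoff_ge0 x : 0 <= cutoff x.
Proof. by rewrite /cutoff; case: ifP => // _; rewrite divr_ge0 ?sqr_ge0// ltW. Qed.

Lemma cutoff_le1 x : cutoff x <= 1.
Proof. by rewrite /cutoff; case: ifP => // _; rewrite ler_pdivrMr// mul1r lerDr. Qed.

Lemma cutoff'_ge0 x : 0 <= cutoff' x.
Proof. by rewrite /cutoff'; case: ifP => // x0; rewrite divr_ge0 ?mulr_ge0 ?sqr_ge0// ltW. Qed.

Lemma cutoff'_le x : 0 < x -> cutoff' x <= 2 * x.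
Proof.
move=> x0; rewrite /cutoff' x0 ler_pdivrMr ?exprn_gt0//.
by rewrite ler_peMr ?mulr_ge0 ?(ltW x0)// exprn_ege1.
Qed.

Lemma cutoff'_le1 x : cutoff' x <= 1.
Proof.
rewrite /cutoff'; case: ifP => // x0; rewrite ler_pdivrMr ?exprn_gt0// mul1r.
have h : 2 * x <= 1 + x ^+ 2 by have := sqr_ge0 (x - 1); rewrite sqrrB; lra.
exact: (le_trans h).
Qed.

Lemma cutoff_le_sqr x : cutoff x <= x ^+ 2.
Proof.
rewrite /cutoff; case: ifP => [x0|_]; last exact: sqr_ge0.
by rewrite ler_pdivrMr// ler_peMr ?sqr_ge0.
Qed.

(** Split according to the signs of [x] and [x + y]. For [x > 0 >= x + y] the value at [x] is at
    most [y^2] and the linear term at most [2 y^2], whence 3; when both points are positive the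
    remainder is an explicit multiple of [y^2]. *)
Lemma cutoff_taylor x y : `|cutoff (x + y) - cutoff x - cutoff' x * y| <= 3 * y ^+ 2.
Proof.
have y20 := sqr_ge0 y.
have [x0|x0] := ltP 0 x; last first.
  rewrite {2}/cutoff /cutoff' !ltNge x0 /= mul0r !subr0 ger0_norm ?cutoff_ge0//.
  rewrite /cutoff; case: ifP => xy; last by rewrite mulr_ge0.
  have : (x + y) ^+ 2 / (1 + (x + y) ^+ 2) <= (x + y) ^+ 2 by rewrite ler_pdivrMr// ler_peMr ?sqr_ge0.
  have : (x + y) ^+ 2 <= y ^+ 2 by rewrite ler_sqr ?nnegrE; lra.
  lra.
have [xy|xy] := ltP 0 (x + y); last first.
  rewrite {1}/cutoff ltNge xy /= sub0r -opprD normrN.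
  have h0 := cutoff_le_sqr x; have h1 := cutoff'_le x0; have h2 := cutoff_ge0 x; have h3 := cutoff'_ge0 x.
  have hy : x <= - y by lra.
  have h4 : x ^+ 2 <= y ^+ 2 by rewrite -[y ^+ 2]sqrrN ler_sqr ?nnegrE; lra.
  apply: (le_trans (ler_normD _ _)); rewrite normrM (ger0_norm h2) (ger0_norm h3).
  rewrite ler0_norm; last by lra.
  have : cutoff' x * - y <= 2 * x * - y by apply: ler_wpM2r => //; lra.
  have : x * - y <= - y * - y by apply: ler_wpM2r => //; lra.
  by rewrite expr2 in h4 *; rewrite expr2; lra.
rewrite /cutoff /cutoff' x0 xy; set b := x + y.
have yE : y = b - x by rewrite /b; ring.
have a0 := D0 x; have b0 := D0 b.
have -> : b ^+ 2 / (1 + b ^+ 2) - x ^+ 2 / (1 + x ^+ 2) - 2 * x / (1 + x ^+ 2) ^+ 2 * y =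
   (1 - x ^+ 2 - 2 * x * b) / ((1 + x ^+ 2) ^+ 2 * (1 + b ^+ 2)) * y ^+ 2.
  by rewrite yE; field; rewrite !gt_eqF.
rewrite normrM (ger0_norm y20) ler_wpM2r//.
rewrite normrM [X in _ * X]gtr0_norm ?invr_gt0 ?mulr_gt0 ?exprn_gt0//.
rewrite ler_pdivrMr ?mulr_gt0 ?exprn_gt0//.
have bp : 0 <= 2 * x * b by rewrite !mulr_ge0// ltW.
have l1 : 2 * x * b <= x ^+ 2 + b ^+ 2 by have := sqr_ge0 (x - b); rewrite sqrrB; lra.
have l2 := D2 x.
have l3 : (1 + x ^+ 2) * (1 + b ^+ 2) <= (1 + x ^+ 2) ^+ 2 * (1 + b ^+ 2).
  by rewrite ler_wpM2r// ltW.
have l4 : (1 + x ^+ 2) * (1 + b ^+ 2) = 1 + x ^+ 2 + b ^+ 2 + (x * b) ^+ 2 by ring.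
have := sqr_ge0 (x * b); have := sqr_ge0 x; have := sqr_ge0 b.
move=> b2 x2 xb2; rewrite ler_norml; apply/andP; split; lra.
Qed.

Lemma cutoff_smooth (I : finType) (n : nat) a :
  smooth (3 * n.+1%:R ^+ 2) (fun (_ : I) x => cutoff (n.+1%:R * (x - a)))
     (fun _ x => n.+1%:R * cutoff' (n.+1%:R * (x - a))).
Proof.
have n1 : 1 <= n.+1%:R :> R by rewrite ler1n.
have n2 : n.+1%:R <= n.+1%:R ^+ 2 :> R by rewrite expr2 ler_peMl.
split=> _ x.
- rewrite ger0_norm ?cutoff_ge0//; have := cutoff_le1 (n.+1%:R * (x - a)); lra.
- rewrite ger0_norm ?mulr_ge0 ?cutoff'_ge0//.
  have : n.+1%:R * cutoff' (n.+1%:R * (x - a)) <= n.+1%:R by rewrite ler_piMr// cutoff'_le1.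
  lra.
- move=> y; have := cutoff_taylor (n.+1%:R * (x - a)) (n.+1%:R * y).
  rewrite -mulrDr (_ : x - a + y = x + y - a); last by ring.
  rewrite (_ : n.+1%:R * cutoff' (n.+1%:R * (x - a)) * y = cutoff' (n.+1%:R * (x - a)) * (n.+1%:R * y)); last by ring.
  by rewrite -mulrA -exprMn.
Qed.

Lemma cutoff_cvg x a : cutoff (n.+1%:R * (x - a)) @[n --> \oo] --> ((a < x)%R%:R : R).
Proof.
have [ax|xa] := ltP a x; last first.
  rewrite (_ : (fun n => _) = fun=> 0); first exact: cvg_cst.
  apply/funext => n; rewrite /cutoff ltNge (_ : _ <= 0)//.
  by rewrite mulr_ge0_le0// subr_le0.
have xa : 0 < x - a by rewrite subr_gt0.
apply/cvgrPdist_le => e e0; near=> n.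
have z0 : 0 < n.+1%:R * (x - a) by rewrite mulr_gt0.
rewrite /cutoff z0; set z := n.+1%:R * (x - a).
have -> : 1%:R - z ^+ 2 / (1 + z ^+ 2) = (1 + z ^+ 2)^-1 by field; rewrite gt_eqF.
rewrite gtr0_norm ?invr_gt0//.
apply: (@le_trans _ _ z^-1).
  rewrite lef_pV2 ?posrE//; have := sqr_ge0 (z - 1); have := sqr_ge0 z; rewrite sqrrB; lra.
have /ltW h : (x - a)^-1 / n.+1%:R < e.
  by near: n; have := @mesh_small _ 0 ((x - a)^-1) e e0; rewrite subr0.
by rewrite /z invfM mulrC.
Unshelve. all: by end_near.
Qed.

End cutoff.

Section expectations.
Context {R : realType} {d} {Omega : measurableType d}.
Variable P : probability Omega R.
Local Notation E f := (\int[P]_w f w).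

Lemma E_bounded (f : Omega -> R) K : measurable_fun setT f -> (forall w, `|f w| <= K) -> `|E f| <= K.
Proof.
move=> mf fK; apply: (le_trans (le_normr_Rintegral measurableT (bounded_int P mf fK))).
rewrite -[leRHS](E_cst P); apply: le_Rintegral => //.
- exact: integrable_norm (bounded_int P mf fK).
- by apply: (@bounded_int _ _ _ P _ `|K|).
Qed.

End expectations.

Section one_step.
Context {R : realType} {d} {Omega : measurableType d}.
Variables (P : probability Omega R) (T : R) (N : nat) (A : 'M[R]_N) (c : R).
Variables (W : R -> Omega -> R) (X : R -> Omega -> 'cV[R]_N).
Hypotheses (hP : measure_is_complete P) (T0 : 0 < T) (hc : 0 < c < 1)
  (hA : rate_matrix A c) (hW : brownian_motion P T W) (hX : markov_chain P T A X)
  (hWX : independent P (filtrationX P X T) (filtrationW P W T))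
  (hM : square_integrable_martingale P T (filtrationX P X) (chain_martingale A X)).
Variable p : R -> 'M[R]_N.
Hypotheses (tp : transition_function A p)
  (mk : transition_law P T X p).

Local Notation FX := (filtrationX P X).
Local Notation FW := (filtrationW P W).
Local Notation G := (filtrationG P W X).
Local Notation FWX := (FWX P T W X).
Local Notation Mi i := (fun t w => chain_martingale A X t w i 0).
Local Notation ip1 := (ip P setT).
Local Notation sqi1 := (sqi P setT).
Local Notation E f := (\int[P]_w f w).
Implicit Types g : 'I_N -> R -> R.

(** The variable g(X_t, W_t), with one real function per state; the form linear in [X_t] lets
    measurability and expectations be treated term by term. *)
Definition val g t w : R := \sum_j X t w j 0 * g j (W t w).

Lemma val_index g t w a : (forall j, X t w j 0 = (j == a)%:R) -> val g t w = g a (W t w).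
Proof.
move=> Xa; rewrite /val (bigD1 a)//= Xa eqxx mul1r big1 ?addr0// => j ja.
by rewrite Xa (negbTE ja) mul0r.
Qed.

Lemma val_bound g K t w : (forall i x, `|g i x| <= K) -> 0 <= t <= T -> `|val g t w| <= K.
Proof. by move=> gK tT; have [a Xa] := chain_index hX w tT; rewrite (val_index _ Xa). Qed.

Lemma val_mw g t : (forall i, measurable_fun setT (g i)) -> 0 <= t <= T -> measurable_wrt (G t) (val g t).
Proof.
move=> mg tT; have sG := @G_sigma _ _ _ P _ W X t.
apply: mw_sum => // j; apply: mwM => //; first exact: X_adaptedG tT.
by apply: (mw_comp _ (mg j)) => //; exact: W_adaptedG tT.
Qed.

Lemma val_measurable g t : (forall i, measurable_fun setT (g i)) -> 0 <= t <= T ->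
  measurable_fun setT (val g t).
Proof. by move=> mg tT; apply: mw_measurable (val_mw mg tT); apply: (G_sub hP hW hX); case/andP: tT. Qed.

Lemma val_sqi g K t : (forall i, measurable_fun setT (g i)) -> (forall i x, `|g i x| <= K) ->
  0 <= t <= T -> sqi1 (val g t).
Proof.
move=> mg gK tT; apply: (@bounded_sqi _ _ _ P _ K) => [|w]; first exact: val_measurable.
exact: val_bound.
Qed.

Lemma valM g h t w : 0 <= t <= T -> val (fun i x => g i x * h i x) t w = val g t w * val h t w.
Proof. by move=> tT; have [a Xa] := chain_index hX w tT; rewrite !(val_index _ Xa). Qed.

Definition avg s t (f : R -> R) x := E (fun w => f (x + (W t w - W s w))).

Definition trans s t g i x := \sum_j p (t - s) j i * avg s t (g j) x.

Lemma shift_measurable s t (f : R -> R) x : 0 <= s -> s <= t -> t <= T -> measurable_fun setT f ->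
  measurable_fun setT (fun w => f (x + (W t w - W s w))).
Proof.
move=> s0 st tT mf; apply: (measurableT_comp mf); apply: measurable_funD => //.
exact: (dW_measurable hW).
Qed.

Lemma avg_smooth K g g' s t : 0 <= s -> s <= t -> t <= T -> smooth K g g' ->
  smooth K (fun i => avg s t (g i)) (fun i => avg s t (g' i)).
Proof.
move=> s0 st tT sg.
have mg i x := shift_measurable x s0 st tT (smooth_measurable sg i).
have mg' i x := shift_measurable x s0 st tT (smooth_measurable' sg i).
have ig i x := bounded_int P (mg i x) (fun w => smooth_bound sg i _).
have ig' i x := bounded_int P (mg' i x) (fun w => smooth_bound' sg i _).
split=> i x.
- by apply: E_bounded => // w; exact: (smooth_bound sg).
- by apply: E_bounded => // w; exact: (smooth_bound' sg).
- move=> y.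
  have -> : avg s t (g i) (x + y) - avg s t (g i) x - avg s t (g' i) x * y =
    E (fun w => g i (x + (W t w - W s w) + y) - g i (x + (W t w - W s w)) - y * g' i (x + (W t w - W s w))).
    rewrite RintegralB//; last 2 first.
    - by apply: rintegrableB => //; under eq_fun do rewrite addrAC; exact: ig.
    - exact: rintegrableZ.
    rewrite RintegralZl// RintegralB//; last by under eq_fun do rewrite addrAC; exact: ig.
    rewrite /avg [X in _ - X]mulrC; congr (_ - _ - _).
    by apply: eq_Rintegral => w _; rewrite addrAC.
  apply: E_bounded => [|w]; last by rewrite [y * _]mulrC; exact: (smooth_taylor sg).
  apply: measurable_funB; last exact: measurable_funM.
  by apply: measurable_funB => //; under eq_fun do rewrite addrAC; exact: mg.
Qed.

(** Each column of [p] is a probability vector and [avg] is an expectation, so the bounds are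
    averaged with the same [K]. A constant that does not grow is what allows arbitrarily many
    backward steps. *)
Lemma trans_smooth K g g' s t : 0 <= s -> s <= t -> t <= T -> smooth K g g' ->
  smooth K (trans s t g) (trans s t g').
Proof.
move=> s0 st tT sg; have sa := avg_smooth s0 st tT sg.
have [p0 p1 _ _ _] := tp; have ts : 0 <= t - s by rewrite subr_ge0.
have conv (f : 'I_N -> R) i C : (forall j, `|f j| <= C) -> `|\sum_j p (t - s) j i * f j| <= C.
  move=> fC; rewrite -[leRHS]mul1r -(p1 _ i ts) mulr_suml; apply: (le_trans (ler_norm_sum _ _ _)).
  by apply: ler_sum => j _; rewrite normrM ger0_norm ?p0// ler_wpM2l// p0.
split=> i x.
- by apply: conv => j; exact: (smooth_bound sa).
- by apply: conv => j; exact: (smooth_bound' sa).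
- move=> y; rewrite /trans mulr_suml -!sumrB.
  rewrite (eq_bigr (fun j => p (t - s) j i * (avg s t (g j) (x + y) - avg s t (g j) x - avg s t (g' j) x * y))).
    by apply: conv => j; exact: (smooth_taylor sa).
  by move=> j _; ring.
Qed.

(* The conditional expectation of [val g t] given the information at time [u]. *)
Lemma trans_mean K g g' u t D : 0 <= u -> u < t -> t <= T -> smooth K g g' -> G u D ->
  ip1 (\1_D) (val g t) = ip1 (\1_D) (val (trans u t g) u).
Proof.
move=> u0 ut tT sg GD; have uT := le_trans (ltW ut) tT.
have u0T : 0 <= u <= T by rewrite u0.
have t0T : 0 <= t <= T by rewrite tT (le_trans u0 (ltW ut)).
have FD : FWX u D by apply: (@G_FWX _ _ _ P T _ W X u uT).
have mD : measurable D by exact: (FWX_sub hP hW hX uT FD).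
have sF := @FWX_sigma _ _ _ P T _ W X u.
have mF := FWX_sub hP hW hX uT.
(* Freeze the past of [W] together with the whole chain, and average over the increment of [W]
   alone. *)
pose Om := g_sigma_algebraType (FWX u).
have mXt j : measurable_fun [set: Om] (fun w : Om => X t w j 0 : R).
  apply/(mwP _ sF); apply: mwS (@chain_adapted _ _ _ P T _ X j t t0T).
  by apply: subset_trans (@FX_FWX _ _ _ P T _ W X u); exact: aug_mono.
have mWu : measurable_fun [set: Om] (W u : Om -> R).
  by apply/(mwP _ sF); apply: mwS (@W_adaptedG _ _ _ P T _ W X u u0T); exact: (@G_FWX _ _ _ P T _ W X u uT).
have m1D : measurable_fun [set: Om] (\1_D : Om -> R).
  by apply/(mwP _ sF); exact: mw_indic.
pose f (z : Om * R) := \1_D z.1 * \sum_j X t z.1 j 0 * g j (W u z.1 + z.2).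
have mf : measurable_fun setT f.
  apply: measurable_funM; first exact: (measurableT_comp m1D).
  apply: measurable_sum => j; apply: measurable_funM; first exact: (measurableT_comp (mXt j)).
  apply: (measurableT_comp (smooth_measurable sg j)); apply: measurable_funD => //.
  exact: (measurableT_comp mWu).
have fE w y a : (forall j, X t w j 0 = (j == a)%:R) -> f (w, y) = \1_D w * g a (W u w + y).
  move=> Xa; rewrite /f; congr (_ * _); rewrite (bigD1 a)//= Xa eqxx mul1r big1 ?addr0// => j ja.
  by rewrite Xa (negbTE ja) mul0r.
have fK z : `|f z| <= K.
  case: z => w y; have [a Xa] := chain_index hX w t0T; rewrite (fE _ _ _ Xa) normrM -[leRHS]mul1r.
  by rewrite ler_pM// ?indic_norm1// (smooth_bound sg).
have mid : measurable_fun [set: Omega] (id : Omega -> Om).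
  by move=> _ B mB; rewrite setTI; apply: mF; rewrite -[FWX u](sigma_algebra_id sF).
have ind (B : set Om) (C : set R) : measurable B -> measurable C ->
    P ((id : Omega -> Om) @^-1` B `&` (W t \- W u) @^-1` C) =
    (P ((id : Omega -> Om) @^-1` B) * P ((W t \- W u)%R @^-1` C))%E.
  move=> mB mC; rewrite setIC muleC.
  apply: (increment_indep hP hW hX hWX u0 ut tT).
    by exists C => //; rewrite setTI.
  by rewrite -[FWX u](sigma_algebra_id sF).
have := integral_freeze mid (dW_measurable hW u0 (ltW ut) tT) ind mf fK.
have avgE w a : (forall j, X t w j 0 = (j == a)%:R) ->
    \int[P]_w' f (w, (W t \- W u) w') = \1_D w * avg u t (g a) (W u w).
  move=> Xa; transitivity (E (fun w' => \1_D w * g a (W u w + (W t w' - W u w')))).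
    by apply: eq_Rintegral => w' _; rewrite (fE _ _ _ Xa).
  rewrite RintegralZl//; apply: bounded_int; last by move=> w'; exact: (smooth_bound sg).
  exact: shift_measurable (ltW ut) tT (smooth_measurable sg a).
have sa := avg_smooth u0 (ltW ut) tT sg.
have s1D := @indic_sqi _ _ _ P _ mD.
have sX := @chain_sqi _ _ _ P _ _ _ _ hX.
pose eta j w := \1_D w * avg u t (g j) (W u w).
have mG j : measurable_wrt (G u) (eta j).
  apply: mwM; [exact: G_sigma|by apply: mw_indic => //; exact: G_sigma|].
  apply: (mw_comp _ (smooth_measurable sa j)); first exact: G_sigma.
  exact: W_adaptedG u0T.
have bG j w : `|eta j w| <= K.
  by rewrite normrM -[leRHS]mul1r ler_pM// ?indic_norm1// (smooth_bound sa).
have seta j : sqi1 (eta j).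
  by apply: bounded_sqi (bG j); apply: mw_measurable (mG j); exact: (G_sub hP hW hX uT).
have sXX i j : sqi1 (fun w => X u w i 0 * X t w j 0).
  apply: (sqi_mulb measurableT (C := 1)); [exact: (chain_measurable hX)|exact: sX|].
  by move=> w _; exact: (chain_norm1 hX).
move=> freeze; transitivity (E (fun w => f (w, (W t \- W u) w))).
  apply: eq_Rintegral => w _; have [a Xa] := chain_index hX w t0T.
  by rewrite (fE _ _ _ Xa) (val_index _ Xa) /= addrC subrK.
rewrite [LHS]freeze.
transitivity (\sum_j ip1 (eta j) (fun w => X t w j 0)).
  transitivity (E (fun w => \sum_j eta j w * X t w j 0)).
    apply: eq_Rintegral => w _; have [a Xa] := chain_index hX w t0T.
    rewrite (avgE _ _ Xa) (bigD1 a)//= Xa eqxx mulr1 big1 ?addr0// => j ja.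
    by rewrite Xa (negbTE ja) mulr0.
  have s1 : sqi1 (fun=> 1) by exact: cst_sqi.
  rewrite -ip1E ip_sumr//; last first.
    move=> j _; apply: (sqi_mulb measurableT (C := K)) => //; last exact: sX.
    by apply: mw_measurable (mG j); exact: (G_sub hP hW hX uT).
  by apply: eq_bigr => j _; rewrite ip1E.
(* It remains to average over the state at [t], given the past of the chain enlarged by all of
   [W]. *)
transitivity (\sum_j \sum_i p (t - u) j i * ip1 (eta j) (fun w => X u w i 0)).
  apply: eq_bigr => j _.
  transitivity (\sum_i ip1 (eta j) (fun w => X u w i 0 * X t w j 0)).
    rewrite -ip_sumr//; apply: eq_ip => // w _.
    by rewrite -mulr_suml (chain_sum1 hX)// mul1r.
  apply: eq_bigr => i _.
  have mGX : measurable_wrt (FXW P X (FW T) u) (eta j).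
    by apply: mwS (mG j); exact: (@G_FXW _ _ _ P T _ W X u uT).
  exact: (markov_FXW hP hX (@FW_sigma _ _ _ P W T) (FW_sub hP hW (lexx T)) hWX tp mk i j u0 (ltW ut) tT mGX (bG j)).
transitivity (\sum_j \sum_i ip1 (\1_D) (fun w => X u w i 0 * (p (t - u) j i * avg u t (g j) (W u w)))).
  apply: eq_bigr => j _; apply: eq_bigr => i _; rewrite -ipZr//; last exact: sX.
  by apply: eq_Rintegral => w _; rewrite /eta; ring.
have sq i j : sqi1 (fun w => X u w i 0 * (p (t - u) j i * avg u t (g j) (W u w))).
  apply: (sqi_mulb measurableT (C := 1)); [exact: (chain_measurable hX)| |by move=> w _; exact: (chain_norm1 hX)].
  apply: sqiZ => //; apply: (@bounded_sqi _ _ _ P _ K); last by move=> w; exact: (smooth_bound sa).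
  by apply: (measurableT_comp (smooth_measurable sa j)); exact: (W_measurable hW).
rewrite exchange_big /=.
rewrite (_ : val _ u = fun w => \sum_i \sum_j X u w i 0 * (p (t - u) j i * avg u t (g j) (W u w))); last first.
  by apply/funext => w; rewrite /val; apply: eq_bigr => i _; rewrite /trans mulr_sumr.
rewrite ip_sumr//; last by move=> i _; apply: sqi_sum.
by apply: eq_bigr => i _; rewrite ip_sumr.
Qed.

Local Notation noise := (noise A W X).
Local Notation bok := (block_ok T G).
Local Notation bsok := (blocks_ok T G).

(* The error is orthogonal to the past and of squared norm O((t - u)^2), so that
   over a partition with [n] steps the errors add up to O(1 / n). *)
Definition step_error u t g g' w : R := val g t w - val (trans u t g) u w -
  (val g' u w * (W t w - W u w) + \sum_j g j (W u w) * (Mi j t w - Mi j u w)).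

Lemma step_blocks K g g' u t eta C : 0 <= u -> u <= t -> t <= T -> smooth K g g' ->
  measurable_wrt (G u) eta -> (forall w, `|eta w| <= C) ->
  exists2 bs : seq (block (option 'I_N)), bsok bs & forall w, blocks_int noise bs w =
    eta w * (val g' u w * (W t w - W u w) + \sum_j g j (W u w) * (Mi j t w - Mi j u w)).
Proof.
move=> u0 ut tT sg meta etaC; have u0T : 0 <= u <= T by rewrite u0 (le_trans ut).
have sG := @G_sigma _ _ _ P _ W X u.
exists (Block u t None (fun w => eta w * val g' u w) ::
   map (fun j => Block u t (Some j) (fun w => eta w * g j (W u w))) (index_enum 'I_N)).
  split.
    split => //=.
      by apply: mwM => //; apply: val_mw => // i; exact: (smooth_measurable' sg).
    exists (C * K) => w; rewrite normrM ler_pM//; apply: val_bound => // i x; exact: (smooth_bound' sg).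
  apply: blocks_ok_map => j _; split => //=.
    apply: mwM => //; apply: (mw_comp _ (smooth_measurable sg j)) => //.
    exact: W_adaptedG u0T.
  by exists (C * K) => w; rewrite normrM ler_pM// (smooth_bound sg).
move=> w; rewrite /blocks_int big_cons big_map [RHS]mulrDr /block_int /=; congr (_ + _); first by rewrite mulrA.
by rewrite mulr_sumr; apply: eq_bigr => j _; rewrite mulrA.
Qed.

Lemma brownian_step_sqi K g g' u t : 0 <= u -> u <= t -> t <= T -> smooth K g g' ->
  sqi1 (fun w => val g' u w * (W t w - W u w)).
Proof.
move=> u0 ut tT sg; have u0T : 0 <= u <= T by rewrite u0 (le_trans ut).
apply: (sqi_mulb measurableT (C := K)).
- by apply: val_measurable => // i; exact: (smooth_measurable' sg).
- exact: (dW_sqi hW u0 ut tT).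
- by move=> w _; apply: val_bound => // i x; exact: (smooth_bound' sg).
Qed.

Lemma chain_step_sqi K g g' u t j : 0 <= u -> u <= t -> t <= T -> smooth K g g' ->
  sqi1 (fun w => g j (W u w) * (Mi j t w - Mi j u w)).
Proof.
move=> u0 ut tT sg; apply: (sqi_mulb measurableT (C := K)).
- apply: (measurableT_comp (smooth_measurable sg j)); apply: (W_measurable hW).
  by rewrite u0 (le_trans ut).
- exact: (increment_sqi hP hX hM j u0 ut tT).
- by move=> w _; exact: (smooth_bound sg).
Qed.

Lemma smooth_val_sqi K g g' t : smooth K g g' -> 0 <= t <= T -> sqi1 (val g t).
Proof. by move=> sg tT; apply: (val_sqi (smooth_measurable sg) _ tT) => i x; exact: (smooth_bound sg). Qed.

Lemma step_error_sqi K g g' u t : 0 <= u -> u <= t -> t <= T -> smooth K g g' ->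
  sqi1 (step_error u t g g').
Proof.
move=> u0 ut tT sg; have u0T : 0 <= u <= T by rewrite u0 (le_trans ut).
have t0T : 0 <= t <= T by rewrite tT (le_trans u0).
apply: sqiB => //; [apply: sqiB => //|apply: sqiD => //].
- exact: smooth_val_sqi sg _.
- exact: smooth_val_sqi (trans_smooth u0 ut tT sg) _.
- exact: brownian_step_sqi sg.
- by apply: sqi_sum => // j _; exact: chain_step_sqi sg.
Qed.

Lemma noise_mono u r : 0 <= r -> r <= u -> u <= T -> forall i, measurable_wrt (G u) (Mi i r).
Proof.
move=> r0 ru uT i; apply: mwS (@chain_martingale_measurable _ _ _ P T _ A X hM i r _).
  by apply: subset_trans (@FX_G _ _ _ P _ W X u); exact: aug_mono.
by rewrite r0 (le_trans ru).
Qed.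

Lemma step_error_mw K g g' u t : 0 <= u -> u <= t -> t <= T -> smooth K g g' ->
  measurable_wrt (G t) (step_error u t g g').
Proof.
move=> u0 ut tT sg; have u0T : 0 <= u <= T by rewrite u0 (le_trans ut).
have t0T : 0 <= t <= T by rewrite tT (le_trans u0).
have sG := @G_sigma _ _ _ P _ W X t.
have sub := @G_mono _ _ _ P _ W X u t ut.
have st := trans_smooth u0 ut tT sg.
have mWu : measurable_wrt (G t) (W u) by apply: mwS (@W_adaptedG _ _ _ P T _ W X u u0T).
apply: mwB => //; [apply: mwB => //|apply: mwD => //].
- by apply: val_mw => // i; exact: (smooth_measurable sg).
- by apply: (mwS sub); apply: val_mw => // i; exact: (smooth_measurable st).
- apply: mwM => //; first by apply: (mwS sub); apply: val_mw => // i; exact: (smooth_measurable' sg).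
  by apply: mwB => //; exact: (@W_adaptedG _ _ _ P T _ W X t t0T).
- apply: mw_sum => // j; apply: mwM => //; first exact: (mw_comp _ (smooth_measurable sg j)).
  by apply: mwB => //; apply: noise_mono => //; rewrite ?lexx// (le_trans u0).
Qed.

(** [trans] is the conditional mean of [val g t], and the first-order terms are increments of [W]
    and [M] with coefficients known at [u]. *)
Lemma step_error_orth K g g' u t xi : 0 <= u -> u < t -> t <= T -> smooth K g g' ->
  measurable_wrt (G u) xi -> sqi1 xi -> ip1 xi (step_error u t g g') = 0.
Proof.
move=> u0 ut' tT sg mxi sxi; have ut := ltW ut'; have uT := le_trans ut tT.
have u0T : 0 <= u <= T by rewrite u0.
have t0T : 0 <= t <= T by rewrite tT (le_trans u0).
have se := step_error_sqi u0 ut tT sg.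
apply: (@integral_mul_eq0 _ _ _ P (G u)) => //; [exact: G_sigma|exact: (G_sub hP hW hX)|exact: sqi_int| |exact: sqi_integrable].
move=> D GD; have mD : measurable D by exact: (G_sub hP hW hX uT GD).
have s1D := @indic_sqi _ _ _ P _ mD.
have m1D : measurable_wrt (G u) (\1_D : Omega -> R) by apply: mw_indic => //; exact: G_sigma.
have st := trans_smooth u0 ut tT sg.
have sG := @G_sigma _ _ _ P _ W X u.
have s1 := smooth_val_sqi sg t0T; have s2 := smooth_val_sqi st u0T.
have mW : measurable_wrt (G u) (W u) by exact: (@W_adaptedG _ _ _ P T _ W X u u0T).
have s12 : sqi1 (val g t \- val (trans u t g) u) by exact: sqiB.
have s3 := brownian_step_sqi u0 ut tT sg; have s4 j := chain_step_sqi j u0 ut tT sg.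
have s5 : sqi1 (fun w => \sum_j g j (W u w) * (Mi j t w - Mi j u w)) by exact: sqi_sum.
rewrite -[LHS]/(ip1 (\1_D) ((val g t \- val (trans u t g) u) \-
    ((fun w => val g' u w * (W t w - W u w)) \+ (fun w => \sum_j g j (W u w) * (Mi j t w - Mi j u w))))).
rewrite ipBr//; last exact: sqiD.
rewrite ipBr// (trans_mean u0 ut' tT sg GD) subrr sub0r ipDr// ip_sumr//.
have -> : ip1 (\1_D) (fun w => val g' u w * (W t w - W u w)) = 0.
  rewrite -[RHS](@W_martingale _ _ _ P T N A W X hP hW hX hWX u t (fun w => \1_D w * val g' u w))//.
  - by apply: eq_Rintegral => w _; rewrite /= mulrA.
  - apply: (@mwS _ _ _ (G u)); first exact: (@G_FWX _ _ _ P T _ W X u uT).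
    by apply: mwM => //; apply: val_mw => // i; exact: (smooth_measurable' sg).
  - apply: (sqi_mulb measurableT (C := 1)); [exact: measurable_indic| |by move=> w _; exact: indic_norm1].
    by apply: (val_sqi (smooth_measurable' sg) _ u0T) => i x; exact: (smooth_bound' sg).
rewrite add0r big1 ?oppr0// => j _.
rewrite -[RHS](@martingale_FXW _ _ _ P T N A X hP hX hM (FW T) (@FW_sigma _ _ _ P W T)
   (FW_sub hP hW (lexx T)) hWX j u t (fun w => \1_D w * g j (W u w)))//.
- by apply: eq_Rintegral => w _; rewrite /= mulrA.
- apply: (@mwS _ _ _ (G u)); first exact: (@G_FXW _ _ _ P T _ W X u uT).
  by apply: mwM => //; exact: (mw_comp _ (smooth_measurable sg j)).
- apply: (sqi_mulb measurableT (C := 1)); [exact: measurable_indic| |by move=> w _; exact: indic_norm1].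
  apply: (@bounded_sqi _ _ _ P _ K); last by move=> w; exact: (smooth_bound sg).
  by apply: (measurableT_comp (smooth_measurable sg j)); exact: (W_measurable hW).
Qed.

Lemma sqr3 (a b e : R) : (a + b + e) ^+ 2 <= 3 * a ^+ 2 + 3 * b ^+ 2 + 3 * e ^+ 2.
Proof.
have := sqr_ge0 (a - b); have := sqr_ge0 (b - e); have := sqr_ge0 (a - e).
rewrite !sqrrB !sqrrD; lra.
Qed.

(** The error has three parts. The Taylor remainder in the Brownian increment [D] is of order [D^2],
    and the fourth moment of [D] is O(h^2). The change of [g'] at a jump of the chain has square at
    most [4 K^2 J D^2], where the jump indicator [J] is independent of [D], so the mean of [J D^2]
    is [h] times that of [J], again O(h^2). The remaining terms are at most [K2 * h]. The constant
    collects the three through [sqr3]. *)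
Lemma step_error_bound K : 0 <= K -> exists C, 0 <= C /\ exists2 h0, 0 < h0 &
  forall g g' u h, smooth K g g' -> 0 <= u -> 0 < h -> h < h0 -> u + h <= T ->
  ip1 (step_error u (u + h) g g') (step_error u (u + h) g g') <= C * h ^+ 2.
Proof.
move=> K0; have [C1 [C10 [h1 h10 jump]]] := transition_jump tp.
have [C2 [C20 [h2 h20 jumpm]]] := jump_mean hP hX (@FW_sigma _ _ _ P W T) (FW_sub hP hW (lexx T)) hWX tp mk.
pose K2 := K + 2 * K * C1 + N%:R * K * KA A.
have K20 : 0 <= K2 by rewrite !addr_ge0 ?mulr_ge0 ?KA_ge0.
exists (3 * K ^+ 2 * 64 + 3 * (4 * K ^+ 2) * C2 + 3 * K2 ^+ 2); split.
  by rewrite !addr_ge0 ?mulr_ge0 ?sqr_ge0.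
exists (Num.min h1 h2); first by rewrite lt_min h10.
move=> g g' u h sg u0 hp + uhT; rewrite lt_min => /andP[hh1 hh2].
have uuh' : u < u + h by rewrite ltrDl.
have uuh := ltW uuh'.
have uT : 0 <= u <= T by rewrite u0 (le_trans uuh).
have uhT' : 0 <= u + h <= T by rewrite uhT (le_trans u0).
have se := step_error_sqi u0 uuh uhT sg.
pose D w := W (u + h) w - W u w.
pose J w := 1 - \sum_a X u w a 0 * X (u + h) w a 0.
have sD : sqi1 D by exact: (dW_sqi hW u0 uuh uhT).
have hE : u + h - u = h by lra.
have sq := @sqrt_gt0 _ u (u + h) uuh'.
have law := W_law hW u0 uuh' uhT; have mD := dW_measurable hW u0 uuh uhT.
have sD2 : sqi1 (fun w => D w ^+ 2) by exact: (normal_sqi2 sq mD law).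
have D4 : ip1 (fun w => D w ^+ 2) (fun w => D w ^+ 2) <= 64 * h ^+ 2.
  apply: (le_trans (normal_fourth sq mD law)).
  by rewrite ler_wpM2l// hE -[4%N]/(2 * 2)%N exprM sqr_sqrtr// ltW.
have J01 w : J w = 0 \/ J w = 1.
  have [a Xa] := chain_index hX w uT; have [b Xb] := chain_index hX w uhT'.
  rewrite /J (bigD1 a)//= Xa eqxx mul1r Xb big1 ?addr0; last by move=> k ka; rewrite Xa (negbTE ka) mul0r.
  by case: (a == b); [left; rewrite subrr|right; rewrite subr0].
have sX := @chain_sqi _ _ _ P _ _ _ _ hX.
have mJF : measurable_wrt (FX T) J.
  have mX k r : 0 <= r <= T -> measurable_wrt (FX T) (fun w => X r w k 0).
    by move=> rT; apply: mwS (@chain_adapted _ _ _ P T _ X k r rT); apply: aug_mono; case/andP: rT.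
  have sF := @FX_sigma _ _ _ P _ X T.
  apply: mwB => //; first exact: mw_cst.
  by apply: mw_sum => // a; apply: mwM => //; exact: mX.
have mJ : measurable_fun setT J by apply: mw_measurable mJF; exact: (FX_sub hP hX (lexx T)).
have bJ w : `|J w| <= 1 by case: (J01 w) => ->; rewrite ?normr0 ?normr1.
have sJ : sqi1 J by exact: bounded_sqi mJ bJ.
have JD : ip1 J (fun w => D w ^+ 2) = h * E J.
  rewrite -[in RHS]hE -(@W_bracket _ _ _ P T N A W X hP hW hX hWX u (u + h) J 1)//.
  by apply: mwS mJF; exact: FX_FWX.
have EJ : E J <= C2 * h by exact: jumpm.
have iD4 := sqi_integrable measurableT sD2 sD2.
have iJD := sqi_integrable measurableT sJ sD2.
pose b w := 3 * K ^+ 2 * (D w ^+ 2 * D w ^+ 2) + (3 * (4 * K ^+ 2) * (J w * D w ^+ 2) + 3 * K2 ^+ 2 * h ^+ 2).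
have ib0 : P.-integrable setT (EFin \o (fun w => 3 * (4 * K ^+ 2) * (J w * D w ^+ 2) + 3 * K2 ^+ 2 * h ^+ 2)).
  by apply: rintegrableD => //; [exact: rintegrableZ|apply: sqi_int; exact: cst_sqi].
have ib : P.-integrable setT (EFin \o b) by apply: rintegrableD => //; exact: rintegrableZ.
have Eb : E b <= (3 * K ^+ 2 * 64 + 3 * (4 * K ^+ 2) * C2 + 3 * K2 ^+ 2) * h ^+ 2.
  rewrite /b RintegralD//; last exact: rintegrableZ.
  rewrite RintegralD//; [|exact: rintegrableZ|by apply: sqi_int; exact: cst_sqi].
  rewrite E_cst RintegralZl// RintegralZl// -/(ip1 J (fun w => D w ^+ 2)) JD.
  have p1 : 3 * K ^+ 2 * \int[P]_w (D w ^+ 2 * D w ^+ 2) <= 3 * K ^+ 2 * (64 * h ^+ 2).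
    by rewrite ler_wpM2l// mulr_ge0// sqr_ge0.
  have p2 : 3 * (4 * K ^+ 2) * (h * E J) <= 3 * (4 * K ^+ 2) * (h * (C2 * h)).
    by rewrite ler_wpM2l ?mulr_ge0 ?sqr_ge0// ler_wpM2l// ltW.
  by rewrite expr2 in p1 *; lra.
apply: le_trans Eb; apply: le_Rintegral => //; first exact: sqi_integrable.
move=> w _; rewrite -expr2.
have [i Xi] := chain_index hX w uT; have [j Xj] := chain_index hX w uhT'.
set x := W u w; set y := D w.
have Wt : W (u + h) w = x + y by rewrite /x /y /D; ring.
pose dr k := drift A X k u (u + h) w.
have errE : step_error u (u + h) g g' w = (g j (x + y) - g j x - g' j x * y) + (g' j x - g' i x) * y +
   ((g i x - trans u (u + h) g i x) + \sum_k g k x * dr k).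
  rewrite /step_error (val_index _ Xj) !(val_index _ Xi) -/x Wt -/(D w) -/y.
  have -> : \sum_k g k x * (Mi k (u + h) w - Mi k u w) = g j x - g i x - \sum_k g k x * dr k.
    rewrite (eq_bigr (fun k => g k x * (k == j)%:R - g k x * (k == i)%:R - g k x * dr k)); last first.
      by move=> k _; rewrite (martingale_increment T0 hX)// Xi Xj -/(dr k); ring.
    by rewrite !sumrB /= !sum_delta.
  by ring.
have tB : `|g i x - trans u (u + h) g i x| <= (K + 2 * K * C1) * h.
  have [p0 p1 _ _ _] := tp; have hp' := ltW hp.
  have pj := jump h hp hh1 i.
  have aB k : `|avg u (u + h) (g k) x - g k x| <= K * h.
    have mg z := shift_measurable z u0 uuh uhT (smooth_measurable sg k).
    have ig := bounded_int P (mg x) (fun w => smooth_bound sg k _).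
    have iDD := sqi_int sD.
    (* The linear term has mean 0; inserting it exposes the Taylor remainder, whose mean is at most
       [K] times the variance [h]. *)
    have -> : avg u (u + h) (g k) x - g k x = E (fun w => g k (x + D w) - g k x - g' k x * D w).
      have i1 : P.-integrable setT (EFin \o (fun w => g k (x + D w) - g k x)).
        by apply: rintegrableB => //; apply: sqi_int; exact: cst_sqi.
      have i2 : P.-integrable setT (EFin \o (fun w => g' k x * D w)) by exact: rintegrableZ.
      rewrite RintegralB// RintegralZl// RintegralB//; last by apply: sqi_int; exact: cst_sqi.
      by rewrite E_cst (normal_mean sq mD law) mulr0 subr0.
    have VD : E (fun w => D w ^+ 2) = h by rewrite (normal_variance sq mD law) sqr_sqrtr hE// ltW.
    rewrite -VD -RintegralZl//; last exact: sqi_int.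
    have mk1 : measurable_fun setT (fun w => g k (x + D w) - g k x - g' k x * D w).
      by apply: measurable_funB; [exact: measurable_funB|exact: measurable_funM].
    have iT : P.-integrable setT (EFin \o (fun w => g k (x + D w) - g k x - g' k x * D w)).
      apply: rintegrableB => //; last exact: rintegrableZ.
      by apply: rintegrableB => //; apply: sqi_int; exact: cst_sqi.
    apply: (le_trans (le_normr_Rintegral measurableT iT)); apply: le_Rintegral => //.
    - exact: integrable_norm iT.
    - by apply: rintegrableZ => //; exact: sqi_int.
    - by move=> w' _; exact: (smooth_taylor sg).
  have -> : g i x - trans u (u + h) g i x = \sum_k p h k i * (g k x - avg u (u + h) (g k) x) +
      \sum_k p h k i * (g i x - g k x).
    rewrite -big_split /=.
    rewrite (eq_bigr (fun k => p h k i * g i x - p h k i * avg u (u + h) (g k) x)); last first.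
      by move=> k _; ring.
    by rewrite sumrB -mulr_suml p1// mul1r /trans hE.
  apply: (le_trans (ler_normD _ _)); rewrite [leRHS]mulrDl; apply: lerD.
    rewrite -[leRHS]mul1r -(p1 h i hp') mulr_suml; apply: (le_trans (ler_norm_sum _ _ _)).
    by apply: ler_sum => k _; rewrite normrM ger0_norm ?p0// ler_wpM2l ?p0// distrC.
  apply: (@le_trans _ _ (\sum_(k | k != i) p h k i * (2 * K))).
    rewrite (bigD1 i)//= subrr mulr0 add0r; apply: (le_trans (ler_norm_sum _ _ _)).
    apply: ler_sum => k _; rewrite normrM ger0_norm ?p0// ler_wpM2l ?p0//.
    by apply: (le_trans (ler_normB _ _)); have := smooth_bound sg i x; have := smooth_bound sg k x; lra.
  rewrite -mulr_suml (_ : \sum_(k | k != i) p h k i = 1 - p h i i); last first.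
    by rewrite -(p1 h i hp') [in RHS](bigD1 i)//= addrC addrA subrr add0r || (rewrite -(p1 h i hp') [in RHS](bigD1 i)//=; ring).
  have : (1 - p h i i) * (2 * K) <= C1 * h * (2 * K) by rewrite ler_wpM2r// mulr_ge0.
  lra.
have dB : `|\sum_k g k x * dr k| <= N%:R * K * KA A * h.
  apply: (le_trans (ler_norm_sum _ _ _)); apply: (@le_trans _ _ (\sum_(k < N) K * (KA A * h))).
    apply: ler_sum => k _; rewrite normrM ler_pM// ?(smooth_bound sg)//.
    by have := drift_bound T0 hX k w u0 uuh uhT; rewrite hE.
  by rewrite sumr_const card_ord -mulr_natr; lra.
rewrite errE; apply: (le_trans (sqr3 _ _ _)); rewrite /b -/y -addrA.
have y20 := sqr_ge0 y.
have nsq (a e : R) : `|a| <= e -> a ^+ 2 <= e ^+ 2.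
  move=> ae; rewrite -real_normK ?num_real// ler_sqr ?nnegrE//; exact: le_trans ae.
apply: lerD; last apply: lerD.
- have := nsq _ _ (smooth_taylor sg j x y); rewrite exprMn => h3.
  by rewrite -mulrA ler_wpM2l// -[X in _ * X]expr2.
- have [J0|J1] := J01 w.
    rewrite J0 mul0r mulr0.
    have ij : i = j.
      apply/eqP; rewrite -[_ == _]negbK; apply/negP => ij.
      move: J0; rewrite /J (bigD1 i)//= Xi eqxx mul1r Xj (negbTE ij) big1 ?addr0.
        by rewrite subr0 => /eqP; rewrite oner_eq0.
      by move=> k ki; rewrite Xi (negbTE ki) mul0r.
    by rewrite ij subrr mul0r expr0n mulr0.
  rewrite J1 mul1r exprMn -[leRHS]mulrA ler_wpM2l// ler_wpM2r//.
  have -> : 4 * K ^+ 2 = (2 * K) ^+ 2 by ring.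
  apply: nsq; apply: (le_trans (ler_normB _ _)).
  by have := smooth_bound' sg i x; have := smooth_bound' sg j x; lra.
- rewrite -mulrA ler_wpM2l// -exprMn; apply: nsq; apply: (le_trans (ler_normD _ _)).
  by apply: (le_trans (lerD tB dB)); rewrite /K2; lra.
Qed.

(** Induction backwards in time: the last step replaces [g] by [trans u (u + h) g], smooth with the
    same [K]. Its error is orthogonal to everything measurable at [u], in particular to the
    accumulated remainder [r], so the squared norms add without cross terms. *)
Lemma steps K s eta C C1 h0 h : 0 <= K -> 0 <= s -> measurable_wrt (G s) eta -> 0 <= C ->
  (forall w, `|eta w| <= C) -> 0 < h -> h < h0 ->
  (forall g g' u h, smooth K g g' -> 0 <= u -> 0 < h -> h < h0 -> u + h <= T ->
     ip1 (step_error u (u + h) g g') (step_error u (u + h) g g') <= C1 * h ^+ 2) ->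
  forall (m : nat) g g', smooth K g g' -> s + m%:R * h <= T ->
  exists g0 g0' bs r, [/\ smooth K g0 g0', bsok bs,
    measurable_wrt (G (s + m%:R * h)) r /\ sqi1 r, ip1 r r <= m%:R * (C ^+ 2 * (C1 * h ^+ 2)) &
    forall w, eta w * val g (s + m%:R * h) w = eta w * val g0 s w + blocks_int noise bs w + r w].
Proof.
move=> K0 s0 meta C0 etaC hp hh0 bound; elim => [|m IH] g g' sg smT.
  exists g, g', [::], (fun=> 0); split => //.
  - by split; [apply: mw_cst; exact: G_sigma|exact: sqi0].
  - by rewrite mul0r ip_zerol.
  - by move=> w; rewrite mul0r addr0 /blocks_int big_nil !addr0.
set u := s + m%:R * h; have hE : s + m.+1%:R * h = u + h by rewrite /u -natr1; ring.
rewrite hE in smT *.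
have u0 : 0 <= u by rewrite addr_ge0// mulr_ge0// ltW.
have su : s <= u by rewrite lerDl mulr_ge0// ltW.
have uuh' : u < u + h by rewrite ltrDl.
have uuh := ltW uuh'; have uT := le_trans uuh smT.
have st := trans_smooth u0 uuh smT sg.
have [g0 [g0' [bs [r [sg0 okbs [mr sr] ipr rE]]]]] := IH _ _ st uT.
have metau : measurable_wrt (G u) eta by apply: mwS meta; exact: G_mono.
have [bs' okbs' bsE'] := step_blocks u0 uuh smT sg metau etaC.
pose er := step_error u (u + h) g g'.
have ser : sqi1 er by exact: (step_error_sqi u0 uuh smT sg).
have metam : measurable_fun setT eta by apply: mw_measurable metau; exact: (G_sub hP hW hX).
have seer : sqi1 (fun w => eta w * er w) by apply: (sqi_mulb measurableT (C := C)).
have sG := @G_sigma _ _ _ P _ W X (u + h).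
have sub := @G_mono _ _ _ P _ W X u (u + h) uuh.
exists g0, g0', (bs' ++ bs), ((fun w => eta w * er w) \+ r); split => //.
- exact: blocks_ok_cat.
- split; last exact: sqiD.
  apply: mwD => //; last exact: mwS mr.
  by apply: mwM => //; [exact: mwS metau|exact: (step_error_mw u0 uuh smT sg)].
- rewrite ipDD// (_ : ip1 (fun w => eta w * er w) r = 0); last first.
    rewrite -[RHS](step_error_orth (xi := fun w => eta w * r w) u0 uuh' smT sg)//.
    + by apply: eq_Rintegral => w _; rewrite -/er; ring.
    + by apply: mwM => //; exact: G_sigma.
    + by apply: (sqi_mulb measurableT (C := C)).
  rewrite mulr0 addr0 -natr1 mulrDl mul1r addrC; apply: lerD => //.
  apply: (le_trans (ip_mulb measurableT metam ser (fun w _ => etaC w))).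
  by rewrite ler_wpM2l ?sqr_ge0//; exact: bound.
- move=> w; rewrite blocks_int_cat /= bsE'.
  have ab (e V V0 Vt S b r' : R) : e * Vt = e * V0 + b + r' ->
      e * V = e * V0 + (e * S + b) + (e * (V - Vt - S) + r').
    by move=> H; rewrite !mulrBr H; ring.
  exact: ab (rE w).
Qed.

(** With [n.+1] steps of length [h] the squared errors total at most [(t - s) * C^2 * C1 * h], which
    a fine partition brings below [e]. *)
Lemma step K g g' s t eta C e : 0 <= s -> s <= t -> t <= T -> smooth K g g' ->
  measurable_wrt (G s) eta -> (forall w, `|eta w| <= C) -> 0 < e ->
  exists g0 g0' bs r, [/\ smooth K g0 g0', bsok bs, sqi1 r, ip1 r r <= e &
    forall w, eta w * val g t w = eta w * val g0 s w + blocks_int noise bs w + r w].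
Proof.
move=> s0; rewrite le_eqVlt => /predU1P[<- _ sg _ _ e0|st tT sg meta etaC e0].
  exists g, g', [::], (fun=> 0); split => //; first exact: sqi0.
    by rewrite ip_zerol ltW.
  by move=> w; rewrite /blocks_int big_nil !addr0.
have [a _] := chain_index hX point (introT andP (conj (lexx 0) (ltW T0))).
have K0 := smooth_ge0 sg a.
have C0 : 0 <= C by apply: le_trans (etaC point).
have [C1 [C10 [h0 h00 bound]]] := step_error_bound K0.
have ts0 : 0 < t - s by rewrite subr_gt0.
have [n hn1 hn2] : exists2 n : nat, (t - s) / n.+1%:R < h0 & (t - s) / n.+1%:R < e / ((t - s) * C ^+ 2 * C1 + 1).
  have den : 0 < (t - s) * C ^+ 2 * C1 + 1 by rewrite ltr_wpDl// !mulr_ge0 ?sqr_ge0// ltW.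
  have H1 := mesh_small s t h00; have H2 := mesh_small s t (divr_gt0 e0 den).
  have [n [n1 n2]] : exists n : nat, (t - s) / n.+1%:R < h0 /\ (t - s) / n.+1%:R < e / ((t - s) * C ^+ 2 * C1 + 1).
    by apply: (@filter_ex _ \oo); near=> n; split; near: n.
  by exists n.
set h := (t - s) / n.+1%:R in hn1 hn2.
have hp : 0 < h by rewrite divr_gt0.
have hnE : n.+1%:R * h = t - s by rewrite mulrC divfK// pnatr_eq0.
have tE : s + n.+1%:R * h = t by rewrite hnE addrC subrK.
have := steps K0 s0 meta C0 etaC hp hn1 bound sg (m := n.+1); rewrite tE => /(_ tT).
move=> [g0 [g0' [bs [r [sg0 okbs [_ sr] ipr rE]]]]].
exists g0, g0', bs, r; split => //; apply: (le_trans ipr).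
have -> : n.+1%:R * (C ^+ 2 * (C1 * h ^+ 2)) = (n.+1%:R * h) * C ^+ 2 * C1 * h by ring.
rewrite hnE.
have q0 : 0 <= (t - s) * C ^+ 2 * C1 by rewrite !mulr_ge0 ?sqr_ge0// ltW.
apply: (@le_trans _ _ (((t - s) * C ^+ 2 * C1 + 1) * h)).
  by rewrite ler_wpM2r ?lerDl// ltW.
by rewrite mulrC -ler_pdivlMr ?ltr_wpDl// ltW.
Unshelve. all: by end_near.
Qed.

End one_step.

(** * Density *)

Section block_scaling.
Context {R : realType} {d} {Omega : measurableType d}.
Variables (T : R) (K : finType) (L : K -> R -> Omega -> R) (G : R -> set (set Omega)).
Hypothesis sG : forall t, sigma_algebra setT (G t).

Lemma blocks_scale_ok (a : R) bs : blocks_ok T (K := K) G bs ->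
  blocks_ok T G (map (block_scale (fun=> a)) bs).
Proof.
elim: bs => //= b bs IH [[lo lohi hi mb [C bC]] okbs]; split; last exact: IH.
split => //=; first by apply: mwM => //; exact: mw_cst.
by exists (`|a| * C) => w; rewrite normrM ler_wpM2l.
Qed.

Lemma blocks_scale_int (a : R) bs w :
  blocks_int L (map (block_scale (fun=> a)) bs) w = a * blocks_int L bs w.
Proof.
rewrite /blocks_int big_map mulr_sumr; apply: eq_bigr => b _.
by rewrite /block_int /= mulrA.
Qed.

End block_scaling.

Lemma cvg_fprod (R : realType) (I : Type) (r : seq I) (u : I -> R^nat) (l : I -> R) :
  (forall i, u i @ \oo --> l i) ->
  (fun n => \prod_(i <- r) u i n) @ \oo --> \prod_(i <- r) l i.
Proof.
move=> ul; elim: r => [|i r IH].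
  rewrite big_nil (_ : (fun n => _) = fun=> 1); first exact: cvg_cst.
  by apply/funext => n; rewrite big_nil.
rewrite big_cons (_ : (fun n => _) = (fun n => u i n * \prod_(j <- r) u j n)).
  exact: cvgM.
by apply/funext => n; rewrite big_cons.
Qed.

Section density.
Context {R : realType} {d} {Omega : measurableType d}.
Variables (P : probability Omega R) (T : R) (N : nat) (A : 'M[R]_N) (c : R).
Variables (W : R -> Omega -> R) (X : R -> Omega -> 'cV[R]_N).
Hypotheses (hP : measure_is_complete P) (T0 : 0 < T) (hc : 0 < c < 1)
  (hA : rate_matrix A c) (hW : brownian_motion P T W) (hX : markov_chain P T A X)
  (hWX : independent P (filtrationX P X T) (filtrationW P W T))
  (hM : square_integrable_martingale P T (filtrationX P X) (chain_martingale A X)).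

Local Notation FX := (filtrationX P X).
Local Notation FW := (filtrationW P W).
Local Notation G := (filtrationG P W X).
Local Notation ip1 := (ip P setT).
Local Notation sqi1 := (sqi P setT).
Local Notation bsok := (blocks_ok T G).
Local Notation I bs := (blocks_int (noise A W X) bs).
Local Notation val := (val W X).

Let itg := noise_integrator hP T0 hc hA hW hX hWX hM.
Let sG t := @G_sigma _ _ _ P _ W X t.

(** Representation up to an arbitrary error: this class is readily closed under L^2 limits, and
    exact integrands are produced only once, later, by completeness. *)
Definition representable xi := sqi1 xi /\ forall e, 0 < e -> exists xi0 bs,
  [/\ measurable_wrt (G 0) xi0, sqi1 xi0, bsok bs &
      ip1 (xi \- (xi0 \+ I bs)) (xi \- (xi0 \+ I bs)) <= e].

Lemma I_sqi bs : bsok bs -> sqi1 (I bs).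
Proof. exact: (blocks_int_sqi itg). Qed.

Lemma representable_approx xi : sqi1 xi -> (forall e, 0 < e -> exists xi' bs,
  [/\ representable xi', bsok bs & ip1 (xi \- (xi' \+ I bs)) (xi \- (xi' \+ I bs)) <= e]) ->
  representable xi.
Proof.
move=> sxi H; split => // e e0; have e4 : 0 < e / 4 by rewrite divr_gt0.
have [xi' [bs [[sxi' rxi'] okbs h1]]] := H _ e4.
have [xi0 [bs' [m0 s0 okbs' h2]]] := rxi' _ e4.
exists xi0, (bs ++ bs'); split => //; first exact: blocks_ok_cat.
have s1 := I_sqi okbs; have s2 := I_sqi okbs'.
rewrite (_ : xi \- _ = (xi \- (xi' \+ I bs)) \+ (xi' \- (xi0 \+ I bs'))); last first.
  by apply/funext => w; rewrite blocks_int_cat /=; ring.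
apply: (le_trans (ip_le2 measurableT _ _)).
- by apply: sqiB => //; exact: sqiD.
- by apply: sqiB => //; exact: sqiD.
- lra.
Qed.

Lemma representable0 xi : measurable_wrt (G 0) xi -> sqi1 xi -> representable xi.
Proof.
move=> m0 s0; split => // e e0; exists xi, [::]; split => //.
rewrite (_ : _ \- _ = fun=> 0) ?ip_zerol ?ltW//.
by apply/funext => w; rewrite /= /blocks_int big_nil addr0 subrr.
Qed.

Lemma representable_lim fs f : (forall n, representable (fs n)) -> sqi1 f ->
  l2cvg P setT fs f -> representable f.
Proof.
move=> rfs sf cf; apply: representable_approx => // e e0.
have [n hn] : exists n, ip1 (fs n \- f) (fs n \- f) <= e.
  move/cvgrPdist_le : cf => /(_ _ e0)[n _ H]; exists n; have := H n (leqnn n).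
  by rewrite sub0r normrN ger0_norm ?ip_ge0.
exists (fs n), [::]; split => //.
rewrite (_ : _ \- _ = fun w => - (fs n \- f) w); last first.
  by apply/funext => w; rewrite /= /blocks_int big_nil addr0 opprB.
have sn : sqi1 (fs n \- f) by apply: sqiB => //; exact: (rfs n).1.
by rewrite ipNl ?(ipC _ _ _ (fun w => - _)) ?ipNl ?opprK//; exact: sqiN.
Qed.

Lemma representableD f g : representable f -> representable g -> representable (f \+ g).
Proof.
move=> [sf rf] [sg rg]; split; first exact: sqiD.
move=> e e0; have e4 : 0 < e / 4 by rewrite divr_gt0.
have [f0 [bs [m0 s0 okbs h1]]] := rf _ e4.
have [g0 [bs' [m0' s0' okbs' h2]]] := rg _ e4.
exists (f0 \+ g0), (bs ++ bs'); split; [exact: mwD|exact: sqiD|exact: blocks_ok_cat|].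
have s1 := I_sqi okbs; have s2 := I_sqi okbs'.
rewrite (_ : f \+ g \- _ = (f \- (f0 \+ I bs)) \+ (g \- (g0 \+ I bs'))); last first.
  by apply/funext => w; rewrite blocks_int_cat /=; ring.
apply: (le_trans (ip_le2 measurableT _ _)).
- by apply: sqiB => //; exact: sqiD.
- by apply: sqiB => //; exact: sqiD.
- lra.
Qed.

Lemma representableZ a f : representable f -> representable (fun w => a * f w).
Proof.
move=> [sf rf]; split; first exact: sqiZ.
move=> e e0; have e4 : 0 < e / (a ^+ 2 + 1) by rewrite divr_gt0// ltr_wpDl// sqr_ge0.
have [f0 [bs [m0 s0 okbs h1]]] := rf _ e4.
exists (fun w => a * f0 w), (map (block_scale (fun=> a)) bs); split.
- by apply: mwM => //; exact: mw_cst.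
- exact: sqiZ.
- exact: blocks_scale_ok.
have s1 := I_sqi okbs.
have s2 : sqi1 (f \- (f0 \+ I bs)) by apply: sqiB => //; exact: sqiD.
rewrite (_ : _ \- _ = (fun w => a * (f \- (f0 \+ I bs)) w)); last first.
  by apply/funext => w; rewrite /= blocks_scale_int; ring.
rewrite ipZl// ?ipZr//; last exact: sqiZ.
rewrite mulrA -expr2; apply: (@le_trans _ _ (a ^+ 2 * (e / (a ^+ 2 + 1)))).
  by rewrite ler_wpM2l// sqr_ge0.
rewrite mulrA ler_pdivrMr ?ltr_wpDl ?sqr_ge0//.
by rewrite [leRHS]mulrC ler_pM2r// lerDl.
Qed.

Lemma representable_ae f g : representable f -> measurable_fun setT g ->
  {ae P, forall w, g w = f w} -> representable g.
Proof.
move=> [sf rf] mg fg; have sg : sqi1 g.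
  by apply: (ae_sqi measurableT mg sf); apply: filterS fg => w + _.
split => // e e0; have [f0 [bs [m0 s0 okbs h1]]] := rf _ e0.
exists f0, bs; split => //; apply: le_trans h1.
have s1 := I_sqi okbs; have sD := sqiD measurableT s0 s1.
have [m1 _] := sqiB measurableT sg sD; have [m2 _] := sqiB measurableT sf sD.
have eq : {ae P, forall w, setT w -> (g \- (f0 \+ I bs)) w = (f \- (f0 \+ I bs)) w}.
  by apply: filterS fg => w /= -> _.
by rewrite (ae_ip measurableT m1 m1 m2 m2 eq eq).
Qed.

Definition smoothable (g : 'I_N -> R -> R) := exists K g', smooth K g g'.

Lemma smoothable_measurable g i : smoothable g -> measurable_fun setT (g i).
Proof. by move=> [K [g' sg]]; exact: (smooth_measurable sg). Qed.

Lemma prod_val_bounded (t : nat -> R) (g : nat -> 'I_N -> R -> R) r :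
  (forall i, 0 <= t i <= T) -> (forall i, smoothable (g i)) ->
  exists C, forall w, `|\prod_(i <- r) val (g i) (t i) w| <= C.
Proof.
move=> tT sg; elim: r => [|i r [C H]]; first by exists 1 => w; rewrite big_nil normr1.
have [K [g' sgi]] := sg i.
exists (K * C) => w; rewrite big_cons normrM ler_pM//.
by apply: (val_bound W hX) => // j x; exact: (smooth_bound sgi).
Qed.

Lemma prod_val_mw (t : nat -> R) (g : nat -> 'I_N -> R -> R) r s : s <= T ->
  (forall i, 0 <= t i <= T) -> (forall i, smoothable (g i)) -> (forall i, i \in r -> t i <= s) ->
  measurable_wrt (G s) (fun w => \prod_(i <- r) val (g i) (t i) w).
Proof.
move=> sT tT sg rs; apply: mw_prod => // i ir.
apply: (@mwS _ _ _ (G (t i))); first by apply: G_mono; exact: rs.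
apply: (@val_mw _ _ _ P T) => // j; exact: smoothable_measurable.
Qed.

(** The times in [r] decrease. The latest factor is expanded from [s] down to the next time [t j],
    the remaining factors being the bounded past coefficient [eta]; the function left over at [t j]
    merges with [g j] into one smooth function. *)
Lemma representable_sorted (t : nat -> R) (g : nat -> 'I_N -> R -> R) r :
  (forall i, 0 <= t i <= T) -> (forall i, smoothable (g i)) ->
  sorted (fun i j => t j <= t i) r -> forall s f, smoothable f -> 0 <= s <= T ->
  (forall i, i \in r -> t i <= s) ->
  representable (fun w => val f s w * \prod_(i <- r) val (g i) (t i) w).
Proof.
have [_ _ _ [p tp mk]] := hX.
move=> tT sg; elim: r => [_|j r IH srt] s f [K [f' sf]] sT0 rs; have /andP[s0 sT] := sT0.
  have sq : sqi1 (fun w => val f s w * \prod_(i <- [::]) val (g i) (t i) w).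
    rewrite (_ : (fun w => _) = val f s); last by apply/funext => w; rewrite big_nil mulr1.
    exact: (smooth_val_sqi hP hW hX sf).
  apply: representable_approx => // e e0.
  have [g0 [g0' [bs [r [sg0 okbs sr ipr rE]]]]] := step hP T0 hW hX hWX hM tp mk
    (lexx 0) s0 sT sf (@mw_cst _ _ _ _ (sG 0) 1) (fun w => lexx `|1|) e0.
  exists (val g0 0), bs; split => //.
    have m0 : measurable_wrt (G 0) (val g0 0).
      by apply: (@val_mw _ _ _ P T); rewrite ?lexx ?(ltW T0)// => i; exact: (smooth_measurable sg0).
    by apply: representable0 => //; apply: (smooth_val_sqi hP hW hX sg0); rewrite lexx ltW.
  rewrite (_ : _ \- _ = r)//; apply/funext => w; rewrite /= big_nil.
  by have := rE w; rewrite !mul1r mulr1 => ->; ring.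
have tjs : t j <= s by apply: rs; rewrite mem_head.
have /andP[tj0 tjT] := tT j.
have rj i : i \in j :: r -> t i <= t j.
  rewrite inE => /predU1P[->//|ir].
  have tr : transitive (fun i j => t j <= t i) by move=> a b e h1 h2; exact: le_trans h1.
  by have /allP/(_ _ ir) := order_path_min tr srt.
have [C HC] := prod_val_bounded (j :: r) tT sg.
have meta := prod_val_mw tjT tT sg rj.
have mprod : measurable_fun setT (fun w => \prod_(i <- j :: r) val (g i) (t i) w).
  by apply: mw_measurable meta; exact: (G_sub hP hW hX).
have sq : sqi1 (fun w => val f s w * \prod_(i <- j :: r) val (g i) (t i) w).
  apply: (sqi_mulb measurableT (C := K)).
  - by case: (smooth_val_sqi hP hW hX sf sT0).
  - exact: bounded_sqi mprod HC.
  - move=> w _; apply: (val_bound W hX); rewrite ?s0// => i x; exact: (smooth_bound sf).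
apply: representable_approx => // e e0.
have [g0 [g0' [bs [r' [sg0 okbs sr ipr rE]]]]] := step hP T0 hW hX hWX hM tp mk
    tj0 tjs sT sf meta HC e0.
exists (fun w => val (fun i x => g0 i x * g j i x) (t j) w * \prod_(i <- r) val (g i) (t i) w), bs; split => //.
  apply: IH => //.
  - exact: path_sorted srt.
  - have [Kj [gj' sgj]] := sg j; exists (4 * (K * Kj)); eexists; exact: smoothM sg0 sgj.
  - by move=> i ir; apply: rj; rewrite inE ir orbT.
rewrite (_ : _ \- _ = r')//; apply/funext => w; rewrite /= (valM W hX)//.
have := rE w; rewrite big_cons.
have ab (v v0 vj pr b rr : R) : vj * pr * v = vj * pr * v0 + b + rr ->
    v * (vj * pr) - (v0 * vj * pr + b) = rr by move=> h; rewrite [v * _]mulrC h; ring.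
exact: ab.
Qed.

Lemma representable_prod (t : nat -> R) (g : nat -> 'I_N -> R -> R) k :
  (forall i, 0 <= t i <= T) -> (forall i, smoothable (g i)) ->
  representable (fun w => \prod_(i < k) val (g i) (t i) w).
Proof.
move=> tT sg; pose le i j := t j <= t i.
have srt : sorted le (sort le (index_iota 0 k)).
  by apply: sort_sorted => i j; exact: le_total.
have E w : \prod_(i < k) val (g i) (t i) w = 1 * \prod_(i <- sort le (index_iota 0 k)) val (g i) (t i) w.
  by rewrite mul1r -(big_mkord xpredT (fun i => val (g i) (t i) w)); apply: perm_big; rewrite perm_sym perm_sort.
have T0' : 0 <= T <= T by rewrite lexx ltW.
(* A constant factor 1 at time [T] starts the induction. *)
rewrite (_ : (fun w => _) = fun w => val (fun _ _ => 1) T w * \prod_(i <- sort le (index_iota 0 k)) val (g i) (t i) w).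
  apply: representable_sorted => //.
  - exists 1, (fun _ _ => 0); split => i x; rewrite ?normr1 ?normr0//.
    by move=> y; rewrite subrr mul0r subr0 normr0 mul1r sqr_ge0.
  - by move=> i _; case/andP: (tT i).
apply/funext => w; rewrite E; congr (_ * _).
have [a Xa] := chain_index hX w T0'; by rewrite (val_index W _ Xa).
Qed.

(** Wide enough for indicators of states and of rays; the common bound 1 dominates products of any
    length. *)
Record limit_class (g : 'I_N -> R -> R) : Prop := LimitClass {
  limit_bound : forall i x, `|g i x| <= 1;
  limit_approx : exists gs : nat -> 'I_N -> R -> R,
    [/\ forall n, smoothable (gs n), forall n i x, `|gs n i x| <= 1 &
        forall i x, (fun n => gs n i x) @ \oo --> g i x] }.

Lemma limit_measurable g i : limit_class g -> measurable_fun setT (g i).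
Proof.
move=> [_ [gs [sgs _ cg]]]; apply: (@measurable_fun_cvg _ _ _ _ (fun n => gs n i)).
  by move=> n; exact: smoothable_measurable.
by move=> x _; exact: cg.
Qed.

Lemma representable_limit (t : nat -> R) (g : nat -> 'I_N -> R -> R) k :
  (forall i, 0 <= t i <= T) -> (forall i, limit_class (g i)) ->
  representable (fun w => \prod_(i < k) val (g i) (t i) w).
Proof.
move=> tT lg.
have [gs Hgs] : exists gs : nat -> nat -> 'I_N -> R -> R, forall i,
   [/\ forall n, smoothable (gs i n), forall n j x, `|gs i n j x| <= 1 &
        forall j x, (fun n => gs i n j x) @ \oo --> g i j x].
  have := fun i => limit_approx (lg i); move/choice => [gs H]; by exists gs.
have b1 (f : nat -> 'I_N -> R -> R) w : (forall i j x, `|f i j x| <= 1) ->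
    `|\prod_(i < k) val (f i) (t i) w| <= 1.
  move=> f1; rewrite normr_prod; apply: prodr_ile1 => i _; rewrite normr_ge0 /=.
  by apply: (val_bound W hX).
have mp (f : nat -> 'I_N -> R -> R) : (forall i j, measurable_fun setT (f i j)) ->
    measurable_fun setT (fun w => \prod_(i < k) val (f i) (t i) w).
  by move=> mf; apply: measurable_prod => i _; exact: (val_measurable hP hW hX).
have rn n : representable (fun w => \prod_(i < k) val (gs i n) (t i) w).
  by apply: (@representable_prod t (fun i => gs i n) k) => // i; have [] := Hgs i.
apply: (representable_lim rn).
  apply: (@bounded_sqi _ _ _ P _ 1).
    by apply: mp => i j; exact: limit_measurable.
  by move=> w; apply: b1 => i j x; exact: limit_bound.
apply: (l2cvg_dominated measurableT (g := fun=> 1)).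
- by move=> n; have [[]] := rn n.
- by apply: mp => i j; exact: limit_measurable.
- exact: cst_sqi.
- apply: aeW => w _.
  apply: (cvg_fprod (u := fun (i : 'I_k) n => val (gs i n) (t i) w)) => i.
  apply: (cvg_finite_sum (u := fun j n => X (t i) w j 0 * gs i n j (W (t i) w))) => j.
  by apply: cvgM; [exact: cvg_cst|have [_ _] := Hgs i; exact].
- by move=> n w _; apply: (b1 (fun i => gs i n)) => i j x; have [] := Hgs i.
Qed.

(** A pi-system of events that generates [G T]. Asking for equality almost surely brings in the
    negligible sets of the augmentation, through a factor 0. *)
Definition elementary B := measurable B /\ exists k (t : nat -> R) (g : nat -> 'I_N -> R -> R),
  [/\ forall i, 0 <= t i <= T, forall i, limit_class (g i) &
      {ae P, forall w, (\1_B w : R) = \prod_(i < k) val (g i) (t i) w}].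

Lemma elementary1 B s g : 0 <= s <= T -> limit_class g -> measurable B ->
  {ae P, forall w, (\1_B w : R) = val g s w} -> elementary B.
Proof.
move=> sT lg mB HB; split => //; exists 1%N, (fun=> s), (fun=> g); split => //.
by apply: filterS HB => w ->; rewrite big_ord_recl big_ord0 mulr1.
Qed.

Lemma elementary_setI : setI_closed elementary.
Proof.
move=> B1 B2 [m1 [k1 [t1 [g1 [tT1 lg1 e1]]]]] [m2 [k2 [t2 [g2 [tT2 lg2 e2]]]]].
split; first exact: measurableI.
exists (k1 + k2)%N, (fun i => if (i < k1)%N then t1 i else t2 (i - k1)%N),
  (fun i => if (i < k1)%N then g1 i else g2 (i - k1)%N).
split; [by move=> i; case: ifP|by move=> i; case: ifP|].
apply: filterS2 e1 e2 => w h1 h2; rewrite indicI /= h1 h2 big_split_ord /=; congr (_ * _).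
  by apply: eq_bigr => i _; rewrite ltn_ord.
by apply: eq_bigr => i _; rewrite ltnNge leq_addr /= addKn.
Qed.

Lemma elementary_representable B : elementary B -> representable (\1_B).
Proof.
move=> [mB [k [t [g [tT lg e]]]]].
by apply: (representable_ae (representable_limit k tT lg)) => //; exact: measurable_indic.
Qed.

Lemma cst_limit_class (f : 'I_N -> R) : (forall i, `|f i| <= 1) -> limit_class (fun i _ => f i).
Proof.
move=> f1; split => //; exists (fun _ i _ => f i); split => //; last by move=> i x; exact: cvg_cst.
move=> _; exists 1, (fun _ _ => 0); split => // i x; rewrite ?normr0//.
by move=> y; rewrite subrr mul0r subr0 normr0 mul1r sqr_ge0.
Qed.

Lemma ray_limit_class a : limit_class (fun _ x => (a < x)%R%:R).
Proof.
split; first by move=> _ x; case: (_ < _); rewrite ?normr1 ?normr0.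
exists (fun n _ x => cutoff (n.+1%:R * (x - a))); split.
- by move=> n; do 2 eexists; exact: cutoff_smooth.
- by move=> n _ x; rewrite ger0_norm ?cutoff_ge0 ?cutoff_le1.
- by move=> _ x; exact: cutoff_cvg.
Qed.

(** An event of the chain at one time depends on its state there, and events of [W] at one time are
    generated by rays. *)
Lemma G_elementary : G T `<=` <<s elementary >>.
Proof.
have sE := smallest_sigma_algebra [set: Omega] elementary.
have neg B : P.-negligible B -> <<s elementary >> B.
  move=> nB; apply: sub_sigma_algebra.
  apply: (@elementary1 B 0 (fun _ _ => 0)); rewrite ?lexx ?(ltW T0)//.
  - by apply: (@cst_limit_class (fun=> 0)) => i; rewrite normr0.
  - exact: hP.
  - have [B' [mB' B'0 BB']] := nB; exists B'; split => // w /= h; apply: BB'.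
    apply: contrapT => nBw; apply: h; rewrite indicE memNset//.
    by apply/esym/big1 => j _; rewrite mulr0.
apply: (smallest_sub sE) => B [].
  apply: (smallest_sub sE) => {}B [/neg//|[s /= + [i _ [C mC <-]]]].
  rewrite in_itv /= => /andP[s0 sT]; have sT' : 0 <= s <= T by rewrite s0.
  apply: sub_sigma_algebra.
  apply: (@elementary1 _ s (fun j _ => \1_C ((j == i)%:R))) => //.
  - by apply: cst_limit_class => j; rewrite indicE; case: (_ \in _); rewrite ?normr1 ?normr0.
  - exact: (chain_measurable hX).
  - apply: aeW => w; have [a Xa] := chain_index hX w sT'.
    rewrite (val_index W _ Xa) !indicE; congr (nat_of_bool _)%:R.
    by rewrite setTI; apply/idP/idP; rewrite !inE /= Xa (eq_sym i).
apply: (smallest_sub sE) => {}B [/neg//|[s /= + [i _ [C mC <-]]]].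
rewrite in_itv /= => /andP[s0 sT]; have sT' : 0 <= s <= T by rewrite s0.
have : measurable_fun [set: g_sigma_algebraType elementary] (W s : g_sigma_algebraType elementary -> R).
  apply: (@measurability _ _ (g_sigma_algebraType elementary) (Rm R) setT (W s) _ (RGenOInfty.measurableE R)) => _ [_ [a ->] <-].
  apply: sub_sigma_algebra; rewrite setTI.
  apply: (@elementary1 _ s (fun _ x => (a < x)%R%:R)) => //.
  - exact: ray_limit_class.
  - by rewrite -[X in measurable X]setTI; exact: (W_measurable hW).
  - apply: aeW => w; have [b Xb] := chain_index hX w sT'.
    rewrite (val_index W _ Xb) indicE; congr (nat_of_bool _)%:R.
    by apply/idP/idP; rewrite inE /= in_itv /= andbT.
by move=> /(_ measurableT C mC).
Qed.

Lemma representable_indic B : G T B -> representable (\1_B).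
Proof.
move=> GB; pose L B := measurable B /\ representable (\1_B).
suff : L B by case.
have LL : lambda_system setT L.
  split => //.
  - split => //; rewrite indicT; apply: representable0; [exact: mw_cst|exact: cst_sqi].
  - move=> B1 B2 sub [m1 r1] [m2 r2]; split; first exact: measurableD.
    rewrite (_ : \1_(B1 `\` B2) = \1_B1 \+ (fun w => (-1) * \1_B2 w)).
      by apply: representableD => //; exact: representableZ.
    apply/funext => x; rewrite /= !indicE in_setD.
    have [xB|xB] := boolP (x \in B2); last by rewrite andbT mulr0 addr0.
    by rewrite (mem_set (sub _ (set_mem xB))) /= mulr1 subrr.
  - move=> F ndF HF; have mF n : measurable (F n) by case: (HF n).
    have mU : measurable (\bigcup_n F n) by exact: bigcupT_measurable.
    split => //; apply: (@representable_lim (fun n => \1_(F n))).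
    + by move=> n; case: (HF n).
    + exact: indic_sqi.
    + apply: (l2cvg_dominated measurableT (g := fun=> 1)).
      * by move=> n; exact: measurable_indic.
      * exact: measurable_indic.
      * exact: cst_sqi.
      * by apply: aeW => w _; exact: cvg_indic_bigcup.
      * by move=> n w _; exact: indic_norm1.
apply: (lambda_system_subset elementary_setI LL) => //.
  by move=> B' eB'; split; [case: eB'|exact: elementary_representable].
exact: G_elementary.
Qed.

Lemma representable_L2 xi : measurable_wrt (G T) xi -> sqi1 xi -> representable xi.
Proof.
move=> mxi sxi; have [fs [sfs bfs cfs]] := mw_approx (sG T) mxi.
have rs f : simple_wrt (G T) f -> representable f.
  elim => [|a B f' GB _ IH]; first by apply: representable0; [exact: mw_cst|exact: sqi0].
  by apply: (@representableD (fun w => a * \1_B w)) => //; apply: representableZ; exact: representable_indic.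
apply: (@representable_lim fs) => //; first by move=> n; exact: rs.
apply: (l2cvg_dominated measurableT (g := fun w => `|xi w|)).
- by move=> n; have [[]] := rs _ (sfs n).
- by case: sxi.
- apply: (sqi_le measurableT _ sxi); last by move=> w _; rewrite normr_id.
  by apply: measurableT_comp => //; case: sxi.
- by apply: aeW => w _; exact: cfs.
- by move=> n w _; exact: bfs.
Qed.

End density.

(** * Cadlag versions of the integrals *)

Section cadlag_functions.
Context {R : realType}.
Variable T : R.
Implicit Types f g : R -> R.

Lemma cadlag_cst (a : R) : cadlag T (fun=> a).
Proof. by split => t _; [exact: cvg_cst|exact: is_cvg_cst]. Qed.

Lemma cadlagD f g : cadlag T f -> cadlag T g -> cadlag T (fun t => f t + g t).
Proof.
move=> [rf lf] [rg lg]; split => t tT; first by apply: cvgD; [exact: rf|exact: rg].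
by apply: is_cvgD; [exact: lf|exact: lg].
Qed.

Lemma cadlagZ a f : cadlag T f -> cadlag T (fun t => a * f t).
Proof.
move=> [rf lf]; split => t tT; first by apply: cvgM; [exact: cvg_cst|exact: rf].
by apply: is_cvgM; [exact: is_cvg_cst|exact: lf].
Qed.

Lemma cadlagB f g : cadlag T f -> cadlag T g -> cadlag T (fun t => f t - g t).
Proof.
move=> cf cg; rewrite (_ : (fun t => _) = fun t => f t + (-1) * g t); last first.
  by apply/funext => t; rewrite mulN1r.
by apply: cadlagD => //; exact: cadlagZ.
Qed.

Lemma cadlag_sum (I : Type) (r : seq I) (F : I -> R -> R) : (forall i, cadlag T (F i)) ->
  cadlag T (fun t => \sum_(i <- r) F i t).
Proof.
move=> cF; elim: r => [|i r IH].
  by under eq_fun do rewrite big_nil; exact: cadlag_cst.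
by under eq_fun do rewrite big_cons; exact: cadlagD.
Qed.

Lemma cadlag_stop f u : cadlag T f -> cadlag T (fun t => f (Num.min u t)).
Proof.
move=> [rf lf]; split => t /andP[t0 tT].
- have [ut|tu] := leP u t.
    apply: cvg_near_cst; near=> s.
    have ts : t < s by near: s; exact: nbhs_right_gt.
    by apply/eqP; rewrite (min_idPl _)// (le_trans ut (ltW ts)).
  apply: (@cvg_trans _ (f s @[s --> t^'+])); last by apply: rf; rewrite t0.
  apply: near_eq_cvg; near=> s.
  have su : s < u by near: s; exact: nbhs_right_lt.
  by rewrite (min_idPr _)// ltW.
- have [tu|ut] := leP t u.
    have /cvg_ex[l fl] := lf t (introT andP (conj t0 tT)).
    apply/cvg_ex; exists l; apply: cvg_trans fl; apply: near_eq_cvg; near=> s.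
    have st : s < t by near: s; exact: nbhs_left_lt.
    by rewrite (min_idPr _)// ltW// (lt_le_trans st).
  apply/cvg_ex; exists (f u); apply: cvg_near_cst; near=> s.
  have us : u < s by near: s; exact: nbhs_left_gt.
  by apply/eqP; rewrite (min_idPl _)// ltW.
Unshelve. all: by end_near.
Qed.

Lemma cadlag_continuous f : {within `[0, T]%classic, continuous f} -> cadlag T f.
Proof.
move=> cf; have [T0|T0] := ltP T 0.
  by split => t /andP[h1 h2]; [have := lt_trans T0 (le_lt_trans h1 h2)|have := lt_trans T0 (lt_le_trans h1 h2)]; rewrite ltxx.
move: T0; rewrite le_eqVlt => /predU1P[T0|T0].
  by split => t; rewrite -T0 => /andP[h1 h2]; [have := le_lt_trans h1 h2|have := lt_le_trans h1 h2]; rewrite ltxx.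
have [cin c0 cT] := (continuous_within_itvP f T0).1 cf.
split => t /andP[t0 tT].
- move: t0; rewrite le_eqVlt => /predU1P[<-//|t0].
  by apply: cvg_at_right_filter; apply: cin; rewrite in_itv /= t0.
- apply/cvg_ex; exists (f t); move: tT; rewrite le_eqVlt => /predU1P[->//|tT].
  by apply: cvg_at_left_filter; apply: cin; rewrite in_itv /= t0.
Qed.

(** A three-epsilon argument; left limits come from the Cauchy criterion, no candidate for the limit
    being at hand. *)
Lemma cadlag_uniform (fs : nat -> R -> R) f : (forall n, cadlag T (fs n)) ->
  (forall e, 0 < e -> exists n, forall t, 0 <= t <= T -> `|fs n t - f t| <= e) -> cadlag T f.
Proof.
move=> cf uf; split => t /andP[t0 tT].
- apply/cvgrPdist_le => e e0; have e3 : 0 < e / 3 by rewrite divr_gt0.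
  have [n Hn] := uf _ e3; have [rn _] := cf n.
  have /cvgrPdist_le/(_ _ e3) rnt := rn t (introT andP (conj t0 tT)).
  near=> s.
  have ts : t < s by near: s; exact: nbhs_right_gt.
  have sT : s < T by near: s; exact: nbhs_right_lt.
  have h1 : `|fs n t - fs n s| <= e / 3 by near: s.
  have h2 := Hn t (introT andP (conj t0 (ltW tT))).
  have h3 := Hn s (introT andP (conj (le_trans t0 (ltW ts)) (ltW sT))).
  have -> : f t - f s = - (fs n t - f t) + (fs n t - fs n s) + (fs n s - f s) by ring.
  apply: (le_trans (ler_normD _ _)); apply: (le_trans (lerD (ler_normD _ _) (lexx _))).
  by rewrite normrN; lra.
- apply: cauchy_cvg; apply: cauchy_exP => e e0; have e3 : 0 < e / 3 by rewrite divr_gt0.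
  have [n Hn] := uf _ e3; have [_ ln] := cf n.
  have /cvg_ex[l /cvgrPdist_le/(_ _ e3) fl] := ln t (introT andP (conj t0 tT)).
  exists l; rewrite /nbhs /=; near=> s.
  have st : s < t by near: s; exact: nbhs_left_lt.
  have s0 : 0 < s by near: s; exact: nbhs_left_gt.
  have h1 : `|l - fs n s| <= e / 3 by near: s.
  have h3 := Hn s (introT andP (conj (ltW s0) (le_trans (ltW st) tT))).
  rewrite /ball /=; have -> : l - f s = (l - fs n s) + (fs n s - f s) by ring.
  by apply: (le_lt_trans (ler_normD _ _)); lra.
Unshelve. all: by end_near.
Qed.

End cadlag_functions.

(** * Maximal inequality and Borel-Cantelli *)

Section kolmogorov.
Context {R : realType} {d} {Omega : measurableType d}.
Variables (P : probability Omega R) (Y : nat -> Omega -> R) (H : nat -> set (set Omega)) (m : nat).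
Hypotheses (sY : forall k, (k <= m)%N -> sqi P setT (Y k))
  (sH : forall k, sigma_algebra setT (H k))
  (mH : forall k l, (k <= l)%N -> (l <= m)%N -> H k `<=` H l)
  (mY : forall k, (k <= m)%N -> measurable_wrt (H k) (Y k))
  (oY : forall k xi, (k <= m)%N -> measurable_wrt (H k) xi -> sqi P setT xi ->
      ip P setT xi (Y m \- Y k) = 0).
Variable lam : R.

Let C k := [set w | `|Y k w| <= lam].
(* [D k] is the indicator of the event that the first [k] values stay within [lam]. *)
Let D k w : R := \prod_(j < k) \1_(C j) w.

Let D01 k w : D k w = 0 \/ D k w = 1.
Proof.
rewrite /D; elim: k => [|k IH]; first by right; rewrite big_ord0.
rewrite big_ord_recr /=; case: IH => ->; first by left; rewrite mul0r.
by rewrite mul1r indicE; case: (_ \in _); [right|left].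
Qed.

Let DS k w : D k.+1 w = D k w * \1_(C k) w.
Proof. by rewrite /D big_ord_recr. Qed.

Let CE k : C k = Y k @^-1` `[- lam, lam]%classic.
Proof. by apply/seteqP; split=> w; rewrite /C /= in_itv /= ler_norml. Qed.

Let mC k : (k <= m)%N -> measurable (C k).
Proof.
move=> km; rewrite CE -[X in measurable X]setTI; have [mYk _] := sY km.
exact: mYk.
Qed.

Let HC k : (k <= m)%N -> H k (C k).
Proof. by move=> km; rewrite CE; exact: mw_preimage (mY km) _. Qed.

Let mwD k : (k <= m)%N -> measurable_wrt (H k) (D k).
Proof.
move=> km; apply: mw_prod => // i _; apply: mw_indic => //.
by apply: (mH (l := k) (ltnW (ltn_ord i)) km); apply: HC; exact: leq_trans (ltnW (ltn_ord i)) km.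
Qed.

Let mD k : (k <= m.+1)%N -> measurable_fun setT (D k).
Proof.
move=> km; apply: measurable_prod => i _; apply: measurable_indic; apply: mC.
by rewrite -ltnS (leq_trans (ltn_ord i)).
Qed.

(** [a k] indicates that [lam] is exceeded for the first time at index [k]. There [lam^2 <= Y_k^2],
    and since [Y_m - Y_k] is orthogonal to [a k] times [Y_k], passing from [Y_k] to [Y_m] can only
    increase the integral. The events are disjoint, so the sum is at most the full squared norm. *)
Lemma kolmogorov_indicator : 0 <= lam ->
  lam ^+ 2 * \int[P]_w (1 - D m.+1 w) <= ip P setT (Y m) (Y m).
Proof.
move=> lam0.
pose a k w := D k w - D k.+1 w.
have a01 k w : a k w = 0 \/ (a k w = 1 /\ lam < `|Y k w|).
  rewrite /a DS; case: (D01 k w) => ->; first by left; rewrite mul0r subrr.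
  rewrite mul1r indicE; have [|] := boolP (w \in C k); first by left; rewrite subrr.
  by rewrite notin_setE /= => /negP; rewrite -ltNge => h; right; rewrite subr0.
have ma k : (k <= m)%N -> measurable_fun setT (a k).
  by move=> km; apply: measurable_funB; apply: mD => //; exact: leqW.
have amw k : (k <= m)%N -> measurable_wrt (H k) (a k).
  move=> km; apply: mwB => //; first exact: mwD.
  rewrite (_ : D k.+1 = fun w => D k w * \1_(C k) w); last by apply/funext => w; exact: DS.
  by apply: mwM => //; [exact: mwD|apply: mw_indic => //; exact: HC].
have ab k w : `|a k w| <= 1 by case: (a01 k w) => [->|[-> _]]; rewrite ?normr0 ?normr1.
have sum_a w : \sum_(k < m.+1) a k w = 1 - D m.+1 w.
  rewrite (eq_bigr (fun k : 'I_m.+1 => - (D k.+1 w - D k w))); last by move=> k _; rewrite opprB.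
  rewrite sumrN -(big_mkord xpredT (fun k => D k.+1 w - D k w)) telescope_sumr//.
  by rewrite opprB /D big_ord0.
have sm := sY (leqnn m).
have saY k l : (k <= m)%N -> (l <= m)%N -> sqi P setT (fun w => a k w * Y l w).
  by move=> km lm; apply: (sqi_mulb measurableT (C := 1)); [exact: ma|exact: sY|move=> w _; exact: ab].
have saI k : (k <= m)%N -> sqi P setT (a k) by move=> km; exact: bounded_sqi (ma k km) (ab k).
have step k : (k <= m)%N -> lam ^+ 2 * \int[P]_w a k w <= ip P setT (fun w => a k w * Y m w) (Y m).
  move=> km; have sk := sY km.
  apply: (@le_trans _ _ (ip P setT (fun w => a k w * Y k w) (Y k))).
    rewrite -RintegralZl//; last by apply: sqi_int; exact: saI.
    apply: le_Rintegral => //.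
    - by apply: rintegrableZ => //; apply: sqi_int; exact: saI.
    - by apply: sqi_integrable => //; exact: saY.
    - move=> w _; case: (a01 k w) => [->|[-> lY]]; first by rewrite mulr0 !mul0r.
      rewrite mulr1 mul1r -expr2 -[leRHS]real_normK ?num_real// ler_sqr ?nnegrE//.
      exact: ltW.
  have sd : sqi P setT (Y m \- Y k) by exact: sqiB.
  have aa w : a k w * a k w = a k w by case: (a01 k w) => [->|[-> _]]; rewrite ?mulr0 ?mulr1.
  have E f g : ip P setT (fun w => a k w * f w) g = ip P setT (fun w => a k w * f w) (fun w => a k w * g w).
    by apply: eq_Rintegral => w _; rewrite mulrACA aa mulrA.
  rewrite [leRHS]E [leLHS]E.
  rewrite (_ : (fun w => a k w * Y m w) = (fun w => a k w * Y k w) \+ (fun w => a k w * (Y m \- Y k) w)); last first.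
    by apply/funext => w /=; ring.
  have s1 := saY k k km km.
  have s2 : sqi P setT (fun w => a k w * (Y m \- Y k) w).
    by apply: (sqi_mulb measurableT (C := 1)); [exact: ma|exact: sd|move=> w _; exact: ab].
  have z : ip P setT (fun w => a k w * Y k w) (fun w => a k w * (Y m \- Y k) w) = 0.
    by rewrite -E; apply: oY => //; apply: mwM => //; [exact: amw|exact: mY].
  rewrite ipDD// z.
  by rewrite mulr0 addr0 lerDl ip_ge0.
have -> : \int[P]_w (1 - D m.+1 w) = \sum_(k < m.+1) \int[P]_w a k w.
  have s1 := @cst_sqi _ _ _ P 1.
  transitivity (ip P setT (fun=> 1) (fun w => \sum_(k < m.+1) a k w)).
    by rewrite ip1E; apply: eq_Rintegral => w _; rewrite sum_a.
  rewrite ip_sumr//; last by move=> k _; apply: saI; rewrite -ltnS.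
  by apply: eq_bigr => k _; rewrite ip1E.
rewrite mulr_sumr; apply: (@le_trans _ _ (\sum_(k < m.+1) ip P setT (fun w => a k w * Y m w) (Y m))).
  by apply: ler_sum => k _; apply: step; rewrite -ltnS.
rewrite -ip_suml//; last by move=> k _; apply: saY => //; rewrite -ltnS.
have sS : sqi P setT (fun w => \sum_(k < m.+1) a k w * Y m w).
  by apply: sqi_sum => // k _; apply: saY => //; rewrite -ltnS.
apply: le_Rintegral => //; [exact: sqi_integrable|exact: sqi_integrable|].
move=> w _; rewrite -mulr_suml sum_a -mulrA -[leRHS]mul1r ler_wpM2r//.
  by rewrite -expr2 sqr_ge0.
by case: (D01 m.+1 w) => ->; lra.
Qed.

Lemma kolmogorov : 0 < lam -> exists B, [/\ measurable B,
  (P B <= (ip P setT (Y m) (Y m) / lam ^+ 2)%:E)%E &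
  forall k w, (k <= m)%N -> lam < `|Y k w| -> B w].
Proof.
move=> lam0; exists [set w | D m.+1 w != 1].
have mB : measurable [set w | D m.+1 w != 1].
  rewrite (_ : [set w | _] = ~` (D m.+1 @^-1` [set 1])); last first.
    by apply/seteqP; split => w /=; [move=> /eqP|move=> h; apply/eqP].
  by apply: measurableC; rewrite -[X in measurable X]setTI; exact: mD.
split => //.
- have -> : P [set w | D m.+1 w != 1] = (\int[P]_w (1 - D m.+1 w))%:E.
    rewrite -[X in P X]setIT -(integral_indic P measurableT)//.
    rewrite /Rintegral fineK; last first.
      apply: integrable_fin_num => //; apply: rintegrableB => //; apply: sqi_int; first exact: cst_sqi.
      by apply: (@bounded_sqi _ _ _ P _ 1); [exact: mD|move=> w; case: (D01 m.+1 w) => ->; rewrite ?normr0 ?normr1].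
    apply: eq_integral => w _; congr (_%:E); rewrite indicE.
    case: (D01 m.+1 w) => e; rewrite e ?subr0 ?subrr.
      by rewrite mem_set//= e eq_sym oner_eq0.
    by rewrite memNset//= e eqxx.
  by rewrite lee_fin ler_pdivlMr ?exprn_gt0// mulrC; apply: kolmogorov_indicator; exact: ltW.
- move=> k w km kY /=; rewrite /D (bigD1 (Ordinal (n := m.+1) (m := k) km))//= indicE memNset; last first.
    by rewrite /C /=; apply/negP; rewrite -ltNge.
  by rewrite mul0r eq_sym oner_eq0.
Qed.

End kolmogorov.

Lemma borel_cantelli_geometric (R : realType) d (Omega : measurableType d)
  (P : probability Omega R) (B : (set Omega)^nat) : (forall n, measurable (B n)) ->
  (forall n, (P (B n) <= ((2^-1) ^+ n)%:E)%E) ->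
  {ae P, forall w, exists n0, forall n, (n0 <= n)%N -> ~ B n w}.
Proof.
move=> mB PB; exists (lim_sup_set B); split.
- by apply: bigcapT_measurable => n; exact: bigcup_measurable.
- apply: lim_sup_set_cvg0 => //.
  apply: (@le_lt_trans _ _ (\sum_(k <oo) ((2^-1 : R) ^+ k)%:E)%E).
    by apply: lee_nneseries => [k _ _|k _]; [exact: measure_ge0|exact: PB].
  rewrite (@cvg_lim _ _ _ _ _ _ 2%:E) ?ltry//.
  rewrite (_ : (fun n => _) = EFin \o series (geometric 1 (2^-1 : R))).
    apply/cvg_EFin; first exact: nearW.
    rewrite [X in _ --> X](_ : _ = 1 * (1 - 2^-1)^-1 :> R); last by field.
    by apply: cvg_geometric_series; rewrite gtr0_norm//; lra.
  apply/funext => n /=; rewrite sumEFin; congr EFin.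
  by apply: eq_bigr => k _; rewrite /geometric /= mul1r.
- move=> w /= nw n _; apply: contrapT => nB; apply: nw; exists n => k nk Bk.
  by apply: nB; exists k.
Qed.

Section complete_integral.
Context {R : realType} {d} {Omega : measurableType d}.
Variables (P : probability Omega R) (T : R) (K M : finType).
Variables (L : K -> R -> Omega -> R) (G : R -> set (set Omega)).
Variable rho : M -> K -> Omega * R -> R.
Hypotheses (itg : integrator P T L G rho) (T0 : 0 < T)
  (GN : forall t, P.-negligible `<=` G t)
  (cadL : {ae P, forall w, forall k, cadlag T (L k ^~ w)}).

Local Notation ip1 := (ip P setT).
Local Notation sqi1 := (sqi P setT).
Local Notation bsok := (blocks_ok T G).
Local Notation I bs := (blocks_int L bs).
Local Notation It t bs := (blocks_int_at L t bs).

Let T0' : 0 <= T <= T. Proof. by rewrite lexx ltW. Qed.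

Lemma blocks_int_at_cadlag bs w : (forall k, cadlag T (L k ^~ w)) -> cadlag T (fun t => It t bs w).
Proof.
move=> cL; under eq_fun do rewrite blocks_int_atE.
apply: cadlag_sum => b; apply: cadlagZ; apply: cadlagB;
  exact: (cadlag_stop (f := L (b_idx b) ^~ w)).
Qed.

Lemma blocks_int_tailE t bs : 0 <= t <= T -> bsok bs ->
  It T bs \- It t bs = I (map (block_tail t) bs).
Proof.
move=> tT okbs; apply/funext => w; rewrite /= (@blocks_int_atT _ _ _ T K L G)//.
by rewrite /blocks_int_at; ring.
Qed.

(** The integral up to [t] and the remaining part are orthogonal; fast convergence at [T] therefore
    passes to every earlier time. *)
Lemma blocks_int_at_le t bs : 0 <= t <= T -> bsok bs ->
  ip1 (It t bs) (It t bs) <= ip1 (I bs) (I bs).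
Proof.
move=> tT okbs; have okt := blocks_tail_ok itg tT okbs.
have s1 := blocks_int_at_sqi itg tT okbs; have s2 := blocks_int_sqi itg okt.
rewrite (_ : I bs = It t bs \+ I (map (block_tail t) bs)); last first.
  by apply/funext => w; rewrite /= /blocks_int_at subrK.
rewrite (ipDD measurableT s1 s2) (blocks_tail_orth itg tT okbs)//; last exact: (blocks_int_at_adapted itg tT okbs).
by rewrite mulr0 addr0 lerDl ip_ge0.
Qed.

(** The inequality holds on each uniform grid, with an exceptional set [B n]. By right-continuity a
    value above [lam] is seen on every sufficiently fine grid. Since these grids are not nested, the
    exceptional set is the lower limit of the [B n], an increasing union of the sets [F m], each of
    which obeys the bound. *)
Lemma blocks_maximal bs lam : bsok bs -> 0 < lam -> exists B, [/\ measurable B,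
  (P B <= (ip1 (I bs) (I bs) / lam ^+ 2)%:E)%E &
  forall w t, (forall k, cadlag T (L k ^~ w)) -> 0 <= t <= T -> lam < `|It t bs w| -> B w].
Proof.
move=> okbs lam0; have T0le := ltW T0.
have pT n k := @part_itv _ T n k T0le.
have grid n : exists B, [/\ measurable B, (P B <= (ip1 (I bs) (I bs) / lam ^+ 2)%:E)%E &
    forall k w, (k <= n.+1)%N -> lam < `|It (part 0 T n k) bs w| -> B w].
  have sY k : (k <= n.+1)%N -> sqi1 (It (part 0 T n k) bs).
    by move=> kn; apply: (blocks_int_at_sqi itg) => //; exact: pT.
  have := @kolmogorov _ _ _ P (fun k => It (part 0 T n k) bs) (fun k => G (part 0 T n k)) n.+1 sY
    (fun k => itg_sigma itg _) _ _ _ lam lam0.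
  rewrite partn (blocks_int_atT L okbs); apply.
  - move=> k l kl ln; apply: (itg_mono itg).
    + by have /andP[] := pT n k (leq_trans kl ln).
    + exact: part_mono.
    + by have /andP[] := pT n l ln.
  - by move=> k kn; apply: (blocks_int_at_adapted itg) => //; exact: pT.
  - move=> k xi kn mxi sxi; rewrite -(blocks_int_atT L okbs) (blocks_int_tailE (pT _ _ kn) okbs).
    by apply: (blocks_tail_orth itg) => //; exact: pT.
have /choice[B HB] := grid.
pose F m := \bigcap_(n in [set n | (m <= n)%N]) B n.
have mF m : measurable (F m).
  apply: bigcap_measurable; first by exists m => /=.
  by move=> n _; have [] := HB n.
have FB m : (P (F m) <= (ip1 (I bs) (I bs) / lam ^+ 2)%:E)%E.
  have [mBm PBm _] := HB m; apply: le_trans PBm; apply: le_measure; rewrite ?inE//.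
  by move=> w Fw; apply: Fw => /=.
exists (\bigcup_m F m); split.
- exact: bigcupT_measurable.
- have ndF : nondecreasing_seq F.
    move=> m n mn; apply/subsetPset => w Fw k /= nk; apply: Fw; exact: leq_trans nk.
  have := @nondecreasing_cvg_mu _ _ _ P F mF (bigcupT_measurable _ mF) ndF.
  move=> cv; rewrite -(cvg_lim _ cv)//; apply: lime_le; first by apply/cvg_ex; eexists; exact: cv.
  by apply: nearW => m; exact: FB.
- move=> w t cL /andP[t0 tT] lt.
  move: tT; rewrite le_eqVlt => /predU1P[tT|tT].
    exists 0%N => // n _; have [_ _ H] := HB n; apply: (H n.+1) => //.
    by rewrite partn -tT.
  have [rc _] := blocks_int_at_cadlag bs cL.
  have cv := cvg_right_step (introT andP (conj t0 tT)) (rc t (introT andP (conj t0 tT))).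
  have [m _ Hm] := cvgr_gt _ (cvg_norm cv) _ lt.
  exists m => // n mn; have := Hm n mn => /=.
  have [k kn [_ ->]] := right_stepE n (introT andP (conj t0 tT)).
  by have [_ _ HBn] := HB n; apply: (HBn k.+1).
Qed.

(* Kolmogorov's inequality and Borel-Cantelli give uniform convergence of the
   elementary integrals along almost every path. *)
Lemma integral_exists (bs : nat -> seq (block K)) : (forall n, bsok (bs n)) ->
  (forall n, ip1 (I (bs n.+1) \- I (bs n)) (I (bs n.+1) \- I (bs n)) <= (8^-1) ^+ n) ->
  exists J : R -> Omega -> R,
  [/\ forall t, 0 <= t <= T -> measurable_wrt (G t) (J t),
      forall w, cadlag T (J ^~ w), forall w, J 0 w = 0 &
      forall t, 0 <= t <= T -> sqi1 (J t) /\ l2cvg P setT (fun n => It t (bs n)) (J t)].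
Proof.
move=> okbs fast.
pose db n := blocks_sub (bs n.+1) (bs n).
have okdb n : bsok (db n) by exact: (blocks_sub_ok itg).
have dbE n t w : It t (db n) w = It t (bs n.+1) w - It t (bs n) w by rewrite blocks_sub_int_at.
(* The level [2^-n] balances size against probability: [8^-n] divided by its square is [2^-n], which
   is summable. *)
have lam0 n : 0 < (2^-1 : R) ^+ n by rewrite exprn_gt0.
have /choice[B HB] := fun n => blocks_maximal (okdb n) (lam0 n).
have PB n : (P (B n) <= ((2^-1) ^+ n)%:E)%E.
  have [_ PBn _] := HB n; apply: (le_trans PBn); rewrite lee_fin blocks_sub_int ler_pdivrMr ?exprn_gt0//.
  apply: (le_trans (fast n)); rewrite -exprM mulnC -exprD -mulSn.
  by rewrite exprM (_ : (2^-1 : R) ^+ 3 = 8^-1)//; field.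
have bc := borel_cantelli_geometric (fun n => let: And3 a _ _ := HB n in a) PB.
(* Outside [good] the integral is set to 0, so that every path is cadlag; the complement is
   negligible, hence in each [G t], and adaptedness is kept. *)
pose good := [set w | (forall k, cadlag T (L k ^~ w)) /\ exists n0, forall n, (n0 <= n)%N -> ~ B n w].
have goodN : P.-negligible (~` good).
  have : {ae P, forall w, good w} by apply: filterS2 cadL bc => w; split.
  by [].
have mgood t : measurable_wrt (G t) (\1_good : Omega -> R).
  apply: mw_indic; first exact: (itg_sigma itg).
  rewrite -[good]setCK; have [_ HD _] := itg_sigma itg t.
  by rewrite -[X in G t X]setTD; apply: HD; exact: GN.
pose J t w := \1_good w * flim (fun n => It t (bs n)) w.
have unif w : good w -> forall e, 0 < e -> exists n, forall t, 0 <= t <= T ->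
    `|It t (bs n) w - J t w| <= e.
  move=> gw; have [cL [n0 Hn0]] := gw; move=> e e0.
  have ct t : 0 <= t <= T -> forall k, (flim (fun n => It t (bs n)) w - It t (bs (k + n0)%N) w) ^+ 2 <= 4 * (4^-1) ^+ k.
    move=> tT; have := @fast_cvg _ (fun k => It t (bs (k + n0)%N) w) 1.
    case=> [k|cu H].
      have nb := Hn0 (k + n0)%N (leq_addl _ _); have [_ _ Hb] := HB (k + n0)%N.
      have le : `|It t (db (k + n0)%N) w| <= (2^-1) ^+ (k + n0).
        by rewrite leNgt; apply/negP => /(Hb w t cL tT).
      rewrite addSn -dbE -real_normK ?num_real//.
      apply: (@le_trans _ _ (4 ^+ k * ((2^-1) ^+ k) ^+ 2)).
        rewrite ler_wpM2l ?exprn_ge0// ler_sqr ?nnegrE ?exprn_ge0//.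
        by apply: (le_trans le); rewrite exprD ler_piMr ?exprn_ge0// exprn_ile1//; lra.
      by rewrite -exprM mulnC exprM -exprMn (_ : 4 * 2^-1 ^+ 2 = 1 :> R) ?expr1n//; field.
    move=> k; have := H k; rewrite mulr1 (_ : limn _ = flim (fun n => It t (bs n)) w)//.
    apply/esym; apply: flimE; rewrite -(cvg_shiftn n0); exact: cu.
  have [k hk] : exists k, 2 * (2^-1 : R) ^+ k <= e.
    have := @cvg_geometric R 2 (2^-1); rewrite gtr0_norm// => /(_ ltac:(lra)).
    by move=> /cvgr0Pnorm_le/(_ _ e0)[k _ Hk]; exists k; have := Hk k (leqnn k); rewrite /geometric /= ger0_norm.
  exists (k + n0)%N => t tT; rewrite /J indicE mem_set// mul1r distrC.
  apply: le_trans hk; rewrite -ler_sqr ?nnegrE ?mulr_ge0// real_normK ?num_real//.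
  apply: (le_trans (ct t tT k)); rewrite exprMn -exprM mulnC exprM.
  have e1 : (2 : R) ^+ 2 = 4 by rewrite -natrX.
  have e2 : (2^-1 : R) ^+ 2 = 4^-1 by rewrite exprVn e1.
  by rewrite e1 e2.
have aJ t : 0 <= t <= T -> measurable_wrt (G t) (J t).
  move=> tT; apply: mwM => //; first exact: (itg_sigma itg).
  apply: mw_flim => [|n]; first exact: (itg_sigma itg).
  exact: (blocks_int_at_adapted itg).
exists J; split=> //.
- move=> w; have [gw|ngw] := pselect (good w); last first.
    rewrite (_ : J ^~ w = fun=> 0); first exact: cadlag_cst.
    by apply/funext => t; rewrite /J indicE memNset// mul0r.
  apply: (@cadlag_uniform _ _ (fun n t => It t (bs n) w)); last exact: unif.
  by move=> n; apply: blocks_int_at_cadlag; case: gw.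
- move=> w; rewrite /J (_ : flim _ w = 0) ?mulr0//; apply: flimE.
  rewrite (_ : (fun n => _) = fun=> 0); first exact: cvg_cst.
  apply/funext => n; rewrite blocks_int_atE.
  elim: (bs n) (okbs n) => [|b l IH]; first by rewrite big_nil.
  move=> [[lo lohi _ _ _] okl]; rewrite big_cons IH// addr0.
  by rewrite !(min_idPr _)// ?subrr ?mulr0// (le_trans lo).
- move=> t tT.
  have sI n : sqi1 (It t (bs n)) by exact: (blocks_int_at_sqi itg).
  have [sfl lfl] := l2cvg_flim measurableT sI (fun n => ltac:(
    rewrite -blocks_sub_int_at; apply: (le_trans (blocks_int_at_le tT (okdb n)));
    rewrite blocks_sub_int; exact: fast)).
  have eqJ : {ae P, forall w, setT w -> J t w = flim (fun n => It t (bs n)) w}.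
    apply: negligibleS goodN => w /= h gw; apply: h => _.
    by rewrite /J indicE mem_set// mul1r.
  have mJ : measurable_fun setT (J t) by apply: mw_measurable (aJ t tT); apply: (itg_sub itg); case/andP: tT.
  split; first exact: (ae_sqi measurableT mJ sfl).
  apply: l2cvg_ae lfl => //; [by case: sfl|by move=> n; case: (sI n)|].
  by apply: filterS eqJ => w h /h ->.
Qed.

End complete_integral.

(** * Simple integrands *)

(** [cl] clamps the points to [[lo, hi]]: a step inside contributes its own increment, a step
    outside contributes 0, and no step straddles [lo] or [hi] since both belong to the sequence. *)
Lemma telescope_sorted (R : realType) (s : seq R) (g : R -> R) (lo hi : R) :
  sorted <=%R s -> lo \in s -> hi \in s -> lo <= hi ->
  \sum_(k < (size s).-1) ((lo <= nth 0 s k) && (nth 0 s k.+1 <= hi))%:R * (g (nth 0 s k.+1) - g (nth 0 s k)) =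
  g hi - g lo.
Proof.
move=> ss los his lohi; pose cl x := Num.max lo (Num.min x hi).
have s0 : (0 < size s)%N by case: (s) los.
have mono i j : (i <= j)%N -> (j < size s)%N -> nth 0 s i <= nth 0 s j.
  by move=> ij js; apply: (sorted_leq_nth le_trans lexx) => //; rewrite inE// (leq_ltn_trans ij).
have iloP : (index lo s < size s)%N by rewrite index_mem.
have ihiP : (index hi s < size s)%N by rewrite index_mem.
transitivity (\sum_(0 <= k < (size s).-1) (g (cl (nth 0 s k.+1)) - g (cl (nth 0 s k)))).
  rewrite big_mkord; apply: eq_bigr => k _.
  have kS : (k.+1 < size s)%N by have := ltn_ord k; rewrite -ltnS prednK.
  have kk : nth 0 s k <= nth 0 s k.+1 by exact: mono.
  have [h1|h1] /= := leP lo (nth 0 s k).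
    have [h2|h2] /= := leP (nth 0 s k.+1) hi.
      rewrite mul1r /cl (min_idPl h2) (min_idPl (le_trans kk h2)) (max_idPr h1).
      by rewrite (max_idPr (le_trans h1 kk)).
    have hk : hi <= nth 0 s k.
      rewrite -(nth_index 0 his); apply: (mono _ _); last exact: ltnW.
      rewrite leqNgt; apply/negP => kh; have := mono _ _ kh ihiP.
      by rewrite nth_index// leNgt h2.
    by rewrite mul0r /cl (min_idPr hk) (min_idPr (ltW h2)) subrr.
  have hk : nth 0 s k.+1 <= lo.
    rewrite -(nth_index 0 los); apply: (mono _ _) => //.
    rewrite ltnNge; apply/negP => kh; have := mono _ _ kh (ltnW kS).
    by rewrite nth_index// leNgt h1.
  rewrite mul0r /cl (min_idPl (le_trans hk lohi)) (min_idPl (le_trans (ltW h1) lohi)).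
  by rewrite (max_idPl hk) (max_idPl (ltW h1)) subrr.
rewrite telescope_sumr// /cl; congr (g _ - g _).
  rewrite min_r ?max_r// -(nth_index 0 his); apply: (mono _ _); last by rewrite prednK.
  by rewrite -ltnS prednK.
rewrite max_l// ge_min; apply/orP; left.
by rewrite -[leRHS](nth_index 0 los); apply: (mono _ _).
Qed.

Lemma big_ord_indic (R : realType) (I : finType) (K : eqType) (e : I -> K) (k : K) (F : K -> R) :
  injective e -> k \in codom e -> \sum_i (k == e i)%:R * F (e i) = F k.
Proof.
move=> ie /codomP[j ->]; rewrite (bigD1 j)//= eqxx mul1r big1 ?addr0// => i ij.
by rewrite (inj_eq ie) eq_sym (negbTE ij) mul0r.
Qed.

Section simple_integrands.
Context {R : realType} {d} {Omega : measurableType d}.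
Variables (P : probability Omega R) (T : R) (K M : finType).
Variables (L : K -> R -> Omega -> R) (G : R -> set (set Omega)).
Variable rho : M -> K -> Omega * R -> R.
Hypotheses (itg : integrator P T L G rho) (T0 : 0 < T).

Local Notation leb := (@lebesgue_measure R).
Local Notation PL := (P \x leb)%E.
Local Notation dom := (@domain R d Omega T).
Local Notation ip1 := (ip P setT).
Local Notation sqi1 := (sqi P setT).
Local Notation ip2 := (ip PL dom).
Local Notation sqi2 := (sqi PL dom).
Local Notation bsok := (blocks_ok T G).
Local Notation It t bs := (blocks_int_at L t bs).
Local Notation block := (@block R d Omega K).
Implicit Types bs : seq block.

Let mdom := @measurable_domain R d Omega T.

Lemma eq_sum_all (p : pred block) bs (F1 F2 : block -> R) : all p bs ->
  (forall b, p b -> F1 b = F2 b) -> \sum_(b <- bs) F1 b = \sum_(b <- bs) F2 b.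
Proof.
move=> + eF; elim: bs => [_|b bs IH /= /andP[pb pbs]]; first by rewrite !big_nil.
by rewrite !big_cons eF// IH.
Qed.

Lemma blocks_ok_flatten (I : eqType) (s : seq I) (f : I -> seq block) :
  (forall i, i \in s -> bsok (f i)) -> bsok (flatten (map f s)).
Proof.
elim: s => //= i s IH H; apply: blocks_ok_cat; first by apply: H; rewrite inE eqxx.
by apply: IH => j js; apply: H; rewrite inE js orbT.
Qed.

Lemma is_integralD Z J Z' J' : is_integral P T L G rho Z J -> is_integral P T L G rho Z' J' ->
  is_integral P T L G rho (fun m => Z m \+ Z' m) (fun t => J t \+ J' t).
Proof.
move=> [bs [okbs cZ cJ]] [bs' [okbs' cZ' cJ']].
exists (fun n => bs n ++ bs' n); split.
- by move=> n; exact: blocks_ok_cat.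
- move=> m; have [sZ lZ] := cZ m; have [sZ' lZ'] := cZ' m.
  split; first exact: (sqiD mdom).
  rewrite (_ : (fun n => _) = (fun n => blocks_proc rho (bs n) m \+ blocks_proc rho (bs' n) m)).
    by apply: (l2cvgD mdom) => // n; exact: (blocks_proc_sqi itg).
  by apply/funext => n; rewrite blocks_proc_cat.
- move=> t tT; have [sJ lJ] := cJ t tT; have [sJ' lJ'] := cJ' t tT.
  split; first exact: sqiD.
  rewrite (_ : (fun n => _) = (fun n => It t (bs n) \+ It t (bs' n))).
    by apply: l2cvgD => // n; exact: (blocks_int_at_sqi itg).
  by apply/funext => n; apply/funext => w; rewrite !blocks_int_atE big_cat /= -!blocks_int_atE.
Qed.

Variables (m : nat) (e : 'I_m -> K) (Lc : R -> Omega -> 'cV[R]_m) (psi : R -> Omega -> 'M[R]_m).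
Hypotheses (ie : injective e) (LcE : forall i t w, Lc t w i 0 = L (e i) t w)
  (psiE : forall q i j, dom q -> psi q.2 q.1 i j = \sum_b rho b (e i) q * rho b (e j) q).

(** [e] embeds the components of the vector integrator [Lc] into the family [L]. These are the L^2
    components of [Z], whose squares add up to its quadratic form in [psi]. *)
Definition rho_proc (Z : R -> Omega -> 'cV[R]_m) (b : M) (q : Omega * R) : R :=
  \sum_i rho b (e i) q * Z q.2 q.1 i 0.

Lemma qform_rho (C : 'cV[R]_m) q : dom q ->
  qform C (psi q.2 q.1) = \sum_b (\sum_i rho b (e i) q * C i 0) ^+ 2.
Proof.
move=> dq; rewrite /qform mxE.
transitivity (\sum_j \sum_i \sum_b (rho b (e i) q * C i 0) * (rho b (e j) q * C j 0)).
  apply: eq_bigr => j _; rewrite mxE mulr_suml; apply: eq_bigr => i _.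
  by rewrite mxE psiE// mulr_sumr mulr_suml; apply: eq_bigr => b _; ring.
rewrite exchange_big /= (eq_bigr (fun i => \sum_b \sum_j (rho b (e i) q * C i 0) * (rho b (e j) q * C j 0))); last first.
  by move=> i _; exact: exchange_big.
rewrite exchange_big /=; apply: eq_bigr => b _.
rewrite expr2 mulr_suml; apply: eq_bigr => i _.
by rewrite mulr_sumr.
Qed.

Definition blocks_of_simple (h : @simple_integrand R d Omega m) : seq block :=
  flatten [seq [seq Block (si_time h k) (si_time h k.+1) (e i) (fun w => si_val h k w i 0)
    | i <- enum 'I_m] | k <- iota 0 (si_size h)].

Lemma sum_blocks_of_simple h (F : block -> R) : \sum_(b <- blocks_of_simple h) F b =
  \sum_(k < si_size h) \sum_i F (Block (si_time h k) (si_time h k.+1) (e i) (fun w => si_val h k w i 0)).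
Proof.
rewrite /blocks_of_simple big_flatten big_map -(big_mkord xpredT (fun k =>
  \sum_i F (Block (si_time h k) (si_time h k.+1) (e i) (fun w => si_val h k w i 0)))).
rewrite /index_iota subn0; apply: eq_bigr => k _.
by rewrite big_map big_enum.
Qed.

Lemma blocks_of_simple_ok h : simple_adapted T G h -> bsok (blocks_of_simple h).
Proof.
move=> [tT tS mv [C bC]]; apply: blocks_ok_flatten => k; rewrite mem_iota add0n => /andP[_ kh].
apply: blocks_ok_map => i _; split => /=.
- by have /andP[] := tT k (ltnW kh).
- exact: tS.
- by have /andP[] := tT k.+1 kh.
- exact: mv.
- by exists C => w; exact: bC.
Qed.

Lemma simple_intE h t w : simple_int Lc h t w = \sum_(k < si_size h) \sum_i si_val h k w i 0 *
  (L (e i) (Num.min (si_time h k.+1) t) w - L (e i) (Num.min (si_time h k) t) w).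
Proof. by apply: eq_bigr => k _; rewrite mxE; apply: eq_bigr => i _; rewrite !mxE !LcE. Qed.

Lemma blocks_of_simple_int h t w : It t (blocks_of_simple h) w = simple_int Lc h t w.
Proof. by rewrite blocks_int_atE sum_blocks_of_simple simple_intE. Qed.

Lemma blocks_of_simple_proc h b q :
  blocks_proc rho (blocks_of_simple h) b q = rho_proc (simple_fun h) b q.
Proof.
rewrite /blocks_proc sum_blocks_of_simple exchange_big /=; apply: eq_bigr => i _.
rewrite /simple_fun summxE mulr_sumr; apply: eq_bigr => k _.
by rewrite /block_proc /=; case: ifP => _; rewrite /= ?mxE; ring.
Qed.

Definition end_points bs := flatten [seq [:: b_lo b; b_hi b] | b <- bs].
Local Notation pts bs := (sort <=%R (end_points bs)).
Local Notation inside bs k b :=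
  ((b_lo b <= nth 0 (pts bs) k) && (nth 0 (pts bs) k.+1 <= b_hi b)).

(** The sorted end points of all blocks form a common refinement, and on each piece the values of
    the blocks covering it are added. Consecutive points may coincide, which gives empty pieces. *)
Definition simple_of_blocks bs : @simple_integrand R d Omega m :=
  SimpleIntegrand (size (end_points bs)).-1 (nth 0 (pts bs))
    (fun k w => \col_i \sum_(b <- bs) (b_idx b == e i)%:R * (b_val b w * (inside bs k b)%:R)).

Lemma end_points_le bs : bsok bs -> all (fun x => 0 <= x <= T) (end_points bs).
Proof.
elim: bs => //= b bs IH [[lo lohi hi _ _] okbs]; rewrite lo (le_trans lohi hi).
by rewrite (le_trans lo lohi) hi IH.
Qed.

Lemma simple_of_blocks_all bs : bsok bs ->
  all (fun b => [&& b_lo b \in pts bs, b_hi b \in pts bs & b_lo b <= b_hi b]) bs.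
Proof.
have H s bs' : {subset end_points bs' <= s} -> bsok bs' ->
    all (fun b => [&& b_lo b \in s, b_hi b \in s & b_lo b <= b_hi b]) bs'.
  elim: bs' => //= b bs' IH ss [[_ lohi _ _ _] okbs].
  rewrite !ss ?inE ?eqxx ?orbT// lohi /=; apply: IH => // x xs; apply: ss.
  by rewrite !inE xs !orbT.
by apply: H => x; rewrite mem_sort.
Qed.

Lemma sorted_pts bs : sorted <=%R (pts bs).
Proof. by apply: sort_sorted; exact: le_total. Qed.

Lemma simple_of_blocks_ok bs : bsok bs -> simple_adapted T G (simple_of_blocks bs).
Proof.
move=> okbs; have ptsT k : 0 <= nth 0 (pts bs) k <= T.
  have [ks|ks] := ltnP k (size (pts bs)).
    have := end_points_le okbs; rewrite -(all_sort _ <=%R) => /(all_nthP 0); exact.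
  by rewrite nth_default// lexx ltW.
split => //=.
- move=> k kn; apply: (sorted_leq_nth le_trans lexx) => //; rewrite ?inE ?size_sort.
  + exact: sorted_pts.
  + by rewrite (leq_trans kn)// leq_pred.
  + by case: (size _) kn.
- move=> k i _; have sG := itg_sigma itg (nth 0 (pts bs) k).
  rewrite (_ : (fun w => _) = (fun w =>
    \sum_(b <- bs) (b_idx b == e i)%:R * (b_val b w * (inside bs k b)%:R))); last first.
    by apply/funext => w; rewrite mxE.
  have /andP[p0 pT] := ptsT k; move: p0 pT sG; move: (pts bs) => s p0 pT sG.
  elim: bs okbs {ptsT} => [_|b bs IH [okb okbs]].
    by under eq_fun do rewrite big_nil; exact: mw_cst.
  under eq_fun do rewrite big_cons; apply: mwD => //; last exact: IH.
  have [lt|_] := boolP (b_lo b <= nth 0 s k); last first.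
    by rewrite /=; under eq_fun do rewrite mulr0 mulr0; exact: mw_cst.
  apply: mwM => //; first exact: mw_cst.
  apply: mwM => //; last exact: mw_cst.
  case: okb => lo _ _ mb _; apply: mwS mb; exact: (itg_mono itg).
- move: (pts bs) => s.
  suff [C HC] : exists C, forall k w i,
      `|\sum_(b <- bs) (b_idx b == e i)%:R * (b_val b w * ((b_lo b <= nth 0 s k) && (nth 0 s k.+1 <= b_hi b))%:R)| <= C.
    by exists C => k w i _; rewrite mxE.
  elim: bs okbs {ptsT} => [_|b bs IH [okb okbs]].
    by exists 0 => k w i; rewrite big_nil normr0.
  have [C HC] := IH okbs; case: okb => _ _ _ _ [D HD].
  exists (D + C) => k w i; rewrite big_cons; apply: (le_trans (ler_normD _ _)); apply: lerD => //.
  rewrite !normrM; have D0 : 0 <= `|b_val b w| by [].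
  case: (_ == _); case: (_ && _); rewrite ?normr0 ?normr1 ?mulr0 ?mul0r ?mul1r ?mulr1 ?HD//;
    exact: le_trans (HD w).
Qed.

(** The function [g] of the end points is arbitrary in order to serve twice: with the stopped
    martingales it gives the integral, and with the indicator of [q.2 <= u] it gives the integrand,
    the indicator of a left-open interval being an increment too. *)
Lemma simple_of_blocks_sum bs (g : K -> R -> R) w : bsok bs ->
  \sum_(k < si_size (simple_of_blocks bs)) \sum_i si_val (simple_of_blocks bs) k w i 0 *
    (g (e i) (si_time (simple_of_blocks bs) k.+1) - g (e i) (si_time (simple_of_blocks bs) k)) =
  \sum_(b <- bs) \sum_i (b_idx b == e i)%:R * (b_val b w * (g (e i) (b_hi b) - g (e i) (b_lo b))).
Proof.
move=> okbs /=.
under eq_bigr => k _ do (under eq_bigr => i _ do rewrite mxE mulr_suml; rewrite exchange_big /=).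
rewrite exchange_big /=; apply: (eq_sum_all (simple_of_blocks_all okbs)) => b /and3P[los his lohi].
rewrite exchange_big /=; apply: eq_bigr => i _.
rewrite -(telescope_sorted (g (e i)) (sorted_pts bs) los his lohi) size_sort !mulr_sumr.
by apply: eq_bigr => k _; ring.
Qed.

Lemma simple_of_blocks_int bs t w : bsok bs -> all (fun b => b_idx b \in codom e) bs ->
  simple_int Lc (simple_of_blocks bs) t w = It t bs w.
Proof.
move=> okbs ce; rewrite simple_intE (simple_of_blocks_sum (fun k u => L k (Num.min u t) w))//.
rewrite blocks_int_atE; apply: (eq_sum_all ce) => b cb.
exact: (big_ord_indic (fun k => b_val b w * (L k (Num.min (b_hi b) t) w - L k (Num.min (b_lo b) t) w))).
Qed.

Lemma indic_oc_diff (a c r : R) : a <= c -> (a < r <= c)%R%:R = (r <= c)%R%:R - (r <= a)%R%:R :> R.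
Proof.
move=> ac; have [ra|ar] /= := leP r a; first by rewrite (le_trans ra ac) subrr.
by rewrite subr0.
Qed.

Lemma simple_of_blocks_proc bs c q : bsok bs -> all (fun b => b_idx b \in codom e) bs ->
  rho_proc (simple_fun (simple_of_blocks bs)) c q = blocks_proc rho bs c q.
Proof.
move=> okbs ce; rewrite /rho_proc /simple_fun.
transitivity (\sum_(k < si_size (simple_of_blocks bs)) \sum_i si_val (simple_of_blocks bs) k q.1 i 0 *
    (rho c (e i) q * (q.2 <= si_time (simple_of_blocks bs) k.+1)%R%:R -
     rho c (e i) q * (q.2 <= si_time (simple_of_blocks bs) k)%R%:R)).
  rewrite exchange_big /=; apply: eq_bigr => i _; rewrite summxE mulr_sumr; apply: eq_bigr => k _.
  have [_ /(_ k (ltn_ord k)) tk _ _] := simple_of_blocks_ok okbs.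
  have := indic_oc_diff q.2 tk; rewrite -mulrBr => <- /=.
  by case: ifP => _; rewrite ?mxE /=; ring.
rewrite (simple_of_blocks_sum (fun k u => rho c k q * (q.2 <= u)%R%:R))//.
apply: (eq_sum_all (p := predI (fun b => b_lo b <= b_hi b) (fun b => b_idx b \in codom e))).
  rewrite all_predI ce andbT; apply: sub_all (simple_of_blocks_all okbs).
  by move=> b /and3P[].
move=> b /andP[/= lohi cb].
rewrite (big_ord_indic (fun k => b_val b q.1 * (rho c k q * (q.2 <= b_hi b)%R%:R - rho c k q * (q.2 <= b_lo b)%R%:R)))//.
by rewrite /block_proc (indic_oc_diff _ lohi); ring.
Qed.

Lemma integral_qform_sub Z h (u : M -> Omega * R -> R) :
  (forall b, sqi2 (u b)) -> (forall b q, dom q -> rho_proc (simple_fun h) b q = u b q) ->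
  (forall b, sqi2 (rho_proc Z b)) ->
  (\int[PL]_(q in dom) (qform (Z q.2 q.1 - simple_fun h q.2 q.1) (psi q.2 q.1))%:E =
   (\sum_b ip2 (rho_proc Z b \- u b) (rho_proc Z b \- u b))%:E)%E.
Proof.
move=> su hu sZ; have sd b : sqi2 (rho_proc Z b \- u b) by exact: (sqiB mdom).
transitivity (\int[PL]_(q in dom) \sum_b ((rho_proc Z b \- u b) q ^+ 2)%:E)%E.
  apply: eq_integral => q; rewrite inE => dq; rewrite qform_rho// sumEFin; congr EFin.
  apply: eq_bigr => b _; congr (_ ^+ 2); rewrite /= -hu// /rho_proc -sumrB.
  by apply: eq_bigr => i _; rewrite !mxE mulrBr.
rewrite ge0_integral_sum//.
- rewrite -sumEFin; apply: eq_bigr => b _; exact: (integral_sqrE mdom).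
- by move=> b; apply/measurable_EFinP; apply: measurable_funX; case: (sd b).
- by move=> b q _; rewrite lee_fin sqr_ge0.
Qed.

Lemma stochastic_of_blocks Z J (bs : nat -> seq block) :
  (forall n, bsok (bs n)) -> (forall n, all (fun b => b_idx b \in codom e) (bs n)) ->
  (forall t, 0 <= t <= T -> measurable_wrt (G t) (J t)) ->
  (forall w, cadlag T (J ^~ w)) ->
  (forall b, sqi2 (rho_proc Z b) /\ l2cvg PL dom (fun n => blocks_proc rho (bs n) b) (rho_proc Z b)) ->
  (forall t, 0 <= t <= T -> sqi1 (J t) /\ l2cvg P setT (fun n => It t (bs n)) (J t)) ->
  is_stochastic_integral P T G Lc psi Z J.
Proof.
move=> okbs ce mJ cJ hZ hJ; split => //; first exact: aeW.
exists (fun n => simple_of_blocks (bs n)); split.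
- by move=> n; exact: simple_of_blocks_ok.
- rewrite (_ : (fun n => _) = EFin \o (fun n => \sum_b
      ip2 (rho_proc Z b \- blocks_proc rho (bs n) b) (rho_proc Z b \- blocks_proc rho (bs n) b))); last first.
    apply/funext => n /=; apply: integral_qform_sub.
    + by move=> b; exact: (blocks_proc_sqi itg).
    + by move=> b q _; exact: simple_of_blocks_proc.
    + by move=> b; case: (hZ b).
  apply/cvg_EFin; first exact: nearW.
  rewrite [X in _ --> X](_ : 0 = \sum_(b : M) 0); last by rewrite big1.
  apply: cvg_finite_sum => b; have [_] := hZ b; rewrite /l2cvg.
  rewrite (_ : (fun n => _) = (fun n => ip2 (rho_proc Z b \- blocks_proc rho (bs n) b) (rho_proc Z b \- blocks_proc rho (bs n) b)))//.
  by apply/funext => n; apply: eq_Rintegral => q _ /=; ring.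
- move=> t tT; have [sJ cvJ] := hJ t tT.
  rewrite (_ : (fun n => _) = EFin \o (fun n => ip1 (It t (bs n) \- J t) (It t (bs n) \- J t))); last first.
    apply/funext => n /=; rewrite -integral_sqrE//; last by apply: sqiB => //; exact: (blocks_int_at_sqi itg).
    by apply: eq_integral => w _; rewrite simple_of_blocks_int//; congr EFin; rewrite /=; ring.
  by apply/cvg_EFin => //; exact: nearW.
Qed.

Lemma blocks_of_stochastic Z J : is_stochastic_integral P T G Lc psi Z J ->
  (forall b, sqi2 (rho_proc Z b)) -> is_integral P T L G rho (rho_proc Z) J.
Proof.
move=> [aJ _ [h [oh cq cs]]] sZ.
have okb n : bsok (blocks_of_simple (h n)) by exact: blocks_of_simple_ok.
have mJ t : 0 <= t <= T -> measurable_fun setT (J t).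
  move=> tT; apply: mw_measurable (aJ t tT); apply: (itg_sub itg).
  by case/andP: tT.
exists (fun n => blocks_of_simple (h n)); split => //.
- move=> b; split => //.
  pose u n c := ip2 (rho_proc Z c \- blocks_proc rho (blocks_of_simple (h n)) c)
                    (rho_proc Z c \- blocks_proc rho (blocks_of_simple (h n)) c).
  have cu : (fun n => \sum_c u n c) @ \oo --> (0 : R).
    have /fine_cvg := cq; rewrite (_ : fine \o _ = fun n => \sum_c u n c)//.
    apply/funext => n /=; rewrite (@integral_qform_sub Z (h n) (blocks_proc rho (blocks_of_simple (h n))))//.
    + by move=> c; exact: (blocks_proc_sqi itg).
    + by move=> c q _; rewrite blocks_of_simple_proc.
  apply: (@squeeze_cvgr _ _ _ _ (fun=> 0) (fun n => \sum_c u n c)) => //; last exact: cvg_cst.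
  apply: nearW => n; rewrite ip_ge0 /=.
  rewrite (_ : ip _ _ _ _ = u n b); last by apply: eq_Rintegral => q _ /=; ring.
  by rewrite (bigD1 b)//= lerDl sumr_ge0// => c _; exact: ip_ge0.
- move=> t tT; have sI n : sqi1 (It t (blocks_of_simple (h n))) by exact: (blocks_int_at_sqi itg).
  have IE n : simple_int Lc (h n) t = It t (blocks_of_simple (h n)).
    by apply/funext => w; rewrite blocks_of_simple_int.
  have := cs t tT; under eq_fun do rewrite IE; move=> {}cs.
  (* A single finite distance to an elementary integral suffices, and convergence to 0 in the
     extended reals provides one. *)
  have sJ : sqi1 (J t).
    have [n hn] : exists n, (\int[P]_w ((J t w - It t (blocks_of_simple (h n)) w) ^+ 2)%:E < +oo)%E.
      have /fine_cvgP[[N _ HN] _] := cs; exists N.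
      by have := HN N (leqnn N); rewrite /= fin_numE => /andP[_]; rewrite lt_neqAle leey andbT.
    rewrite (_ : J t = (J t \- It t (blocks_of_simple (h n))) \+ It t (blocks_of_simple (h n))); last first.
      by apply/funext => w /=; rewrite subrK.
    apply: sqiD => //; split => //; apply: measurable_funB; first exact: mJ.
    by case: (sI n).
  split => //; have /fine_cvg := cs; rewrite (_ : fine \o _ = fun n =>
    ip1 (It t (blocks_of_simple (h n)) \- J t) (It t (blocks_of_simple (h n)) \- J t))//.
  apply/funext => n; rewrite -[RHS]/(fine (_)%:E) -integral_sqrE//; last exact: sqiB.
  by congr fine; apply: eq_integral => w _; congr EFin; rewrite /=; ring.
Qed.

End simple_integrands.

(** * Substitution of processes into random functions *)

Section substitution.
Context d (S : measurableType d) (R : realType).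
Variable H : set (set S).
Hypothesis sH : sigma_algebra setT H.

Lemma mw_cvg (fs : nat -> S -> R) f : (forall n, measurable_wrt H (fs n)) ->
  (forall x, fs ^~ x @ \oo --> f x) -> measurable_wrt H f.
Proof.
move=> mf cf; rewrite (_ : f = flim fs); first exact: mw_flim.
by apply/funext => x; apply/esym; exact: flimE.
Qed.

(** The induction peels off one indicator at a time; the free shift [y] absorbs the constant added
    on [B]. *)
Lemma mw_subst_simple (Phi : S -> R -> R) s : simple_wrt H s ->
  (forall y, measurable_wrt H (Phi ^~ y)) ->
  forall y, measurable_wrt H (fun x => Phi x (s x + y)).
Proof.
move=> ss mPhi; elim: ss => [y|c B s' HB _ IH y].
  by under eq_fun do rewrite add0r; exact: mPhi.
rewrite (_ : (fun x => _) = fun x => \1_B x * Phi x (s' x + (c + y)) + (1 - \1_B x) * Phi x (s' x + y)).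
  by apply: mwD => //; apply: mwM => //; first exact: mw_indic;
    apply: mwB => //; [exact: mw_cst|exact: mw_indic].
apply/funext => x; rewrite indicE; case: (_ \in _) => /=.
  by rewrite mul1r subrr mul0r addr0 mulr1; congr (Phi _ _); ring.
by rewrite mul0r subr0 mul1r mulr0 !add0r.
Qed.

(** The Caratheodory condition: measurable for fixed [y], continuous in [y]. Simple functions
    converging pointwise to [g] reduce to [mw_subst_simple]. *)
Lemma mw_subst (Phi : S -> R -> R) g : (forall y, measurable_wrt H (Phi ^~ y)) ->
  (forall x, continuous (Phi x)) -> measurable_wrt H g ->
  measurable_wrt H (fun x => Phi x (g x)).
Proof.
move=> mPhi cPhi /(mw_approx sH)[gs [sgs _ cgs]].
apply: (@mw_cvg (fun n x => Phi x (gs n x))) => [n|x].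
  by have := @mw_subst_simple Phi (gs n) (sgs n) mPhi 0; under eq_fun do rewrite addr0.
by apply: (cvg_comp (gs ^~ x) (Phi x)) (cgs x) _; exact: cPhi.
Qed.

(** Coordinates are substituted one at a time, [mix k] having the first [k] done, so that continuity
    along each axis is enough; the Lipschitz condition in the seminorm provides it. *)
Lemma mw_subst_col m (Phi : S -> 'cV[R]_m -> R) (g : S -> 'cV[R]_m) :
  (forall v, measurable_wrt H (Phi ^~ v)) ->
  (forall x v k, continuous (fun y : R => Phi x (v + y *: delta_mx k 0))) ->
  (forall i, measurable_wrt H (fun x => g x i 0)) ->
  measurable_wrt H (fun x => Phi x (g x)).
Proof.
move=> mPhi cPhi mg.
pose mix k (v : 'cV[R]_m) x : 'cV[R]_m := \col_i (if (i < k)%N then g x i 0 else v i 0).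
have key k : (k <= m)%N -> forall v, measurable_wrt H (fun x => Phi x (mix k v x)).
  elim: k => [_ v|k IH km v].
    rewrite (_ : (fun x => _) = Phi ^~ v)//; apply/funext => x; congr (Phi _ _).
    by apply/matrixP => i j; rewrite mxE (ord1 j).
  pose k' := Ordinal km.
  pose Psi x y := Phi x (mix k (v + (y - v k' 0) *: delta_mx k' 0) x).
  have -> : (fun x => Phi x (mix k.+1 v x)) = fun x => Psi x (g x k' 0).
    apply/funext => x; congr (Phi _ _); apply/matrixP => i j; rewrite !mxE ltnS leq_eqVlt.
    rewrite andbT; have [->|ik] := eqVneq i k'.
      by rewrite /= eqxx ltnn /= mulr1 addrC subrK.
    have -> : (nat_of_ord i == k) = false by apply: contra_neqF ik => /eqP ik; exact: val_inj.
    by rewrite /= mulr0 addr0.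
  apply: mw_subst => //.
  - by move=> y; exact: IH (ltnW km) _.
  - move=> x y; rewrite /Psi.
    have -> : (fun y => Phi x (mix k (v + (y - v k' 0) *: delta_mx k' 0) x)) =
      (fun y => Phi x (mix k v x - v k' 0 *: delta_mx k' 0 + y *: delta_mx k' 0)).
      apply/funext => z; congr (Phi _ _); apply/matrixP => i j; rewrite !mxE andbT.
      rewrite (ord1 j) eqxx andbT; case: ifP => [ik|_]; last by ring.
      have -> : (i == k') = false by apply/negbTE; rewrite -val_eqE /= ltn_eqF.
      by rewrite !mulr0; ring.
    exact: cPhi.
rewrite (_ : (fun x => _) = fun x => Phi x (mix m 0 x)); first exact: key.
apply/funext => x; congr (Phi _ _); apply/matrixP => i j.
by rewrite mxE ltn_ord (ord1 j).
Qed.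

End substitution.

Section trace.
Context d (S : measurableType d) (R : realType) (D : set S).

(** Lets functions given on [D], and sigma-algebras on [D] such as the predictable one, be handled
    by the lemmas about sigma-algebras on the whole space. *)
Definition trace_sets (H : set (set S)) : set (set S) := [set B | H (D `&` B)].

Lemma trace_sigma H : sigma_algebra D H -> sigma_algebra setT (trace_sets H).
Proof.
move=> [H0 HD HU]; split.
- by rewrite /trace_sets /= setI0.
- move=> B HB; rewrite /trace_sets /= setTD (_ : _ `&` _ = D `\` (D `&` B)); first exact: HD.
  by apply/seteqP; split => x /=; [move=> [Dx nB]; split => // -[]|move=> [Dx h]; split => // Bx; exact: h].
- by move=> F HF; rewrite /trace_sets /= setI_bigcupr; apply: HU.
Qed.

Lemma trace_mw H (f : S -> R) :
  measurable_wrt (trace_sets H) f <-> preimage_set_system D f measurable `<=` H.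
Proof.
split => h _ [B mB <-].
  by have /= := h (f @^-1` B); rewrite /trace_sets /=; apply; exists B; rewrite ?setTI.
by rewrite setTI; apply: h; exists B.
Qed.

Hypothesis mD : measurable D.

Lemma trace_measurable : sigma_algebra setT (trace_sets measurable).
Proof.
apply: trace_sigma; split => [|B mB|F mF]; [exact: measurable0|exact: measurableD|].
exact: bigcupT_measurable.
Qed.

Lemma trace_measurable_fun (f : S -> R) :
  measurable_wrt (trace_sets measurable) f <-> measurable_fun D f.
Proof.
split => [h _ B mB|h _ [B mB <-]].
  by have /= := h (f @^-1` B); rewrite /trace_sets /=; apply; exists B; rewrite ?setTI.
by rewrite setTI /trace_sets /=; exact: h.
Qed.

End trace.

(** * Time integrals *)

(* An almost minimiser [k] of the distance from [U] to a subspace is almost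
   orthogonal to the subspace after subtraction from [U]. *)
Lemma near_projection d (Omega : measurableType d) (R : realType) (P : probability Omega R)
  (H : set (set Omega)) (U : Omega -> R) (e : R) :
  sigma_algebra setT H -> sqi P setT U -> 0 < e ->
  exists k, [/\ measurable_wrt H k, sqi P setT k,
    ip P setT (U \- k) (U \- k) <= ip P setT U U &
    forall k', measurable_wrt H k' -> sqi P setT k' ->
      ip P setT (U \- k) k' ^+ 2 <= e * ip P setT k' k'].
Proof.
move=> sH sU e0.
pose E := [set x | exists k, [/\ measurable_wrt H k, sqi P setT k & x = ip P setT (U \- k) (U \- k)]].
have E0 : E (ip P setT U U).
  exists (fun=> 0); split; [exact: mw_cst|exact: sqi0|].
  by rewrite (_ : U \- (fun=> 0) = U)//; apply/funext => w /=; rewrite subr0.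
have hE : has_inf E.
  by split; [exists (ip P setT U U)|exists 0 => _ [k [_ _ ->]]; exact: ip_ge0].
have lb k : measurable_wrt H k -> sqi P setT k -> inf E <= ip P setT (U \- k) (U \- k).
  by move=> mk sk; apply: ge_inf; [case: hE|exists k].
have [k0 [mk0 sk0 hk0 hU]] : exists k0, [/\ measurable_wrt H k0, sqi P setT k0,
    ip P setT (U \- k0) (U \- k0) <= inf E + e & ip P setT (U \- k0) (U \- k0) <= ip P setT U U].
  have [x [k [mk sk xk]] xE] := inf_adherent e0 hE.
  have [le|lt] := leP (ip P setT (U \- k) (U \- k)) (ip P setT U U).
    by exists k; split => //; rewrite -xk ltW.
  exists (fun=> 0); rewrite (_ : U \- (fun=> 0) = U); last by apply/funext => w /=; rewrite subr0.
  split => //; [exact: mw_cst|exact: sqi0|].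
  by rewrite (le_trans (ltW lt))// -xk ltW.
exists k0; split => // k' mk' sk'.
have sUk := sqiB measurableT sU sk0.
have [z|nz] := eqVneq (ip P setT k' k') 0.
  by have := cauchy_schwarz measurableT sUk sk'; rewrite z !mulr0.
pose a := ip P setT (U \- k0) k' / ip P setT k' k'.
have sak : sqi P setT (fun w => a * k' w) by exact: sqiZ.
have := lb (k0 \+ (fun w => a * k' w)) (@mwD _ _ _ H sH _ _ mk0 (@mwM _ _ _ H sH _ _ (@mw_cst _ _ _ H sH a) mk')) (sqiD measurableT sk0 sak).
rewrite (_ : U \- _ = (U \- k0) \- (fun w => a * k' w)); last by apply/funext => w /=; ring.
rewrite ipBB// ipZl// !ipZr//.
set u := ip P setT (U \- k0) (U \- k0) in hk0 *; set v := ip P setT (U \- k0) k'.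
have kp : 0 < ip P setT k' k' by rewrite lt_def nz ip_ge0.
rewrite /a -/v; move: (ip P setT k' k') nz kp => q nz kp h.
have h2 : v ^+ 2 / q <= e.
  have -> : v ^+ 2 / q = 2 * (v / q * v) - v / q * (v / q * q) by field.
  by lra.
by rewrite -ler_pdivrMr.
Qed.

(** When the integral on the right is infinite the inequality is trivial, which frees the
    applications from checking integrability of [g / u]. *)
Lemma weighted_cauchy_schwarz d (S : measurableType d) (R : realType)
  (mu : {measure set S -> \bar R}) (D : set S) (u g : S -> R) (c : R) : measurable D ->
  sqi mu D u -> (forall x, 0 < u x) -> ip mu D u u <= c -> 0 < c -> measurable_fun D g ->
  (((\int[mu]_(x in D) g x) ^+ 2)%:E <= c%:E * \int[mu]_(x in D) ((g x / u x) ^+ 2)%:E)%E.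
Proof.
move=> mD su u0 uc c0 mg.
have mgu : measurable_fun D (fun x => g x / u x).
  apply: measurable_funM => //; apply: (@measurable_comp _ _ _ _ _ _ [set x : R | 0 < x] (@GRing.inv R) _ u).
  - by rewrite (_ : mkset _ = `]0, +oo[%classic)//; apply/seteqP; split => x /=; rewrite in_itv /= andbT.
  - by move=> _ [x _ <-] /=.
  - apply: open_continuous_measurable_fun; first exact: open_gt.
    by move=> x; rewrite inE /= => x0; apply: inv_continuous; rewrite gt_eqF.
  - by case: su.
have [lt|ge] := boolP (\int[mu]_(x in D) ((g x / u x) ^+ 2)%:E < +oo)%E; last first.
  move: ge; rewrite -leNgt leye_eq => /eqP ->; rewrite gt0_muley ?lte_fin//.
  exact: leey.
have sgu : sqi mu D (fun x => g x / u x) by split.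
rewrite integral_sqrE// -EFinM lee_fin.
rewrite (_ : \int[mu]_(x in D) g x = ip mu D u (fun x => g x / u x)); last first.
  by apply: eq_Rintegral => x _; rewrite mulrCA divff ?mulr1// gt_eqF.
apply: (le_trans (cauchy_schwarz mD su sgu)); apply: ler_wpM2r => //.
exact: ip_ge0.
Qed.

Lemma dom_fubini_measurable_t {R : realType} {d} {Omega : measurableType d} (P : probability Omega R) (T : R)
  (f : OxR Omega R -> R) :
  (P \x (@lebesgue_measure R))%E.-integrable (domain T) (EFin \o f) ->
  measurable_fun (`[0, T]%classic : set (Rm R)) (fun t => \int[P]_w (f (w, t))%:E)%E.
Proof.
move=> /(integrable_mkcond _ (measurable_domain T)).1 ig.
have h := measurable_fubini_G ig.
apply/(measurable_restrictT _ (measurable_itv _)).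
by apply: eq_measurable_fun h => t _; exact: patch_dom_w.
Qed.

Lemma lebesgue_measure_0b (R : realType) (b : R) : 0 < b -> (lebesgue_measure `[0%R, b]%classic = b%:E)%E.
Proof. by move=> b0; rewrite lebesgue_measure_itv /= lte_fin b0 sube0. Qed.

Section time_integrals.
Context {R : realType} {d} {Omega : measurableType d}.
Variables (P : probability Omega R) (T : R) (f : OxR Omega R -> R).
Hypothesis (T0 : 0 < T).

Local Notation leb := (@lebesgue_measure R).
Local Notation PL := (P \x leb)%E.
Local Notation dom := (@domain R d Omega T).
Local Notation I := (`[0, T]%classic : set R).
Local Notation sqi1 := (sqi P setT).
Local Notation ip1 := (ip P setT).
Local Notation ip2 := (ip PL dom).
Local Notation sqi2 := (sqi PL dom).
Hypothesis sf : sqi2 f.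

Let mdom := @measurable_domain R d Omega T.

Definition good_path : set Omega := [set w | (\int[leb]_(s in I) ((f (w, s)) ^+ 2)%:E < +oo)%E].

Lemma path_measurable w : measurable_fun (I : set (Rm R)) (fun s : Rm R => f (w, s)).
Proof.
apply: (@measurable_comp _ _ _ _ _ _ (dom : set (OxR Omega R)) f _ (fun s => (w, s))).
- exact: mdom.
- by move=> _ [s sI <-].
- by case: sf.
- by apply: measurable_funTS; exact: measurable_pair1.
Qed.

Let f2m : measurable_fun dom (fun q => ((f q) ^+ 2)%:E).
Proof. by apply/measurable_EFinP; apply: measurable_funX; case: sf. Qed.

Let f2p q : dom q -> (0 <= ((f q) ^+ 2)%:E)%E. Proof. by rewrite lee_fin sqr_ge0. Qed.

Lemma good_path_ae : {ae P, forall w, good_path w}.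
Proof.
have : P.-integrable setT (fun w => \int[leb]_(s in I) ((f (w, s)) ^+ 2)%:E)%E.
  apply/integrableP; split; first exact: (dom_tonelli_measurable_w f2m f2p).
  under eq_integral => w _.
    rewrite gee0_abs; last by apply: integral_ge0 => s _; rewrite lee_fin sqr_ge0.
    over.
  by rewrite -(dom_tonelli_w P f2m f2p); case: sf.
move=> /(integrable_ae measurableT); apply: filterS => w /(_ Logic.I).
by rewrite fin_numE => /andP[_]; rewrite /good_path /= lt_neqAle leey andbT.
Qed.

Lemma good_path_sqi w : good_path w -> sqi leb I (fun s => f (w, s)).
Proof. by move=> gw; split => //; exact: path_measurable. Qed.

Definition time_integral w : R := \int[leb]_(s in I) f (w, s).

Lemma dom_integrable : PL.-integrable dom (EFin \o f).
Proof. by apply: (sqi_integrable1 mdom) => //; exact: PL_fin. Qed.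

Lemma path_integrable w : good_path w -> leb.-integrable I (EFin \o (fun s => f (w, s))).
Proof.
have mI : measurable (I : set (Rm R)) by exact: measurable_itv.
have lI : (leb I < +oo)%E by rewrite lebesgue_measure_0b ?ltry.
by move=> gw; apply: (@sqi_integrable1 _ _ _ leb I mI) => //; exact: good_path_sqi.
Qed.

Lemma time_integral_measurable : measurable_fun setT time_integral.
Proof.
rewrite /time_integral /Rintegral.
apply: (measurableT_comp (f := @fine R)) => //.
exact: (dom_fubini_measurable_w dom_integrable).
Qed.

Lemma time_integral_le w : (((time_integral w) ^+ 2)%:E <= T%:E * \int[leb]_(s in I) ((f (w, s)) ^+ 2)%:E)%E.
Proof.
have lI : (leb I < +oo)%E by rewrite lebesgue_measure_0b ?ltry.
have mI : measurable (I : set (Rm R)) by exact: measurable_itv.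
have s1 : sqi leb I (fun=> 1 : R).
  by apply: (@sqi_bounded _ _ _ leb _ mI _ 1) => // s _; rewrite normr1.
have -> : (\int[leb]_(s in I) ((f (w, s)) ^+ 2)%:E = \int[leb]_(s in I) ((f (w, s) / 1) ^+ 2)%:E)%E.
  by apply: eq_integral => s _; rewrite divr1.
apply: (weighted_cauchy_schwarz mI s1) => //; last exact: path_measurable.
rewrite /ip mulr1 Rintegral_cst// mul1r.
by rewrite [X in fine X](_ : _ = T%:E)//; exact: lebesgue_measure_0b.
Qed.

Lemma time_integral_int_le : (\int[P]_w ((time_integral w) ^+ 2)%:E <= T%:E * (ip2 f f)%:E)%E.
Proof.
rewrite -(integral_sqrE mdom sf) (dom_tonelli_w P f2m f2p) -ge0_integralZl//; last first.
- by rewrite lee_fin ltW.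
- by move=> w _; apply: integral_ge0 => s _; rewrite lee_fin sqr_ge0.
- exact: (dom_tonelli_measurable_w f2m f2p).
apply: ge0_le_integral => //.
- by move=> w _; rewrite lee_fin sqr_ge0.
- by apply/measurable_EFinP; apply: measurable_funX; exact: time_integral_measurable.
- by apply: measurable_funeM; exact: (dom_tonelli_measurable_w f2m f2p).
- by move=> w _; exact: time_integral_le.
Qed.

Lemma time_integral_sqi : sqi1 time_integral.
Proof.
split; first exact: time_integral_measurable.
by apply: (le_lt_trans time_integral_int_le); rewrite -EFinM ltry.
Qed.

Lemma path_mean_sqi (v : Omega -> R) : sqi1 v -> sqi2 (fun q => v q.1).
Proof.
move=> sv; have mv : measurable_fun dom (fun q : OxR Omega R => v q.1).
  by apply: measurable_funTS; apply: measurableT_comp => //; case: sv.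
split => //; rewrite (dom_tonelli_w (T := T) P (f := fun q => ((v q.1) ^+ 2)%:E)); last first.
- by move=> q _; rewrite lee_fin sqr_ge0.
- by apply/measurable_EFinP; apply: measurable_funX.
have -> : (\int[P]_w \int[leb]_(t in I) ((v (w, t).1) ^+ 2)%:E = \int[P]_w (T%:E * ((v w) ^+ 2)%:E))%E.
  apply: eq_integral => w _; rewrite (integral_cst leb (measurable_itv _) ((v w ^+ 2)%:E)) muleC.
  by rewrite [X in (X * _)%E](_ : _ = T%:E)//; exact: lebesgue_measure_0b.
rewrite ge0_integralZl//.
- by rewrite (integral_sqrE measurableT sv) -EFinM ltry.
- by apply/measurable_EFinP; apply: measurable_funX; case: sv.
- by move=> w _; rewrite lee_fin sqr_ge0.
- by rewrite lee_fin ltW.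
Qed.

Lemma path_mean_measurable (v : Omega -> R) : sqi1 v ->
  measurable_fun (I : set (Rm R)) (fun s => \int[P]_w (v w * f (w, s))%:E)%E.
Proof.
move=> sv; have iv := sqi_integrable mdom (path_mean_sqi sv) sf.
exact: (dom_fubini_measurable_t iv).
Qed.

Lemma time_integral_ip (v : Omega -> R) : sqi1 v ->
  ((ip1 v time_integral)%:E = \int[leb]_(s in I) \int[P]_w (v w * f (w, s))%:E)%E.
Proof.
move=> sv; have iv := sqi_integrable mdom (path_mean_sqi sv) sf.
transitivity (\int[PL]_(q in dom) (v q.1 * f q)%:E)%E; last exact: (dom_fubini_t iv).
rewrite (dom_fubini_w iv) /ip /Rintegral fineK; last first.
  exact: (integrable_fin_num measurableT (sqi_integrable measurableT sv time_integral_sqi)).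
apply: ae_eq_integral => //.
- by apply/measurable_EFinP; apply: measurable_funM; [case: sv|case: time_integral_sqi].
- exact: (dom_fubini_measurable_w iv).
apply: filterS good_path_ae => w /path_integrable iw _.
rewrite (_ : (\int[leb]_(s in I) (v w * f (w, s))%:E = \int[leb]_(s in I) ((v w)%:E * (f (w, s))%:E))%E).
  rewrite integralZl// EFinM /time_integral /Rintegral fineK//.
  exact: integrable_fin_num.
by apply: eq_integral => s _; rewrite EFinM.
Qed.

Variable H : set (set Omega).
Hypotheses (sH : sigma_algebra setT H) (Hm : H `<=` measurable) (HN : P.-negligible `<=` H)
  (mf : forall s, 0 <= s <= T -> measurable_wrt H (fun w => f (w, s))).

(* Only the sections of [f] are [H]-measurable, so Fubini does not give the
   [H]-measurability of the integral; instead the integral is approximated in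
   L^2 by [H]-measurable variables. *)
Lemma time_integral_mw : measurable_wrt H time_integral.
Proof.
have sU := time_integral_sqi.
pose C := T + ip2 f f + 1 + 4 * ip1 time_integral time_integral.
suff approx (n : nat) : exists k, [/\ measurable_wrt H k, sqi1 k &
    ip1 (k \- time_integral) (k \- time_integral) <= C * harmonic n].
  have /choice[k hk] := approx.
  apply: (mw_l2cvg sH HN (fs := k)) => //.
  - by move=> n; case: (hk n).
  - by move=> n; case: (hk n).
  - apply: cvg0_le (@cvgZ0 R C _ (@cvg_harmonic R)) => n.
    by rewrite ip_ge0 /=; case: (hk n).
set dl := harmonic n; have dl0 : 0 < dl by exact: harmonic_gt0.
have [k [mk sk kU hk]] := near_projection sH sU (exprn_gt0 2 dl0).
(* Weakened to a bound affine in the squared norm of [k'], which can be integrated when [k'] runs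
   over the time slices of [f]. *)
have lin k' : measurable_wrt H k' -> sqi1 k' -> `|ip1 (time_integral \- k) k'| <= dl * (1 + ip1 k' k').
  move=> mk' sk'; have q0 := ip_ge0 P setT k'.
  have r0 : 0 <= dl * (1 + ip1 k' k') by apply: mulr_ge0; [exact: ltW|exact: addr_ge0].
  rewrite -(ler_sqr (normr_ge0 _) r0) real_normK ?num_real//.
  apply: (le_trans (hk _ mk' sk')); rewrite exprMn ler_wpM2l ?sqr_ge0//.
  by move: (ip1 k' k') q0 => q q0; nra.
exists k; split => //; have sUk := sqiB measurableT sU sk.
rewrite ipBC ipBr//.
(* By Fubini this product is the time integral of the products with the slices of [f], each
   [H]-measurable and thus almost orthogonal to [time_integral \- k]. *)
have h1 : ip1 (time_integral \- k) time_integral <= dl * (T + ip2 f f).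
  rewrite -lee_fin time_integral_ip//.
  have mI : measurable (I : set (Rm R)) by exact: measurable_itv.
  have m2 : measurable_fun (I : set (Rm R)) (fun s => \int[P]_w ((f (w, s)) ^+ 2)%:E)%E.
    exact: (@dom_tonelli_measurable_t _ _ _ P T (fun q => ((f q) ^+ 2)%:E) f2m f2p).
  have p2 s : (0 <= \int[P]_w ((f (w, s)) ^+ 2)%:E)%E.
    by apply: integral_ge0 => w _; rewrite lee_fin sqr_ge0.
  apply: (@le_trans _ _ (\int[leb]_(s in I) (dl%:E * (1 + \int[P]_w ((f (w, s)) ^+ 2)%:E)))%E).
    apply: (le_trans (lee_abs _)).
    have mg := path_mean_measurable sUk.
    apply: (le_trans (le_abse_integral _ mI mg)).
    apply: ge0_le_integral => //.
    - exact: measurableT_comp.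
    - by apply: measurable_funeM; apply: emeasurable_funD.
    - move=> s /=; rewrite in_itv /= => sI.
      have [lt|] := boolP (\int[P]_w ((f (w, s)) ^+ 2)%:E < +oo)%E; last first.
        rewrite -leNgt leye_eq => /eqP ->.
        by rewrite addey// gt0_muley ?lte_fin ?leey.
      have ms : measurable_wrt H (fun w => f (w, s)) by exact: mf.
      have ss : sqi1 (fun w => f (w, s)) by split => //; exact: mw_measurable ms.
      rewrite (integral_sqrE measurableT ss) -(@fineK _ (\int[P]_w _)%E); last first.
        exact: (integrable_fin_num measurableT (sqi_integrable measurableT sUk ss)).
      by have := lin _ ms ss; rewrite -lee_fin EFinM EFinD.
  rewrite ge0_integralZl//; last first.
  - by rewrite lee_fin ltW.
  - by move=> s _; rewrite adde_ge0.
  - exact: emeasurable_funD.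
  rewrite ge0_integralD// integral_cst// mul1e -(dom_tonelli_t P f2m f2p) (integral_sqrE mdom sf).
  by rewrite [X in (X + _)%E](_ : _ = T%:E)//; exact: lebesgue_measure_0b.
have h2 := lin k mk sk.
have h3 : ip1 k k <= 4 * ip1 time_integral time_integral.
  have := ipB_le2 measurableT sU sUk.
  rewrite (_ : time_integral \- (time_integral \- k) = k); last by apply/funext => w /=; ring.
  by move: kU; lra.
rewrite /C {C}; have := ler_norm (- ip1 (time_integral \- k) k); rewrite normrN => h4.
have h5 : dl * ip1 k k <= dl * (4 * ip1 time_integral time_integral) by rewrite ler_wpM2l// ltW.
have arith (a b q p F D : R) : a <= D * (T + F) -> `|b| <= D * (1 + q) -> - b <= `|b| ->
  D * q <= D * (4 * p) -> a - b <= (T + F + 1 + 4 * p) * D by nra.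
exact: arith h1 h2 h4 h5.
Qed.

End time_integrals.

Section integral_process.
Context {R : realType} {d} {Omega : measurableType d}.
Variables (P : probability Omega R) (T : R) (f : OxR Omega R -> R).
Variable G : R -> set (set Omega).

Local Notation leb := (@lebesgue_measure R).
Local Notation PL := (P \x leb)%E.
Local Notation dom := (@domain R d Omega T).
Local Notation sqi1 := (sqi P setT).
Local Notation sqi2 := (sqi PL dom).
Hypotheses (T0 : 0 < T) (sf : sqi2 f) (sG : forall t, sigma_algebra setT (G t))
  (Gm : forall t, t <= T -> G t `<=` measurable) (GN : forall t, P.-negligible `<=` G t)
  (Gmono : forall s t, 0 <= s -> s <= t -> t <= T -> G s `<=` G t)
  (af : forall t, 0 <= t <= T -> measurable_wrt (G t) (fun w => f (w, t))).

Let mdom := @measurable_domain R d Omega T.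

Lemma domain_sub t : t <= T -> @domain R d Omega t `<=` dom.
Proof.
by move=> tT [w s] [_ /=]; rewrite !in_itv /= => /andP[s0 st]; split => //=; rewrite in_itv /= s0 (le_trans st).
Qed.

Lemma sqi_domain t : t <= T -> sqi PL (domain t) f.
Proof.
move=> tT; have sub := domain_sub tT; have mt := @measurable_domain R d Omega t.
case: sf => mf fi; split; first exact: measurable_funS mf.
apply: le_lt_trans fi; apply: ge0_subset_integral => //.
- by apply/measurable_EFinP; apply: measurable_funX.
- by move=> q _; rewrite lee_fin sqr_ge0.
Qed.

(** The factor restricts to paths of finite square integral, so that every path, and not only almost
    every one, is continuous in [t]. *)
Definition integral_process t w : R :=
  \1_(good_path T f) w * \int[leb]_(s in `[0, t]%classic) f (w, s).

Lemma integral_processE t : {ae P, forall w, integral_process t w = \int[leb]_(s in `[0, t]%classic) f (w, s)}.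
Proof.
apply: filterS (good_path_ae sf) => w gw.
by rewrite /integral_process indicE mem_set// mul1r.
Qed.

Lemma integral_process0 w : integral_process 0 w = 0.
Proof. by rewrite /integral_process set_itv1 Rintegral_set1 mulr0. Qed.

Lemma integral_process_mw t : 0 <= t <= T -> measurable_wrt (G t) (integral_process t).
Proof.
move=> /andP[]; rewrite le_eqVlt => /predU1P[<- _|t0 tT].
  by rewrite (_ : integral_process 0 = fun=> 0); [exact: mw_cst|apply/funext => w; rewrite integral_process0].
apply: (@mw_ae _ _ _ P (G t) (sG t) (GN t) (time_integral t f)).
  apply: (time_integral_mw t0 (sqi_domain tT) (sG t) (Gm tT) (GN t)) => s /andP[s0 st].
  by apply: mwS (af _); [exact: Gmono|rewrite s0 (le_trans st)].
by apply: filterS (integral_processE t) => w ->.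
Qed.

Lemma integral_process_sqi t : 0 <= t <= T -> sqi1 (integral_process t).
Proof.
move=> tT; have mV : measurable_fun setT (integral_process t).
  by apply: mw_measurable (integral_process_mw tT); apply: Gm; case/andP: tT.
case/andP: tT; rewrite le_eqVlt => /predU1P[<- _|t0 tT].
  by rewrite (_ : integral_process 0 = fun=> 0); [exact: sqi0|apply/funext => w; rewrite integral_process0].
apply: (ae_sqi measurableT mV (time_integral_sqi t0 (sqi_domain tT))).
by apply: filterS (integral_processE t) => w -> _.
Qed.

Lemma integral_process_continuous w : {within `[0, T]%classic, continuous (integral_process ^~ w)}.
Proof.
have [gw|nw] := pselect (good_path T f w).
  have -> : integral_process ^~ w = fun t => \int[leb]_(s in `[0, t]%classic) f (w, s).
    by apply/funext => t; rewrite /integral_process indicE mem_set// mul1r.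
  exact: (parameterized_integral_continuous (ltW T0) (path_integrable T0 sf gw)).
have -> : integral_process ^~ w = fun=> 0.
  by apply/funext => t; rewrite /integral_process indicE memNset// mul0r.
by move=> x; exact: cvg_cst.
Qed.

Lemma integral_process_diff : {ae P, forall w, forall t, 0 <= t <= T ->
  integral_process T w - integral_process t w = \int[leb]_(s in `[t, T]%classic) f (w, s)}.
Proof.
apply: filterS (good_path_ae sf) => w gw t /andP[t0 tT].
have iw := path_integrable T0 sf gw.
rewrite /integral_process indicE mem_set// !mul1r Rintegral_itvB ?bnd_simp//.
apply: Rintegral_itv_obnd_cbnd; apply: integrableS iw => //.
by move=> s /=; rewrite !in_itv /= => /andP[ts ->]; rewrite (le_trans t0 (ltW ts)).
Qed.

End integral_process.

(** * The weighted estimate *)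

Section weighted_estimate.
Context {R : realType}.
Local Notation leb := (@lebesgue_measure R).

Lemma integral_exp (k a b : R) : k != 0 -> a <= b ->
  (\int[leb]_(t in `[a, b]) (expR (k * t))%:E = ((expR (k * b) - expR (k * a)) / k)%:E)%E.
Proof.
move=> k0; rewrite le_eqVlt => /predU1P[<-|ab].
  by rewrite set_itv1 integral_set1 subrr mul0r.
have dF (x : R) : is_derive x (1 : R) (fun t : R => k^-1 * expR (k * t) : R) (expR (k * x)).
  have h : is_derive x (1 : R) (fun y : R => k * y : R) k.
    by apply: is_derive_eq; rewrite /GRing.scale/= mulr1.
  have h2 : is_derive x (1 : R) (fun t : R => expR (k * t) : R) (expR (k * x) * k).
    exact: (is_derive1_comp (f := expR) (g := fun y => k * y)).
  apply: (is_derive_eq (@is_deriveZ _ _ _ _ k^-1 x 1 _ h2)).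
  by rewrite /GRing.scale/= mulrCA mulVf ?mulr1.
have cE : continuous (fun t : R => expR (k * t)).
  by move=> t; apply: continuous_comp; [exact: mulrl_continuous|exact: continuous_expR].
have cF : continuous (fun t : R => k^-1 * expR (k * t)).
  by move=> t; apply: cvgM; [exact: cvg_cst|exact: cE].
rewrite (@continuous_FTC2 _ _ (fun t => k^-1 * expR (k * t)) _ _ ab).
- by rewrite -EFinB -mulrBr mulrC.
- by apply: continuous_subspaceT.
- split.
  + by move=> x _; have [] := dF x.
  + by apply: cvg_at_right_filter; exact: cF.
  + by apply: cvg_at_left_filter; exact: cF.
- by move=> x _; rewrite derive1E; have [_ ->] := dF x.
Qed.

Lemma measurable_lt_indic (t : R) : measurable_fun setT (fun s : Rm R => (t < s)%R%:R : R).
Proof.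
apply: (@measurableT_comp _ _ _ _ _ _ (fun b : bool => b%:R : R)) => //.
by apply: measurable_fun_ltr; [exact: measurable_cst|exact: measurable_id].
Qed.

Lemma measurable_expR_mul (k : R) : measurable_fun setT (fun s : Rm R => expR (k * s)).
Proof. by apply: measurableT_comp => //; apply: measurable_funM. Qed.

Variable T : R.
Hypothesis T0 : 0 < T.
Local Notation I := (`[0%R, T]%classic : set (Rm R)).

Let mI : measurable I. Proof. exact: measurable_itv. Qed.
Let mlt1 := measurable_lt_indic.
Let mexp := measurable_expR_mul.

Let mlt2 (s : R) : measurable_fun setT (fun t : Rm R => (t < s)%R%:R : R).
Proof.
apply: (@measurableT_comp _ _ _ _ _ _ (fun b : bool => b%:R : R)) => //.
by apply: measurable_fun_ltr; [exact: measurable_id|exact: measurable_cst].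
Qed.

Let ker (phi : R -> \bar R) (p : Rm R * Rm R) : \bar R :=
  ((p.1 < p.2)%R%:R%:E * (phi \_ I) p.2)%E.

Let mker phi : measurable_fun I phi -> measurable_fun setT (ker phi).
Proof.
move=> mphi; apply: emeasurable_funM.
  apply/measurable_EFinP; apply: (@measurableT_comp _ _ _ _ _ _ (fun b : bool => b%:R : R)) => //.
  by apply: measurable_fun_ltr; [exact: measurable_fst|exact: measurable_snd].
by apply: (measurableT_comp (f := (phi \_ I))) => //; exact/(measurable_restrictT _ mI).
Qed.

Lemma tonelli_triangle (v : R -> R) (phi : R -> \bar R) :
  measurable_fun setT (v : Rm R -> R) -> (forall t, 0 <= v t) ->
  measurable_fun I phi -> (forall s, 0 <= phi s)%E ->
  (\int[leb]_(t in I) ((v t)%:E * \int[leb]_(s in I) ((t < s)%R%:R%:E * phi s)) =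
   \int[leb]_(s in I) ((\int[leb]_(t in I) (v t * (t < s)%R%:R)%:E) * phi s))%E.
Proof.
move=> mv v0 mphi phi0.
pose h p : \bar R := ((\1_I p.1 * v p.1)%:E * ker phi p)%E.
have pI0 s : (0 <= (phi \_ I) s)%E by apply: erestrict_ge0.
have mh : measurable_fun setT h.
  apply: emeasurable_funM; last exact: mker.
  apply/measurable_EFinP; apply: measurable_funM.
    by apply: (measurableT_comp (f := (\1_I : Rm R -> R))).
  by apply: (measurableT_comp (f := (v : Rm R -> R))).
have h0 p : (0 <= h p)%E by rewrite !mule_ge0 ?lee_fin ?mulr_ge0 ?indicE.
have mrow t : measurable_fun I (fun s : Rm R => ((t < s)%R%:R%:E * phi s)%E).
  apply: emeasurable_funM => //; apply/measurable_EFinP; apply: measurable_funTS.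
  exact: mlt1.
have := @fubini_tonelli _ _ _ _ _ leb leb _ mh h0.
rewrite (_ : (\int[leb]_x \int[leb]_y h (x, y) = \int[leb]_(t in I) ((v t)%:E * \int[leb]_(s in I) ((t < s)%R%:R%:E * phi s)))%E); last first.
  rewrite [RHS]integral_mkcond; apply: eq_integral => t _.
  transitivity (\int[leb]_(s in I) ((\1_I t * v t)%:E * ((t < s)%R%:R%:E * phi s)))%E.
    rewrite [RHS]integral_mkcond; apply: eq_integral => s _.
    by rewrite /h /ker /= !patchE; case: ifP => _; rewrite ?mule0.
  rewrite ge0_integralZl ?lee_fin ?mulr_ge0 ?indicE//; last first.
    by move=> s _; rewrite mule_ge0 ?lee_fin.
  by rewrite patchE; case: ifP => _; rewrite ?mul1r// mul0r mul0e.
move=> ->; rewrite [RHS]integral_mkcond; apply: eq_integral => s _.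
transitivity ((\int[leb]_(t in I) (v t * (t < s)%R%:R)%:E) * (phi \_ I) s)%E; last first.
  by rewrite !patchE; case: ifP => _ //; rewrite mule0.
rewrite muleC -ge0_integralZl//; last first.
- by move=> t _; rewrite lee_fin mulr_ge0.
- apply/measurable_EFinP; apply: measurable_funTS; apply: measurable_funM => //.
rewrite [RHS]integral_mkcond; apply: eq_integral => t _.
rewrite /h /ker /= [RHS]patchE; case: ifP => tI; last by rewrite indicE tI !mul0r mul0e.
by rewrite indicE tI mul1r muleA -EFinM muleC.
Qed.

Lemma triangle_measurable (phi : R -> \bar R) : measurable_fun I phi -> (forall s, 0 <= phi s)%E ->
  measurable_fun setT (fun t : Rm R => \int[leb]_(s in I) ((t < s)%R%:R%:E * phi s))%E.
Proof.
move=> mphi phi0.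
have k0 p : (0 <= ker phi p)%E by rewrite mule_ge0 ?lee_fin//; exact: erestrict_ge0.
have mF := @measurable_fun_fubini_tonelli_F _ _ _ _ _ leb _ (mker mphi) k0.
rewrite [X in measurable_fun _ X](_ : _ = fubini_F leb (ker phi))//.
apply/funext => t; rewrite integral_mkcond; apply: eq_integral => s _.
by rewrite /ker /= !patchE; case: ifP => _; rewrite ?mule0.
Qed.

Lemma exp_triangle (k s : R) : 0 < k -> 0 <= s <= T ->
  (\int[leb]_(t in I) (expR (k * t) * (t < s)%R%:R)%:E = ((expR (k * s) - 1) / k)%:E)%E.
Proof.
move=> k0 /andP[s0 sT].
have cE := measurable_expR_mul k.
transitivity (\int[leb]_(t in `[0%R, s[) (expR (k * t))%:E)%E.
  rewrite integral_mkcond [RHS]integral_mkcond; apply: eq_integral => t _; rewrite !patchE.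
  have -> : (t \in (`[0, s[%classic : set R)) = (t \in I) && (t < s).
    rewrite !mem_setE !in_itv /=; apply/idP/idP.
      by move=> /andP[-> ts]; rewrite ts (le_trans (ltW ts) sT).
    by move=> /andP[/andP[-> _] ->].
  by case: (t \in I) => //=; case: (t < s); rewrite ?mulr1 ?mulr0.
rewrite integral_itv_bndo_bndc; last by apply/measurable_EFinP; exact: measurable_funTS.
by rewrite integral_exp ?gt_eqF// mulr0 expR0.
Qed.

Variables (al bb ff : R -> \bar R) (g : R).
Hypotheses (g0 : 0 < g) (al0 : forall t, (0 <= al t)%E) (bb0 : forall t, (0 <= bb t)%E)
  (ff0 : forall t, (0 <= ff t)%E) (mal : measurable_fun I al) (mbb : measurable_fun I bb)
  (mff : measurable_fun I ff).
Hypothesis energy : forall t, 0 <= t <= T ->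
  (al t + \int[leb]_(s in I) ((t < s)%R%:R%:E * bb s) <=
   (expR (- g * t) / g)%:E * \int[leb]_(s in I) ((t < s)%R%:R%:E * ((expR (g * s))%:E * ff s)))%E.

Let mexpE (k : R) : measurable_fun I (fun t : Rm R => (expR (k * t))%:E).
Proof. by apply/measurable_EFinP; apply: measurable_funTS. Qed.

Let mtri (phi : R -> \bar R) : measurable_fun I phi -> (forall s, 0 <= phi s)%E ->
  measurable_fun I (fun t : Rm R => \int[leb]_(s in I) ((t < s)%R%:R%:E * phi s))%E.
Proof. by move=> mphi p0; apply: measurable_funTS; exact: triangle_measurable. Qed.

Let tri0 (phi : R -> \bar R) t : (forall s, 0 <= phi s)%E ->
  (0 <= \int[leb]_(s in I) ((t < s)%R%:R%:E * phi s))%E.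
Proof. by move=> p0; apply: integral_ge0 => s _; rewrite mule_ge0 ?lee_fin. Qed.

Local Notation ek k t := (expR (k * t))%:E.
Local Notation K := (\int[leb]_(s in I) (ek (2 * g) s * ff s))%E.

Let e0 (k t : R) : (0 <= ek k t)%E. Proof. by rewrite lee_fin expR_ge0. Qed.

Let gff0 s : (0 <= ek g s * ff s)%E. Proof. by rewrite mule_ge0. Qed.

Let mgff : measurable_fun I (fun s : Rm R => ek g s * ff s)%E.
Proof. exact: emeasurable_funM. Qed.

(** Multiply [energy] at [t] by [expR (2 * g * t)] and integrate over [t]. Exchanging the order on
    the triangle [t < s] leaves [(expR (2 * g * s) - 1) / (2 * g)] in front of [bb], and at most
    [expR (g * s) / g] in front of [expR (g * s) * ff]. *)
Let first_estimate :
  ((2 * g)%:E * \int[leb]_(t in I) (ek (2 * g) t * al t) +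
   \int[leb]_(s in I) ((expR (2 * g * s) - 1)%:E * bb s) <= (2 / g)%:E * K)%E.
Proof.
have h1 : (\int[leb]_(t in I) (ek (2 * g) t * al t) +
    \int[leb]_(t in I) (ek (2 * g) t * \int[leb]_(s in I) ((t < s)%R%:R%:E * bb s)) <=
    g^-1%:E * \int[leb]_(t in I) (ek g t * \int[leb]_(s in I) ((t < s)%R%:R%:E * (ek g s * ff s))))%E.
  rewrite -ge0_integralD//; first last.
  - by apply: emeasurable_funM => //; exact: mtri.
  - by move=> t _; rewrite mule_ge0// tri0.
  - exact: emeasurable_funM.
  - by move=> t _; rewrite mule_ge0.
  rewrite -ge0_integralZl//; first last.
  - by rewrite lee_fin invr_ge0 ltW.
  - by move=> t _; rewrite mule_ge0// tri0.
  - by apply: emeasurable_funM => //; exact: mtri.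
  apply: ge0_le_integral => //.
  - by move=> t _; rewrite adde_ge0// mule_ge0// tri0.
  - by apply: emeasurable_funD; apply: emeasurable_funM => //; exact: mtri.
  - by apply: measurable_funeM; apply: emeasurable_funM => //; exact: mtri.
  move=> t /=; rewrite in_itv /= => tT.
  rewrite -ge0_muleDr ?tri0//; apply: (le_trans (lee_wpmul2l (e0 _ _) (energy tT))).
  rewrite muleA muleA -!EFinM (_ : expR (2 * g * t) * (expR (- g * t) / g) = g^-1 * expR (g * t))//.
  rewrite mulrA -expRD mulrC; congr (_ * expR _); ring.
move: h1; rewrite (tonelli_triangle (mexp (2 * g)) (fun t => expR_ge0 _) mbb bb0).
rewrite (tonelli_triangle (mexp g) (fun t => expR_ge0 _) mgff gff0).
have g2 : 0 < 2 * g by rewrite mulr_gt0.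
have em1 (k s : R) : 0 < k -> 0 <= s -> 0 <= expR (k * s) - 1.
  by move=> k0 s0; rewrite subr_ge0 -expR0 ler_expR mulr_ge0// ltW.
have -> : (\int[leb]_(s in I) ((\int[leb]_(t in I) (expR (2 * g * t) * (t < s)%R%:R)%:E) * bb s) =
    (2 * g)^-1%:E * \int[leb]_(s in I) ((expR (2 * g * s) - 1)%:E * bb s))%E.
  rewrite -ge0_integralZl//; first last.
  - by rewrite lee_fin invr_ge0 ltW.
  - by move=> s /=; rewrite in_itv /= => /andP[s0 _]; rewrite mule_ge0// lee_fin em1.
  - apply: emeasurable_funM => //; apply/measurable_EFinP; apply: measurable_funB => //.
    by apply: measurable_funTS; (exact: mlt1 || exact: mexp).
  apply: eq_integral => s; rewrite mem_setE in_itv /= => sT.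
  by rewrite exp_triangle// mulrC EFinM muleA.
have h2 : (\int[leb]_(s in I) ((\int[leb]_(t in I) (expR (g * t) * (t < s)%R%:R)%:E) * (ek g s * ff s)) <=
    g^-1%:E * K)%E.
  rewrite -ge0_integralZl//; first last.
  - by rewrite lee_fin invr_ge0 ltW.
  - by move=> s _; rewrite mule_ge0.
  - exact: emeasurable_funM.
  apply: ge0_le_integral => //.
  - by move=> s _; rewrite mule_ge0// integral_ge0// => t _; rewrite lee_fin mulr_ge0// expR_ge0.
  - apply: (@eq_measurable_fun _ _ _ _ _ (fun s : Rm R => ((expR (g * s) - 1) / g)%:E * (ek g s * ff s))%E).
      by move=> s; rewrite mem_setE in_itv /= => sT; rewrite exp_triangle.
    apply: emeasurable_funM => //; apply/measurable_EFinP; apply: measurable_funM => //.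
    by apply: measurable_funB => //; by apply: measurable_funTS; (exact: mlt1 || exact: mexp).
  - by apply: measurable_funeM; exact: emeasurable_funM.
  move=> s /=; rewrite in_itv /= => sT; rewrite exp_triangle// !muleA -!EFinM.
  apply: lee_wpmul2r => //; rewrite lee_fin mulrC mulrA [leRHS]mulrC ler_pM2r ?invr_gt0//.
  have -> : 2 * g * s = g * s + g * s by ring.
  by rewrite expRD ler_wpM2l ?expR_ge0// gerBl.
move=> h1; have h3 := le_trans h1 (lee_wpmul2l _ h2).
have {h3} := h3 (ltac:(by rewrite lee_fin invr_ge0 ltW)).
move=> /(lee_wpmul2l (x := (2 * g)%:E) (ltac:(by rewrite lee_fin ltW))).
rewrite ge0_muleDr; first last.
- apply: mule_ge0; first by rewrite lee_fin invr_ge0 ltW.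
  apply: integral_ge0 => s /=; by rewrite in_itv /= => /andP[s0 _]; rewrite mule_ge0// lee_fin em1.
- by apply: integral_ge0 => s _; rewrite mule_ge0.
rewrite !muleA -!EFinM mulfV ?gt_eqF// mul1e.
by rewrite (_ : 2 * g / g / g = 2 / g)//; field; rewrite gt_eqF.
Qed.

(** The [- 1] subtracted from the weight of [bb] in [first_estimate] is made up for by [energy] at
    time 0, which bounds the integral of [bb] by [K / g]; hence 3 = 2 + 1. *)
Lemma weighted_estimate :
  ((2 * g)%:E * \int[leb]_(t in I) (ek (2 * g) t * al t) +
   \int[leb]_(s in I) (ek (2 * g) s * bb s) <= (3 / g)%:E * K)%E.
Proof.
have mbb0 : measurable_fun (`]0, T]%classic : set (Rm R)) bb.
  apply: measurable_funS mbb => // s /=; rewrite !in_itv /= => /andP[s0 ->].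
  by rewrite (ltW s0).
have h0 : (\int[leb]_(s in I) bb s <= g^-1%:E * K)%E.
  have -> : (\int[leb]_(s in I) bb s = \int[leb]_(s in I) ((0 < s)%R%:R%:E * bb s))%E.
    rewrite -!integral_itv_obnd_cbnd.
    - apply: eq_integral => s; rewrite mem_setE in_itv /= => /andP[-> _].
      by rewrite mul1e.
    - by apply: emeasurable_funM => //; apply/measurable_EFinP; apply: measurable_funTS; (exact: mlt1 || exact: mexp).
    - exact: mbb0.
  have := energy (introT andP (conj (lexx 0) (ltW T0))).
  rewrite mulr0 expR0 div1r => h; apply: le_trans (le_trans h _).
    by rewrite leeDr.
  apply: lee_wpmul2l; first by rewrite lee_fin invr_ge0 ltW.
  apply: ge0_le_integral => //.
  - by move=> s _; rewrite mule_ge0 ?lee_fin.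
  - apply: emeasurable_funM => //; apply/measurable_EFinP; by apply: measurable_funTS; (exact: mlt1 || exact: mexp).
  - exact: emeasurable_funM.
  move=> s /=; rewrite in_itv /= => /andP[s0 _]; rewrite muleA -EFinM.
  apply: lee_wpmul2r => //; rewrite lee_fin.
  apply: (@le_trans _ _ (expR (g * s))).
    by case: (0 < s); rewrite ?mul1r// mul0r expR_ge0.
  by rewrite ler_expR ler_wpM2r// ler_pMl// ler1n.
have -> : (\int[leb]_(s in I) (ek (2 * g) s * bb s) =
   \int[leb]_(s in I) ((expR (2 * g * s) - 1)%:E * bb s) + \int[leb]_(s in I) bb s)%E.
  have e1 s : 0 <= s -> (0 <= (expR (2 * g * s) - 1)%:E * bb s)%E.
    move=> s0; rewrite mule_ge0// lee_fin subr_ge0 -expR0 ler_expR.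
    by rewrite !mulr_ge0// ltW.
  rewrite -ge0_integralD//; first last.
  - apply: emeasurable_funM => //; apply/measurable_EFinP; apply: measurable_funB => //.
    by apply: measurable_funTS; (exact: mlt1 || exact: mexp).
  - by move=> s /=; rewrite in_itv /= => /andP[/e1].
  apply: eq_integral => s; rewrite mem_setE in_itv /= => /andP[s0 _].
  rewrite -[X in (_ + X)%E]mul1e -ge0_muleDl ?lee_fin//; last first.
    by rewrite subr_ge0 -expR0 ler_expR !mulr_ge0// ltW.
  by rewrite -EFinD subrK.
rewrite addeA; have -> : (3 / g)%:E = ((2 / g)%:E + g^-1%:E)%E by rewrite -EFinD; congr EFin; ring.
rewrite ge0_muleDl ?lee_fin; [|by rewrite divr_ge0// ltW|by rewrite invr_ge0 ltW].
exact: leeD first_estimate h0.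
Qed.

End weighted_estimate.

(** * Martingale representation *)

Lemma trace_mw_eq d (S : measurableType d) (R : realType) (D : set S) (H : set (set S)) (f g : S -> R) :
  (forall x, D x -> f x = g x) -> measurable_wrt (trace_sets D H) f -> measurable_wrt (trace_sets D H) g.
Proof.
move=> fg mf _ [B mB <-]; rewrite setTI /trace_sets /=.
rewrite (_ : D `&` g @^-1` B = D `&` f @^-1` B); last first.
  by apply/seteqP; split => x [Dx] /= h; split => //=; [rewrite fg|rewrite -fg].
by have := mf (f @^-1` B); rewrite /trace_sets /=; apply; exists B; rewrite ?setTI.
Qed.

(** Simple approximations of [v] reduce to indicators, which the hypothesis covers. Used for the two
    kinds of rectangles that generate the predictable sets. *)
Lemma mw_rectangle d (Omega : measurableType d) d' (S : measurableType d') (R : realType)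
  (H : set (set Omega)) (H' : set (set (Omega * S))) (v : Omega -> R) (E : set S) :
  sigma_algebra setT H -> sigma_algebra setT H' ->
  (forall C, H C -> H' (C `*` E)) -> measurable_wrt H v ->
  measurable_wrt H' (fun q : Omega * S => v q.1 * \1_E q.2).
Proof.
move=> sH sH' HE /(mw_approx sH)[vs [svs _ cvs]].
apply: (@mw_cvg _ _ _ H' sH' (fun n q => vs n q.1 * \1_E q.2)) => [n|q].
  elim: (svs n) => [|c B f HB _ IH].
    rewrite (_ : (fun q => _) = fun=> 0); first exact: mw_cst.
    by apply/funext => q; rewrite mul0r.
  rewrite (_ : (fun q => _) = fun q : Omega * S => c * \1_(B `*` E) q + f q.1 * \1_E q.2).
    apply: mwD => //; apply: mwM => //; first exact: mw_cst.
    by apply: mw_indic => //; exact: HE.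
  apply/funext => q; rewrite mulrDl -mulrA; congr (c * _ + _).
  rewrite !indicE -natrM mulnb; congr (nat_of_bool _)%:R.
  by rewrite in_setX.
by apply: cvgM; [exact: cvs|exact: cvg_cst].
Qed.

Section representation.
Context {R : realType} {d} {Omega : measurableType d}.
Variables (P : probability Omega R) (T : R) (N : nat) (A : 'M[R]_N) (c : R).
Variables (W : R -> Omega -> R) (X : R -> Omega -> 'cV[R]_N).
Hypotheses (hP : measure_is_complete P) (T0 : 0 < T) (hc : 0 < c < 1)
  (hA : rate_matrix A c) (hW : brownian_motion P T W) (hX : markov_chain P T A X)
  (hWX : independent P (filtrationX P X T) (filtrationW P W T))
  (hM : square_integrable_martingale P T (filtrationX P X) (chain_martingale A X)).

Local Notation leb := (@lebesgue_measure R).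
Local Notation PL := (P \x leb)%E.
Local Notation dom := (@domain R d Omega T).
Local Notation G := (filtrationG P W X).
Local Notation ip1 := (ip P setT).
Local Notation sqi1 := (sqi P setT).
Local Notation ip2 := (ip PL dom).
Local Notation sqi2 := (sqi PL dom).
Local Notation bsok := (blocks_ok T G).
Local Notation L := (noise A W X).
Local Notation rho := (@noise_rho R d Omega N A X).
Local Notation I bs := (blocks_int L bs).
Local Notation It t bs := (blocks_int_at L t bs).
Local Notation block := (@block R d Omega (option 'I_N)).
Implicit Types bs : seq block.

Let itg := noise_integrator hP T0 hc hA hW hX hWX hM.

Let mdom := @measurable_domain R d Omega T.

Let sG t : sigma_algebra setT (G t). Proof. exact: G_sigma. Qed.
Let GN t : P.-negligible `<=` G t. Proof. exact: G_negligible. Qed.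
Let Gm t : t <= T -> G t `<=` measurable.
Proof. by move=> tT; exact: (@G_sub _ _ _ P T N A W X hP hW hX t tT). Qed.
Let Gmono s t : s <= t -> G s `<=` G t. Proof. exact: G_mono. Qed.

Lemma noise_cadlag : {ae P, forall w, forall k, cadlag T (L k ^~ w)}.
Proof.
have [_ _ cW _] := hW; apply: filterS cW => w cW [i|]; last exact: cadlag_continuous.
rewrite /= (_ : (fun t => _) = fun t => (X t w i 0 - X 0 w i 0) -
   \int[leb]_(s in `[0, t]%classic) (A *m X s w) i 0); last first.
  by apply/funext => t; rewrite /chain_martingale !mxE.
apply: cadlagB; first by apply: cadlagB; [case: hX|exact: cadlag_cst].
apply: cadlag_continuous; apply: (parameterized_integral_continuous (ltW T0)).
exact: (AX_integrable T0 hX).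
Qed.

Definition chain_idx (i : 'I_N) : option 'I_N := Some i.
Definition brownian_idx (i : 'I_1) : option 'I_N := None.
Local Notation Wcol := (fun t w => const_mx (W t w) : 'cV[R]_1).

Lemma brownian_colE i t w : Wcol t w i 0 = L (brownian_idx i) t w.
Proof. by rewrite mxE. Qed.

Lemma chain_colE i t w : chain_martingale A X t w i 0 = L (chain_idx i) t w.
Proof. by []. Qed.

Lemma brownian_psiE q i j : dom q -> (1%:M : 'M[R]_1) i j =
  \sum_b rho b (brownian_idx i) q * rho b (brownian_idx j) q.
Proof.
move=> _; rewrite big_option /= mulr1 big1 ?addr0; last by move=> b _; rewrite mulr0.
by rewrite (ord1 i) (ord1 j) mxE.
Qed.

Lemma chain_psiE q i j : dom q -> psi A X q.2 q.1 i j =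
  \sum_b rho b (chain_idx i) q * rho b (chain_idx j) q.
Proof.
move=> dq; rewrite big_option /= mulr0 add0r.
by rewrite -(psiLE T0 hA hX i j dq) -(sum_rho T0 hc hA hX i j dq).
Qed.

Lemma rho_proc_brownian (Z : R -> Omega -> R) b q :
  rho_proc rho brownian_idx (fun t w => const_mx (Z t w)) b q = (b == None)%:R * Z q.2 q.1.
Proof.
rewrite /rho_proc big_ord_recl big_ord0 addr0 mxE.
by case: b => [b|] /=; rewrite ?mul0r ?mul1r.
Qed.

Lemma rho_proc_chain_None (Z : R -> Omega -> 'cV[R]_N) q : rho_proc rho chain_idx Z None q = 0.
Proof. by rewrite /rho_proc big1// => i _; rewrite mul0r. Qed.

Lemma rho_proc_chain (Z : R -> Omega -> 'cV[R]_N) b q a : (forall j, XL X j q = (j == a)%:R) ->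
  rho_proc rho chain_idx Z (Some b) q = Num.sqrt (A b a) * (Z q.2 q.1 b 0 - Z q.2 q.1 a 0).
Proof.
move=> Xa; rewrite /rho_proc.
under eq_bigr do rewrite (noise_rho_index _ _ _ Xa) -mulrA mulrBl.
rewrite -mulr_sumr sumrB (bigD1 b)//= eqxx mul1r big1 => [|i ib]; last first.
  by rewrite eq_sym (negbTE ib) mul0r.
rewrite (bigD1 a)//= eqxx mul1r big1 => [|i ia]; last by rewrite eq_sym (negbTE ia) mul0r.
by rewrite !addr0.
Qed.

Lemma seminorm2_rho (Z : R -> Omega -> 'cV[R]_N) q : dom q ->
  seminorm2 A X q.2 q.1 (Z q.2 q.1) = \sum_b (rho_proc rho chain_idx Z (Some b) q) ^+ 2.
Proof.
move=> dq; rewrite /seminorm2 (qform_rho chain_psiE _ dq) big_option /=.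
by rewrite -/(rho_proc rho chain_idx Z None q) rho_proc_chain_None expr0n add0r.
Qed.

(** The integrand against the martingale [k] itself, before multiplication by [rho]. *)
Definition coefs bs k (q : Omega * R) : R :=
  \sum_(b <- bs) (b_idx b == k)%:R * (b_val b q.1 * (b_lo b < q.2 <= b_hi b)%R%:R).

Lemma blocks_proc_coefs bs b q : blocks_proc rho bs b q = \sum_k rho b k q * coefs bs k q.
Proof.
rewrite /coefs; under [RHS]eq_bigr do rewrite mulr_sumr.
rewrite exchange_big /=; apply: eq_bigr => bl _; rewrite /block_proc.
rewrite (bigD1 (b_idx bl))//= eqxx mul1r big1 ?addr0; first by ring.
by move=> k kb; rewrite eq_sym (negbTE kb) mul0r mulr0.
Qed.

Lemma blocks_proc_None bs q : blocks_proc rho bs None q = coefs bs None q.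
Proof. by rewrite blocks_proc_coefs big_option /= mul1r big1 ?addr0// => i _; rewrite mul0r. Qed.

Lemma blocks_proc_Some bs b q a : (forall j, XL X j q = (j == a)%:R) ->
  blocks_proc rho bs (Some b) q = Num.sqrt (A b a) * (coefs bs (Some b) q - coefs bs (Some a) q).
Proof.
move=> Xa; rewrite blocks_proc_coefs big_option /= mul0r add0r.
have := rho_proc_chain (fun t w => \col_i coefs bs (Some i) (w, t)) b Xa.
rewrite /= !mxE -!surjective_pairing => <-; rewrite /rho_proc.
by apply: eq_bigr => i _; rewrite mxE -surjective_pairing.
Qed.

Lemma coefs_adapted bs k t : bsok bs -> 0 <= t <= T ->
  measurable_wrt (G t) (fun w => coefs bs k (w, t)).
Proof.
move=> + tT; elim: bs => [_|b bs IH [[lo lohi hi mb _] okbs]].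
  rewrite (_ : (fun w => _) = fun=> 0); first exact: mw_cst.
  by apply/funext => w; rewrite /coefs big_nil.
rewrite (_ : (fun w => _) = fun w => (b_idx b == k)%:R * (b_val b w * (b_lo b < t <= b_hi b)%R%:R) + coefs bs k (w, t)); last first.
  by apply/funext => w; rewrite /coefs big_cons.
apply: mwD => //; last exact: IH.
apply: mwM => //; first exact: mw_cst.
have [/andP[lt _]|_] := boolP (b_lo b < t <= b_hi b).
  by apply: mwM => //; [apply: mwS mb; exact: Gmono (ltW lt)|exact: mw_cst].
rewrite (_ : (fun w => _) = fun=> 0); first exact: mw_cst.
by apply/funext => w; rewrite mulr0.
Qed.

Local Notation Pred := (@trace_sets _ (OxR Omega R) dom (predictable_sets T G)).

Let sPred : sigma_algebra setT Pred.
Proof. by apply: trace_sigma; exact: smallest_sigma_algebra. Qed.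

Lemma predictable_rectangle (v : Omega -> R) (s t : R) : 0 <= s -> s <= t -> t <= T -> measurable_wrt (G s) v ->
  measurable_wrt Pred (fun q : OxR Omega R => v q.1 * (s < q.2 <= t)%R%:R).
Proof.
move=> s0; rewrite le_eqVlt => /predU1P[<- _ _|st tT mv].
  rewrite (_ : (fun q => _) = fun=> 0); first exact: mw_cst.
  by apply/funext => q; case: ltP => //=; rewrite ?mulr0// leNgt => ->; rewrite mulr0.
rewrite (_ : (fun q => _) = fun q : Omega * R => v q.1 * \1_(`]s, t]%classic) q.2); last first.
  by apply/funext => q; rewrite itv_indicE.
apply: (mw_rectangle (sG s)) => // C GC; rewrite /trace_sets /=.
have -> : dom `&` (C `*` `]s, t]) = C `*` `]s, t]%classic.
  apply/seteqP; split => q /=; first by move=> [].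
  move=> [Cq qst]; split => //; split => //=; move: qst; rewrite /= !in_itv /= => /andP[sq qt].
  by rewrite (le_trans s0 (ltW sq)) (le_trans qt).
by apply: sub_sigma_algebra; right; exists s, t, C.
Qed.

Lemma predictable0 (v : Omega -> R) : measurable_wrt (G 0) v ->
  measurable_wrt Pred (fun q : OxR Omega R => (q.2 == 0)%:R * v q.1).
Proof.
move=> mv; rewrite (_ : (fun q => _) = fun q : Omega * R => v q.1 * \1_([set 0]) q.2); last first.
  apply/funext => q; rewrite mulrC indicE; congr (_ * (nat_of_bool _)%:R).
  by apply/eqP/idP; rewrite inE.
apply: (mw_rectangle (sG 0)) => // C GC; rewrite /trace_sets /=.
have -> : dom `&` (C `*` [set 0]) = C `*` [set (0 : R)].
  apply/seteqP; split => q /=; first by move=> [].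
  by move=> [Cq /= q0]; split => //; split => //=; rewrite q0 in_itv /= lexx ltW.
by apply: sub_sigma_algebra; left; exists C.
Qed.

Lemma coefs_predictable bs k : bsok bs -> measurable_wrt Pred (coefs bs k).
Proof.
elim: bs => [_|b bs IH [[lo lohi hi mb _] okbs]].
  rewrite (_ : coefs _ _ = fun=> 0); first exact: mw_cst.
  by apply/funext => w; rewrite /coefs big_nil.
rewrite (_ : coefs _ _ = fun q => (b_idx b == k)%:R *
  (b_val b q.1 * (b_lo b < q.2 <= b_hi b)%R%:R) + coefs bs k q); last first.
  by apply/funext => w; rewrite /coefs big_cons.
apply: mwD => //; last exact: IH.
by apply: mwM => //; [exact: mw_cst|exact: predictable_rectangle].
Qed.

(** On the domain [XL] is the limit of the [XLn], sums of indicators of left-open intervals weighted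
    by variables known at their left end points, with a term at time 0. *)
Lemma XL_predictable a : measurable_wrt Pred (XL X a).
Proof.
apply: (@trace_mw_eq _ (OxR Omega R) R dom _ (flim (fun n => XLn T X n a))).
  by move=> q dq; apply: flimE; exact: (XL_cvg T0 hX).
apply: mw_flim => // n; apply: mwD => //.
  by apply: (@predictable0 (fun w => X 0 w a 0)); apply: (@X_adaptedG _ _ _ P T); rewrite lexx ltW.
have pT k := @part_itv _ T n k (ltW T0).
apply: mw_sum => // k; have k1 := ltn_ord k.
have /andP[p0 pT0] := pT k (ltnW k1); have /andP[p1 pT1] := pT k.+1 k1.
apply: (@predictable_rectangle (fun w => X (part 0 T n k) w a 0)) => //; first by apply: part_mono => //; exact: ltW.
by apply: (@X_adaptedG _ _ _ P T); rewrite p0.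
Qed.

Lemma predictable_measurable : predictable_sets T G `<=` @measurable _ (OxR Omega R).
Proof.
apply: smallest_sub.
  split => [|B mB|F mF]; [exact: measurable0|exact: measurableD|].
  exact: bigcupT_measurable.
move=> B [[C GC ->]|[s [t [C [s0 st tT GC ->]]]]].
  by apply: measurableX; [apply: Gm GC; exact: ltW|exact: measurable_set1].
apply: measurableX; last exact: measurable_itv.
by apply: Gm GC; exact: le_trans (ltW st) tT.
Qed.

Lemma predictable_measurable_fun (f : OxR Omega R -> R) :
  measurable_wrt Pred f -> measurable_fun dom f.
Proof.
move=> /(@trace_mw _ (OxR Omega R) R dom (predictable_sets T G)) mf.
apply/(@trace_measurable_fun _ (OxR Omega R) R dom mdom).
apply/(@trace_mw _ (OxR Omega R) R dom).
by apply: subset_trans mf _; exact: predictable_measurable.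
Qed.

Section limit_integrands.
Variable bs : nat -> seq block.
Hypothesis okbs : forall n, bsok (bs n).
Hypothesis fast : forall n, ip1 (I (bs n.+1) \- I (bs n)) (I (bs n.+1) \- I (bs n)) <= (8^-1) ^+ n.

Definition lim_brownian (t : R) (w : Omega) : R := flim (fun n => coefs (bs n) None) (w, t).

(** The seminorm sees only the differences between the entries of an integrand and its entry at the
    current state. Subtracting the latter, written as a sum against [XL], selects the representative
    that vanishes at the current state; without it the entries of the approximations need not
    converge. Being a pointwise limit of predictable processes, it is predictable without
    modification. *)
Definition lim_chain (t : R) (w : Omega) : 'cV[R]_N :=
  \col_j flim (fun n q => coefs (bs n) (Some j) q - \sum_a XL X a q * coefs (bs n) (Some a) q) (w, t).

Lemma blocks_proc_fast b n : ip2 (blocks_proc rho (bs n.+1) b \- blocks_proc rho (bs n) b)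
  (blocks_proc rho (bs n.+1) b \- blocks_proc rho (bs n) b) <= (8^-1) ^+ n.
Proof.
have okd := blocks_sub_ok itg (okbs n.+1) (okbs n).
rewrite -blocks_sub_proc; apply: le_trans (fast n); rewrite -blocks_sub_int (blocks_isom itg okd okd).
by rewrite [leRHS](bigD1 b)//= lerDl sumr_ge0// => k _; exact: ip_ge0.
Qed.

Let proc_flim b := l2cvg_flim mdom (fun n => blocks_proc_sqi itg b (okbs n)) (blocks_proc_fast b).

Lemma lim_brownian_proc : sqi2 (fun q => lim_brownian q.2 q.1) /\
  l2cvg PL dom (fun n => blocks_proc rho (bs n) None) (fun q => lim_brownian q.2 q.1).
Proof.
have -> : (fun q => lim_brownian q.2 q.1) = flim (fun n => blocks_proc rho (bs n) None).
  apply/funext => q; rewrite /lim_brownian -surjective_pairing; congr (flim _ q).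
  by apply/funext => n; apply/funext => q'; rewrite blocks_proc_None.
exact: proc_flim.
Qed.

Lemma lim_brownian_adapted : adapted T G lim_brownian.
Proof. by move=> t tT; apply: mw_flim => // n; exact: coefs_adapted. Qed.

Lemma lim_chain_predictable : predictable T G lim_chain.
Proof.
move=> i; apply/(@trace_mw _ (OxR Omega R) R dom (predictable_sets T G)).
rewrite (_ : (fun p => _) = flim (fun n q => coefs (bs n) (Some i) q - \sum_a XL X a q * coefs (bs n) (Some a) q)); last first.
  by apply/funext => q; rewrite mxE -surjective_pairing.
apply: mw_flim => // n; apply: mwB => //; first exact: coefs_predictable.
by apply: mw_sum => // a; apply: mwM => //; [exact: XL_predictable|exact: coefs_predictable].
Qed.

Let lim_chain_index q j a : (forall i, XL X i q = (i == a)%:R) ->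
  lim_chain q.2 q.1 j 0 = flim (fun n q => coefs (bs n) (Some j) q - coefs (bs n) (Some a) q) q.
Proof.
move=> Xa; rewrite mxE -surjective_pairing /flim; congr fine; congr limn_esup.
apply/funext => n; congr EFin; congr (_ - _); rewrite (bigD1 a)//= Xa eqxx mul1r big1 ?addr0// => i ia.
by rewrite Xa (negbTE ia) mul0r.
Qed.

Lemma rho_lim_chain_measurable b : measurable_fun dom (rho_proc rho chain_idx lim_chain b).
Proof.
apply: measurable_sum => i; apply: measurable_funM; first exact: (itg_rho itg).
apply: predictable_measurable_fun.
by apply/(@trace_mw _ (OxR Omega R) R dom); exact: lim_chain_predictable.
Qed.

(** Entry [b] of the normalised integrand is component [b] divided by [Num.sqrt (A b a)], which is
    positive for [b] other than the current state [a] by the lower bound on the rates. Convergence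
    of the components thus gives convergence of the entries. *)
Lemma lim_chain_proc b : sqi2 (rho_proc rho chain_idx lim_chain (Some b)) /\
  l2cvg PL dom (fun n => blocks_proc rho (bs n) (Some b)) (rho_proc rho chain_idx lim_chain (Some b)).
Proof.
have [cv _ _] := flim_fast mdom (fun n => blocks_proc_sqi itg (Some b) (okbs n)) (blocks_proc_fast (Some b)).
have [sl lF] := proc_flim (Some b); set F := flim _ in cv sl lF.
have eF : {ae PL, forall q, dom q -> rho_proc rho chain_idx lim_chain (Some b) q = F q}.
  apply: filterS cv => q h dq; have {}h := h dq; have [a Xa] := XL_index T0 hX dq.
  rewrite (rho_proc_chain _ _ Xa) !(lim_chain_index _ Xa).
  have fl0 : flim (fun n q => coefs (bs n) (Some a) q - coefs (bs n) (Some a) q) q = 0.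
    by apply: flimE; rewrite (_ : (fun n => _) = fun=> 0); [exact: cvg_cst|apply/funext => n; rewrite subrr].
  rewrite fl0; have [eba|ba] := eqVneq b a.
    rewrite eba fl0 subr0 mulr0; apply/esym/flimE.
    rewrite (_ : (fun n => _) = fun=> 0); first exact: cvg_cst.
    by apply/funext => n; rewrite (blocks_proc_Some _ _ Xa) eba subrr mulr0.
  have s0 : Num.sqrt (A b a) != 0.
    rewrite gt_eqF// sqrtr_gt0; case: hA => _ /(_ b a ba)/andP[cA _].
    by case/andP: hc => c0 _; exact: lt_le_trans cA.
  rewrite subr0 (flimE (l := (Num.sqrt (A b a))^-1 * F q)); first by rewrite mulrA mulfV// mul1r.
  rewrite (_ : (fun n => _) = fun n => (Num.sqrt (A b a))^-1 * blocks_proc rho (bs n) (Some b) q).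
    by apply: cvgM => //; exact: cvg_cst.
  by apply/funext => n; rewrite (blocks_proc_Some _ _ Xa) mulrA mulVf// mul1r.
have mZ := rho_lim_chain_measurable (Some b).
split; first exact: (ae_sqi mdom mZ sl eF).
apply: (l2cvg_ae mdom _ mZ _ _ lF); [by case: sl|by move=> n; case: (blocks_proc_sqi itg (Some b) (okbs n))|].
by apply: negligibleS eF => q /= nh h; apply: nh => dq; rewrite /= h.
Qed.

Lemma lim_brownian_M2 : M2 P T G lim_brownian.
Proof.
have [[m i] _] := lim_brownian_proc.
by split => //; exact: lim_brownian_adapted.
Qed.

Lemma lim_chain_P2 : P2 P T A G X lim_chain.
Proof.
split; first exact: lim_chain_predictable.
have -> : (\int[PL]_(q in dom) (seminorm2 A X q.2 q.1 (lim_chain q.2 q.1))%:E =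
    \int[PL]_(q in dom) \sum_b ((rho_proc rho chain_idx lim_chain (Some b) q) ^+ 2)%:E)%E.
  by apply: eq_integral => q; rewrite inE => dq; rewrite seminorm2_rho// sumEFin.
rewrite ge0_integral_sum//.
- apply: lte_sum_pinfty => b _; by have [[]] := lim_chain_proc b.
- move=> b; apply/measurable_EFinP; apply: measurable_funX; exact: rho_lim_chain_measurable.
- by move=> b q _; rewrite lee_fin sqr_ge0.
Qed.

End limit_integrands.

Local Notation part_of s bs := (seq.filter (fun b : block => (b_idx b == None) == s) bs).

Lemma blocks_ok_filter (p : pred block) bs : bsok bs -> bsok (seq.filter p bs).
Proof. by elim: bs => //= b bs IH [okb okbs]; case: ifP => _ /=; [split => //|]; exact: IH. Qed.

Lemma blocks_proc_part s bs b q :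
  blocks_proc rho (part_of s bs) b q = ((b == None) == s)%:R * blocks_proc rho bs b q.
Proof.
rewrite /blocks_proc big_filter big_mkcond mulr_sumr; apply: eq_bigr => bl _.
rewrite /block_proc; have [|nb] := boolP ((b == None) == (b_idx bl == None)); last first.
  have -> : rho b (b_idx bl) q = 0 by case: b nb => [b|]; case: (b_idx bl).
  by rewrite !mulr0 if_same.
by move=> /eqP ->; case: ifP => _; rewrite ?mul1r ?mul0r.
Qed.

(** [rho] does not mix [W] with the chain, so that selecting the blocks of one kind acts as a
    coordinate projection on the components. *)
Lemma blocks_part_isom s bs : bsok bs -> ip1 (I (part_of s bs)) (I (part_of s bs)) <= ip1 (I bs) (I bs).
Proof.
move=> okbs; have okp := blocks_ok_filter (fun b : block => (b_idx b == None) == s) okbs.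
rewrite (blocks_isom itg okp okp) (blocks_isom itg okbs okbs).
apply: ler_sum => b _; apply: ip_le => //; first by case: (blocks_proc_sqi itg b okp).
- exact: (blocks_proc_sqi itg).
- move=> q _; rewrite blocks_proc_part normrM ler_piMl//.
  by case: (_ == _); rewrite ?normr1 ?normr0.
Qed.

Lemma blocks_part_sum bs w : I bs w = I (part_of true bs) w + I (part_of false bs) w.
Proof.
rewrite /blocks_int !big_filter (bigID (fun b => b_idx b == None)) /=.
by congr (_ + _); apply: eq_bigl => b; case: (_ == None).
Qed.

Lemma blocks_orth xi bs : bsok bs -> measurable_wrt (G 0) xi -> sqi1 xi -> ip1 xi (I bs) = 0.
Proof.
move=> okbs mxi sxi; have T00 : 0 <= (0 : R) <= T by rewrite lexx ltW.
rewrite -(blocks_tail_orth itg T00 okbs mxi sxi); congr (ip1 xi (blocks_int L _)).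
elim: bs okbs => //= b bs IH [[lo lohi _ _ _] okbs]; rewrite -IH//.
by rewrite /block_tail (max_idPl lo) (max_idPl (le_trans lo lohi)); case: b {lo lohi}.
Qed.

(** The approximations, an initial variable [u n] plus an integral, form a fast Cauchy sequence. The
    integral of a difference is orthogonal to [G 0], so by Pythagoras the initial variables and the
    integrals are Cauchy separately, and projection separates the Brownian blocks from those of the
    chain. The sum of the three limits is identified with [xi] in L^2. *)
Theorem representation xi : measurable_wrt (G T) xi -> sqi1 xi ->
  exists U0 J1 J2 Z1 Z2,
  [/\ [/\ measurable_wrt (G 0) U0, sqi1 U0, M2 P T G Z1 & P2 P T A G X Z2],
      [/\ is_ito_integral P T G W Z1 J1,
          is_stochastic_integral P T G (chain_martingale A X) (psi A X) Z2 J2,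
          forall w, cadlag T (J1 ^~ w) & forall w, cadlag T (J2 ^~ w)],
      forall w, J1 0 w = 0 /\ J2 0 w = 0,
      forall t, 0 <= t <= T -> sqi1 (J1 t) /\ sqi1 (J2 t) &
      {ae P, forall w, xi w = U0 w + J1 T w + J2 T w}].
Proof.
move=> mxi sxi; have [_ rep] := representable_L2 hP T0 hc hA hW hX hWX hM mxi sxi.
have en (n : nat) : 0 < (8^-1 : R) ^+ n / 4 by rewrite divr_gt0// exprn_gt0.
have /choice[x hx] : forall n : nat, exists x : (Omega -> R) * seq block,
    [/\ measurable_wrt (G 0) x.1, sqi1 x.1, bsok x.2 &
      ip1 (xi \- (x.1 \+ I x.2)) (xi \- (x.1 \+ I x.2)) <= (8^-1 : R) ^+ n / 4].
  by move=> n; have [y [bs h]] := rep _ (en n); exists (y, bs).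
pose u n := (x n).1; pose bs n := (x n).2.
have okbs n : bsok (bs n) by case: (hx n).
have mu0 n : measurable_wrt (G 0) (u n) by case: (hx n).
have su n : sqi1 (u n) by case: (hx n).
have sI n : sqi1 (I (bs n)) by exact: (blocks_int_sqi itg).
have sv n : sqi1 (u n \+ I (bs n)) by exact: sqiD.
pose D n := blocks_sub (bs n.+1) (bs n).
have okD n : bsok (D n) by exact: (blocks_sub_ok itg).
have DI n : I (D n) = I (bs n.+1) \- I (bs n) by exact: blocks_sub_int.
have small n : ip1 (u n.+1 \- u n) (u n.+1 \- u n) + ip1 (I (D n)) (I (D n)) <= (8^-1) ^+ n.
  have sdu := sqiB measurableT (su n.+1) (su n).
  have mdu : measurable_wrt (G 0) (u n.+1 \- u n) by exact: (@mwB _ _ _ (G 0) (sG 0) _ _ (mu0 n.+1) (mu0 n)).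
  have := ipDD measurableT sdu (blocks_int_sqi itg (okD n)).
  rewrite (blocks_orth (okD n) mdu sdu) mulr0 addr0 => <-.
  rewrite (_ : (u n.+1 \- u n) \+ I (D n) = (u n.+1 \+ I (bs n.+1)) \- (u n \+ I (bs n))); last first.
    by rewrite DI; apply/funext => w /=; ring.
  apply: (le_trans (ip_dist_le2 measurableT (sv n.+1) sxi (sv n))).
  have [_ _ _ h1] := hx n.+1; have [_ _ _ h2] := hx n.
  rewrite (ipBC _ _ _ xi).
  have h3 : (8^-1 : R) ^+ n.+1 <= (8^-1) ^+ n.
    by rewrite exprS ler_piMl ?exprn_ge0// invf_le1// ler1n.
  move: h1 h2; rewrite -/(u n.+1) -/(bs n.+1) -/(u n) -/(bs n); lra.
have fastu n : ip1 (u n.+1 \- u n) (u n.+1 \- u n) <= (8^-1) ^+ n.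
  by apply: le_trans (small n); rewrite lerDl ip_ge0.
have fastI n : ip1 (I (bs n.+1) \- I (bs n)) (I (bs n.+1) \- I (bs n)) <= (8^-1) ^+ n.
  by rewrite -DI; apply: le_trans (small n); rewrite lerDr ip_ge0.
pose bp s n := part_of s (bs n).
have okp s n : bsok (bp s n) by exact: blocks_ok_filter.
have fastp s n : ip1 (I (bp s n.+1) \- I (bp s n)) (I (bp s n.+1) \- I (bp s n)) <= (8^-1) ^+ n.
  apply: le_trans (fastI n); rewrite -DI; apply: le_trans (blocks_part_isom s (okD n)).
  by rewrite /D /blocks_sub filter_cat filter_map -/(blocks_sub _ _) blocks_sub_int.
have ints s := integral_exists itg T0 GN noise_cadlag (okp s) (fastp s).
have [J1 [aJ1 cJ1 zJ1 hJ1]] := ints true.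
have [J2 [aJ2 cJ2 zJ2 hJ2]] := ints false.
have [sU0 lu] := l2cvg_flim measurableT su fastu.
have z0 : sqi2 (fun=> 0) /\ l2cvg PL dom (fun _ : nat => fun=> 0) (fun=> 0).
  by split; [exact: sqi0|exact: l2cvg_cst].
exists (flim u), J1, J2, (lim_brownian bs), (lim_chain bs); split.
- split => //; first exact: mw_flim.
  + exact: lim_brownian_M2.
  + exact: lim_chain_P2.
- split => //.
  + apply: (@stochastic_of_blocks _ _ _ P T _ _ L G rho itg T0 _ brownian_idx Wcol _ _ brownian_colE
      brownian_psiE _ _ (bp true)) => //.
    * by move=> i j _; rewrite (ord1 i) (ord1 j).
    * move=> n; rewrite all_filter (eq_all (a2 := predT)) ?all_predT// => b /=.
      by case: (b_idx b) => //=; exact: (codom_f brownian_idx ord0).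
    * move=> [b|].
        rewrite (_ : rho_proc _ _ _ _ = fun=> 0); last first.
          by apply/funext => q; rewrite rho_proc_brownian mul0r.
        rewrite (_ : (fun n => _) = fun=> fun=> 0); first exact: z0.
        by apply/funext => n; apply/funext => q; rewrite blocks_proc_part mul0r.
      rewrite (_ : rho_proc _ _ _ _ = fun q => lim_brownian bs q.2 q.1); last first.
        by apply/funext => q; rewrite rho_proc_brownian mul1r.
      rewrite (_ : (fun n => _) = fun n => blocks_proc rho (bs n) None); first exact: lim_brownian_proc.
      by apply/funext => n; apply/funext => q; rewrite blocks_proc_part mul1r.
  + apply: (@stochastic_of_blocks _ _ _ P T _ _ L G rho itg T0 _ chain_idx _ _ _ chain_colE
      chain_psiE _ _ (bp false)) => //.
    * move=> n; rewrite all_filter (eq_all (a2 := predT)) ?all_predT// => b /=.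
      by case: (b_idx b) => //= i; exact: (codom_f chain_idx i).
    * move=> [b|]; last first.
        rewrite (_ : rho_proc _ _ _ _ = fun=> 0); last first.
          by apply/funext => q; exact: rho_proc_chain_None.
        rewrite (_ : (fun n => _) = fun=> fun=> 0); first exact: z0.
        by apply/funext => n; apply/funext => q; rewrite blocks_proc_part mul0r.
      rewrite (_ : (fun n => _) = fun n => blocks_proc rho (bs n) (Some b)); first exact: lim_chain_proc.
      by apply/funext => n; apply/funext => q; rewrite blocks_proc_part mul1r.
- by [].
- by move=> t tT; split; [case: (hJ1 t tT)|case: (hJ2 t tT)].
- have TT : 0 <= T <= T by rewrite lexx ltW.
  have [s1 l1] := hJ1 T TT; have [s2 l2] := hJ2 T TT.
  have sIp s n : sqi1 (I (bp s n)) by exact: (blocks_int_sqi itg).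
  have lI s J : l2cvg P setT (fun n => It T (bp s n)) J -> l2cvg P setT (fun n => I (bp s n)) J.
    by rewrite (_ : (fun n => It T _) = fun n => I (bp s n))//; apply/funext => n; exact: (blocks_int_atT L (okp s n)).
  have lsum : l2cvg P setT (fun n => u n \+ I (bs n)) (flim u \+ (J1 T \+ J2 T)).
    rewrite (_ : (fun n => _) = fun n => u n \+ (I (bp true n) \+ I (bp false n))); last first.
      by apply/funext => n; apply/funext => w /=; rewrite blocks_part_sum.
    apply: l2cvgD => //; first by move=> n; exact: sqiD.
    + exact: sqiD.
    + by apply: l2cvgD => //; exact: lI.
  have lxi : l2cvg P setT (fun n => u n \+ I (bs n)) xi.
    apply: (@l2cvg_geometric _ _ _ P setT _ _ 1 (8^-1)); first by lra.
    move=> n; have [_ _ _ h] := hx n; rewrite mul1r.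
    apply: (@le_trans _ _ ((8^-1) ^+ n / 4)); last by rewrite ler_piMr ?exprn_ge0//; lra.
    by rewrite ipBC.
  have sJ : sqi1 (flim u \+ (J1 T \+ J2 T)) by apply: sqiD => //; exact: sqiD.
  have := ip_eq0_ae measurableT (sqiB measurableT sxi sJ) (l2cvg_unique measurableT sv sxi sJ lxi lsum).
  by apply: filterS => w /(_ Logic.I) /= h; rewrite -addrA; apply/eqP; rewrite -subr_eq0 h.
Qed.

End representation.

(** * The driver *)

Lemma qformZ (R : realType) m (a : R) (C : 'cV[R]_m) psi : qform (a *: C) psi = a ^+ 2 * qform C psi.
Proof. by rewrite /qform -scalemxAr linearZ /= -scalemxAl -scalemxAl !mxE expr2 mulrA. Qed.

Lemma qform0 (R : realType) m (psi : 'M[R]_m) : qform 0 psi = 0.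
Proof. by rewrite /qform mulmx0 mxE. Qed.

Lemma mw_subst3 d (S : measurableType d) (R : realType) m (H : set (set S))
  (Phi : S -> R -> R -> 'cV[R]_m -> R) (y z1 : S -> R) (z2 : S -> 'cV[R]_m) :
  sigma_algebra setT H -> (forall a b v, measurable_wrt H (fun x => Phi x a b v)) ->
  (forall x b v, continuous (fun a => Phi x a b v)) ->
  (forall x a v, continuous (fun b => Phi x a b v)) ->
  (forall x a b v k, continuous (fun r : R => Phi x a b (v + r *: delta_mx k 0))) ->
  measurable_wrt H y -> measurable_wrt H z1 -> (forall i, measurable_wrt H (fun x => z2 x i 0)) ->
  measurable_wrt H (fun x => Phi x (y x) (z1 x) (z2 x)).
Proof.
move=> sH mPhi c1 c2 c3 my mz1 mz2.
apply: (mw_subst_col sH (Phi := fun x v => Phi x (y x) (z1 x) v)) => // v.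
apply: (mw_subst sH (Phi := fun x b => Phi x (y x) b v)) => // b.
by apply: (mw_subst sH (Phi := fun x a => Phi x a b v)).
Qed.

Section generator.
Context {R : realType} {d} {Omega : measurableType d}.
Variables (P : probability Omega R) (T : R) (N : nat) (A : 'M[R]_N) (c : R).
Variables (W : R -> Omega -> R) (X : R -> Omega -> 'cV[R]_N) (F : driver R Omega N).
Hypotheses (hP : measure_is_complete P) (T0 : 0 < T) (hc : 0 < c < 1)
  (hA : rate_matrix A c) (hW : brownian_motion P T W) (hX : markov_chain P T A X)
  (hWX : independent P (filtrationX P X T) (filtrationW P W T))
  (hM : square_integrable_martingale P T (filtrationX P X) (chain_martingale A X))
  (hF1 : driver_M2 P T W X F) (hF2 : driver_lipschitz T A X F).

Local Notation leb := (@lebesgue_measure R).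
Local Notation PL := (P \x leb)%E.
Local Notation dom := (@domain R d Omega T).
Local Notation G := (filtrationG P W X).
Local Notation sqi1 := (sqi P setT).
Local Notation ip1 := (ip P setT).
Local Notation ip2 := (ip PL dom).
Local Notation sqi2 := (sqi PL dom).
Local Notation rho := (@noise_rho R d Omega N A X).

Local Notation ci := (@chain_idx N).

Let itg := noise_integrator hP T0 hc hA hW hX hWX hM.

Let mdom := @measurable_domain R d Omega T.

Let sG t : sigma_algebra setT (G t). Proof. exact: G_sigma. Qed.
Let GN t : P.-negligible `<=` G t. Proof. exact: G_negligible. Qed.
Let Gm t : t <= T -> G t `<=` measurable.
Proof. by move=> tT; exact: (@G_sub _ _ _ P T N A W X hP hW hX t tT). Qed.
Let Gmono s t : s <= t -> G s `<=` G t. Proof. exact: G_mono. Qed.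

Definition generator (Y Z1 : R -> Omega -> R) (Z2 : R -> Omega -> 'cV[R]_N) (q : Omega * R) : R :=
  F q.1 q.2 (Y q.2 q.1) (Z1 q.2 q.1) (Z2 q.2 q.1) (X q.2 q.1).

Let states_basis a : states (basis_vec a : 'cV[R]_N). Proof. by exists a. Qed.

(** Along a coordinate axis the squared seminorm of a difference is a multiple of the squared
    difference of the coordinates, so the Lipschitz condition yields continuity in each real
    argument separately. *)
Lemma driver_continuous w t a : 0 <= t <= T ->
  [/\ forall z1 z2, continuous (fun y => F w t y z1 z2 (basis_vec a)),
      forall y z2, continuous (fun z1 => F w t y z1 z2 (basis_vec a)) &
      forall y z1 v k, continuous (fun r : R => F w t y z1 (v + r *: delta_mx k 0) (basis_vec a))].
Proof.
move=> tT; have [mu mu0 lip] := hF2; split.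
- move=> z1 z2; apply: (@lipschitz_sqr_continuous _ _ mu) => x y.
  apply: (le_trans (lip w t _ x y z1 z1 z2 z2 tT (states_basis a))).
  by rewrite !subrr /seminorm2 qform0 normr0 expr0n /= !addr0 real_normK ?num_real.
- move=> y0 z2; apply: (@lipschitz_sqr_continuous _ _ mu) => x y.
  apply: (le_trans (lip w t _ y0 y0 x y z2 z2 tT (states_basis a))).
  by rewrite !subrr /seminorm2 qform0 normr0 expr0n /= add0r addr0 real_normK ?num_real.
- move=> y0 z1 v k; apply: (@lipschitz_sqr_continuous _ _ (mu * qform (delta_mx k 0) (psi A X t w))) => x y.
  apply: (le_trans (lip w t _ y0 y0 z1 z1 _ _ tT (states_basis a))).
  rewrite !subrr normr0 expr0n /= !add0r opprD addrACA subrr add0r -scalerBl.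
  by rewrite /seminorm2 qformZ le_eqVlt; apply/orP; left; apply/eqP; ring.
Qed.

(** Measurability of [F] is assumed for a fixed state; the sum over states reduces the random state
    to that case. *)
Lemma driver_states w t y z1 z2 : 0 <= t <= T ->
  F w t y z1 z2 (X t w) = \sum_a X t w a 0 * F w t y z1 z2 (basis_vec a).
Proof.
move=> tT; have [sX _ _ _] := hX; have [a _ <-] := sX t w tT.
rewrite (bigD1 a)//= /basis_vec mxE !eqxx mul1r big1 ?addr0// => b ba.
by rewrite mxE (negbTE ba) mul0r.
Qed.

Section generator_process.
Variables (Y Z1 : R -> Omega -> R) (Z2 : R -> Omega -> 'cV[R]_N).
Hypotheses (hY : M2 P T G Y) (hZ1 : M2 P T G Z1) (hZ2 : P2 P T A G X Z2).

(** The sets whose section at time [t] lies in [G t] form a sigma-algebra that contains the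
    generating rectangles. *)
Lemma predictable_adapted i t : 0 <= t <= T -> measurable_wrt (G t) (fun w => Z2 t w i 0).
Proof.
move=> tT _ [B mB <-]; rewrite setTI; have [/(_ i) pZ _] := hZ2.
have dt w : dom (w, t) by split => //=; rewrite in_itv.
pose S : set (set (Omega * R)) := [set E | G t [set w | E (w, t)]].
suff sub : predictable_sets T G `<=` S.
  have := sub _ (pZ _ (ex_intro2 _ _ B mB erefl)); rewrite /S /=.
  by congr (G t); apply/seteqP; split => w //= [].
have [G0 GD GU] := sG t.
apply: smallest_sub.
  split; first exact: G0.
  - move=> E SE; rewrite /S /= (_ : mkset _ = setT `\` [set w | E (w, t)]); first exact: GD.
    by apply/seteqP; split => w /= [_ h]; split => //; exact: dt.
  - by move=> E SE; rewrite /S /= (_ : mkset _ = \bigcup_k [set w | E k (w, t)]); first exact: GU.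
move=> E [[C GC ->]|[r [u [C [r0 ru uT GC ->]]]]]; rewrite /S /=.
  have [t0|t0] := eqVneq t 0.
    rewrite (_ : mkset _ = C); first by rewrite t0.
    by apply/seteqP; split => w /=; [case|].
  rewrite (_ : mkset _ = set0); first exact: G0.
  by apply/seteqP; split => w //= [_ h]; move: t0; rewrite h eqxx.
have [tru|tru] := boolP (r < t <= u); last first.
  rewrite (_ : mkset _ = set0); first exact: G0.
  by apply/seteqP; split => w //= [_]; rewrite in_itv /= (negbTE tru).
rewrite (_ : mkset _ = C).
  by apply: (@Gmono r t) => //; case/andP: tru => /ltW.
by apply/seteqP; split => w /=; [case|move=> Cw; rewrite in_itv].
Qed.

Lemma chain_integrand_measurable i : measurable_fun dom (fun q : OxR Omega R => Z2 q.2 q.1 i 0).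
Proof.
apply: (predictable_measurable_fun hP T0 hW hX).
by apply/(@trace_mw _ (OxR Omega R) R dom); case: hZ2.
Qed.

Lemma generator_adapted t : 0 <= t <= T -> measurable_wrt (G t) (fun w => generator Y Z1 Z2 (w, t)).
Proof.
move=> tT.
rewrite (_ : (fun w => _) = fun w => \sum_a X t w a 0 * F w t (Y t w) (Z1 t w) (Z2 t w) (basis_vec a)); last first.
  by apply/funext => w; rewrite /generator /= driver_states.
apply: mw_sum => // a; apply: mwM => //; first exact: (@X_adaptedG _ _ _ P T).
apply: (mw_subst3 (Phi := fun w y z1 z2 => F w t y z1 z2 (basis_vec a)) (sG t)).
- by move=> y z1 z2; have [ad _ _] := hF1 y z1 z2 (states_basis a); exact: ad.
- by move=> w; have [h _ _] := driver_continuous w a tT.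
- by move=> w; have [_ h _] := driver_continuous w a tT.
- by move=> w; have [_ _ h] := driver_continuous w a tT.
- by case: hY => + _ _; exact.
- by case: hZ1 => + _ _; exact.
- by move=> i; exact: predictable_adapted.
Qed.

Lemma generator_measurable : measurable_fun dom (generator Y Z1 Z2 : OxR Omega R -> R).
Proof.
have sH := trace_measurable mdom.
have tr f := @trace_measurable_fun _ (OxR Omega R) R dom mdom f.
(* The Lipschitz condition concerns times in [[0, T]] only; multiplying by the indicator of the
   domain makes continuity hold everywhere. *)
have cut (q : OxR Omega R) (phi : R -> R) : (0 <= q.2 <= T -> continuous phi) ->
    continuous (fun y => \1_dom q * phi y).
  move=> cphi; rewrite indicE; have [dq|nq] := pselect (dom q); last first.
    by rewrite memNset//; under eq_fun do rewrite mul0r; move=> x; exact: cvg_cst.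
  rewrite mem_set//; under eq_fun do rewrite mul1r; apply: cphi.
  by case: dq => _ /=; rewrite in_itv.
apply: (@eq_measurable_fun _ _ _ _ dom (fun q : OxR Omega R =>
   \sum_a X q.2 q.1 a 0 * (\1_dom q * F q.1 q.2 (Y q.2 q.1) (Z1 q.2 q.1) (Z2 q.2 q.1) (basis_vec a)))).
  move=> q; rewrite inE => dq; rewrite /generator driver_states; last first.
    by case: dq => _ /=; rewrite in_itv.
  by apply: eq_bigr => a _; rewrite indicE mem_set// mul1r.
apply: measurable_sum => a; apply: measurable_funM.
  apply: (@cadlag_measurable2 _ _ _ T (fun t w => X t w a 0) T0).
  - by move=> t tT; case: hX => _ mX _ _; exact: mX.
  - by move=> w t tT; exact: (chain_right hX).
apply/tr.
apply: (mw_subst3 (Phi := fun q y z1 z2 => \1_dom q * F q.1 q.2 y z1 z2 (basis_vec a)) sH).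
- move=> y z1 z2; apply/tr.
  apply: measurable_funM; first by apply: measurable_funTS; exact: measurable_indic.
  by have [_ h _] := hF1 y z1 z2 (states_basis a).
- by move=> q z1 z2; apply: (cut q (fun y => F q.1 q.2 y z1 z2 _)) => /(driver_continuous q.1 a)[h _ _]; exact: h.
- by move=> q y z2; apply: (cut q (fun z => F q.1 q.2 y z z2 _)) => /(driver_continuous q.1 a)[_ h _]; exact: h.
- move=> q y z1 v k; apply: (cut q (fun r => F q.1 q.2 y z1 (v + r *: delta_mx k 0) _)).
  by move=> /(driver_continuous q.1 a)[_ _ h]; exact: h.
- by apply/tr; case: hY.
- by apply/tr; case: hZ1.
- by move=> i; apply/tr; exact: chain_integrand_measurable.
Qed.

Lemma rho_chain_sqi b : sqi2 (rho_proc rho ci Z2 b).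
Proof.
have mr k : measurable_fun dom (rho_proc rho ci Z2 k).
  apply: measurable_sum => i; apply: measurable_funM; first exact: (itg_rho itg).
  exact: chain_integrand_measurable.
split; first exact: mr.
case: b => [b|]; last first.
  rewrite (_ : rho_proc _ _ _ _ = fun=> 0); first by case: (sqi0 PL dom).
  by apply/funext => q; exact: rho_proc_chain_None.
case: hZ2 => _; apply: le_lt_trans; apply: ge0_le_integral => //.
- by move=> q _; rewrite lee_fin sqr_ge0.
- by apply/measurable_EFinP; apply: measurable_funX; exact: mr.
- apply/measurable_EFinP.
  apply: (@eq_measurable_fun _ _ _ _ dom (fun q => \sum_k (rho_proc rho ci Z2 (Some k) q) ^+ 2)).
    by move=> q; rewrite inE => dq; rewrite (seminorm2_rho T0 hc hA hX).
  by apply: measurable_sum => k; apply: measurable_funX; exact: mr.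
- move=> q dq; rewrite lee_fin (seminorm2_rho T0 hc hA hX)// (bigD1 b)//= lerDl.
  by apply: sumr_ge0 => k _; exact: sqr_ge0.
Qed.

Lemma brownian_integrand_sqi : sqi2 (fun q => Z1 q.2 q.1).
Proof. by case: hZ1. Qed.

Lemma solution_sqi : sqi2 (fun q => Y q.2 q.1).
Proof. by case: hY. Qed.

Lemma driver0_sqi a : sqi2 (fun q => F q.1 q.2 0 0 0 (basis_vec a)).
Proof. by case: (hF1 0 0 0 (states_basis a)). Qed.

(** Lipschitz comparison with [F] at zero arguments. The factor [1 + mu], whose square exceeds [mu],
    avoids a square root, and summing over the states removes the dependence on [X]. *)
Lemma generator_sqi : sqi2 (generator Y Z1 Z2).
Proof.
have [mu mu0 lip] := hF2.
pose u : OxR Omega R -> R := fun q =>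
  \sum_a `|F q.1 q.2 0 0 0 (basis_vec a)| + (1 + mu) *
    (`|Y q.2 q.1| + `|Z1 q.2 q.1| + \sum_b `|rho_proc rho ci Z2 (Some b) q|).
have nsq (g : OxR Omega R -> R) : sqi2 g -> sqi2 (fun q => `|g q|).
  move=> sg; apply: (sqi_le mdom _ sg); last by move=> q _; rewrite normr_id.
  by apply: measurableT_comp => //; case: sg.
have su : sqi2 u.
  apply: (sqiD mdom); first by apply: (sqi_sum mdom) => a _; apply: nsq; exact: driver0_sqi.
  apply: (sqiZ mdom); apply: (sqiD mdom).
    by apply: (sqiD mdom); apply: nsq; [exact: solution_sqi|exact: brownian_integrand_sqi].
  by apply: (sqi_sum mdom) => b _; apply: nsq; exact: rho_chain_sqi.
apply: (sqi_le mdom generator_measurable su) => q dq.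
have tT : 0 <= q.2 <= T by case: dq => _ /=; rewrite in_itv.
have [sX _ _ _] := hX; have [a _ aX] := sX q.2 q.1 tT.
have s0 : 0 <= \sum_b `|rho_proc rho ci Z2 (Some b) q| by apply: sumr_ge0.
rewrite [leRHS]ger0_norm; last first.
  by rewrite addr_ge0 ?sumr_ge0// mulr_ge0 ?addr_ge0// ltW.
have h : `|generator Y Z1 Z2 q - F q.1 q.2 0 0 0 (basis_vec a)| <= (1 + mu) *
    (`|Y q.2 q.1| + `|Z1 q.2 q.1| + \sum_b `|rho_proc rho ci Z2 (Some b) q|).
  rewrite -ler_sqr ?nnegrE ?mulr_ge0 ?addr_ge0//; last by rewrite ltW.
  rewrite /generator -aX; apply: (le_trans (lip q.1 q.2 _ _ _ _ _ _ _ tT (states_basis a))).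
  rewrite !subr0 (seminorm2_rho T0 hc hA hX)//.
  have sq : \sum_b (rho_proc rho ci Z2 (Some b) q) ^+ 2 <=
      (\sum_b `|rho_proc rho ci Z2 (Some b) q|) ^+ 2.
    rewrite [leRHS]expr2 mulr_sumr; apply: ler_sum => b _.
    rewrite -real_normK ?num_real// expr2 ler_wpM2r//.
    by rewrite (bigD1 b)//= lerDl sumr_ge0.
  have r0 : 0 <= \sum_b (rho_proc rho ci Z2 (Some b) q) ^+ 2 by apply: sumr_ge0 => b _; exact: sqr_ge0.
  have arith (y z s r : R) : 0 <= y -> 0 <= z -> 0 <= s -> 0 <= r -> r <= s ^+ 2 ->
      mu * (y ^+ 2 + z ^+ 2 + r) <= ((1 + mu) * (y + z + s)) ^+ 2.
    move=> y0 z0 s1 r1 rs; have h1 : y ^+ 2 + z ^+ 2 + r <= (y + z + s) ^+ 2 by nra.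
    have h2 : mu <= (1 + mu) ^+ 2 by nra.
    rewrite exprMn; apply: ler_pM => //; first exact: ltW.
    by rewrite !addr_ge0 ?sqr_ge0.
  exact: arith.
rewrite -[generator _ _ _ q](subrK (F q.1 q.2 0 0 0 (basis_vec a))) addrC.
apply: (le_trans (ler_normD _ _)); apply: lerD => //.
by rewrite (bigD1 a)//= lerDl sumr_ge0.
Qed.

End generator_process.

End generator.

(** * The equation *)

Lemma subset_itv_tail (R : realType) (b t : R) : 0 <= t -> `[t, b]%classic `<=` `[0, b]%classic.
Proof. by move=> t0 s /=; rewrite !in_itv /= => /andP[ts ->]; rewrite (le_trans t0 ts). Qed.

(** * Norms with the weight [expR (2 * g * t)] *)

Section weighted_norm.
Context {R : realType} {d} {Omega : measurableType d}.
Variables (P : probability Omega R) (T : R).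
Hypothesis T0 : 0 < T.
Local Notation leb := (@lebesgue_measure R).
Local Notation PL := (P \x leb)%E.
Local Notation dom := (@domain R d Omega T).
Local Notation sqi2 := (sqi PL dom).
Local Notation sqi1 := (sqi P setT).
Local Notation ip1 := (ip P setT).
Local Notation ip2 := (ip PL dom).
Local Notation I := (`[0%R, T]%classic : set (Rm R)).
Implicit Types h : OxR Omega R -> R.

Let mdom := @measurable_domain R d Omega T.

Let mI : measurable I. Proof. exact: measurable_itv. Qed.

Definition wint (g : R) h : \bar R := (\int[PL]_(q in dom) (expR (2 * g * q.2) * h q)%:E)%E.

Definition mean_at h (s : R) : \bar R := (\int[P]_w (h (w, s))%:E)%E.

Let mE h : measurable_fun dom h -> measurable_fun dom (EFin \o h).
Proof. by move=> mh; exact/measurable_EFinP. Qed.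

Lemma mean_at_ge0 h : (forall q, 0 <= h q) -> forall s, (0 <= mean_at h s)%E.
Proof. by move=> h0 s; apply: integral_ge0 => w _; rewrite lee_fin. Qed.

Lemma mean_at_measurable h : measurable_fun dom h -> (forall q, 0 <= h q) ->
  measurable_fun I (mean_at h).
Proof.
move=> mh h0; have p0 q : dom q -> (0 <= (EFin \o h) q)%E by rewrite /= lee_fin.
exact: (@dom_tonelli_measurable_t _ _ _ P T (EFin \o h) (mE mh) p0).
Qed.

Lemma dom_weight (k : R -> R) h : measurable_fun setT (k : Rm R -> R) -> (forall s, 0 <= k s) ->
  measurable_fun dom h -> (forall q, 0 <= h q) ->
  (\int[PL]_(q in dom) (k q.2 * h q)%:E = \int[leb]_(s in I) ((k s)%:E * mean_at h s))%E.
Proof.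
move=> mk k0 mh h0.
have mkh : measurable_fun dom (fun q => k q.2 * h q).
  apply: measurable_funM => //; apply: measurable_funTS.
  by apply: (measurableT_comp (f := (k : Rm R -> R))).
have p0 q : dom q -> (0 <= (k q.2 * h q)%:E)%E by rewrite lee_fin mulr_ge0.
rewrite (@dom_tonelli_t _ _ _ P T (fun q => (k q.2 * h q)%:E) (mE mkh) p0).
apply: eq_integral => s; rewrite mem_setE in_itv /= => sI.
under eq_integral do rewrite EFinM.
rewrite ge0_integralZl ?lee_fin//; last by move=> w _; rewrite lee_fin.
apply/measurable_EFinP.
apply: (@measurable_comp _ _ _ _ _ _ (dom : set (OxR Omega R)) h _ (fun w => (w, s))) => //.
by move=> _ [w _ <-]; split => //=; rewrite in_itv.
Qed.

Lemma wint_ge0 g h : (forall q, 0 <= h q) -> (0 <= wint g h)%E.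
Proof. by move=> h0; apply: integral_ge0 => q _; rewrite lee_fin mulr_ge0// expR_ge0. Qed.

Lemma mexp2 (g : R) : measurable_fun [set: OxR Omega R] (fun q : OxR Omega R => expR (2 * g * q.2)).
Proof. exact: (measurableT_comp (measurable_expR_mul _)). Qed.

Let mw g h : measurable_fun dom h -> measurable_fun dom (fun q => (expR (2 * g * q.2) * h q)%:E).
Proof.
move=> mh; apply/measurable_EFinP; apply: measurable_funM => //.
by apply: measurable_funTS; exact: mexp2.
Qed.

Lemma le_wint g h h' : measurable_fun dom h -> measurable_fun dom h' ->
  (forall q, 0 <= h q) -> (forall q, dom q -> h q <= h' q) -> (wint g h <= wint g h')%E.
Proof.
move=> mh mh' h0 hh'; apply: ge0_le_integral => //.
- by move=> q _; rewrite lee_fin mulr_ge0// expR_ge0.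
- exact: mw.
- exact: mw.
- by move=> q dq; rewrite lee_fin ler_wpM2l ?expR_ge0// hh'.
Qed.

Lemma wintD g h h' : measurable_fun dom h -> measurable_fun dom h' ->
  (forall q, 0 <= h q) -> (forall q, 0 <= h' q) ->
  (wint g (fun q => (h q + h' q)%R) = wint g h + wint g h')%E.
Proof.
move=> mh mh' h0 h0'; rewrite /wint -ge0_integralD//; last first.
- exact: mw.
- by move=> q _; rewrite lee_fin mulr_ge0// expR_ge0.
- exact: mw.
- by move=> q _; rewrite lee_fin mulr_ge0// expR_ge0.
by apply: eq_integral => q _; rewrite mulrDr EFinD.
Qed.

Lemma wintZ g a h : 0 <= a -> measurable_fun dom h -> (forall q, 0 <= h q) ->
  (wint g (fun q => (a * h q)%R) = a%:E * wint g h)%E.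
Proof.
move=> a0 mh h0; rewrite /wint -ge0_integralZl//; last first.
- by move=> q _; rewrite lee_fin mulr_ge0// expR_ge0.
- exact: mw.
by apply: eq_integral => q _; rewrite -EFinM mulrCA.
Qed.

(** On [[0, T]] the weight lies between 1 and [expR (2 * g * T)], so that both norms define the same
    convergence. *)
Lemma wint_bounds g f : 0 <= g -> sqi2 f ->
  ((ip2 f f)%:E <= wint g (fun q => (f q ^+ 2)%R) <= (expR (2 * g * T) * ip2 f f)%:E)%E.
Proof.
move=> g0 sf; have mf2 : measurable_fun dom (fun q => f q ^+ 2) by apply: measurable_funX; case: sf.
rewrite EFinM -(integral_sqrE mdom sf); apply/andP; split.
  apply: ge0_le_integral => //.
  - by move=> q _; rewrite lee_fin sqr_ge0.
  - exact: mE.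
  - exact: mw.
  move=> q [_ /=]; rewrite in_itv /= => /andP[q0 _]; rewrite lee_fin ler_peMl ?sqr_ge0//.
  by rewrite -expR0 ler_expR !mulr_ge0.
rewrite -ge0_integralZl//; last first.
- by move=> q _; rewrite lee_fin sqr_ge0.
- exact: mE.
apply: ge0_le_integral => //.
- by move=> q _; rewrite lee_fin mulr_ge0 ?sqr_ge0// expR_ge0.
- exact: mw.
- by apply: measurable_funeM; exact: mE.
move=> q [_ /=]; rewrite in_itv /= => /andP[q0 qT]; rewrite -EFinM lee_fin ler_wpM2r ?sqr_ge0//.
by rewrite ler_expR ler_wpM2l// mulr_ge0.
Qed.

Lemma uniform_sqi (V : R -> Omega -> R) C :
  measurable_fun dom (fun q : OxR Omega R => V q.2 q.1) ->
  (forall t, 0 <= t <= T -> sqi1 (V t) /\ ip1 (V t) (V t) <= C) -> sqi2 (fun q => V q.2 q.1).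
Proof.
move=> mV hV; split => //.
have m2 : measurable_fun dom (fun q : OxR Omega R => V q.2 q.1 ^+ 2) by apply: measurable_funX.
have p2 q : dom q -> (0 <= (V q.2 q.1 ^+ 2)%:E)%E by rewrite lee_fin sqr_ge0.
rewrite (@dom_tonelli_t _ _ _ P T (fun q => (V q.2 q.1 ^+ 2)%:E) (mE m2) p2).
apply: (@le_lt_trans _ _ (\int[leb]_(s in I) C%:E)%E); last first.
  rewrite integral_cst//= [X in (_ * X)%E](_ : _ = T%:E); last exact: lebesgue_measure_0b.
  by rewrite -EFinM ltry.
apply: ge0_le_integral => //.
- by move=> s _; apply: integral_ge0 => w _; rewrite lee_fin sqr_ge0.
- exact: (@dom_tonelli_measurable_t _ _ _ P T (fun q => (V q.2 q.1 ^+ 2)%:E) (mE m2) p2).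
move=> s /=; rewrite in_itv /= => sT; have [sV VC] := hV s sT.
by rewrite (integral_sqrE measurableT sV) lee_fin.
Qed.

Lemma ae_paths (f f' : OxR Omega R -> R) : sqi2 f -> sqi2 f' ->
  ip2 (f \- f') (f \- f') = 0 -> {ae P, forall w, forall t, 0 <= t <= T ->
    \int[leb]_(u in `[t, T]%classic) f (w, u) = \int[leb]_(u in `[t, T]%classic) f' (w, u)}.
Proof.
move=> sf sf' z; have sd := sqiB mdom sf sf'.
pose D2 : OxR Omega R -> R := fun q => (f \- f') q ^+ 2.
have m2 : measurable_fun dom D2 by apply: measurable_funX; case: sd.
have p2 q : dom q -> (0 <= (EFin \o D2) q)%E by rewrite lee_fin sqr_ge0.
have := integral_sqrE mdom sd; rewrite z (@dom_tonelli_w _ _ _ P T _ (mE m2) p2).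
have mw2 := @dom_tonelli_measurable_w _ _ _ T _ (mE m2) p2.
have w20 w : (0 <= \int[leb]_(t in I) (EFin \o D2) (w, t))%E.
  by apply: integral_ge0 => s _; rewrite lee_fin sqr_ge0.
move=> z0; have : (\int[P]_w `|\int[leb]_(t in I) (EFin \o D2) (w, t)| = 0)%E.
  by rewrite -[RHS]z0; apply: eq_integral => w _; rewrite gee0_abs.
move=> /(ae_eq_integral_abs _ measurableT mw2).
have gf := good_path_ae sf; have gf' := good_path_ae sf'.
apply: filterS3 gf gf' => w gf gf' /(_ Logic.I) h t /andP[t0 tT].
have sub := @subset_itv_tail _ T t t0.
have sfw := good_path_sqi sf gf; have sfw' := good_path_sqi sf' gf'.
have sdw := sqiB mI sfw sfw'.
have dz : ip leb I ((fun s => f (w, s)) \- (fun s => f' (w, s))) ((fun s => f (w, s)) \- (fun s => f' (w, s))) = 0.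
  by apply: EFin_inj; rewrite -(integral_sqrE mI sdw); exact: h.
have aeq := ip_eq0_ae mI sdw dz.
have mt : measurable (`[t, T]%classic : set (Rm R)) by exact: measurable_itv.
congr fine; apply: ae_eq_integral => //.
- by apply/measurable_EFinP; apply: measurable_funS (path_measurable sf w).
- by apply/measurable_EFinP; apply: measurable_funS (path_measurable sf' w).
apply: negligibleS aeq => s /= nh hh; apply: nh => sI; congr EFin; apply/eqP.
by rewrite -subr_eq0; apply/eqP; apply: hh; exact: sub.
Qed.

End weighted_norm.

Section bsde_solutions.
Context {R : realType} {d} {Omega : measurableType d}.
Variables (P : probability Omega R) (T : R) (N : nat) (A : 'M[R]_N) (c : R).
Variables (W : R -> Omega -> R) (X : R -> Omega -> 'cV[R]_N) (F : driver R Omega N) (Q : Omega -> R).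
Hypotheses (hP : measure_is_complete P) (T0 : 0 < T) (hc : 0 < c < 1)
  (hA : rate_matrix A c) (hW : brownian_motion P T W) (hX : markov_chain P T A X)
  (hWX : independent P (filtrationX P X T) (filtrationW P W T))
  (hM : square_integrable_martingale P T (filtrationX P X) (chain_martingale A X))
  (hF1 : driver_M2 P T W X F) (hF2 : driver_lipschitz T A X F)
  (hQ : L2 P (filtrationG P W X T) Q).

Local Notation leb := (@lebesgue_measure R).
Local Notation PL := (P \x leb)%E.
Local Notation dom := (@domain R d Omega T).
Local Notation G := (filtrationG P W X).
Local Notation sqi1 := (sqi P setT).
Local Notation ip1 := (ip P setT).
Local Notation ip2 := (ip PL dom).
Local Notation sqi2 := (sqi PL dom).
Local Notation L := (noise A W X).
Local Notation rho := (@noise_rho R d Omega N A X).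
Local Notation ci := (@chain_idx N).
Local Notation bi := (@brownian_idx N).
Local Notation gen := (generator X F).

Let itg := noise_integrator hP T0 hc hA hW hX hWX hM.

Let mdom := @measurable_domain R d Omega T.

Let sG t : sigma_algebra setT (G t). Proof. exact: G_sigma. Qed.
Let GN t : P.-negligible `<=` G t. Proof. exact: G_negligible. Qed.
Let Gm t : t <= T -> G t `<=` measurable.
Proof. by move=> tT; exact: (@G_sub _ _ _ P T N A W X hP hW hX t tT). Qed.
Let Gmono s t : s <= t -> G s `<=` G t. Proof. exact: G_mono. Qed.
Let Gmono' s t : 0 <= s -> s <= t -> t <= T -> G s `<=` G t. Proof. by move=> _ st _; exact: Gmono. Qed.

Definition total_proc (Z1 : R -> Omega -> R) (Z2 : R -> Omega -> 'cV[R]_N) b : Omega * R -> R :=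
  rho_proc rho bi (fun t w => const_mx (Z1 t w)) b \+ rho_proc rho ci Z2 b.

Lemma total_proc_None Z1 Z2 q : total_proc Z1 Z2 None q = Z1 q.2 q.1.
Proof. by rewrite /total_proc /= rho_proc_brownian rho_proc_chain_None mul1r addr0. Qed.

Lemma total_proc_Some Z1 Z2 b q : total_proc Z1 Z2 (Some b) q = rho_proc rho ci Z2 (Some b) q.
Proof. by rewrite /total_proc /= rho_proc_brownian mul0r add0r. Qed.

(* [f] stands for the process [F(t, Y_t, Z1_t, Z2_t, X_t)], decoupled from the unknowns. *)
Definition solves (f : Omega * R -> R) (Y Z1 : R -> Omega -> R) (Z2 : R -> Omega -> 'cV[R]_N)
    (J1 J2 : R -> Omega -> R) :=
  [/\ [/\ M2 P T G Y, M2 P T G Z1 & P2 P T A G X Z2],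
      is_ito_integral P T G W Z1 J1,
      is_stochastic_integral P T G (chain_martingale A X) (psi A X) Z2 J2 &
      {ae P, forall w, forall t, 0 <= t <= T ->
        Y t w - \int[leb]_(u in `[t, T]%classic) f (w, u)
        + (J1 T w - J1 t w) + (J2 T w - J2 t w) = Q w}].

Lemma bsde_solutionE Y Z1 Z2 : bsde_solution P T A W X F Q Y Z1 Z2 <->
  exists J1 J2, solves (gen Y Z1 Z2) Y Z1 Z2 J1 J2.
Proof.
split; first by move=> [hY hZ1 hZ2 [J1 [J2 [i1 i2 e]]]]; exists J1, J2; split.
by move=> [J1 [J2 [[hY hZ1 hZ2] i1 i2 e]]]; split => //; exists J1, J2; split.
Qed.

Lemma total_integral Z1 Z2 J1 J2 : M2 P T G Z1 -> P2 P T A G X Z2 ->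
  is_ito_integral P T G W Z1 J1 ->
  is_stochastic_integral P T G (chain_martingale A X) (psi A X) Z2 J2 ->
  is_integral P T L G rho (total_proc Z1 Z2) (fun t => J1 t \+ J2 t).
Proof.
move=> hZ1 hZ2 i1 i2; apply: (is_integralD itg).
  apply: (blocks_of_stochastic itg (brownian_colE A W X) (brownian_psiE A X) i1) => b.
  have s1 := brownian_integrand_sqi hZ1; case: b => [b|].
    rewrite (_ : rho_proc _ _ _ _ = fun=> 0); first exact: sqi0.
    by apply/funext => q; rewrite rho_proc_brownian mul0r.
  rewrite (_ : rho_proc _ _ _ _ = fun q => Z1 q.2 q.1)//.
  by apply/funext => q; rewrite rho_proc_brownian mul1r.
apply: (blocks_of_stochastic itg (chain_colE A W X) (chain_psiE T0 hc hA hX) i2) => b.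
exact: (rho_chain_sqi hP T0 hc hA hW hX hWX hM hZ2).
Qed.

Definition good f := sqi2 f /\ forall t, 0 <= t <= T -> measurable_wrt (G t) (fun w => f (w, t)).

Lemma generator_good Y Z1 Z2 : M2 P T G Y -> M2 P T G Z1 -> P2 P T A G X Z2 -> good (gen Y Z1 Z2).
Proof.
move=> hY hZ1 hZ2; split.
  exact: (generator_sqi hP T0 hc hA hW hX hWX hM hF1 hF2 hY hZ1 hZ2).
exact: (generator_adapted hX hF1 hF2 hY hZ1 hZ2).
Qed.

Lemma integral_process_ip_le f t : sqi2 f -> 0 <= t <= T ->
  measurable_fun setT (integral_process T f t) ->
  ip1 (integral_process T f t) (integral_process T f t) <= T * ip2 f f.
Proof.
move=> sf /andP[]; rewrite le_eqVlt => /predU1P[<- _ _|t0 tT mV].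
  rewrite (_ : integral_process T f 0 = fun=> 0); last by apply/funext => w; exact: integral_process0.
  by rewrite ip_zerol mulr_ge0 ?ip_ge0 ?ltW.
have st := sqi_domain sf tT.
have e : {ae P, forall w, setT w -> integral_process T f t w = time_integral t f w}.
  by apply: filterS (integral_processE sf t) => w -> _.
have mt := time_integral_measurable st.
rewrite (ae_ip measurableT mV mV mt mt e e).
have le := time_integral_int_le t0 st.
rewrite (integral_sqrE measurableT (time_integral_sqi t0 st)) -EFinM lee_fin in le.
apply: (le_trans le); apply: ler_pM => //; [exact: ltW|exact: ip_ge0|].
rewrite -lee_fin -(integral_sqrE (measurable_domain t) st) -(integral_sqrE mdom sf).
apply: ge0_subset_integral => //.
- exact: measurable_domain.
- by apply/measurable_EFinP; apply: measurable_funX; case: sf.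
- by move=> q _; rewrite lee_fin sqr_ge0.
- exact: domain_sub.
Qed.

(** Represent [Q] plus the full time integral, and let [Y] be the same representation stopped at
    [t], minus the time integral up to [t]: it is adapted and cadlag by construction, and the
    equation becomes algebra. Its square integrability comes from norms bounded uniformly in [t]. *)
Lemma solves_exists f : good f -> exists Y Z1 Z2 J1 J2, solves f Y Z1 Z2 J1 J2.
Proof.
move=> [sf af]; pose U := integral_process T f.
have mU t : 0 <= t <= T -> measurable_wrt (G t) (U t).
  by move=> tT; apply: (integral_process_mw sf sG Gm GN Gmono' af).
have sU t : 0 <= t <= T -> sqi1 (U t).
  by move=> tT; apply: (integral_process_sqi sf sG Gm GN Gmono' af).
have TT : 0 <= T <= T by rewrite lexx ltW.
have T00 : 0 <= (0 : R) <= T by rewrite lexx ltW.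
have [mQ iQ] := hQ.
have sQ : sqi1 Q by split => //; apply: mw_measurable mQ; exact: Gm.
have mxi : measurable_wrt (G T) (Q \+ U T) by apply: mwD => //; exact: mU.
have [U0 [J1 [J2 [Z1 [Z2 [[mU0 sU0 hZ1 hZ2] [i1 i2 c1 c2] z0 sJ xiE]]]]]] :=
  representation hP T0 hc hA hW hX hWX hM mxi (sqiD measurableT sQ (sU T TT)).
have [a1 _ _] := i1; have [a2 _ _] := i2.
pose Y t w := U0 w + (J1 t w + J2 t w) - U t w.
have eqY : {ae P, forall w, forall t, 0 <= t <= T ->
    Y t w - \int[leb]_(u in `[t, T]%classic) f (w, u) + (J1 T w - J1 t w) + (J2 T w - J2 t w) = Q w}.
  apply: filterS2 xiE (integral_process_diff T0 sf) => w /= h1 h2 t tT.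
  rewrite -(h2 t tT) /Y -/(U T w) -/(U t w); move: h1.
  move: (Q w) (U T w) (U0 w) (J1 T w) (J2 T w) => a b e f' g h.
  have -> : a = e + f' + g - b by rewrite -h addrK.
  by ring.
have mJ t : 0 <= t <= T -> measurable_wrt (G t) (J1 t \+ J2 t).
  by move=> tT; apply: mwD => //; [exact: a1|exact: a2].
have aY : adapted T G Y.
  move=> t tT; apply: mwB => //; last exact: mU.
  by apply: mwD => //; [apply: mwS mU0; apply: Gmono; case/andP: tT|exact: mJ].
have sJJ t : 0 <= t <= T -> sqi1 (J1 t \+ J2 t).
  by move=> tT; have [s1 s2] := sJ t tT; exact: sqiD.
have cU w : cadlag T (U ^~ w).
  by apply: cadlag_continuous; exact: (integral_process_continuous T0 sf).
have cY w : cadlag T (Y ^~ w).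
  apply: cadlagB => //; apply: cadlagD; first exact: cadlag_cst.
  exact: cadlagD.
have mY : measurable_fun dom (fun q : OxR Omega R => Y q.2 q.1).
  apply: (@cadlag_measurable2 _ _ _ T Y T0).
  - by move=> t tT; apply: mw_measurable (aY t tT); apply: Gm; case/andP: tT.
  - by move=> w t tT; have [r _] := cY w; exact: r.
have iZ := total_integral hZ1 hZ2 i1 i2.
have leJ t : 0 <= t <= T -> ip1 (J1 t \+ J2 t) (J1 t \+ J2 t) <= ip1 (J1 T \+ J2 T) (J1 T \+ J2 T).
  move=> tT; have o := is_integral_orth itg T0 iZ tT (mJ t tT) (sJJ t tT).
  have sd := sqiB measurableT (sJJ T TT) (sJJ t tT).
  rewrite [leRHS](_ : _ = ip1 ((J1 t \+ J2 t) \+ ((J1 T \+ J2 T) \- (J1 t \+ J2 t)))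
    ((J1 t \+ J2 t) \+ ((J1 T \+ J2 T) \- (J1 t \+ J2 t)))); last first.
    by apply: eq_Rintegral => w _ /=; ring.
  by rewrite (ipDD measurableT (sJJ t tT) sd) o mulr0 addr0 lerDl ip_ge0.
have sqY : sqi2 (fun q => Y q.2 q.1).
  apply: (@uniform_sqi _ _ _ P T T0 Y (2 * (2 * ip1 U0 U0 + 2 * ip1 (J1 T \+ J2 T) (J1 T \+ J2 T)) + 2 * (T * ip2 f f)) mY).
  move=> t tT; have sD := sqiD measurableT sU0 (sJJ t tT).
  split; first exact: (sqiB measurableT sD (sU t tT)).
  apply: (le_trans (ipB_le2 measurableT sD (sU t tT))); apply: lerD.
    rewrite ler_wpM2l//; apply: (le_trans (ip_le2 measurableT sU0 (sJJ t tT))).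
    by rewrite lerD2l ler_wpM2l// leJ.
  rewrite ler_wpM2l//; apply: integral_process_ip_le => //.
  by case: (sU t tT).
exists Y, Z1, Z2, J1, J2; split => //; split => //.
by split => //; case: sqY.
Qed.

Lemma good_sub f f' : good f -> good f' -> good (f \- f').
Proof.
move=> [sf af] [sf' af']; split; first exact: (sqiB mdom).
by move=> t tT; apply: (@mwB _ _ _ (G t) (sG t) _ _ (af t tT) (af' t tT)).
Qed.

Lemma path_integralB f f' : sqi2 f -> sqi2 f' -> {ae P, forall w, forall t, 0 <= t <= T ->
  \int[leb]_(u in `[t, T]%classic) (f \- f') (w, u) =
  \int[leb]_(u in `[t, T]%classic) f (w, u) - \int[leb]_(u in `[t, T]%classic) f' (w, u)}.
Proof.
move=> sf sf'; apply: filterS2 (good_path_ae sf) (good_path_ae sf') => w gf gf' t /andP[t0 tT].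
have sub := @subset_itv_tail _ T t t0.
by rewrite -RintegralB//; [apply: integrableS (path_integrable T0 sf gf)|
  apply: integrableS (path_integrable T0 sf' gf')].
Qed.

(** Cauchy-Schwarz with the weight [expR (- (g / 2) * s)], whose square has integral at most
    [expR (- g * t) / g] over [[t, T]]. *)
Lemma path_bound (phi : R -> R) (g t : R) : 0 < g -> 0 <= t <= T ->
  measurable_fun (`[0, T]%classic : set (Rm R)) (phi : Rm R -> R) ->
  (((\int[leb]_(u in `[t, T]%classic) phi u) ^+ 2)%:E <=
   (expR (- g * t) / g)%:E * \int[leb]_(s in `[0%R, T]) ((t < s)%R%:R * expR (g * s) * phi s ^+ 2)%:E)%E.
Proof.
move=> g0 /andP[t0 tT] mphi.
have mt : measurable (`[t, T]%classic : set (Rm R)) by exact: measurable_itv.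
have sub := @subset_itv_tail _ T t t0.
have mphi' := measurable_funS (measurable_itv _) sub mphi.
have mexp := @measurable_expR_mul R.
have su : sqi leb (`[t, T]%classic : set (Rm R)) (fun s => expR (- (g / 2) * s)).
  apply: (@sqi_bounded _ _ _ leb _ mt _ 1).
  - exact: (itv_lty sub).
  - by apply: measurable_funTS; exact: mexp.
  - move=> s /=; rewrite in_itv /= => /andP[ts _]; rewrite ger0_norm ?expR_ge0// -expR0 ler_expR.
    by rewrite mulNr oppr_le0 mulr_ge0 ?divr_ge0 ?(ltW g0)// (le_trans t0 ts).
have c0 : 0 < expR (- g * t) / g by rewrite divr_gt0 ?expR_gt0.
have uu : ip leb (`[t, T]%classic : set (Rm R)) (fun s => expR (- (g / 2) * s)) (fun s => expR (- (g / 2) * s)) <= expR (- g * t) / g.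
  rewrite -lee_fin -(integral_sqrE mt su).
  rewrite (_ : (\int[leb]_(s in `[t, T]) (expR (- (g / 2) * s) ^+ 2)%:E = \int[leb]_(s in `[t, T]) (expR (- g * s))%:E)%E); last first.
    apply: eq_integral => s _; rewrite expr2 -expRD; congr (expR _)%:E; by field.
  rewrite integral_exp ?oppr_eq0 ?gt_eqF// lee_fin invrN mulrN mulrBl opprB gerBl.
  by rewrite divr_ge0 ?expR_ge0// ltW.
apply: (le_trans (weighted_cauchy_schwarz mt su (fun s => expR_gt0 _) uu c0 mphi')).
apply: lee_wpmul2l; first by rewrite lee_fin ltW.
have e s : (phi s / expR (- (g / 2) * s)) ^+ 2 = expR (g * s) * phi s ^+ 2.
  rewrite exprMn mulrC -expRN expr2 -expRD; congr (expR _ * _); by field.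
under eq_integral do rewrite e.
have mh : measurable_fun (`[t, T]%classic : set (Rm R)) (fun s : Rm R => (expR (g * s) * phi s ^+ 2)%:E).
  apply/measurable_EFinP; apply: measurable_funM; last exact: measurable_funX.
  by apply: measurable_funTS; exact: mexp.
rewrite -integral_itv_obnd_cbnd; last first.
  by apply: measurable_funS mh => // s /=; rewrite !in_itv /= => /andP[/ltW -> ->].
rewrite [leLHS]integral_mkcond [leRHS]integral_mkcond le_eqVlt; apply/orP; left; apply/eqP.
apply: eq_integral => s _; rewrite !patchE !mem_setE !in_itv /=.
have [ts|st] /= := ltP t s; last by rewrite !mul0r if_same.
by rewrite (ltW (le_lt_trans t0 ts)) mul1r.
Qed.

Section difference.
Variables (f f' : Omega * R -> R) (Y Z1 : R -> Omega -> R) (Z2 : R -> Omega -> 'cV[R]_N)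
  (J1 J2 : R -> Omega -> R) (Y' Z1' : R -> Omega -> R) (Z2' : R -> Omega -> 'cV[R]_N)
  (J1' J2' : R -> Omega -> R).
Hypotheses (sol : solves f Y Z1 Z2 J1 J2) (sol' : solves f' Y' Z1' Z2' J1' J2')
  (gf : good f) (gf' : good f').

Let df : OxR Omega R -> R := f \- f'.
Let y (t : R) (w : Omega) : R := Y t w - Y' t w.
Let z b : OxR Omega R -> R := total_proc Z1 Z2 b \- total_proc Z1' Z2' b.
Let zq (q : OxR Omega R) : R := \sum_b (z b q) ^+ 2.
Let K (t : R) (w : Omega) : R := (J1 t w + J2 t w) - (J1' t w + J2' t w).

Lemma difference_integral : is_integral P T L G rho z K.
Proof.
have [[_ h1 h2] i1 i2 _] := sol; have [[_ h1' h2'] i1' i2' _] := sol'.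
exact: (is_integralB itg (total_integral h1 h2 i1 i2) (total_integral h1' h2' i1' i2')).
Qed.

Lemma difference_eq : {ae P, forall w, forall t, 0 <= t <= T ->
  y t w + (K T w - K t w) = \int[leb]_(u in `[t, T]%classic) df (w, u)}.
Proof.
have [_ _ _ e] := sol; have [_ _ _ e'] := sol'; have [sf _] := gf; have [sf' _] := gf'.
apply: filterS3 e e' (path_integralB sf sf') => w e e' h t tT.
rewrite /df (h t tT) /y /K; have := e t tT; have := e' t tT; lra.
Qed.

Lemma z_sqi b : sqi2 (z b).
Proof. by have [bs [_ hz _]] := difference_integral; case: (hz b). Qed.

Lemma df_good : good df. Proof. exact: good_sub. Qed.

Let V := integral_process T df.

Lemma difference_process t : 0 <= t <= T ->
  [/\ measurable_wrt (G t) (y t), sqi1 (y t), sqi1 (V T \- V t),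
      {ae P, forall w, setT w -> (y t \+ (K T \- K t)) w = (V T \- V t) w} & sqi1 (K T \- K t)].
Proof.
move=> tT; have [sd ad] := df_good; have TT : 0 <= T <= T by rewrite lexx ltW.
have sV s : 0 <= s <= T -> sqi1 (V s).
  by move=> sT; apply: (integral_process_sqi sd sG Gm GN Gmono' ad).
have sVV := sqiB measurableT (sV T TT) (sV t tT).
have [bs [_ _ hK]] := difference_integral.
have [sKT _] := hK T TT; have [sKt _] := hK t tT.
have sKK := sqiB measurableT sKT sKt.
have my : measurable_wrt (G t) (y t).
  have [[[aY _ _] _ _] _ _ _] := sol; have [[[aY' _ _] _ _] _ _ _] := sol'.
  exact: (@mwB _ _ _ (G t) (sG t) _ _ (aY t tT) (aY' t tT)).
have eq1 : {ae P, forall w, setT w -> (y t \+ (K T \- K t)) w = (V T \- V t) w}.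
  apply: filterS2 difference_eq (integral_process_diff T0 sd) => w h1 h2 _ /=.
  by rewrite (h1 t tT) -(h2 t tT).
split => //; apply: (ae_sqi measurableT _ (sqiB measurableT sVV sKK)).
  by apply: mw_measurable my; apply: Gm; case/andP: tT.
by apply: filterS eq1 => w /(_ Logic.I) /= <- _; rewrite addrK.
Qed.

(** Almost surely y_t + (K_T - K_t) = V_T - V_t. As [y t] is known at [t], it is orthogonal to the
    integral over []t, T]], whose norm is given by the isometry. *)
Lemma difference_isom t : 0 <= t <= T -> ip1 (y t) (y t) +
    \sum_b ip2 (fun p => (t < p.2)%R%:R * z b p) (fun p => (t < p.2)%R%:R * z b p) =
  ip1 (V T \- V t) (V T \- V t).
Proof.
move=> tT; have [my sy sV e sK] := difference_process tT.
rewrite -(is_integral_isom itg T0 difference_integral tT).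
have m1 : measurable_fun setT (y t \+ (K T \- K t)) by case: (sqiD measurableT sy sK).
have [m2 _] := sV.
rewrite -(ae_ip measurableT m1 m1 m2 m2 e e) (ipDD measurableT sy sK).
by rewrite (is_integral_orth itg T0 difference_integral tT my sy) mulr0 addr0.
Qed.

Let mzq : measurable_fun dom zq.
Proof. by apply: measurable_sum => b; apply: measurable_funX; case: (z_sqi b). Qed.

Let zq0 q : 0 <= zq q. Proof. by apply: sumr_ge0 => b _; exact: sqr_ge0. Qed.

Let df2 (q : OxR Omega R) : R := df q ^+ 2.
Let mdf2 : measurable_fun dom df2. Proof. by apply: measurable_funX; case: df_good => -[]. Qed.
Let df20 q : 0 <= df2 q. Proof. exact: sqr_ge0. Qed.

Let y2 (q : OxR Omega R) : R := y q.2 q.1 ^+ 2.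
Let my2 : measurable_fun dom y2.
Proof.
apply: measurable_funX; apply: measurable_funB; first by case: sol => -[[]].
by case: sol' => -[[]].
Qed.
Let y20 q : 0 <= y2 q. Proof. exact: sqr_ge0. Qed.

Let mlt := @measurable_lt_indic R.
Let mexp := @measurable_expR_mul R.

(** By [difference_isom] the left-hand side is the squared norm of the time integral of [f - f']
    over [[t, T]], which [path_bound] estimates path by path. *)
Lemma difference_energy g t : 0 < g -> 0 <= t <= T ->
  (mean_at P y2 t + \int[leb]_(s in `[0%R, T]) ((t < s)%R%:R%:E * mean_at P zq s) <=
   (expR (- g * t) / g)%:E *
     \int[leb]_(s in `[0%R, T]) ((t < s)%R%:R%:E * ((expR (g * s))%:E * mean_at P df2 s)))%E.
Proof.
move=> g0 tT; have [my sy sV e sK] := difference_process tT.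
have -> : mean_at P y2 t = (ip1 (y t) (y t))%:E by rewrite -(integral_sqrE measurableT sy).
rewrite -(dom_weight P (k := fun s => (t < s)%R%:R) (mlt t) (fun s => ler0n R _) mzq zq0).
have -> : (\int[PL]_(q in dom) ((t < q.2)%R%:R * zq q)%:E =
    (\sum_b ip2 (fun p => (t < p.2)%R%:R * z b p) (fun p => (t < p.2)%R%:R * z b p))%:E)%E.
  have st b : sqi2 (fun p => (t < p.2)%R%:R * z b p).
    apply: (@sqi_mulb _ _ _ _ _ mdom _ _ 1 _ (z_sqi b)) => [|q _].
      by apply: measurable_funTS; exact: (measurableT_comp (mlt t)).
    by case: (_ < _); rewrite ?normr1 ?normr0.
  rewrite -sumEFin; under [RHS]eq_bigr do rewrite -(integral_sqrE mdom (st _)).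
  rewrite -ge0_integral_sum//.
  - apply: eq_integral => q _; rewrite sumEFin; congr EFin; rewrite mulr_sumr; apply: eq_bigr => b _.
    by case: (t < q.2); rewrite ?mul1r// !mul0r expr0n.
  - by move=> b; apply/measurable_EFinP; apply: measurable_funX; case: (st b).
  - by move=> b q _; rewrite lee_fin sqr_ge0.
rewrite -EFinD difference_isom// -(integral_sqrE measurableT sV).
pose k (s : R) := (t < s)%R%:R * expR (g * s).
have mk : measurable_fun setT (k : Rm R -> R) by apply: measurable_funM.
have k0 s : 0 <= k s by rewrite mulr_ge0// expR_ge0.
have -> : (\int[leb]_(s in `[0%R, T]) ((t < s)%R%:R%:E * ((expR (g * s))%:E * mean_at P df2 s)) =
    \int[leb]_(s in `[0%R, T]) ((k s)%:E * mean_at P df2 s))%E.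
  by apply: eq_integral => s _; rewrite muleA -EFinM.
rewrite -(dom_weight P mk k0 mdf2 df20).
pose kd (q : OxR Omega R) : R := k q.2 * df2 q.
have mkd : measurable_fun dom (EFin \o kd).
  apply/measurable_EFinP; apply: measurable_funM => //; apply: measurable_funTS.
  exact: (measurableT_comp (f := (k : Rm R -> R))).
have kd0 q : dom q -> (0 <= (EFin \o kd) q)%E.
  by rewrite lee_fin mulr_ge0.
rewrite (@dom_tonelli_w _ _ _ P T _ mkd kd0) -ge0_integralZl//; last first.
- by rewrite lee_fin divr_ge0 ?expR_ge0// ltW.
- by move=> w _; apply: integral_ge0 => s _; rewrite lee_fin mulr_ge0.
- exact: (@dom_tonelli_measurable_w _ _ _ T _ mkd kd0).
apply: ae_ge0_le_integral => //.
- by move=> w _; rewrite lee_fin sqr_ge0.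
- by apply/measurable_EFinP; apply: measurable_funX; case: sV.
- move=> w _; rewrite mule_ge0 ?lee_fin ?divr_ge0 ?expR_ge0 ?(ltW g0)//.
  by apply: integral_ge0 => s _; rewrite lee_fin mulr_ge0.
- by apply: measurable_funeM; exact: (@dom_tonelli_measurable_w _ _ _ T _ mkd kd0).
have [sd _] := df_good.
apply: filterS (integral_process_diff T0 sd) => w h _.
have -> : (V T \- V t) w = \int[leb]_(u in `[t, T]%classic) df (w, u) by exact: h.
exact: (path_bound g0 tT (path_measurable sd w)).
Qed.

Lemma difference_estimate g : 0 < g ->
  ((2 * g)%:E * wint P T g y2 + wint P T g zq <= (3 / g)%:E * wint P T g df2)%E.
Proof.
move=> g0; have m2 := mexp (2 * g).
have e0 s : 0 <= expR (2 * g * s) by exact: expR_ge0.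
rewrite /wint (dom_weight P m2 e0 my2 y20) (dom_weight P m2 e0 mzq zq0) (dom_weight P m2 e0 mdf2 df20).
apply: weighted_estimate => //.
- by move=> t; exact: mean_at_ge0.
- by move=> t; exact: mean_at_ge0.
- by move=> t; exact: mean_at_ge0.
- exact: mean_at_measurable.
- exact: mean_at_measurable.
- exact: mean_at_measurable.
- by move=> t tT; exact: difference_energy.
Qed.

Lemma difference_cadlag : {ae P, forall w, cadlag T (K ^~ w)}.
Proof.
have [_ [_ c1 _] [_ c2 _] _] := sol; have [_ [_ c1' _] [_ c2' _] _] := sol'.
have c12 : {ae P, forall w, cadlag T (fun t => J1 t w + J2 t w)}.
  by apply: filterS2 c1 c2 => w; exact: cadlagD.
by apply: filterS3 c1' c2' c12 => w h1 h2 h3; apply: cadlagB => //; exact: cadlagD.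
Qed.

(** For a fixed [t] the isometry forces [y t] to vanish almost surely, hence K_T = K_t. This holds
    simultaneously at all grid points, then at all times by right-continuity of [K]; the equation
    finally carries it over to [Y], which is not itself assumed to have regular paths. *)
Lemma difference_zero : ip2 df df = 0 -> {ae P, forall w, forall t, 0 <= t <= T -> Y t w = Y' t w}.
Proof.
move=> z0; have [sf _] := gf; have [sf' _] := gf'; have [sd _] := df_good.
have TT : 0 <= T <= T by rewrite lexx ltW.
have int0 : {ae P, forall w, forall t, 0 <= t <= T -> \int[leb]_(u in `[t, T]%classic) df (w, u) = 0}.
  apply: filterS2 (ae_paths sf sf' z0) (path_integralB sf sf') => w h1 h2 t tT.
  by rewrite /df h2// h1// subrr.
have KT t : 0 <= t <= T -> {ae P, forall w, K T w = K t w}.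
  move=> tT; have [my sy sV e sK] := difference_process tT.
  have eV : {ae P, forall w, setT w -> (V T \- V t) w = 0}.
    by apply: filterS2 int0 (integral_process_diff T0 sd) => w h1 h2 _; rewrite /= h2// h1.
  have ipV : ip1 (V T \- V t) (V T \- V t) = 0.
    have [mV _] := sV.
    have m0 : measurable_fun setT (fun _ : Omega => 0 : R) by exact: measurable_cst.
    by rewrite (ae_ip measurableT mV mV m0 m0 eV eV) ip_zerol.
  have ipy : ip1 (y t) (y t) = 0.
    apply/eqP; rewrite eq_le ip_ge0 andbT -ipV -(difference_isom tT) lerDl.
    by apply: sumr_ge0 => b _; exact: ip_ge0.
  apply: filterS3 e eV (ip_eq0_ae measurableT sy ipy) => w /(_ Logic.I) /= h1 /(_ Logic.I) /= h2 /(_ Logic.I) h3.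
  by apply/eqP; rewrite -subr_eq0; apply/eqP; move: h1; rewrite h2 h3 add0r.
have pT n k := @part_itv _ T n k (ltW T0).
have grid : {ae P, forall w, forall n k : nat, (k <= n.+1)%N -> K T w = K (part 0 T n k) w}.
  apply/ae_foralln => n; apply/ae_foralln => k.
  have [kn|kn] := leqP k n.+1; last by apply: aeW.
  by apply: filterS (KT _ (pT n k kn)) => w ->.
apply: filterS3 grid difference_cadlag (filterI difference_eq int0) => w hg [rc _] [he h0] t tT.
have Kt : K T w = K t w.
  have [->//|tlt] := eqVneq t T.
  have tT' : 0 <= t < T by case/andP: tT => -> tT; rewrite lt_neqAle tlt.
  have cv := cvg_right_step tT' (rc t tT').
  apply: (@cvg_unique _ _ _ _ _ _ _ cv) => //.
  rewrite (_ : (fun n => _) = fun=> K T w); first exact: cvg_cst.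
  apply/funext => n; have [k kn [_ ->]] := right_stepE n tT'.
  by rewrite -hg.
have := he t tT; rewrite h0// Kt subrr addr0 /y => h.
by apply/eqP; rewrite -subr_eq0 h.
Qed.

End difference.

Lemma generator_lipschitz mu Y Z1 Z2 Y' Z1' Z2' : (forall w t x y y' z1 z1' z2 z2', 0 <= t <= T -> states x ->
    `|F w t y z1 z2 x - F w t y' z1' z2' x| ^+ 2 <=
      mu * (`|y - y'| ^+ 2 + `|z1 - z1'| ^+ 2 + seminorm2 A X t w (z2 - z2'))) ->
  forall q, dom q -> (gen Y Z1 Z2 q - gen Y' Z1' Z2' q) ^+ 2 <=
    mu * ((Y q.2 q.1 - Y' q.2 q.1) ^+ 2 + \sum_b (total_proc Z1 Z2 b q - total_proc Z1' Z2' b q) ^+ 2).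
Proof.
move=> lip q dq; have tT : 0 <= q.2 <= T by case: dq => _ /=; rewrite in_itv.
have [sX _ _ _] := hX; rewrite -real_normK ?num_real//.
apply: (le_trans (lip q.1 q.2 _ _ _ _ _ _ _ tT (sX q.2 q.1 tT))).
rewrite !real_normK ?num_real//.
rewrite (seminorm2_rho T0 hc hA hX (fun t w => Z2 t w - Z2' t w) dq) big_option !total_proc_None addrA.
rewrite le_eqVlt; apply/orP; left; apply/eqP; congr (_ * (_ + _)); apply: eq_bigr => b _.
rewrite !total_proc_Some; congr (_ ^+ 2); rewrite /rho_proc -sumrB; apply: eq_bigr => i _.
by rewrite !mxE mulrBr.
Qed.

Local Notation wdist g f f' := (wint P T g (fun q => ((f q - f' q) ^+ 2)%R)).
Local Notation ydist g Y Y' := (wint P T g (fun q => ((Y q.2 q.1 - Y' q.2 q.1) ^+ 2)%R)).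
Local Notation zdist g Z1 Z2 Z1' Z2' :=
  (wint P T g (fun q => (\sum_b (total_proc Z1 Z2 b q - total_proc Z1' Z2' b q) ^+ 2)%R)).

(** The choice of [g] ensures [2 * g >= 1], so that the estimate bounds the plain sum of the two
    distances, and [3 * mu / g <= 16^-1], a rate for squared distances below the [8^-1] demanded by
    [flim_fast]. *)
Lemma contraction : exists2 g, 0 < g & forall f f' Y Z1 Z2 J1 J2 Y' Z1' Z2' J1' J2',
  solves f Y Z1 Z2 J1 J2 -> solves f' Y' Z1' Z2' J1' J2' -> good f -> good f' ->
  (ydist g Y Y' +
   zdist g Z1 Z2 Z1' Z2' <=
     (3 / g)%:E * wdist g f f')%E /\
  (wdist g (gen Y Z1 Z2) (gen Y' Z1' Z2') <=
     16^-1%:E * wdist g f f')%E.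
Proof.
have [mu mu0 lip] := hF2; have [g g1 g2] : exists2 g : R, 1 <= g & 48 * mu <= g.
  by exists (Num.max 1 (48 * mu)); rewrite le_max lexx ?orbT.
have g0 : 0 < g by exact: lt_le_trans g1.
exists g => // f f' Y Z1 Z2 J1 J2 Y' Z1' Z2' J1' J2' sol sol' gf gf'.
have [[hY hZ1 hZ2] _ _ _] := sol; have [[hY' hZ1' hZ2'] _ _ _] := sol'.
have my : measurable_fun dom (fun q : OxR Omega R => (Y q.2 q.1 - Y' q.2 q.1) ^+ 2).
  by apply: measurable_funX; apply: measurable_funB; [case: hY|case: hY'].
have mz : measurable_fun dom (fun q : OxR Omega R => \sum_b (total_proc Z1 Z2 b q - total_proc Z1' Z2' b q) ^+ 2).
  apply: measurable_sum => b; apply: measurable_funX.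
  by case: (z_sqi sol sol' b).
have y0 q : 0 <= (Y q.2 q.1 - Y' q.2 q.1) ^+ 2 by exact: sqr_ge0.
have zq0 q : 0 <= \sum_b (total_proc Z1 Z2 b q - total_proc Z1' Z2' b q) ^+ 2.
  by apply: sumr_ge0 => b _; exact: sqr_ge0.
have est := difference_estimate sol sol' gf gf' g0.
have h : (ydist g Y Y' +
   zdist g Z1 Z2 Z1' Z2' <=
     (3 / g)%:E * wdist g f f')%E.
  apply: le_trans est; apply: leeD => //.
  rewrite -[leLHS]mul1e; apply: lee_wpmul2r; first exact: wint_ge0.
  by rewrite lee_fin; lra.
split => //.
apply: (@le_trans _ _ (mu%:E * (ydist g Y Y' +
   zdist g Z1 Z2 Z1' Z2'))%E).
  rewrite -wintD// -wintZ//; last 3 first.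
  - exact: ltW.
  - exact: measurable_funD.
  - by move=> q; rewrite addr_ge0.
  apply: le_wint => //.
  - have [[m _] _] := generator_good hY hZ1 hZ2; have [[m' _] _] := generator_good hY' hZ1' hZ2'.
    by apply: measurable_funX; exact: measurable_funB.
  - by apply: measurable_funM => //; exact: measurable_funD.
  - by move=> q; exact: sqr_ge0.
  - exact: generator_lipschitz lip.
apply: (le_trans (lee_wpmul2l _ h)); first by rewrite lee_fin ltW.
rewrite muleA -EFinM; apply: lee_wpmul2r; first by apply: wint_ge0 => q; exact: sqr_ge0.
rewrite lee_fin mulrA ler_pdivrMr//; lra.
Qed.

Theorem bsde_exists : exists Y Z1 Z2, bsde_solution P T A W X F Q Y Z1 Z2.
Proof.
have [g g0 ctr] := contraction; have g0' := ltW g0.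
(* The map from [f] to a solution is obtained by choice; outside [good] it takes the zero tuple as a
   default. *)
have /choice[S HS] : forall f, exists s : (R -> Omega -> R) * (R -> Omega -> R) *
    (R -> Omega -> 'cV[R]_N) * (R -> Omega -> R) * (R -> Omega -> R),
    good f -> solves f s.1.1.1.1 s.1.1.1.2 s.1.1.2 s.1.2 s.2.
  move=> f; have [gf|ngf] := pselect (good f); last first.
    by exists (fun=> fun=> 0, fun=> fun=> 0, fun=> fun=> 0, fun=> fun=> 0, fun=> fun=> 0).
  have [Y [Z1 [Z2 [J1 [J2 sol]]]]] := solves_exists gf.
  by exists (Y, Z1, Z2, J1, J2).
pose nx f := gen (S f).1.1.1.1 (S f).1.1.1.2 (S f).1.1.2.
have gnx f : good f -> good (nx f).
  by move=> /HS[[hY hZ1 hZ2] _ _ _]; exact: generator_good.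
pose fs n := iter n nx (fun=> 0).
have gfs n : good (fs n).
  elim: n => [|n IH]; last exact: gnx.
  by split => [|t tT]; [exact: sqi0|exact: mw_cst].
have ctr' f f' : good f -> good f' -> (wdist g (nx f) (nx f') <=
    16^-1%:E * wdist g f f')%E.
  by move=> gf gf'; have [] := ctr _ _ _ _ _ _ _ _ _ _ _ _ (HS f gf) (HS f' gf') gf gf'.
have sB f f' : good f -> good f' -> sqi2 (f \- f').
  by move=> [s _] [s' _]; exact: (sqiB mdom).
pose s0 := expR (2 * g * T) * ip2 (fs 1 \- fs 0) (fs 1 \- fs 0).
have wn n : (wdist g (fs n.+1) (fs n) <= (16^-1 ^+ n * s0)%:E)%E.
  elim: n => [|n IH].
    by rewrite expr0 mul1r; have /andP[_] := wint_bounds g0' (sB _ _ (gfs 1%N) (gfs 0%N)).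
  apply: (le_trans (ctr' _ _ (gfs n.+1) (gfs n))); rewrite exprS -mulrA EFinM.
  by apply: lee_wpmul2l => //; rewrite lee_fin invr_ge0.
(* Starting the sequence at [n0] absorbs the initial distance [s0], since [flim_fast] allows no
   constant in front of the rate. *)
have [n0 hn0] : exists n0 : nat, s0 <= 2 ^+ n0.
  exists (Num.truncn s0).+1; apply: (le_trans (ltW (truncnS_gt s0))).
  by rewrite -natrX ler_nat ltnW// ltn_expl.
have fast n : ip2 (fs (n.+1 + n0)%N \- fs (n + n0)%N) (fs (n.+1 + n0)%N \- fs (n + n0)%N) <= (8^-1) ^+ n.
  have /andP[h _] := wint_bounds g0' (sB _ _ (gfs (n + n0).+1) (gfs (n + n0)%N)).
  have := le_trans h (wn (n + n0)%N); rewrite lee_fin addSn => {}h; apply: (le_trans h).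
  apply: (@le_trans _ _ (16^-1 ^+ (n + n0) * 2 ^+ n0)).
    by rewrite ler_wpM2l ?exprn_ge0 ?invr_ge0.
  rewrite exprD -mulrA -exprMn -[leRHS]mulr1; apply: ler_pM; rewrite ?exprn_ge0 ?mulr_ge0 ?invr_ge0//.
    by apply: lerXn2r; rewrite ?nnegrE ?invr_ge0//; lra.
  by rewrite exprn_ile1 ?mulr_ge0 ?invr_ge0//; lra.
have [_ sfl ifl] := flim_fast mdom (fun n => let: conj a _ := gfs (n + n0)%N in a) fast.
have [_ lf] := l2cvg_flim mdom (fun n => let: conj a _ := gfs (n + n0)%N in a) fast.
set f := flim _ in sfl ifl lf.
have gf : good f.
  split => // t tT; apply: (@mw_flim _ _ _ (G t) (sG t) (fun n w => fs (n + n0)%N (w, t))).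
  by move=> n; have [_ a] := gfs (n + n0)%N; exact: a.
have gnf := gnx f gf.
pose C := expR (2 * g * T) * 8.
have near_fix n : ip2 (nx f \- fs (n.+1 + n0)%N) (nx f \- fs (n.+1 + n0)%N) <= C * (4^-1) ^+ n.
  have /andP[h _] := wint_bounds g0' (sB _ _ gnf (gfs (n.+1 + n0)%N)).
  have /andP[_ h'] := wint_bounds g0' (sB _ _ gf (gfs (n + n0)%N)).
  rewrite -lee_fin; apply: (le_trans h).
  apply: (le_trans (ctr' _ _ gf (gfs (n + n0)%N))).
  apply: (@le_trans _ _ (1%:E * wdist g f (fs (n + n0)%N))%E).
    apply: lee_wpmul2r; first by apply: wint_ge0 => q; exact: sqr_ge0.
    by rewrite lee_fin invf_le1// ler1n.
  rewrite mul1e; apply: (le_trans h'); rewrite lee_fin /C -[leRHS]mulrA.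
  by apply: ler_wpM2l; [exact: expR_ge0|exact: ifl].
have sfs n : sqi2 (fs (n.+1 + n0)%N) by case: (gfs (n.+1 + n0)%N).
have cfl : l2cvg PL dom (fun n => fs (n.+1 + n0)%N) f by move: lf; rewrite /l2cvg -cvg_shiftS.
have cnf : l2cvg PL dom (fun n => fs (n.+1 + n0)%N) (nx f).
  apply: (@l2cvg_geometric _ _ _ PL dom _ _ C (4^-1)); first by lra.
  by move=> n; rewrite ipBC.
have [snf _] := gnf.
(* The same iterates converge to [f] and to its image, so [f] is a fixed point up to a null set;
   [ae_paths] turns this into equality of the time integrals in the equation. *)
have fix0 := l2cvg_unique mdom sfs sfl snf cfl cnf.
have [hM2 i1 i2 e] := HS f gf.
exists (S f).1.1.1.1, (S f).1.1.1.2, (S f).1.1.2; apply/bsde_solutionE.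
exists (S f).1.2, (S f).2; split => //.
by apply: filterS2 e (ae_paths sfl snf fix0) => w h h' t tT; rewrite -(h t tT) (h' t tT).
Qed.

(** Each solution solves the decoupled equation for its own generator, so the weighted distance [D]
    of the two generators satisfies [D <= D / 16]. It is finite because generators are
    square-integrable, hence it is 0. The estimate then annihilates the differences of the
    integrands, and [difference_zero] gives equality of [Y] and [Y'] at all times. *)
Theorem bsde_unique Y Z1 Z2 Y' Z1' Z2' : bsde_solution P T A W X F Q Y Z1 Z2 ->
  bsde_solution P T A W X F Q Y' Z1' Z2' -> same_solution P T A X Y Z1 Z2 Y' Z1' Z2'.
Proof.
move=> /bsde_solutionE[J1 [J2 sol]] /bsde_solutionE[J1' [J2' sol']].
have [g g0 ctr] := contraction; have g0' := ltW g0.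
have [[hY hZ1 hZ2] _ _ _] := sol; have [[hY' hZ1' hZ2'] _ _ _] := sol'.
have gf := generator_good hY hZ1 hZ2; have gf' := generator_good hY' hZ1' hZ2'.
have [est ctr1] := ctr _ _ _ _ _ _ _ _ _ _ _ _ sol sol' gf gf'.
have sd : sqi2 (gen Y Z1 Z2 \- gen Y' Z1' Z2') by apply: (sqiB mdom); [case: gf|case: gf'].
set D := wdist g (gen Y Z1 Z2) (gen Y' Z1' Z2') in est ctr1.
have /andP[lo up] : ((ip2 (gen Y Z1 Z2 \- gen Y' Z1' Z2') (gen Y Z1 Z2 \- gen Y' Z1' Z2'))%:E <= D <=
   (expR (2 * g * T) * ip2 (gen Y Z1 Z2 \- gen Y' Z1' Z2') (gen Y Z1 Z2 \- gen Y' Z1' Z2'))%:E)%E.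
  exact: wint_bounds.
have D0 : (0 <= D)%E by apply: wint_ge0 => q; exact: sqr_ge0.
have Dz : D = 0%E.
  have Dfin : D \is a fin_num by rewrite ge0_fin_numE// (le_lt_trans up)// ltry.
  move: D0 ctr1; rewrite -(fineK Dfin) -EFinM !lee_fin => h1 h2.
  by congr EFin; apply/eqP; rewrite eq_le h1 andbT; lra.
have ip0 : ip2 (gen Y Z1 Z2 \- gen Y' Z1' Z2') (gen Y Z1 Z2 \- gen Y' Z1' Z2') = 0.
  by apply/eqP; rewrite eq_le ip_ge0 andbT -lee_fin; move: lo; rewrite Dz.
have zs b := z_sqi sol sol' b.
have z0 b : ip2 (total_proc Z1 Z2 b \- total_proc Z1' Z2' b) (total_proc Z1 Z2 b \- total_proc Z1' Z2' b) = 0.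
  apply/eqP; rewrite eq_le ip_ge0 andbT -lee_fin.
  have /andP[h _] := wint_bounds g0' (zs b); apply: (le_trans h).
  have zq0 : (zdist g Z1 Z2 Z1' Z2' <= 0)%E.
    move: est; rewrite Dz mule0; apply: le_trans; rewrite leeDr//.
    by apply: wint_ge0 => q; exact: sqr_ge0.
  apply: le_trans zq0; apply: le_wint.
  - by apply: measurable_funX; case: (zs b).
  - by apply: measurable_sum => k; apply: measurable_funX; case: (zs k).
  - by move=> q; exact: sqr_ge0.
  - by move=> q _; rewrite (bigD1 b)//= lerDl sumr_ge0// => k _; exact: sqr_ge0.
have zae b := ip_eq0_ae mdom (zs b) (z0 b).
split.
- exact: (difference_zero sol sol' gf gf' ip0).
- apply: filterS (zae None) => q h dq; have := h dq; rewrite /= !total_proc_None => /eqP.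
  by rewrite subr_eq0 => /eqP.
- have zall : {ae (P \x leb)%E, forall q, forall b, dom q ->
      (total_proc Z1 Z2 b \- total_proc Z1' Z2' b) q = 0}.
    by apply: filter_forall => b; exact: zae.
  apply: negligibleS zall => q /= nh h; apply: nh => dq.
  rewrite (seminorm2_rho T0 hc hA hX (fun t w => Z2 t w - Z2' t w) dq) big1// => b _.
  have := h (Some b) dq => /=; rewrite !total_proc_Some /rho_proc -sumrB => e.
  rewrite (_ : \sum_i _ = 0) ?expr0n// -[RHS]e; apply: eq_bigr => i _.
  by rewrite !mxE mulrBr.
Qed.

End bsde_solutions.

Theorem theorem3p5 (R : realType) (d : measure_display)
    (Omega : measurableType d) (P : probability Omega R) (T : R)
    (N : nat) (A : 'M[R]_N) (c : R)
    (W : R -> Omega -> R) (X : R -> Omega -> 'cV[R]_N)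
    (F : driver R Omega N) (Q : Omega -> R)
    (hP : measure_is_complete P) (hT : 0 < T)
    (hc : 0 < c < 1) (hA : rate_matrix A c)
    (hW : brownian_motion P T W)
    (hX : markov_chain P T A X)
    (hWX : independent P (filtrationX P X T) (filtrationW P W T))
    (hM : square_integrable_martingale P T (filtrationX P X)
            (chain_martingale A X))
    (hF1 : driver_M2 P T W X F)
    (hF2 : driver_lipschitz T A X F)
    (hQ : L2 P (filtrationG P W X T) Q) :
  (exists Y Z1 Z2, bsde_solution P T A W X F Q Y Z1 Z2) /\
  (forall Y Z1 Z2 Y' Z1' Z2',
     bsde_solution P T A W X F Q Y Z1 Z2 ->
     bsde_solution P T A W X F Q Y' Z1' Z2' ->
     same_solution P T A X Y Z1 Z2 Y' Z1' Z2').
Proof.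
split; first exact: (bsde_exists hP hT hc hA hW hX hWX hM hF1 hF2 hQ).
move=> Y Z1 Z2 Y' Z1' Z2'.
exact: (bsde_unique hP hT hc hA hW hX hWX hM hF1 hF2).
Qed.
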